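(* Let $\mathcal{M}$ be a semi-finite von Neumann algebra with normal, semi-finite, faithful trace $\tau$. Let $E$ be the Köthe dual of a separable symmetric Banach function space on $\mathbb{R}_+$. Suppose that $1\leq p<q<\infty$ and let $S_k:L^{p,1}(\mathcal{M})_+ + L^{q,1}(\mathcal{M})_+\to S(\tau)_+$ $(k\geq1)$ be positive linear operators for which there are constants $C_p,C_q$ with $$\|(S_k(x))_{k\geq1}\|_{L^r(\mathcal{M};l^\infty)}\leq C_r\|x\|_{L^{r,1}(\mathcal{M})}\qquad(x\in L^{r,1}(\mathcal{M})_+,\ r=p,q).$$ If $q_E<q$ and either $p=1$ or $p_E>p$, then there is a constant $C$ (depending only on $E$, $p$, $q$, $C_p$, $C_q$) such that $$\|(S_k(x))_{k\geq1}\|_{E(\mathcal{M};l^\infty)}\leq C\|x\|_{E(\mathcal{M})}\qquad(x\in E(\mathcal{M})_+).$$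
   Context: For measurable a.e. finite $f$ on $\mathbb{R}_+$, $d(v;f)=\lambda(|f|>v)$ ($\lambda$ Lebesgue measure); $S(\mathbb{R}_+)$ denotes those $f$ with $d(v;f)<\infty$ for some $v>0$; $\mu_t(f)=\inf\{v>0:d(v;f)\le t\}$. A (nonzero) symmetric Banach function space $F$ on $\mathbb{R}_+$ is a complete normed linear subspace of $S(\mathbb{R}_+)$ such that $f\in S(\mathbb{R}_+)$, $g\in F$, $\mu(f)\le\mu(g)$ imply $f\in F$, $\|f\|_F\le\|g\|_F$. Its Köthe dual is the symmetric Banach function space $F^\times=\{g\in S(\mathbb{R}_+):\|g\|_{F^\times}<\infty\}$, $\|g\|_{F^\times}=\sup\{\int_0^\infty|fg|\,dt:\|f\|_F\le1\}$. With $(D_af)(u)=f(au)$ on $E$, the Boyd indices are $p_E=\lim_{u\to\infty}\frac{\log u}{\log\|D_{1/u}\|}$, $q_E=\lim_{u\downarrow0}\frac{\log u}{\log\|D_{1/u}\|}$ ($=\infty$ if the denominator vanishes). $E^{(2)}=\{g\in S(\mathbb{R}_+):|g|^2\in E\}$, $\|g\|_{E^{(2)}}=\||g|^2\|_E^{1/2}$. $S(\tau)$ is the $*$-algebra of $\tau$-measurable operators affiliated with $\mathcal{M}$, $\mu_t(x)=\inf\{v>0:\tau(e^{|x|}(v,\infty))\le t\}$, $E(\mathcal{M})=\{x\in S(\tau):\mu(x)\in E\}$, $\|x\|_{E(\mathcal{M})}=\|\mu(x)\|_E$; the subscript $+$ denotes positive cones. $\|x\|_{L^{r,1}(\mathcal{M})}=\int_0^\infty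 t^{1/r-1}\mu_t(x)\,dt$. Positive linear on the cone means additive and positively homogeneous with positive values. $E(\mathcal{M};l^\infty)$ is the space of sequences $x=(x_k)_{k\ge1}$ in $E(\mathcal{M})$ that factor as $x_k=ay_kb$ with $a,b\in E^{(2)}(\mathcal{M})$ and $(y_k)$ a bounded sequence in $\mathcal{M}$, with norm $\|x\|_{E(\mathcal{M};l^\infty)}=\inf\|a\|_{E^{(2)}(\mathcal{M})}\sup_k\|y_k\|_\infty\|b\|_{E^{(2)}(\mathcal{M})}$ over all such factorizations; $L^r(\mathcal{M};l^\infty)$ is the case $E=L^r$. The inequalities include the assertion that the sequences belong to the respective spaces. *)

(* Defs.v *)
(* Unbounded operators on a complex Hilbert space are represented by their
   graphs, bounded ones by functions.  Functions on the half-line are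
   represented by functions R -> R of which only the restriction to `[0, +oo[
   matters; they are not quotiented by a.e. equality. *)
From HB Require Import structures.
From mathcomp Require Import all_boot all_order all_algebra.
From mathcomp Require Import sesquilinear complex.
From mathcomp Require Import all_classical all_reals all_analysis.
Set Implicit Arguments.
Unset Strict Implicit.
Unset Printing Implicit Defensive.
Import Order.TTheory GRing.Theory Num.Theory.
Import numFieldNormedType.Exports.
Local Open Scope classical_set_scope.
Local Open Scope ring_scope.

(* inf {v > 0 : d v <= t}; it is only +oo, for the distribution functions
   below, at t = 0. *)
Definition rearrangement (R : realType) (d : R -> \bar R) (t : R) : \bar R :=
  ereal_inf [set v%:E | v in [set v : R | 0 < v /\ (d v <= t%:E)%E]].

Section FunctionSpaces.
Context {R : realType}.
Implicit Types f g : R -> R.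

Definition halfline : set R := `[0, +oo[.

Definition eq_ae0 f : Prop :=
  {ae lebesgue_measure, forall t : R, halfline t -> f t = 0}.

Definition distribution_fun f (v : R) : \bar R :=
  lebesgue_measure [set t : R | halfline t /\ v < `|f t|].

Definition mu_fun f : R -> \bar R := rearrangement (distribution_fun f).

Definition Sfun : set (R -> R) :=
  [set f | measurable_fun halfline f /\
           exists v : R, 0 < v /\ (distribution_fun f v < +oo)%E].

(* The value of [fnorm] outside [fcarrier] is irrelevant. *)
Record fspace := FSpace { fcarrier : set (R -> R); fnorm : (R -> R) -> R }.

Implicit Types E F : fspace.

Record symmetric_banach F : Prop := SymmetricBanach {
  sb_measurable : fcarrier F `<=` Sfun;
  sb_zero : fcarrier F (fun=> 0);
  sb_add : forall f g, fcarrier F f -> fcarrier F g -> fcarrier F (f \+ g);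
  sb_scale : forall (c : R) f, fcarrier F f -> fcarrier F (fun t => c * f t);
  sb_ge0 : forall f, fcarrier F f -> 0 <= fnorm F f;
  sb_eq0 : forall f, fcarrier F f -> fnorm F f = 0 -> eq_ae0 f;
  sb_normZ : forall (c : R) f, fcarrier F f ->
    fnorm F (fun t => c * f t) = `|c| * fnorm F f;
  sb_triangle : forall f g, fcarrier F f -> fcarrier F g ->
    fnorm F (f \+ g) <= fnorm F f + fnorm F g;
  sb_complete : forall u : nat -> R -> R, (forall n, fcarrier F (u n)) ->
    (forall e : R, 0 < e -> exists n0 : nat, forall m n : nat,
       (n0 <= m)%N -> (n0 <= n)%N -> fnorm F (u m \- u n) <= e) ->
    exists f, fcarrier F f /\ fnorm F (u n \- f) @[n --> \oo] --> (0 : R);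
  sb_symmetric : forall f g, Sfun f -> fcarrier F g ->
    (forall t : R, halfline t -> (mu_fun f t <= mu_fun g t)%E) ->
    fcarrier F f /\ fnorm F f <= fnorm F g;
  sb_nonzero : exists f, fcarrier F f /\ ~ eq_ae0 f }.

Definition separable_fspace F : Prop :=
  exists D : nat -> R -> R, (forall n, fcarrier F (D n)) /\
    forall f, fcarrier F f -> forall e : R, 0 < e ->
      exists n : nat, fnorm F (f \- D n) < e.

Definition kothe_norm F g : \bar R :=
  ereal_sup [set (\int[lebesgue_measure]_(t in halfline) (`|f t * g t|)%:E)%E
            | f in [set f | fcarrier F f /\ fnorm F f <= 1]].

Definition kothe_dual F : fspace :=
  FSpace [set g | Sfun g /\ (kothe_norm F g < +oo)%E]
         (fun g => fine (kothe_norm F g)).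

Definition dilation (a : R) f : R -> R := fun u => f (a * u).

Definition dilation_norm E (a : R) : \bar R :=
  ereal_sup [set (fnorm E (dilation a f))%:E
            | f in [set f | fcarrier E f /\ fnorm E f <= 1]].

Definition boyd_quotient E (u : R) : \bar R :=
  let d := ln (fine (dilation_norm E u^-1)) in
  if d == 0 then +oo%E else (ln u / d)%:E.

Definition lower_boyd E : \bar R := lim (boyd_quotient E u @[u --> +oo%R]).
Definition upper_boyd E : \bar R := lim (boyd_quotient E u @[u --> 0^'+]).

Definition convexification2 E : fspace :=
  FSpace [set g | Sfun g /\ fcarrier E (fun t => `|g t| ^+ 2)]
         (fun g => Num.sqrt (fnorm E (fun t => `|g t| ^+ 2))).

Definition Lr_int (r : R) f : \bar R :=
  (\int[lebesgue_measure]_(t in halfline) (`|f t| `^ r)%:E)%E.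

Definition Lr (r : R) : fspace :=
  FSpace [set f | measurable_fun halfline f /\ (Lr_int r f < +oo)%E]
         (fun f => fine (Lr_int r f) `^ r^-1).

End FunctionSpaces.
Arguments fspace : clear implicits.

(* The inner product is linear in its first argument. *)
Record hilbertSpace (R : realType) := HilbertSpace {
  hilbert_sort :> completeNormedModType R[i];
  dot : {dot hilbert_sort for (@Num.conj R[i])};
  dot_norm : forall x : hilbert_sort, dot x x = `|x| ^+ 2 }.

Section Operators.
Context {R : realType} {H : hilbertSpace R}.
Local Notation "<< x , y >>" := (@dot R H x y) (at level 0).
Implicit Types (a b u : H -> H) (T U A : set (H * H)).

Definition bounded_op : set (H -> H) := [set a | linear a /\ continuous a].

Definition opnorm a : R := sup [set complex.Re `|a x| | x in [set x : H | `|x| <= 1]].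

Definition is_adjoint a b : Prop := forall x y : H, <<a x, y>> = <<x, b y>>.

Definition le_op a b : Prop := forall x : H, <<a x, x>> <= <<b x, x>>.

Definition commutant (M : set (H -> H)) : set (H -> H) :=
  [set b | bounded_op b /\ forall a, M a -> a \o b = b \o a].

(* The second condition makes M a unital algebra of bounded operators. *)
Record von_neumann_algebra (M : set (H -> H)) : Prop := VonNeumannAlgebra {
  vN_star : forall a, M a -> exists b, M b /\ is_adjoint a b;
  vN_bicommutant : commutant (commutant M) = M }.

Definition positive_part (M : set (H -> H)) : set (H -> H) :=
  [set a | M a /\ le_op (fun=> 0) a].

(* Nets are replaced by directed sets in normality; only the values of tau on
   the positive part of M matter. *)
Record nsf_trace (M : set (H -> H)) (tau : (H -> H) -> \bar R) : Prop := NsfTrace {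
  trace_ge0 : forall a, positive_part M a -> (0 <= tau a)%E;
  trace_add : forall a b, positive_part M a -> positive_part M b ->
    tau (a \+ b) = (tau a + tau b)%E;
  trace_scale : forall (c : R) a, 0 <= c -> positive_part M a ->
    tau (fun x => c%:C%C *: a x) = (c%:E * tau a)%E;
  trace_cyclic : forall a b, M a -> is_adjoint a b -> tau (b \o a) = tau (a \o b);
  trace_normal : forall (D : set (H -> H)) s,
    D `<=` positive_part M -> D !=set0 ->
    (forall a b, D a -> D b -> exists c, [/\ D c, le_op a c & le_op b c]) ->
    positive_part M s -> (forall a, D a -> le_op a s) ->
    (forall b, positive_part M b -> (forall a, D a -> le_op a b) -> le_op s b) ->
    tau s = ereal_sup [set tau a | a in D];
  trace_semifinite : forall a, positive_part M a -> a <> (fun=> 0) ->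
    exists b, [/\ positive_part M b, le_op b a, b <> (fun=> 0) & (tau b < +oo)%E];
  trace_faithful : forall a, positive_part M a -> tau a = 0%E -> a = (fun=> 0) }.

Definition graph_op a : set (H * H) := [set p | p.2 = a p.1].

Definition domain_op T : set H := [set p.1 | p in T].

Record closed_op T : Prop := ClosedOp {
  closed_op0 : T (0, 0);
  closed_op_linear : forall (c : R[i]) p q, T p -> T q ->
    T (c *: p.1 + q.1, c *: p.2 + q.2);
  closed_op_fun : forall y, T (0, y) -> y = 0;
  closed_op_dense : dense (domain_op T);
  closed_op_closed : closed T }.

Definition adjoint_op T : set (H * H) :=
  [set p | forall q, T q -> <<q.2, p.1>> = <<q.1, p.2>>].

Definition comp_op T U : set (H * H) :=
  [set p | exists y, U (p.1, y) /\ T (y, p.2)].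

Definition add_op T U : set (H * H) :=
  [set p | exists y z, [/\ T (p.1, y), U (p.1, z) & p.2 = y + z]].

Definition scale_op (c : R) T : set (H * H) :=
  [set (p.1, c%:C%C *: p.2) | p in T].

(* The operations of S(tau) are the closures of the algebraic ones. *)
Definition strong_add T U : set (H * H) := closure (add_op T U).
Definition strong_mul T U : set (H * H) := closure (comp_op T U).
Definition strong_scale c T : set (H * H) := closure (scale_op c T).

Record positive_op T : Prop := PositiveOp {
  positive_op_closed : closed_op T;
  positive_op_adjoint : adjoint_op T = T;
  positive_op_ge0 : forall p, T p -> 0 <= <<p.2, p.1>> }.

Definition abs_op T : set (H * H) :=
  xget set0 [set A | positive_op A /\ comp_op A A = comp_op (adjoint_op T) T].

Definition spectral_mass (e : set R -> H -> H) (x : H) (B : set R) : \bar R :=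
  ((complex.Re `|e B x|) ^+ 2)%:E.

(* e is the spectral measure of the self-adjoint operator A; the last two
   conditions state A = \int l de(l): the domain of A and, by polarization, its
   values are determined by the scalar measures B |-> <e(B)x, x> = |e(B)x|^2. *)
Record spectral_measure A (e : set R -> H -> H) : Prop := SpectralMeasure {
  spectral_bounded : forall B, measurable B -> bounded_op (e B);
  spectral_idem : forall B, measurable B -> e B \o e B = e B;
  spectral_selfadj : forall B, measurable B -> is_adjoint (e B) (e B);
  spectral_setT : e setT = id;
  spectral_setI : forall B C, measurable B -> measurable C ->
    e (B `&` C) = e B \o e C;
  spectral_sigma_additive : forall B : nat -> set R,
    (forall n, measurable (B n)) -> trivIset setT B ->
    forall x : H, series (fun n => e (B n) x) @ \oo --> e (\bigcup_n B n) x;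
  spectral_domain : forall x,
    domain_op A x <-> (\int[spectral_mass e x]_l (l ^+ 2)%:E < +oo)%E;
  spectral_form : forall p, A p ->
    <<p.2, p.1>> = (fine (\int[spectral_mass e p.1]_l l%:E)%E)%:C%C }.

Definition spectral_proj A : set R -> H -> H :=
  xget ((fun=> id) : set R -> H -> H) [set e | spectral_measure A e].

End Operators.

Section NoncommutativeSpaces.
Context {R : realType} {H : hilbertSpace R}.
Variables (M : set (H -> H)) (tau : (H -> H) -> \bar R).
Implicit Types (x a b : set (H * H)) (E : fspace R) (r : R).

Definition affiliated x : Prop :=
  closed_op x /\
  forall u, commutant M u -> forall p, x p -> x (u p.1, u p.2).

Definition distribution_op x (v : R) : \bar R :=
  tau (spectral_proj (abs_op x) `]v, +oo[).

Definition mu_op x : R -> \bar R := rearrangement (distribution_op x).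

Definition Stau : set (set (H * H)) :=
  [set x | affiliated x /\
           exists v : R, 0 < v /\ (distribution_op x v < +oo)%E].

(* mu_op x is finite on `]0, +oo[ for x in Stau. *)
Definition nc_space E : set (set (H * H)) :=
  [set x | Stau x /\ fcarrier E (fine \o mu_op x)].

Definition nc_norm E x : R := fnorm E (fine \o mu_op x).

Definition lorentz_norm r x : \bar R :=
  (\int[lebesgue_measure]_(t in halfline) ((t `^ (r^-1 - 1))%:E * mu_op x t))%E.

Definition lorentz_space r : set (set (H * H)) :=
  [set x | Stau x /\ (lorentz_norm r x < +oo)%E].

Definition linf_factorization E (x : nat -> set (H * H)) a (y : nat -> H -> H) b :=
  [/\ nc_space (convexification2 E) a, nc_space (convexification2 E) b,
      forall k, M (y k),
      has_ubound [set opnorm (y k) | k in setT] &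
      forall k, x k = strong_mul (strong_mul a (graph_op (y k))) b].

(* Sequences are indexed from 0. *)
Definition linf_space E : set (nat -> set (H * H)) :=
  [set x | (forall k, nc_space E (x k)) /\
           exists a y b, linf_factorization E x a y b].

Definition linf_norm E (x : nat -> set (H * H)) : R :=
  inf [set c | exists a y b, linf_factorization E x a y b /\
    c = nc_norm (convexification2 E) a * sup [set opnorm (y k) | k in setT]
        * nc_norm (convexification2 E) b].

Definition lorentz_cone (p q : R) : set (set (H * H)) :=
  [set z | exists x y, [/\ lorentz_space p x /\ positive_op x,
                           lorentz_space q y /\ positive_op y &
                           z = strong_add x y]].

Record positive_linear (K : set (set (H * H))) (S : set (H * H) -> set (H * H)) :
    Prop := PositiveLinear {
  pl_positive : forall x, K x -> Stau (S x) /\ positive_op (S x);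
  pl_add : forall x y, K x -> K y ->
    S (strong_add x y) = strong_add (S x) (S y);
  pl_scale : forall (c : R) x, 0 <= c -> K x ->
    S (strong_scale c x) = strong_scale c (S x) }.

Definition lorentz_maximal_bound (S : nat -> set (H * H) -> set (H * H)) r
    (C : R) : Prop :=
  forall x, lorentz_space r x -> positive_op x ->
    linf_space (Lr r) (fun k => S k x) /\
    linf_norm (Lr r) (fun k => S k x) <= C * fine (lorentz_norm r x).

End NoncommutativeSpaces.

(* Main.v *)
Require Import Defs.
From HB Require Import structures.
From mathcomp Require Import all_boot all_order all_algebra.
From mathcomp Require Import sesquilinear complex.
From mathcomp Require Import all_classical all_reals all_analysis.
From mathcomp Require Import measurable_realfun ring lra.
Set Implicit Arguments.
Unset Strict Implicit.
Unset Printing Implicit Defensive.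
Import Order.TTheory GRing.Theory Num.Theory.
Import numFieldNormedType.Exports.
Local Open Scope classical_set_scope.
Local Open Scope ring_scope.

(** A factorization of (S_k x) in L^r(M; l^oo) yields one increasing sequence A of bounded
    positive forms dominating every S_k x; the size of A is measured by its K-functional between
    L^1 and L^oo. Cut x by its spectral measure at the levels mu_x(2^j). On the j-th piece the
    L^(p,1) and L^(q,1) norms are comparable to mu_x(2^j) 2^(j/p) and mu_x(2^j) 2^(j/q), and
    truncating the majorant for p by the one for q bounds K(A_j, s) by mu_x(2^j) times the smaller
    of the two powers of s. The sum over j is a Calderon operator applied to mu_x, bounded on E
    because of the Boyd indices. If d is the square root of the closed form sup A, then mu_d^2 is
    majorized by this function, hence d belongs to E^(2), and S_k x <= d^2 gives S_k x = d y_k d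
    with a contraction y_k of M. *)

(** The [S k] are additive but carry no continuity, so an infinite sum of pieces of [x] cannot be
    pushed through them. Additivity is used for finitely many pieces; what remains of [x] is small
    in L^(p,1) at large values and in L^(q,1) at small ones, so it has majorants with small
    K-functional, which [mle_tails] discards in the limit. The second obstacle is domains: sums and
    products in S(tau) are closures and majorants are unbounded. Hence forms replace operators, and
    comparisons are tested at resolvent images of a dense set of vectors on which the operators
    involved are bounded; the trace provides that density ([joint_dense]). The square root of the
    majorant enters because a factorization with equal outer factors [d] is sought and E^(2)
    measures [d]. When p = 1 no lower index is given: the scales below s then telescope into a
    single integral of mu_x ([avg_telescope]). The norm of a Koethe dual is a supremum of pairings,
    so bounds on integrals over sets of given measure are bounds in norm ([majorized_norm]). *)

Lemma le_of_eq d (T : porderType d) (x y : T) : x = y -> (x <= y)%O.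
Proof. by move=> ->. Qed.

Lemma pow2_gt {R : realType} (x : R) j : (Num.trunc x < j)%N -> x < 2 ^+ j.
Proof.
move=> h; apply: lt_le_trans (truncnS_gt x) _; rewrite -natrX ler_nat.
by apply: leq_trans h _; apply/ltnW/ltn_expl.
Qed.


Lemma cvg_le_seq {R : realType} (u v : nat -> R) l m : u @ \oo --> l -> v @ \oo --> m ->
  (forall n, u n <= v n) -> l <= m.
Proof. by move=> ul vm uv; apply: ler_cvg_to ul vm _; apply: nearW. Qed.

(** * Distribution functions and decreasing rearrangements *)

Section Rearrangement.
Context {R : realType}.
Implicit Types (D : R -> \bar R) (s t v w l : R).

Definition noninc D := forall v w, v <= w -> (D w <= D v)%E.

Lemma rearr_ge D w t : noninc D -> (t%:E < D w)%E -> (w%:E <= rearrangement D t)%E.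
Proof.
move=> hD tD; apply: le_ereal_inf_tmp => _ [v [v0 Dv] <-]; rewrite leNgt; apply/negP => vw.
by have := le_lt_trans (hD _ _ (ltW vw)) (le_lt_trans Dv tD); rewrite ltxx.
Qed.

Lemma rearr_le D w t : 0 < w -> (D w <= t%:E)%E -> (rearrangement D t <= w%:E)%E.
Proof. by move=> w0 Dw; apply: ereal_inf_lbound; exists w. Qed.

Lemma rearr_ge0 D t : (0 <= rearrangement D t)%E.
Proof. by apply: le_ereal_inf_tmp => _ [v [v0 _] <-]; rewrite ltW. Qed.

Lemma rearr_noninc D t t' : t <= t' -> (rearrangement D t' <= rearrangement D t)%E.
Proof.
move=> tt; apply: le_ereal_inf_tmp => _ [v [v0 Dv] <-]; apply: rearr_le => //.
exact: le_trans Dv _.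
Qed.

Definition below (d : \bar R) : set R := [set t | 0 < t /\ (t%:E < d)%E].

Lemma belowE d : (0 <= d)%E -> measurable (below d) /\ lebesgue_measure (below d) = d.
Proof.
case: d => [d| |] //; last first.
  move=> _; have -> : below +oo = `]0, +oo[%classic.
    by apply/seteqP; split=> t; rewrite /below /= in_itv andbT ?ltry; [case|].
  by split; [exact: measurable_itv|rewrite lebesgue_measure_itv ltry].
rewrite lee_fin => d0; have -> : below d%:E = `]0, d[%classic.
  by apply/seteqP; split=> t; rewrite /below /= in_itv /= lte_fin; [move=> [-> ->]|move/andP].
split; first exact: measurable_itv.
rewrite lebesgue_measure_itv lte_fin; case: ltP => [_|d0']; first by rewrite sube0.
by congr _%:E; apply/le_anti/andP.
Qed.

Lemma measurable_halfline : measurable (@halfline R).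
Proof. exact: measurable_itv. Qed.

(** The rearrangement at [t] is at least [v] for every [t] in [below (D v)], and that interval has
    length [D v]. A weighted sum of values of [D] is thus the integral of a step function, bounded
    pointwise by [phi] of the rearrangement. The sequence [c] lists pairs (weight, level); with [D]
    the trace of spectral projections this turns traces into integrals. *)
Lemma layer_int D (phi : R -> R) (c : seq (R * R)) : noninc D -> (forall v, 0 <= D v)%E ->
  (forall t, 0 < t -> rearrangement D t \is a fin_num) ->
  measurable_fun halfline (fun t => phi (fine (rearrangement D t))) ->
  all (fun p => (0 <= p.1) && (0 < p.2)) c -> (forall l, 0 <= phi l) ->
  (forall l, 0 <= l -> \sum_(p <- c) p.1 * (p.2 <= l)%R%:R <= phi l) ->
  (\sum_(p <- c) (p.1%:E * D p.2) <= \int[lebesgue_measure]_(t in halfline) (phi (fine (rearrangement D t)))%:E)%E.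
Proof.
move=> hD D0 fin mphi hc phi0 hphi; have mh := measurable_halfline.
pose f (p : R * R) (t : R) := (`|p.1|%:E * (\1_(below (D p.2)) t)%:E)%E.
have mb (p : R * R) : measurable (below (D p.2)) by case: (belowE (D0 p.2)).
have mi (p : R * R) : measurable_fun halfline (fun t : R => (\1_(below (D p.2)) t : R)%:E).
  by apply: measurable_funTS; apply/measurable_EFinP.
have mf p : measurable_fun halfline (f p) by apply: measurable_funeM.
have f0 p t : halfline t -> (0 <= f p t)%E by move=> _; rewrite /f.
have fE p : (\int[lebesgue_measure]_(t in halfline) f p t = `|p.1|%:E * D p.2)%E.
  rewrite (ge0_integralZl_EFin (@lebesgue_measure R) mh _ (mi p))// integral_indic//; last exact: mb.
  congr (_ * _)%E; rewrite -[RHS](proj2 (belowE (D0 p.2))).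
  by rewrite setIidl// => t [t0]; rewrite /halfline /= in_itv /= andbT ltW.
have -> : (\sum_(p <- c) (p.1%:E * D p.2) = \sum_(p <- c) \int[lebesgue_measure]_(t in halfline) f p t)%E.
  by apply: eq_big_seq => p pc; move/allP : hc => /(_ _ pc) /andP[p1]; rewrite fE ger0_norm.
rewrite -(ge0_integral_sum (@lebesgue_measure R) mh mf f0).
apply: ge0_le_integral => //.
- by move=> t ht; apply: sume_ge0 => p _; exact: f0.
- exact: emeasurable_sum => p; exact: mf.
- exact/measurable_EFinP.
move=> t _; have [t0|t0] := ltP 0 t; last first.
  rewrite big1 ?lee_fin// => p; rewrite /f indicE memNset ?mule0// => -[h].
  by rewrite ltNge t0 in h.
rewrite (_ : \sum_(p <- c) f p t = (\sum_(p <- c) `|p.1| * \1_(below (D p.2)) t)%:E)%E; last first.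
  by rewrite -sumEFin.
rewrite lee_fin; apply: le_trans (hphi _ (fine_ge0 (rearr_ge0 D t))).
rewrite big_seq [X in _ <= X]big_seq; apply: ler_sum => p pc; move/allP : hc => /(_ _ pc) /andP[p1].
rewrite ger0_norm// ler_wpM2l// indicE; case: (boolP (t \in _)) => [/set_mem [_ tD]|_]; last by rewrite ler0n.
suff -> : p.2 <= fine (rearrangement D t) by [].
by rewrite -lee_fin fineK ?fin//; exact: rearr_ge.
Qed.

End Rearrangement.

(** * Dyadic layers of a nonnegative number *)

Section Layers.
Context {R : realType}.
Implicit Types (u v : R) (J : nat).

Definition dy J : R := 2^-1 ^+ J.

(** Layers of height [2^-J] are stacked up to height [2^J], hence [4^J] of them: the mesh tends to 0
    and the range to infinity together. *)
Definition layers J u : R := \sum_(0 <= i < 4 ^ J) dy J * (dy J * i.+1%:R < u)%R%:R.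

Lemma dy_gt0 J : 0 < dy J. Proof. by rewrite exprn_gt0. Qed.

Lemma layers_bounds J u : 0 <= u -> layers J u <= u /\ (u <= 2 ^+ J -> u - dy J <= layers J u).
Proof.
move=> u0; have d0 := dy_gt0 J.
have h N : let s := \sum_(0 <= i < N) dy J * (dy J * i.+1%:R < u)%R%:R in
    (dy J * N%:R < u -> s = dy J * N%:R) /\ (u <= dy J * N%:R -> u - dy J <= s <= u).
  elim: N => [|N [h1 h2]] /=; first by rewrite big_geq//; lra.
  rewrite big_nat_recr//=; case: ltP => [lt|ge]; rewrite ?mulr0 ?addr0; split=> //.
  - have lt' : dy J * N%:R < u by apply: le_lt_trans lt; rewrite ler_pM2l// ler_nat.
    by move=> _; rewrite h1// -[in RHS]addn1 natrD mulrDr.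
  - move=> _; case: (leP u (dy J * N%:R)) => [|lt]; first exact: h2.
    lra.
have dJ : dy J * (4 ^ J)%:R = 2 ^+ J.
  by rewrite natrX -exprMn; congr (_ ^+ _); field.
have [h1 h2] := h (4 ^ J)%N; rewrite dJ in h1 h2; split=> [|le]; last by case/andP: (h2 le).
by case: (leP u (2 ^+ J)) => [/h2/andP[]//|lt]; rewrite /layers h1// ltW.
Qed.

Lemma layers_cvg u : 0 <= u -> layers J u @[J --> \oo] --> u.
Proof.
move=> u0.
have c : u - dy J @[J --> \oo] --> u.
  rewrite -[X in _ --> X]subr0; apply: cvgB; first exact: cvg_cst.
  by apply: cvg_expr; rewrite ger0_norm// invf_lt1// ltr1n.
apply: @squeeze_cvgr (cvg_cst _).
near=> J; have [h1 h2] := layers_bounds J u0; rewrite h1 andbT; apply: h2.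
by apply/ltW/pow2_gt; near: J; exact: nbhs_infty_gt.
Unshelve. all: by end_near. Qed.

End Layers.

(** * Dilations and selection of subsets on the half-line *)

Section Boyd.
Context {R : realType}.
Implicit Types (f g h phi : R -> R) (A B C : set R) (a b r s t u v w p q T : R).

Local Notation leb := (@lebesgue_measure R).

Lemma measure_dilation a A : 0 < a -> measurable A ->
  leb ((fun t => a * t) @^-1` A) = ((a^-1)%:E * leb A)%E.
Proof.
move=> a0 mA; pose ph : R -> measurableTypeR R := fun t => a * t.
have mph : measurable_fun setT ph by exact: mulrl_measurable.
have -> : leb A = (a%:E * leb (ph @^-1` A))%E; last first.
  by rewrite muleA -EFinM mulVf ?gt_eqF// mul1e.
have a1 : 0 <= a by exact: ltW.
apply: (lebesgue_measure_unique (mu := mscale (NngNum a1) (pushforward leb ph))) => // _ [[c d]] _ <-.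
have E : ph @^-1` [set` `]c, d]] = [set` `](c / a), (d / a)]].
  by apply/seteqP; split=> x /=; rewrite !in_itv/= /ph ltr_pdivrMr// ler_pdivlMr// mulrC.
change (leb [set` `]c, d]] = (a%:E * leb (ph @^-1` [set` `]c, d]]))%E); rewrite E.
rewrite !lebesgue_measure_itv !lte_fin ltr_pM2r ?invr_gt0//; case: ifP => _; last by rewrite mule0.
by rewrite -EFinM -mulrBl mulrC divfK ?gt_eqF.
Qed.

Lemma halfline_dilation a : 0 < a -> (fun t => a * t) @^-1` halfline = @halfline R.
Proof. by move=> a0; apply/seteqP; split=> x; rewrite /halfline /= !in_itv/= !andbT pmulr_rge0. Qed.

Lemma halfline_dilE a t : 0 < a -> halfline (a * t) <-> halfline t.
Proof. by move=> a0; rewrite -[X in _ <-> X t](halfline_dilation a0). Qed.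

Lemma int_dilation a (g : R -> \bar R) : 0 < a -> measurable_fun halfline g -> (forall t, 0 <= g t)%E ->
  (\int[leb]_(t in halfline) g (a * t)%R = (a^-1)%:E * \int[leb]_(t in halfline) g t)%E.
Proof.
move=> a0; pose ph : R -> measurableTypeR R := fun t => a * t.
have : measurable_fun setT ph by exact: mulrl_measurable.
have := @measurable_halfline R.
have a1 : 0 <= a^-1 by rewrite invr_ge0 ltW.
transitivity (\int[leb]_(t in ph @^-1` halfline) (g \o ph) t)%E; first by rewrite halfline_dilation.
rewrite -ge0_integral_pushforward//.
transitivity (\int[mscale (NngNum a1) leb]_(t in halfline) g t)%E; last exact: ge0_integral_mscale.
 apply: eq_measure_integral => B mB _.
exact: measure_dilation.
Qed.

Lemma measurable_dilation a f : 0 < a -> measurable_fun halfline f -> measurable_fun halfline (dilation a f).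
Proof.
move=> a0 mf; apply: (@measurable_comp _ _ _ _ _ _ halfline f halfline (fun t => a * t)) => //.
- exact: measurable_halfline.
- by move=> _ [x] xh <-; exact/halfline_dilE.
- exact: mulrl_measurable.
Qed.

Lemma measurable_super f v : measurable_fun halfline f -> measurable [set t | halfline t /\ v < `|f t|].
Proof.
move=> mf; have mn : measurable_fun halfline (fun t => `|f t|) by exact: measurableT_comp.
have := mn (@measurable_halfline R) `]v, +oo[%classic (measurable_itv _); congr (measurable).
by apply/seteqP; split=> x /=; rewrite in_itv andbT.
Qed.

Lemma dist_dilation a f v : 0 < a -> measurable_fun halfline f ->
  distribution_fun (dilation a f) v = ((a^-1)%:E * distribution_fun f v)%E.
Proof.
move=> a0 mf; rewrite -(measure_dilation a0 (measurable_super v mf)); congr (leb).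
by apply/seteqP; split=> x [h1]; split=> //; move: h1; rewrite halfline_dilE.
Qed.

Lemma mu_fun_le f g : (forall v, (0 < v)%R -> distribution_fun f v <= distribution_fun g v)%E ->
  forall t, (mu_fun f t <= mu_fun g t)%E.
Proof.
move=> h t; apply: le_ereal_inf_tmp => _ [v [v0 Dv] <-]; apply: rearr_le => //.
exact: le_trans (h _ v0) Dv.
Qed.

Lemma dist_noninc f : measurable_fun halfline f -> noninc (distribution_fun f).
Proof.
move=> mf v w vw; apply: le_measure; rewrite ?inE; try exact: measurable_super.
by move=> t [ht vt]; split=> //; exact: le_lt_trans vt.
Qed.

Lemma leb_sub A B : measurable A -> measurable B -> A `<=` B -> (leb A <= leb B)%E.
Proof. by move=> mA mB AB; apply: le_measure; rewrite ?inE. Qed.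

Lemma leb_U A B : measurable A -> measurable B -> A `&` B = set0 -> leb (A `|` B) = (leb A + leb B)%E.
Proof. by move=> mA mB AB; exact: measureU. Qed.

Lemma leb_U2 A B : measurable A -> measurable B -> (leb (A `|` B) <= leb A + leb B)%E.
Proof. by move=> mA mB; exact: measureU2. Qed.

Lemma leb_bigU (B : nat -> set R) (K : \bar R) : (forall n, measurable (B n)) ->
  (forall n k, (n <= k)%N -> B n `<=` B k) -> (forall n, leb (B n) <= K)%E -> (leb (\bigcup_n B n) <= K)%E.
Proof.
move=> mB nB hB.
have c := @nondecreasing_cvg_mu _ _ _ leb B mB (bigcup_measurable (fun n _ => mB n)) (fun n k nk => introT (subsetPset _ _) (nB n k nk)).
by rewrite -(cvg_lim _ c)//; apply: lime_le; [apply/cvg_ex; eexists; exact: c|exact: nearW].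
Qed.

Lemma int_U A B f : measurable A -> measurable B -> A `&` B = set0 -> A `<=` halfline -> B `<=` halfline ->
  measurable_fun halfline f -> (forall t, 0 <= f t) ->
  (\int[leb]_(t in A `|` B) (f t)%:E = \int[leb]_(t in A) (f t)%:E + \int[leb]_(t in B) (f t)%:E)%E.
Proof.
move=> mA mB AB Ah Bh mf f0; rewrite ge0_integral_setU//.
- apply/measurable_EFinP; apply: measurable_funS _ _ mf; first exact: measurable_halfline.
  by move=> x [/Ah|/Bh].
- by move=> *; rewrite lee_fin.
- by apply/disj_setPS; rewrite AB.
Qed.

(** The measure of the part of [C] in [0, t] is 1-Lipschitz in [t], so the intermediate value
    theorem finds where to cut. *)
Lemma subset_measure C (r : R) : measurable C -> C `<=` halfline -> 0 <= r -> (r%:E <= leb C)%E -> (leb C < +oo)%E ->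
  exists2 B, measurable B & B `<=` C /\ leb B = r%:E.
Proof.
move=> mC Ch r0 rC Cf.
have [re|rne] := eqVneq (leb C) r%:E; first by exists C => //; split=> //.
have rC' : (r%:E < leb C)%E by rewrite lt_neqAle eq_sym rne.
pose g t := fine (leb (C `&` `[0, t]%classic)).
have mI t : measurable (C `&` `[0, t]%classic) by exact: measurableI.
have fI t : leb (C `&` `[0, t]%classic) \is a fin_num.
  by rewrite ge0_fin_numE//; apply: le_lt_trans Cf; apply: leb_sub => [].
have gE t : leb (C `&` `[0, t]%classic) = (g t)%:E by rewrite fineK.
have lip s t : s <= t -> g s <= g t <= g s + (t - s).
  move=> st; rewrite -!lee_fin EFinD -!gE; apply/andP; split.
    apply: leb_sub => // x [Cx]; rewrite /= !in_itv/= => /andP[x0 xs].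
    by rewrite x0 (le_trans xs).
  have -> : (t - s)%:E = leb `]s, t]%classic.
    by rewrite lebesgue_measure_itv lte_fin; move: st; rewrite le_eqVlt => /predU1P[->|->]; rewrite ?ltxx ?subrr.
  apply: le_trans (leb_U2 (mI s) (measurable_itv `]s, t])).
  apply: leb_sub => //; first exact: measurableU.
  move=> x [Cx]; rewrite /= !in_itv/= => /andP[x0]; case: (leP) => h; [left|right] => //.
  by split=> //=; rewrite x0.
have cg : continuous g.
  move=> t; apply/cvgrPdist_le => e; exists e => //= s /ltW.
  case: (leP s t) => st.
    have[h1] := lip _ _ st; rewrite !ger0_norm; lra.
  have[h1] := lip _ _ (ltW st); have e1 : t - s <= 0 by lra.
  rewrite (ler0_norm e1) ler0_norm; lra.
have g0 : g 0 = 0.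
  apply/eqP; rewrite eq_le fine_ge0//= andbT -lee_fin -gE; apply: le_trans (_ : _ <= leb [set 0%R])%E _.
    apply: leb_sub => // x [_] /=; rewrite in_itv/= => /andP[x0 x1]; apply/eqP; rewrite eq_le x0 andbT//.
  by rewrite lebesgue_measure_set1.
have [n rn] : exists n : nat, r <= g n%:R.
  apply: contrapT => /forallNP nh; have : (leb C <= r%:E)%E; last by rewrite leNgt rC'.
  have CE : C = \bigcup_n (C `&` `[0, n%:R]%classic).
    rewrite -setI_bigcupr setIidl// => x /Ch; rewrite /halfline /= in_itv/= andbT => x0.
    by exists (Num.trunc x).+1 => //=; rewrite in_itv/= x0 ltW// truncnS_gt.
  rewrite(congr1 leb CE); apply: leb_bigU => // [m n mn x [Cx]|n].
    by rewrite /= !in_itv/= => /andP[x0 xm]; rewrite x0 (le_trans xm)// ler_nat.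
  by rewrite gE lee_fin ltW// ltNge; apply/negP.
have [t _ gt] : exists2 t, t \in `[0, n%:R] & g t = r.
  apply: IVT; [by rewrite ler0n|exact: continuous_subspaceT|].
  by rewrite g0 ge_min r0 le_max rn orbT.
exists (C `&` `[0, t]%classic) => //; split; first by move=> ? [].
by rewrite gE gt.
Qed.

(* Halve [A] and keep the half where [f] is larger: this settles the ratio [1/2],
   and the binary digits of [k / 2^n] give the others. *)
Lemma select n k A f : (k <= 2 ^ n)%N -> measurable A -> A `<=` halfline -> (leb A < +oo)%E ->
  measurable_fun halfline f -> (forall t, 0 <= f t) ->
  exists2 B, measurable B & [/\ B `<=` A, leb B = ((k%:R / 2 ^+ n)%:E * leb A)%E &
    ((k%:R / 2 ^+ n)%:E * \int[leb]_(t in A) (f t)%:E <= \int[leb]_(t in B) (f t)%:E)%E].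
Proof.
move=> + + + + mf f0; have I0 C : (0 <= \int[leb]_(t in C) (f t)%:E)%E by apply: integral_ge0 => *; rewrite lee_fin.
elim: n k A => [|n IH] k A kn mA Ah Af.
  rewrite expr0 divr1; case: k kn => [_|[_|//]]; first by exists set0 => //; rewrite measure0 integral_set0 !mul0e; split.
  by exists A => //; rewrite !mul1e; split.
have fA : leb A \is a fin_num by rewrite ge0_fin_numE.
set m := fine (leb A); have mE : leb A = m%:E by rewrite fineK.
have m0 : 0 <= m by rewrite -lee_fin -mE.
have [A1 [A2 [[m1 m2] [D1 D2] [E0 EU] [h1 h2] h12]]] : exists A1 A2, [/\ measurable A1 /\ measurable A2,
    A1 `<=` A /\ A2 `<=` A, A1 `&` A2 = set0 /\ A = A1 `|` A2, leb A1 = (m / 2)%:E /\ leb A2 = (m / 2)%:E &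
    (\int[leb]_(t in A2) (f t)%:E <= \int[leb]_(t in A1) (f t)%:E)%E].
  have [|||C mC [CA hC]] := @subset_measure A (m / 2) mA Ah; [lra|by rewrite mE lee_fin; lra|by []|].
  have mD := measurableD mA mC; have CD : C `&` (A `\` C) = set0 by rewrite setDIK.
  have hD : leb (A `\` C) = (m / 2)%:E.
    have := leb_U mC mD CD; rewrite setDUK// mE hC => e.
    have : leb (A `\` C) \is a fin_num by rewrite ge0_fin_numE// (le_lt_trans (leb_sub mD mA (@subDsetl _ _ _))).
    by case: (leb _) e => // d [] e _; congr _%:E; lra.
  case: (leP (\int[leb]_(t in A `\` C) (f t)%:E)%E (\int[leb]_(t in C) (f t)%:E)%E) => [h|/ltW h].
    by exists C, (A `\` C); rewrite setDUK//; split=> //; split=> //; exact: subDsetl.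
  by exists (A `\` C), C; rewrite setIC setUC setDUK//; split=> //; split=> //; exact: subDsetl.
have fin B : measurable B -> B `<=` A -> (leb B < +oo)%E by move=> mB BA; apply: le_lt_trans Af; exact: leb_sub.
set p := (\int[leb]_(t in A1) _)%E in h12; set q := (\int[leb]_(t in A2) _)%E in h12.
have [p0 q0] : (0 <= p)%E /\ (0 <= q)%E by split; exact: I0.
have -> : (\int[leb]_(t in A) (f t)%:E = p + q)%E by rewrite EU int_U//; [exact: subset_trans Ah|exact: subset_trans Ah].
have p2 : 0 < 2 ^+ n :> R by rewrite exprn_gt0.
rewrite mE exprS invfM [_ * (2^-1 * _)]mulrCA mulrC; have [kl|kl] := leqP k (2 ^ n).
  have [B mB [BA hB iB]] := IH k A1 kl m1 (subset_trans D1 Ah) (fin _ m1 D1).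
  exists B => //; split; [exact: subset_trans D1|by rewrite hB h1 -!EFinM mulrA [in RHS]mulrAC|apply: le_trans iB].
  move: (k%:R / _) (divr_ge0 (ler0n R k) (ltW p2)) => c c0.
  apply: le_trans (lee_wpmul2l _ (leeD2l p h12)) _; first by rewrite lee_fin divr_ge0.
  by rewrite ge0_muleDr// -ge0_muleDl ?lee_fin ?divr_ge0// -EFinD -splitr.
have kl' : (k - 2 ^ n <= 2 ^ n)%N by rewrite leq_subLR addnn -mul2n -expnS.
have [B mB [BA hB iB]] := IH _ A2 kl' m2 (subset_trans D2 Ah) (fin _ m2 D2).
move: hB iB; rewrite natrB ?(ltnW kl)// natrX mulrBl mulfV ?gt_eqF//; set c := k%:R / _ => hB iB.
have [c1 c2] : 1 <= c /\ c <= 2 by rewrite ler_pdivlMr// ler_pdivrMr// mul1r -natrX -natrM !ler_nat -expnS (ltnW kl).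
have A1B : A1 `&` B = set0 by apply/seteqP; split=> // x [xA /BA xB]; rewrite -E0.
exists (A1 `|` B); first exact: measurableU.
split=> [x [/D1//|/BA/D2//]||]; first by rewrite leb_U// hB h1 h2 -!EFinM -EFinD; congr _%:E; lra.
rewrite int_U//; [|exact: subset_trans Ah|by move=> x /BA/D2/Ah].
apply: le_trans (leeD2l p iB); rewrite -/p ge0_muleDr//.
(* The requested fraction is [c / 2] with [c] between 1 and 2. Taking all of the better half exceeds
   its share by the weight [1 - c / 2], and [q <= p] lets this excess pay for what is missing from
   the other half. *)
rewrite [in leRHS](_ : p = (c / 2)%:E * p + (1 - c / 2)%:E * p)%E; last first.
  by rewrite -ge0_muleDl ?lee_fin; [rewrite -EFinD addrC subrK mul1e|lra|lra].
have -> : ((c / 2)%:E * q = (1 - c / 2)%:E * q + (c - 1)%:E * q)%E.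
  by rewrite -ge0_muleDl ?lee_fin; [rewrite -EFinD; congr (_%:E * _)%E|..]; lra.
by rewrite -addeA leeD2l// leeD2r// lee_wpmul2l// lee_fin; lra.
Qed.
(** The selections must agree along the whole chain, so [select] is applied to the innermost set and
    to each successive difference; proportions of measure and lower bounds for the integral then add
    up on every [S i] at once. *)
Lemma select_chain n k (S : nat -> set R) f N : (k <= 2 ^ n)%N -> let th : R := k%:R / 2 ^+ n in (forall i, measurable (S i)) -> (forall i, S i `<=` halfline) ->
  (forall i, S i.+1 `<=` S i) -> (leb (S 0%N) < +oo)%E -> measurable_fun halfline f ->
  (forall t, 0 <= f t) ->
  exists2 B, measurable B & B `<=` S 0%N /\ forall i, (i <= N)%N -> leb (B `&` S i) = (th%:E * leb (S i))%E /\
    (th%:E * \int[leb]_(t in S i) (f t)%:E <= \int[leb]_(t in B `&` S i) (f t)%:E)%E.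
Proof.
move=> kn th; elim: N S => [|N IH] S mS Sh Sd Sf mf f0.
  have [B mB [BS]] := select kn (mS 0%N) (Sh 0%N) Sf mf f0.
  by exists B => //; split=> // i; rewrite leqn0 => /eqP ->; rewrite setIidl.
have [] := IH (fun i => S i.+1) => //.
  by apply: le_lt_trans Sf; exact: leb_sub.
move=> B1 mB1 [B1S hB1].
have mD : measurable (S 0%N `\` S 1%N) by exact: measurableD.
have [] := @select n k (S 0%N `\` S 1%N) f kn => //.
- by move=> x [/Sh].
- by apply: le_lt_trans Sf; apply: leb_sub => //.
move=> B0 mB0 [B0S B0E].
have dec i : (0 < i)%N -> S i `<=` S 1%N.
  by case: i => // i _; elim: i => // i IHi; exact: subset_trans IHi.
exists (B0 `|` B1); first exact: measurableU.
split=> [x [/B0S[]//|/B1S/Sd//]|i].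
case: i => [_|i]; last first.
  rewrite ltnS => iN; have -> : (B0 `|` B1) `&` S i.+1 = B1 `&` S i.+1; last exact: hB1.
  apply/seteqP; split=> x [h Sx]; split=> //; [|by right].
  by case: h => // /B0S[_] /(_ (dec i.+1 isT _ Sx)).
have [h1 h2] := hB1 0%N isT.
have dis : B0 `&` B1 = set0 by apply/seteqP; split=> // x [/B0S[_ nx] /B1S].
have S01 : S 0%N = (S 0%N `\` S 1%N) `|` S 1%N by rewrite setUC setDUK.
have disS : (S 0%N `\` S 1%N) `&` S 1%N = set0 by apply/seteqP; split=> // x [[]].
rewrite setIidl; last move=> x [/B0S[]//|/B1S/Sd//].
rewrite setIidl// in h1 h2; split.
  by rewrite leb_U// B0E h1 -ge0_muleDr// -leb_U// -S01.
rewrite {1}S01 !int_U//.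
- rewrite ge0_muleDr; [exact: leeD| |]; by apply: integral_ge0 => *; rewrite lee_fin.
- by move=> x /B0S[/Sh].
- by move=> x /B1S/Sh.
- by move=> x [/Sh].
Qed.

Lemma noninc_measurable g : (forall s t, 0 < s -> s <= t -> g t <= g s) -> measurable_fun halfline g.
Proof.
move=> hg.
have : measurable_fun (`]0, +oo[ : set R) g.
  apply: (measurability (@RGenCInfty.G R)) => [| _ [_] [r] -> <-]; first exact: RGenCInfty.measurableE.
  apply: is_interval_measurable => s t /=; rewrite !in_itv !andbT => -[s0 gs] [t0 gt] u /andP[su ut].
  have u0 := lt_le_trans s0 su; split; rewrite in_itv andbT//.
  exact: le_trans (hg _ _ u0 ut).
by move=> /measurable_fun_itv_obnd_cbndP.
Qed.

(** On the block from [b] to [2 b] a nonincreasing [g] contributes at most [b * g b]. The blocks run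
    in both directions from [a], which is left free so that it can be put at the level of a spectral
    cut. *)
Lemma dyadic_integral g (a L : R) : 0 < a -> (forall t, 0 <= g t) ->
  (forall s t, 0 < s -> s <= t -> g t <= g s) ->
  (forall n, \sum_(0 <= i < n) (a * 2 ^+ i * g (a * 2 ^+ i) + a * 2 ^- i.+1 * g (a * 2 ^- i.+1)) <= L) ->
  (\int[leb]_(t in `]0%R, +oo[) (g t)%:E <= L%:E)%E.
Proof.
move=> a0 g0 hg hL; have mg := noninc_measurable hg.
have msub (D : set R) : measurable D -> D `<=` halfline -> measurable_fun D (EFin \o g).
  by move=> mD sD; apply/measurable_EFinP; apply: measurable_funS mg => //; exact: measurable_halfline.
have sub (b c : R) : 0 < b -> `[b, c[ `<=` halfline.
  by move=> b0 t /=; rewrite /halfline /= !in_itv /= andbT => /andP[bt _]; rewrite (le_trans (ltW b0)).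
have step (b : R) : 0 < b -> (\int[leb]_(t in `[b, (2 * b)%R[) (g t)%:E <= (b * g b)%:E)%E.
  move=> b0; apply: le_trans (_ : (\int[leb]_(t in `[b, (2 * b)%R[) (g b)%:E <= _)%E).
    apply: ge0_le_integral => //; [by move=> t _; rewrite lee_fin|by apply: msub => //; exact: sub|].
    by move=> t /=; rewrite in_itv/= => /andP[bt _]; rewrite lee_fin hg.
  rewrite integral_cst//= lebesgue_measure_itv/= lte_fin ltr_pMl// ltr1n -EFinD -EFinM lee_fin.
  by rewrite mulrC ler_wpM2r//; lra.
pose F n : set R := [set` `[a * 2 ^- n, a * 2 ^+ n[].
have p2 n : 0 < 2 ^+ n :> R by rewrite exprn_gt0.
have an n : 0 < a * 2 ^- n by rewrite mulr_gt0// invr_gt0.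
have le1 n : 1 <= 2 ^+ n :> R by rewrite exprn_ege1// ler1n.
have mono n : a * 2 ^- n <= a * 2 ^+ n.
  by rewrite ler_pM2l//; apply: le_trans (le1 n); rewrite invf_le1.
have split (b c d : R) : 0 < b -> b <= c -> c <= d -> (\int[leb]_(t in `[b, d[) (g t)%:E =
    \int[leb]_(t in `[b, c[) (g t)%:E + \int[leb]_(t in `[c, d[) (g t)%:E)%E.
  move=> b0 bc cd; rewrite (@itv_bndbnd_setU _ _ _ (BLeft c)) ?bnd_simp//.
  rewrite ge0_integral_setU//; [|by move=> t _; rewrite lee_fin|].
    by apply: msub; [exact: measurableU|rewrite subUset; split; apply: sub => //; exact: lt_le_trans bc].
  rewrite disj_set2E; apply/eqP/seteqP; split=> // t [/=]; rewrite !in_itv/= => /andP[_ h1] /andP[h2 _].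
  by move: (lt_le_trans h1 h2); rewrite ltxx.
have H n : (\int[leb]_(t in F n) (g t)%:E <= (\sum_(0 <= i < n)
    (a * 2 ^+ i * g (a * 2 ^+ i) + a * 2 ^- i.+1 * g (a * 2 ^- i.+1)))%:E)%E.
  elim: n => [|n IH]; first by rewrite big_geq// /F expr0 invr1 set_itv_ge ?integral_set0// bnd_simp ltxx.
  have E1 : a * 2 ^- n = 2 * (a * 2 ^- n.+1) by rewrite exprS invfM mulrCA [2 * (_ * _)]mulrA mulfV ?mul1r.
  have E2 : a * 2 ^+ n.+1 = 2 * (a * 2 ^+ n) by rewrite exprS mulrCA.
  have h1 : a * 2 ^- n.+1 <= a * 2 ^- n by rewrite E1 ler_peMl ?ler1n// ltW.
  have h2 : a * 2 ^+ n <= a * 2 ^+ n.+1 by rewrite E2 ler_peMl ?ler1n// mulr_ge0 ?(ltW a0) ?(ltW (p2 n)).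
  rewrite /F (split _ (a * 2 ^- n))//; last exact: le_trans (mono n) h2.
  rewrite (split (a * 2 ^- n) (a * 2 ^+ n))// big_nat_recr//= [X in (_ <= (_ + X)%:E)%E]addrC addrCA !EFinD.
  by apply: leeD => //; apply: leeD; [rewrite E1|rewrite E2]; apply: step; rewrite ?mulr_gt0.
have cov : \bigcup_n F n = [set` `]0, +oo[].
  apply/seteqP; split=> [t [n _]|t]; rewrite /F /= !in_itv/= andbT; first by move=> /andP[h _]; exact: lt_le_trans (an n) h.
  move=> t0; exists (Num.truncn (t / a + a / t)).+1 => //; rewrite /F /= in_itv/=; set m := (Num.truncn _).+1.
  have hm : t / a + a / t < 2 ^+ m by exact: pow2_gt.
  have [h1 h2] : 0 < t / a /\ 0 < a / t by split; exact: divr_gt0.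
  apply/andP; split; first by rewrite ler_pdivrMr// mulrC -ler_pdivrMr//; lra.
  by rewrite mulrC -ltr_pdivrMr//; lra.
have c : (\int[leb]_(t in F n) (g t)%:E @[n --> \oo] --> \int[leb]_(t in \bigcup_n F n) (g t)%:E)%E.
  apply: ge0_nondecreasing_set_cvg_integral => [m n mn|n|n|n t _]; [|exact: measurable_itv| |by rewrite lee_fin].
    apply/subsetPset => t; rewrite /F /= !in_itv/= => /andP[h1 h2]; apply/andP; split.
      by apply: le_trans h1; rewrite ler_pM2l// lef_pV2 ?posrE// ler_eXn2l// ltr1n.
    by apply: lt_le_trans h2 _; rewrite ler_pM2l// ler_eXn2l// ltr1n.
  by apply: msub; [exact: measurable_itv|exact: (sub _ _ (an n))].
rewrite -cov -(cvg_lim _ c)//; apply: lime_le; first exact: cvgP c.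
by apply: nearW => n; apply: le_trans (H n) _; rewrite lee_fin.
Qed.

Definition window g T n : R := \sum_(0 <= j < n) g (T * 2 ^+ j) + \sum_(0 <= j < n) g (T * 2 ^- j.+1).

Lemma window_double g T n : (forall t, 0 <= g t) -> window g T n <= window g (2 * T) n.+1.
Proof.
move=> g0; rewrite [X in _ <= _ + X]big_nat_recl//= addrA; apply: lerD; last first.
  apply: le_of_eq; apply: eq_bigr => j _; congr (g).
  by rewrite [in RHS]exprS; field.
rewrite [2 * T]mulrC mulfK//addrC.
have -> : g T + \sum_(0 <= j < n.+1) g (T * 2 * 2 ^+ j) = \sum_(0 <= j < n.+2) g (T * 2 ^+ j).
  rewrite [RHS]big_nat_recl//= expr0 mulr1; congr (_ + _); apply: eq_bigr => j; by rewrite exprS mulrA.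
by rewrite !big_nat_recr//= -addrA lerDl addr_ge0.
Qed.

Lemma window_half g T n : (forall t, 0 <= g t) -> window g T n <= window g (T / 2) n.+1.
Proof.
move=> g0; rewrite /window big_nat_recl//= expr0 mulr1 [g _ + _]addrC -addrA; apply: lerD.
  apply: le_of_eq; apply: eq_bigr => j.
  by rewrite exprS mulrA divfK.
have -> : g (T / 2) + \sum_(0 <= j < n.+1) g (T / 2 * 2 ^- j.+1) = \sum_(0 <= j < n.+2) g (T * 2 ^- j.+1).
  rewrite [RHS]big_nat_recl//= expr1; congr (_ + _); apply: eq_bigr => j.
  by rewrite [in RHS]exprS invfM mulrA.
by rewrite !big_nat_recr//= -addrA lerDl addr_ge0.
Qed.

(** Doubling or halving the centre shifts the samples by one place, and one extra term on either
    side keeps all the old ones. The scale starting at 1 can therefore be recentred at a [T]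
    comparable with [s], the point where [kap] changes its formula. *)
Lemma window_center g s n : 0 < s -> (forall t, 0 <= g t) ->
  exists T m, s <= T < 2 * s /\ window g 1 n <= window g T m.
Proof.
move=> s0 g0.
have up m : window g 1 n <= window g (2 ^+ m) (n + m).
  elim: m => [|m IH]; first by rewrite addn0.
  by apply: le_trans IH _; rewrite exprS addnS; exact: window_double.
have dn m : window g 1 n <= window g (2 ^- m) (n + m).
  elim: m => [|m IH]; first by rewrite invr1 addn0.
  by apply: le_trans IH _; rewrite exprSr invfM addnS; exact: window_half.
have pow t : exists m, t < 2 ^+ m.
  by exists (Num.trunc t).+1; exact: pow2_gt.
have [s1|s1] := ltP 1 s.
  have ex : exists m, s <= 2 ^+ m by have [m /ltW] := pow s; exists m.
  case: (ex_minnP ex) => -[|m] sm mn; first by move: sm; rewrite leNgt s1.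
  exists (2 ^+ m.+1), (n + m.+1)%N; split; last exact: up.
  rewrite sm exprS ltr_pM2l// ltNge; apply/negP => h; by have := mn _ h; rewrite ltnn.
have ex : exists m, 2 ^- m.+1 < s.
  have [m hm] := pow s^-1; exists m; rewrite invf_plt ?posrE//; apply: lt_trans hm _.
  by rewrite exprS ltr_pMl// ltr1n.
case: (ex_minnP ex) => m sm mn; exists (2 ^- m), (n + m)%N; split; last exact: dn.
apply/andP; split; last by move: sm; rewrite exprS invfM ltr_pdivrMl//.
case: m sm mn => [|m] sm mn; first by rewrite invr1.
rewrite leNgt; apply/negP => h; by have := mn _ h; rewrite ltnn.
Qed.

(** For [p <= q] this is the smaller of [s^(1 - 1/p) T^(1/p)] and [s^(1 - 1/q) T^(1/q)]: up to the
    height of the piece and a constant, the bound on the K-functional at [s] of the image of a piece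
    living at scale [T]. *)
Definition kap p q s T : R :=
  if s <= T then s `^ (1 - q^-1) * T `^ q^-1 else s `^ (1 - p^-1) * T `^ p^-1.

Lemma kap_ge0 p q s T : 0 <= kap p q s T.
Proof. by rewrite /kap; case: ifP => _; rewrite mulr_ge0 ?powR_ge0. Qed.

Lemma pow2_powR r j : (2 ^+ j) `^ r = (2 `^ r) ^+ j :> R.
Proof. by elim: j => [|j IH]; [rewrite powR1|rewrite !exprS powRM// IH]. Qed.

Lemma pow2V_powR r j : (2 ^- j) `^ r = (2 `^ r) ^- j :> R.
Proof.
have x0 : (2 `^ r) ^+ j != 0 :> R by [].
apply: (mulIf x0); rewrite mulVf// -pow2_powR -powRM// mulVf ?powR1//.
Qed.

(** * Averages of dilates and the discretized Calderon operator *)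

Section Averages.
Variable f : R -> R.
Hypotheses (mf : measurable_fun halfline f) (f0 : forall t, 0 <= f t)
  (fd : forall s t, 0 < s -> s <= t -> f t <= f s).

(** An integral of the dilate of [f] by [u]. Unlike samples of [f], these integrals can be paired
    with elements of [F], so that dilation norms control them. *)
Definition avg u s : \bar R := (\int[leb]_(t in below s%:E) (f (u * t))%:E)%E.

Lemma below_halfline (d : \bar R) : below d `<=` halfline.
Proof. by move=> t [t0]; rewrite /halfline /= in_itv/= andbT ltW. Qed.

Lemma below_fin s : 0 <= s -> measurable (below s%:E) /\ leb (below s%:E) = s%:E.
Proof. by move=> s0; apply: belowE. Qed.

Lemma avg_meas u (X : set R) : 0 < u -> measurable X -> X `<=` halfline -> measurable_fun X (fun t => (f (u * t))%:E).
Proof.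
move=> u0 mX Xh; apply/measurable_EFinP.
by apply: (measurable_funS _ Xh (measurable_dilation u0 mf)); exact: measurable_halfline.
Qed.

Lemma avg_ge0 u s : (0 <= avg u s)%E. Proof. by apply: integral_ge0 => t; rewrite lee_fin. Qed.

Lemma avg_low u s : 0 < u -> 0 < s -> ((s * f (u * s))%:E <= avg u s)%E.
Proof.
move=> u0 s0; have [mB BE] := below_fin (ltW s0).
rewrite mulrC EFinM -BE -(integral_cst leb mB); apply: ge0_le_integral => //.
- by move=> t _; rewrite lee_fin.
- exact: avg_meas u0 mB (@below_halfline _).
by move=> t [t0 ts]; apply: fd; [rewrite mulr_gt0|rewrite ler_pM2l// ltW//].
Qed.

Lemma itv_halfline a b : 0 <= a -> [set` `]a, b]] `<=` halfline.
Proof. by move=> a0 t; rewrite /halfline /= !in_itv andbT => /andP[h _]; apply: ltW; apply: le_lt_trans h. Qed.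

Lemma avg_subset (A B : set R) u : 0 < u -> measurable A -> measurable B -> A `<=` B -> B `<=` halfline ->
  (\int[leb]_(t in A) (f (u * t))%:E <= \int[leb]_(t in B) (f (u * t))%:E)%E.
Proof.
by move=> u0 mA mB AB Bh; apply: ge0_subset_integral => //; [exact: avg_meas|move=> t; rewrite lee_fin].
Qed.

(** Each product [f x * x] is at most twice the integral of [f] from [x / 2] to [x], and these
    intervals are disjoint and lie below [s]. This replaces the lower Boyd index when [p = 1]. *)
Lemma avg_telescope T s n : 0 < T -> T / 2 < s ->
  ((\sum_(0 <= j < n) f (T * 2 ^- j.+1) * (T * 2 ^- j.+1))%:E <= 2%:E * avg 1 s)%E.
Proof.
move=> T0 Ts; pose x m := T * 2 ^- m.+1; pose I m := (\int[leb]_(t in [set` `](x m), (T / 2)%R]]) (f (1 * t))%:E)%E.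
have x0 m : 0 < x m by rewrite mulr_gt0//.
have xT m : x m <= T / 2.
  by rewrite ler_pM2l// lef_pV2 ?posrE// exprS ler_peMr// exprn_ege1// ler1n.
have x2 m : x m.+1 = x m / 2 by rewrite /x [2 ^+ m.+2]exprS invfM mulrCA mulrC.
have xh m b : [set` `](x m), b]] `<=` halfline by exact: itv_halfline (ltW (x0 m)).
suff h m : ((\sum_(0 <= j < m) f (x j) * x j)%:E <= 2%:E * I m)%E.
  apply: le_trans (h n) _; apply: lee_wpmul2l; first by rewrite lee_fin.
  have [mB _] := below_fin (ltW (le_lt_trans (ltW (divr_gt0 T0 (ltr0Sn R 1))) Ts)).
  apply: avg_subset => //; last exact: below_halfline.
  move=> t /=; rewrite/= => /andP[h1]; split; first exact: lt_trans h1.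
  by rewrite lte_fin; exact: le_lt_trans Ts.
elim: m => [|m IH]; first by rewrite big_geq//; apply: mule_ge0; [rewrite lee_fin|apply: integral_ge0 => t; rewrite lee_fin].
have J1 : ((f (x m) * (x m / 2))%:E <= \int[leb]_(t in [set` `](x m.+1), (x m)]]) (f (1 * t))%:E)%E.
  have E : leb [set` `](x m.+1), (x m)]] = (x m / 2)%:E.
    rewrite lebesgue_measure_itv/= lte_fin x2 ltr_pdivrMr// ltr_pMr// ltr1n; congr (_%:E); lra.
  rewrite EFinM -E -(integral_cst leb (measurable_itv _)); apply: ge0_le_integral => //.
  - by move=> t _; rewrite lee_fin.
  - exact: avg_meas.
  by move=> t /=; rewrite/= => /andP[h1 h2]; rewrite lee_fin mul1r fd// (lt_trans _ h1).
have J2 : (\int[leb]_(t in [set` `](x m.+1), (x m)]]) (f (1 * t))%:E + I m <= I m.+1)%E.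
  rewrite /I -ge0_integral_setU//.
  - apply: avg_subset => //; first exact: measurableU.
    move=> t [|] /=; rewrite/= => /andP[h1 h2]; apply/andP; split=> //; first exact: le_trans (xT m).
    by apply: lt_trans h1; rewrite x2 ltr_pdivrMr// ltr_pMr// ltr1n.
  - by apply: avg_meas => //; [exact: measurableU|move=> t [|]; exact: xh].
  - by move=> t _; rewrite lee_fin.
  - apply/disj_setPS => t [] /=; rewrite !in_itv/= => /andP[_ h1] /andP[h2]; by move: h2; rewrite ltNge h1.
rewrite big_nat_recr//= EFinD; apply: le_trans (lee_wpmul2l _ J2); last by rewrite lee_fin.
rewrite ge0_muleDr; [|by apply: integral_ge0 => t; rewrite lee_fin|by apply: integral_ge0 => t; rewrite lee_fin].
rewrite addeC; apply: leeD => //; apply: le_trans (lee_wpmul2l _ J1); last by rewrite lee_fin.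
have -> : f (x m) * x m = 2 * (f (x m) * (x m / 2)) by field.
by rewrite EFinM.
Qed.

(** Partial sums of the discretized Calderon operator at [s]: what the K-functionals of the dyadic
    pieces add up to. *)
Definition kpart p q s n : R :=
  \sum_(0 <= i < n) (f (2 ^+ i) * kap p q s (2 ^+ i)) + \sum_(0 <= i < n) (f (2 ^- i.+1) * kap p q s (2 ^- i.+1)).

(** The same operator with samples replaced by integrals of dilates over ]0, s[. Scales above [s]
    use dilations by [2^j]; those below use the weights [b] and the dilations [w]. *)
Definition kbar q (b w : nat -> R) s : \bar R :=
  (\sum_(0 <= j <oo) ((2 * (2 `^ q^-1) ^+ j)%:E * avg (2 ^+ j) s + (b j)%:E * avg (w j) s))%E.

(* The weights of the averages over the scales below [s]. *)
Definition weights p (b w : nat -> R) : Prop := (forall j, 0 <= b j /\ 0 < w j) /\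
  (p = 1 /\ b = (fun j => if j is 0%N then 2 else 0) /\ w = (fun=> 1) \/
   b = (fun j => (2 `^ p^-1) ^- j) /\ w = (fun j => 2 ^- j.+1)).

Lemma kbar_term0 q (b w : nat -> R) s j : (forall j, 0 <= b j /\ 0 < w j) ->
  (0 <= (2 * (2 `^ q^-1) ^+ j)%:E * avg (2 ^+ j) s + (b j)%:E * avg (w j) s)%E.
Proof.
move=> hb; apply: adde_ge0; apply: mule_ge0; rewrite ?avg_ge0//; last by case: (hb j).
Qed.

(** After recentring, [T] lies in [[s, 2 s[]. A sample at [T 2^j] is at most the value of [f] at
    [s 2^j], hence at most the mean over ]0, s[ of the dilate by [2^j]; the factor 2 in [kbar] pays
    for [T < 2 s]. Samples below [T] are treated likewise, or telescoped if [p = 1]. *)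
Lemma kpart_le p q (b w : nat -> R) s n : 1 <= p -> 1 <= q -> weights p b w -> 0 < s -> ((kpart p q s n)%:E <= kbar q b w s)%E.
Proof.
move=> p1 q1 [hb hw] s0; pose g t := if 0 < t then f t * kap p q s t else 0.
have g0 t : 0 <= g t by rewrite /g; case: ifP => //; rewrite mulr_ge0 ?kap_ge0.
have p0 := lt_le_trans ltr01 p1; have q0 := lt_le_trans ltr01 q1.
have sE r : s `^ (1 - r^-1) * s `^ r^-1 = s by rewrite -powRD ?(gt_eqF s0) ?implybT// subrK powRr1 ?ltW.
have e2 j : 0 < 2 ^+ j :> R by rewrite exprn_gt0.
have d2 j : 0 < 2 ^- j :> R by rewrite invr_gt0.
have -> : kpart p q s n = window g 1 n.
  by congr (_ + _); apply: eq_bigr => j _; rewrite mul1r /g ?e2 ?d2.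
have [T [m [/andP[sT T2] h]]] := window_center n s0 g0.
have T0 : 0 < T by exact: lt_le_trans sT.
(* One more term on each side makes both sums nonempty; the case [p = 1] splits off the index 0. *)
apply: le_trans (_ : _ <= (window g T m.+1)%:E)%E _.
  rewrite lee_fin; apply: le_trans h _; apply: lerD; by rewrite [X in _ <= X]big_nat_recr//= lerDl.
have hup j : ((g (T * 2 ^+ j))%:E <= (2 * (2 `^ q^-1) ^+ j)%:E * avg (2 ^+ j) s)%E.
  apply: le_trans (lee_wpmul2l _ (avg_low (e2 j) s0)); last by [].
  have sTj : s <= T * 2 ^+ j by apply: le_trans sT _; rewrite ler_peMr ?exprn_ege1 ?ler1n// ltW.
  rewrite /g mulr_gt0// /kap sTj.
  have fj : f (T * 2 ^+ j) <= f (2 ^+ j * s) by rewrite mulrC fd ?mulr_gt0// ler_pM2l.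
  have Tq : T `^ q^-1 <= 2 * s `^ q^-1.
    apply: le_trans (_ : (2 * s) `^ q^-1 <= _).
      by apply: ge0_ler_powR; rewrite ?nnegrE ?invr_ge0 ?(ltW q0) ?(ltW T0) ?(ltW T2)// mulr_ge0 ?ltW.
    rewrite powRM ?(ltW s0)//; apply: ler_wpM2r; first exact: powR_ge0.
    by rewrite -[X in _ <= X]powRr1// ler_powR ?ler1n// invf_le1.
  have kj : s `^ (1 - q^-1) * (T * 2 ^+ j) `^ q^-1 <= 2 * (2 `^ q^-1) ^+ j * s.
    rewrite powRM ?(ltW T0)// pow2_powR -[X in _ <= _ * X](sE q) [X in _ <= X]mulrC -[X in _ <= X]mulrA.
    apply: ler_wpM2l; first exact: powR_ge0.
    rewrite mulrA; apply: ler_wpM2r; first by [].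
    by rewrite mulrC.
  apply: le_trans (ler_pM (f0 _) (mulr_ge0 (powR_ge0 _ _) (powR_ge0 _ _)) fj kj) _.
  by rewrite mulrC -[leLHS]mulrA.
have hdn j : g (T * 2 ^- j.+1) = f (T * 2 ^- j.+1) * (s `^ (1 - p^-1) * (T * 2 ^- j.+1) `^ p^-1) /\ T * 2 ^- j.+1 <= s * 2 ^- j.
  have lt : T * 2 ^- j.+1 < s * 2 ^- j.
    by rewrite exprS invfM mulrA ltr_pM2r// ltr_pdivrMr// mulrC.
  split; last exact: ltW.
  rewrite /g mulr_gt0// /kap leNgt (lt_le_trans lt)// ler_piMr ?(ltW s0)// invf_le1 ?exprn_ege1 ?ler1n//.
have hlow : ((\sum_(0 <= j < m.+1) g (T * 2 ^- j.+1))%:E <= \sum_(0 <= j < m.+1) (b j)%:E * avg (w j) s)%E.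
  case: hw => [[pE [-> ->]]|[-> ->]].
    rewrite [X in (_ <= X)%E]big_nat_recl//= [X in (_ + X)%E]big1 ?adde0; last by move=> j; rewrite mul0e.
    rewrite (eq_bigr (fun j => f (T * 2 ^- j.+1) * (T * 2 ^- j.+1))) => [|j].
      by apply: avg_telescope => //; rewrite ltr_pdivrMr// mulrC.
    by rewrite (hdn j).1 pE invr1 subrr powRr0 mul1r powRr1// mulr_ge0 ?ltW.
  rewrite -sumEFin; apply: lee_sum => j _.
  apply: le_trans (lee_wpmul2l _ (avg_low (d2 j.+1) s0)); last by [].
  rewrite (hdn j).1.
  have fj : f (T * 2 ^- j.+1) <= f (2 ^- j.+1 * s) by rewrite mulrC fd ?mulr_gt0// ler_pM2l.
  have kj : s `^ (1 - p^-1) * (T * 2 ^- j.+1) `^ p^-1 <= (2 `^ p^-1) ^- j * s.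
    rewrite -[X in _ <= _ * X](sE p)mulrCA; apply: ler_wpM2l; first exact: powR_ge0.
    apply: le_trans (_ : (s * 2 ^- j) `^ p^-1 <= _).
      by apply: ge0_ler_powR; rewrite ?nnegrE ?invr_ge0 ?(ltW p0) ?(hdn j).2// mulr_ge0 ?ltW.
    by rewrite powRM ?(ltW s0)// mulrC pow2V_powR.
  apply: le_trans (ler_pM (f0 _) (mulr_ge0 (powR_ge0 _ _) (powR_ge0 _ _)) fj kj) _.
  by rewrite mulrC -[leLHS]mulrA.
apply: le_trans (nneseries_lim_ge m.+1 (fun j _ _ => kbar_term0 q s j hb)).
rewrite big_split /= /window EFinD; apply: leeD hlow; rewrite -sumEFin; exact: lee_sum.
Qed.

End Averages.

Lemma int_indic (S : set R) (g : R -> R) : measurable S -> S `<=` halfline ->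
  (\int[leb]_(t in halfline) (\1_S t * g t)%:E = \int[leb]_(t in S) (g t)%:E)%E.
Proof.
move=> mS Sh; rewrite -[in RHS](setIidr Sh) integral_mkcondr; apply: eq_integral => t _.
by rewrite patchE indicE; case: (t \in S); rewrite ?mul1r ?mul0r.
Qed.

Lemma int_steps J N (S : nat -> set R) g : (forall i, measurable (S i)) -> (forall i, S i `<=` halfline) ->
  measurable_fun halfline g -> (forall t, 0 <= g t) ->
  measurable_fun halfline (fun t => \sum_(0 <= i < N) (dy J)%:E * (\1_(S i) t * g t)%:E)%E /\
  (\int[leb]_(t in halfline) \sum_(0 <= i < N) (dy J)%:E * (\1_(S i) t * g t)%:E =
   \sum_(0 <= i < N) (dy J)%:E * \int[leb]_(t in S i) (g t)%:E)%E.
Proof.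
move=> mS Sh mg g0; have d0 := ltW (@dy_gt0 R J); have mh := @measurable_halfline R.
have mt i : measurable_fun halfline (fun t => (\1_(S i) t * g t)%:E).
  apply/measurable_EFinP; apply: measurable_funM => //; exact/measurable_funTS/measurable_indic.
have mtd i : measurable_fun halfline (fun t => (dy J)%:E * (\1_(S i) t * g t)%:E)%E by exact: emeasurable_funM.
split; first exact: emeasurable_sum.
rewrite ge0_integral_sum//; last by move=> i t _; rewrite mule_ge0 ?lee_fin// mulr_ge0.
apply: eq_bigr => i _; rewrite ge0_integralZl_EFin ?int_indic//; [by move=> t _; rewrite lee_fin mulr_ge0|exact: mt].
Qed.

(** [|f|] is the limit of its [layers]; cutting to [[0, J]] makes the level sets nested of finite
    measure, and Fatou passes to the limit. Integrals against [w] thus reduce to integrals of [w]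
    over sets no larger than the level sets of [f]. *)
Lemma layer_cake_le f (w : R -> R) (K : \bar R) : measurable_fun halfline f -> measurable_fun halfline w -> (forall t, 0 <= w t) ->
  (forall J (S : nat -> set R), (forall i, measurable (S i)) -> (forall i, S i `<=` halfline) ->
    (forall i, S i.+1 `<=` S i) -> (leb (S 0%N) < +oo)%E ->
    (forall i, leb (S i) <= distribution_fun f (dy J * i.+1%:R))%E ->
    (\sum_(0 <= i < 4 ^ J) (dy J)%:E * \int[leb]_(t in S i) (w t)%:E <= K)%E) ->
  (\int[leb]_(t in halfline) (`|f t| * w t)%:E <= K)%E.
Proof.
move=> mf mw w0 hK; pose X J : set R := [set` `[0, J%:R]].
pose S J i : set R := X J `&` [set t | halfline t /\ dy J * i.+1%:R < `|f t|].
have mS J i : measurable (S J i) by apply: measurableI; [exact: measurable_itv|exact: measurable_super].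
have Sh J i : S J i `<=` halfline by move=> t [_ []].
pose g J t := (\sum_(0 <= i < 4 ^ J) (dy J)%:E * (\1_(S J i) t * w t)%:E)%E.
have g0 J t : halfline t -> (0 <= g J t)%E.
  by move=> _; apply: sume_ge0 => i _; rewrite mule_ge0 ?lee_fin ?mulr_ge0// ltW// dy_gt0.
have hg J := int_steps J (4 ^ J) (mS J) (Sh J) mw w0.
apply: le_trans (_ : _ <= \int[leb]_(t in halfline) limn_einf (g^~ t))%E _.
  apply: le_of_eq; apply: eq_integral => t; rewrite inE => ht.
  have c : g J t @[J --> \oo] --> (`|f t| * w t)%:E.
    suff: (layers J `|f t| * w t)%:E @[J --> \oo] --> (`|f t| * w t)%:E.
      apply: cvg_trans; apply: near_eq_cvg; near=> J.
      rewrite /g mulr_suml -sumEFin; apply: eq_bigr => i _; rewrite -EFinM mulrA; congr (_ * _ * _)%:E.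
      rewrite indicE; congr (_%:R); congr nat_of_bool; apply/idP/idP; rewrite inE; last by case=> _ [].
      move=> lt; split=> //; move: ht; rewrite /X /halfline /= !in_itv/= andbT => t0; rewrite t0/=.
      apply: le_trans (ltW (truncnS_gt t)) _; rewrite ler_nat; near: J; exact: nbhs_infty_ge.
    by apply: cvg_EFin; [exact: nearW|apply: cvgMr_tmp; exact: layers_cvg].
  by symmetry; exact: (cvg_limn_einf_sup c).1.
apply: le_trans (fatou leb _ (fun J => proj1 (hg J)) g0) _; first exact: measurable_halfline.
rewrite limn_einf_lim; apply: lime_le; first exact: is_cvg_einfs.
apply: nearW => J; apply: le_trans (_ : _ <= K)%E; first by apply: ereal_inf_lbound; exists J => /=.
rewrite (proj2 (hg J)); apply: hK => // [i t [Xt [ht lt]]| |i].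
- by split=> //; split=> //; apply: le_lt_trans lt; rewrite ler_pM2l ?dy_gt0// ler_nat.
- apply: le_lt_trans (leb_sub (mS J 0%N) (measurable_itv `[0, J%:R]) _) _; first by move=> t [].
  by rewrite lebesgue_measure_itv/=; case: ifP => _; rewrite ?ltry.
- by apply: leb_sub; [exact: mS|exact: measurable_super|move=> t []].
Unshelve. all: by end_near. Qed.

(** * The Koethe dual norm, its dilations and its Boyd indices *)

Section KotheDual.
Variable F : fspace R.
Hypothesis hF : symmetric_banach F.
Local Notation kn := (kothe_norm F).
Local Notation E := (kothe_dual F).

Lemma F_meas phi : fcarrier F phi -> measurable_fun halfline phi.
Proof. by move=> /(sb_measurable) []. Qed.

Lemma F_dist phi (psi : R -> R) : fcarrier F phi -> measurable_fun halfline psi ->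
  (forall v, (0 < v)%R -> distribution_fun psi v <= distribution_fun phi v)%E ->
  fcarrier F psi /\ fnorm F psi <= fnorm F phi.
Proof.
move=> Fp mp h; have [_ [v [v0 fin]]] := sb_measurable hF Fp; apply: sb_symmetric => //.
  by split=> //; exists v; split=> //; exact: le_lt_trans (h _ v0) fin.
by move=> t _; exact: mu_fun_le.
Qed.

Lemma kn_ge0 g : (0 <= kn g)%E.
Proof.
apply: ereal_sup_ubound; exists (fun=> 0); first split; first exact: sb_zero.
  have := sb_normZ hF 0 (sb_zero hF); rewrite normr0 !mul0r => ->; exact: ler01.
by rewrite -[RHS](@integral0 _ _ _ leb halfline); apply: eq_integral => t; rewrite mul0r normr0.
Qed.

Lemma kn_pair phi g : fcarrier F phi -> fnorm F phi <= 1 ->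
  (\int[leb]_(t in halfline) (`|phi t * g t|)%:E <= kn g)%E.
Proof. by move=> Fp n1; apply: ereal_sup_ubound; exists phi. Qed.

Lemma kn_le g K : (forall phi, fcarrier F phi -> fnorm F phi <= 1 ->
  (\int[leb]_(t in halfline) (`|phi t * g t|)%:E <= K)%E) -> (kn g <= K)%E.
Proof. by move=> h; apply: ge_ereal_sup => _ [phi [Fp n1] <-]; exact: h. Qed.

Lemma meas_pair phi g : fcarrier F phi -> measurable_fun halfline g ->
  measurable_fun halfline (fun t => (`|phi t * g t|)%:E).
Proof.
move=> /F_meas mp mg; apply/measurable_EFinP; apply: measurableT_comp => //; exact: measurable_funM.
Qed.

Lemma kn_mono f g : measurable_fun halfline f -> measurable_fun halfline g ->
  (forall t, 0 < t -> `|f t| <= `|g t|) -> (kn f <= kn g)%E.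
Proof.
move=> mf mg h; apply: kn_le => phi Fp n1; apply: le_trans (kn_pair g Fp n1).
apply: ae_ge0_le_integral; [exact: measurable_halfline| |exact: meas_pair| |exact: meas_pair|].
- by move=> t.
- by move=> t.
exists [set 0]; split; [exact: measurable_set1|exact: lebesgue_measure_set1|move=> t nh].
apply: contrapT => t0; apply: nh; rewrite /halfline /= in_itv/= andbT le_eqVlt eq_sym.
by move=> /predU1P[//|tp]; rewrite lee_fin !normrM ler_wpM2l// h.
Qed.

Lemma F_dilation a phi : 1 <= a -> fcarrier F phi ->
  fcarrier F (dilation a phi) /\ fnorm F (dilation a phi) <= fnorm F phi.
Proof.
move=> a1 Fp; have a0 : 0 < a by exact: lt_le_trans.
have mp := F_meas Fp; apply: F_dist => //; first exact: measurable_dilation.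
move=> v _; rewrite dist_dilation//; rewrite -[leRHS]mul1e; apply: lee_wpmul2r => //.
by rewrite lee_fin invf_le1.
Qed.

(** A change of variables moves the dilation to the test function, where it is by [a^-1 >= 1] and
    shrinks the distribution function, hence the norm in [F]. *)
Lemma kn_dilation_le1 a f : 0 < a -> a <= 1 -> measurable_fun halfline f ->
  (kn (dilation a f) <= (a^-1)%:E * kn f)%E.
Proof.
move=> a0 a1 mf; apply: kn_le => phi Fp n1.
have [Fd nd] : fcarrier F (dilation a^-1 phi) /\ fnorm F (dilation a^-1 phi) <= fnorm F phi.
  by apply: F_dilation => //; rewrite invf_ge1.
have mg := meas_pair Fd mf.
have := int_dilation a0 mg; rewrite /dilation.
under [X in (_ -> X = _)%E -> _]eq_integral do rewrite mulrA mulVf ?gt_eqF// mul1r.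
move=> ->//; apply: lee_wpmul2l; first by rewrite lee_fin invr_ge0 ltW.
exact: kn_pair (le_trans nd n1).
Qed.

(** Where the step function exceeds [v], more than [v / dy J] of the nested sets meet, so the point
    lies in the set whose index is the integer part of that quotient. *)
Lemma step_dist phi J N (S : nat -> set R) v : 0 < v -> measurable_fun halfline phi ->
  (forall i, measurable (S i)) -> (forall i, S i `<=` halfline) -> (forall i, S i.+1 `<=` S i) ->
  (forall i, leb (S i) <= distribution_fun phi (dy J * i.+1%:R))%E ->
  (distribution_fun (fun t => \sum_(0 <= i < N) dy J * \1_(S i) t)%R v <= distribution_fun phi v)%E.
Proof.
move=> v0 mp mS Sh Sd hS; have d0 := dy_gt0 (R := R).
have dec i k : (i <= k)%N -> S k `<=` S i.
  by move=> /subnK <-; elim: (k - i)%N => // m IH; apply: subset_trans IH; exact: Sd.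
set m := Num.trunc (v / dy J).
have m1 : dy J * m%:R <= v by rewrite mulrC -ler_pdivlMr//; rewrite truncn_le divr_ge0// ltW.
have m2 : v < dy J * m.+1%:R by rewrite mulrC -ltr_pdivrMr//; exact: truncnS_gt.
apply: le_trans (le_trans (_ : _ <= leb (S m))%E (hS m)) _; last exact/dist_noninc/ltW.
rewrite /distribution_fun; apply: le_measure; rewrite ?inE.
  by apply: measurable_super; apply: measurable_sum => i; apply: measurable_funM.
  exact: mS.
move=> t [ht]; apply: contraPP => nS; apply/negP; rewrite -leNgt; apply: le_trans m1.
rewrite ger0_norm; last by apply: sumr_ge0 => i; rewrite mulr_ge0// ltW.
rewrite -mulr_sumr ler_pM2l//.
apply: le_trans (_ : _ <= \sum_(0 <= i < N) (i < m)%N%:R) _.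
  apply: ler_sum => i; rewrite indicE; case: ltnP => [_|mi]; first by case: (_ \in _).
  by rewrite memNset// => /(dec _ _ mi).
rewrite -natr_sum ler_nat; apply: leq_trans (geq_minr N m); elim: N {mS} => [|N IH]; first by rewrite big_geq.
rewrite big_nat_recr//=; apply: leq_trans (leq_add IH (leqnn _)) _.
by case: ltnP => h; rewrite leq_min ?addn1 ?addn0 ?leqnn ?andbT//; exact: leqW.
Qed.

(** Nested sets no larger than the level sets of [phi] assemble into a function whose distribution
    function lies below that of [phi], again in the unit ball of [F]. Rearranged or thinned level
    sets can therefore be tested against [g]. *)
Lemma step_pair phi J N (S : nat -> set R) g : fcarrier F phi -> fnorm F phi <= 1 ->
  (forall i, measurable (S i)) -> (forall i, S i `<=` halfline) -> (forall i, S i.+1 `<=` S i) ->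
  (forall i, leb (S i) <= distribution_fun phi (dy J * i.+1%:R))%E -> measurable_fun halfline g ->
  (\sum_(0 <= i < N) (dy J)%:E * \int[leb]_(t in S i) (`|g t|)%:E <= kn g)%E.
Proof.
move=> Fp n1 mS Sh Sd hS mg; have d0 := dy_gt0 (R := R) J.
pose psi (t : R) : R := \sum_(0 <= i < N) dy J * \1_(S i) t.
have mpsi : measurable_fun halfline psi.
  by apply: measurable_sum => i; apply: measurable_funM => //.
have [Fs ns] := F_dist Fp mpsi (fun v hv => step_dist N hv (F_meas Fp) mS Sh Sd hS).
have mn : measurable_fun halfline (fun t => `|g t|) by exact: measurableT_comp.
rewrite -(proj2 (int_steps J N mS Sh mn _))//; apply: le_trans (kn_pair g Fs (le_trans ns n1)).
apply: le_of_eq; apply: eq_integral => t _; rewrite normrM ger0_norm; last first.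
  by apply: sumr_ge0 => i _; rewrite mulr_ge0// ltW.
by rewrite mulr_suml -sumEFin; apply: eq_bigr => i _; rewrite -EFinM mulrA.
Qed.

(** A change of variables stretches [phi] by [a >= 1], which [F] does not control. Instead, of every
    stretched level set one keeps the fraction [a^-1] that carries at least that fraction of the
    integral of [|f|]. The thinned sets are no larger than the level sets of [phi], and the factor
    [a] so lost cancels the Jacobian. *)
Let kn_dilation_dyadic n k f : (0 < k <= 2 ^ n)%N -> measurable_fun halfline f -> (kn (dilation (2 ^+ n / k%:R) f) <= kn f)%E.
Proof.
move=> /andP[k0 kn1] mf; set a := _ / _; have a0 : 0 < a by rewrite divr_gt0 ?exprn_gt0 ?ltr0n.
have ai0 : 0 < a^-1 by rewrite invr_gt0.
apply: kn_le => phi Fp n1; set ph := dilation a^-1 phi.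
have mp : measurable_fun halfline phi := F_meas Fp.
have mph : measurable_fun halfline ph by exact: measurable_dilation.
have mn : measurable_fun halfline (fun t => (`|ph t * f t|)%:E).
  by apply/measurable_EFinP; apply: measurableT_comp => //; exact: measurable_funM.
have mnf : measurable_fun halfline (fun t => `|f t|) by exact: measurableT_comp.
have := int_dilation a0 mn (fun t => _); rewrite /ph /dilation.
under [X in (_ -> X = _)%E -> _]eq_integral do rewrite mulrA mulVf ?gt_eqF// mul1r.
move=> ->//; rewrite lee_pdivrMl//.
have -> : (\int[leb]_(t in halfline) `|phi (a^-1 * t)%R * f t|%:E = \int[leb]_(t in halfline) (`|ph t| * `|f t|)%:E)%E.
  by apply: eq_integral => t _; rewrite normrM.
apply: (layer_cake_le mph mnf) => // J S mS Sh Sd Sf hS.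
have aE : a^-1 = k%:R / 2 ^+ n by rewrite invf_div.
have [B mB [BS hB]] := select_chain (4 ^ J) kn1 mS Sh Sd Sf mnf (fun t => normr_ge0 _); rewrite -aE in hB.
pose S' i := if (i <= 4 ^ J)%N then B `&` S i else set0.
have hS' i : (leb (S' i) <= distribution_fun phi (dy J * i.+1%:R))%E.
  rewrite /S'; case: ifP => iN; last by rewrite measure0.
  have [-> _] := hB i iN; rewrite lee_pdivrMl//; apply: le_trans (hS i) _.
  by rewrite dist_dilation// invrK.
apply: le_trans (_ : _ <= a%:E * \sum_(0 <= i < 4 ^ J) (dy J)%:E * \int[leb]_(t in S' i) (`|f t|)%:E)%E _.
  rewrite ge0_sume_distrr; last first.
    by move=> i _; apply: mule_ge0; [rewrite lee_fin ltW// dy_gt0|apply: integral_ge0 => *].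
  rewrite big_seq [X in (_ <= X)%E]big_seq; apply: lee_sum => i; rewrite mem_index_iota => /andP[_ /ltnW iN].
  rewrite muleCA; apply: lee_wpmul2l; first by rewrite lee_fin ltW// dy_gt0.
  by rewrite -lee_pdivrMl// /S' iN; case: (hB i).
apply: lee_wpmul2l; first by rewrite ltW.
apply: (step_pair (4 ^ J) Fp n1 _ _ _ hS') => // i; rewrite /S'.
- by case: ifP => // _; exact: measurableI.
- by case: ifP => [_ t [_ /Sh]|_ t []].
- by case: ltnP => iN; [rewrite (ltnW iN) => t [Bt /Sd]|move=> ?].
Qed.


(** [select] handles dyadic ratios only. A ratio [a' = 2^n / k] with [a <= a'] and [a' / a <= 1 + d]
    is used, and the remaining dilation by [a / a' <= 1] costs at most [a' / a] by
    [kn_dilation_le1]. *)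
Lemma kn_dilation_ge1 a f : 1 <= a -> measurable_fun halfline f -> (kn (dilation a f) <= kn f)%E.
Proof.
move=> a1 mf; have a0 : 0 < a := lt_le_trans ltr01 a1; have := kn_ge0 f; case E : (kn f) => [K| |] //; last by move=> _; rewrite leey.
rewrite lee_fin => K0; apply/lee_addgt0Pr => e e0; pose d := e / (K + 1).
have K1 : 0 < K + 1 by rewrite ltr_wpDl.
have d0 : 0 < d by rewrite divr_gt0.
pose n := (Num.truncn (a * (1 + d^-1))).+1; have p2 : 0 < 2 ^+ n :> R by rewrite exprn_gt0.
have hn : 1 + d^-1 < 2 ^+ n / a.
  by rewrite ltr_pdivlMr// mulrC; exact: pow2_gt.
pose k := Num.truncn (2 ^+ n / a); have ka : k%:R <= 2 ^+ n / a by rewrite truncn_le// divr_ge0 ?ltW.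
have kS : 2 ^+ n / a < k.+1%:R := truncnS_gt _.
have kd : d^-1 < k%:R by move: kS; rewrite -natr1; lra.
have k0 : 0 < k%:R :> R by apply: lt_trans kd; rewrite invr_gt0.
have kn1 : (0 < k <= 2 ^ n)%N.
  by rewrite -(ltr0n R) k0 -(ler_nat R) natrX; apply: le_trans ka _; rewrite ler_pdivrMr// ler_peMr // ltW.
pose a' : R := 2 ^+ n / k%:R; have a'0 : 0 < a' by rewrite divr_gt0.
have aa' : a <= a' by rewrite ler_pdivlMr// mulrC -ler_pdivlMr.
have -> : dilation a f = dilation (a / a') (dilation a' f).
  by apply/funext => t; rewrite /dilation mulrA [a' * _]mulrC divfK ?gt_eqF.
have aa0 : 0 < a / a' by rewrite divr_gt0.
apply: le_trans (kn_dilation_le1 aa0 _ (measurable_dilation a'0 mf)) _; first by rewrite ler_pdivrMr// mul1r.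
apply: le_trans (lee_wpmul2l _ (kn_dilation_dyadic kn1 mf)) _; first by rewrite lee_fin invr_ge0 ltW.
rewrite E -EFinD -EFinM lee_fin invf_div.
have h : a' / a <= 1 + d.
  rewrite mulrAC ler_pdivrMr//; apply: ltW; apply: lt_trans kS _; rewrite -natr1 mulrDl mul1r ltrD2l.
  by rewrite mulrC -ltr_pdivrMr// div1r.
apply: le_trans (ler_wpM2r K0 h) _; rewrite mulrDl mul1r lerD2l mulrAC ler_pdivrMr// ler_wpM2l ?(ltW e0)//.
by rewrite lerDl.
Qed.

Lemma kn_scale c f : 0 <= c -> measurable_fun halfline f -> (kn (fun t => c * f t)%R <= c%:E * kn f)%E.
Proof.
move=> c0 mf; apply: kn_le => phi Fp n1.
apply: le_trans (lee_wpmul2l (_ : 0 <= c%:E)%E (kn_pair f Fp n1)); last by rewrite lee_fin.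
rewrite -ge0_integralZl_EFin//; try exact: measurable_halfline; try exact: (meas_pair).
apply: le_of_eq; apply: eq_integral => t.
by rewrite mulrCA normrM ger0_norm.
Qed.

Lemma kn_dilation a f : 0 < a -> measurable_fun halfline f -> (kn (dilation a f) <= (Num.max 1 a^-1)%:E * kn f)%E.
Proof.
move=> a0 mf; have [a1|a1] := leP 1 a.
  apply: le_trans (kn_dilation_ge1 a1 mf) _; rewrite -[leLHS]mul1e lee_wpmul2r ?kn_ge0// lee_fin.
  by rewrite le_max lexx.
apply: le_trans (kn_dilation_le1 a0 (ltW a1) mf) _; rewrite lee_wpmul2r ?kn_ge0// lee_fin.
by rewrite le_max lexx orbT.
Qed.

Lemma dual_dilation a f : 0 < a -> fcarrier E f -> fcarrier E (dilation a f).
Proof.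
move=> a0 [[mf [v [v0]]]]; split; [split; [exact: measurable_dilation|]|].
  exists v; split=> //; rewrite dist_dilation//; apply: lte_mul_pinfty => //.
  by rewrite lee_fin invr_ge0 ltW.
apply: le_lt_trans (kn_dilation a0 mf) _; apply: lte_mul_pinfty => //.
by rewrite lee_fin le_max ler01.
Qed.

Lemma dual_zero : fcarrier E (fun=> 0) /\ kn (fun=> 0) = 0%E.
Proof.
have k0 : kn (fun=> 0) = 0%E.
  apply/eqP; rewrite eq_le kn_ge0 andbT; apply: kn_le => phi.
  by under eq_integral do rewrite mulr0 normr0; rewrite integral0.
split=> //; split; last by rewrite k0.
split; first exact: measurable_cst.
exists 1; rewrite /distribution_fun (_ : [set t | _] = set0) ?measure0//.
by apply/seteqP; split=> // t [_]; rewrite normr0 ltr10.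
Qed.

Definition dilnorm a : R := fine (dilation_norm E a).

Lemma dilation_norm_bounds a : 0 < a -> dilation_norm E a = (dilnorm a)%:E /\
  [/\ 0 <= dilnorm a, 1 <= a -> dilnorm a <= 1 & forall f, fcarrier E f -> (kn (dilation a f) <= (dilnorm a)%:E * kn f)%E].
Proof.
move=> a0.
have kfin f : fcarrier E f -> kn f = (fine (kn f))%:E.
  by case=> _ kf; rewrite fineK// ge0_fin_numE// kn_ge0.
have kd0 f : 0 <= fine (kn f) by rewrite fine_ge0// kn_ge0.
have ub (K : R) : 0 <= K -> (forall f, fcarrier E f -> (kn (dilation a f) <= K%:E * kn f)%E) -> (dilation_norm E a <= K%:E)%E.
  move=> K0 h; apply: ge_ereal_sup => _ [f [Ef n1] <-]; rewrite lee_fin -lee_fin -kfin; last exact: dual_dilation.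
  apply: le_trans (h f Ef) _; rewrite (kfin _ Ef); exact: ler_piMr.
have ge0 : (0 <= dilation_norm E a)%E.
  apply: ereal_sup_ubound; exists (fun=> 0); last by rewrite /= /dilation dual_zero.2.
  by split; [exact: dual_zero.1|rewrite /= dual_zero.2].
have fin : dilation_norm E a \is a fin_num.
  rewrite ge0_fin_numE//; apply: le_lt_trans (ub (Num.max 1 a^-1) _ _) (ltry _); first by rewrite le_max ler01.
  by move=> f [[mf _] _]; exact: kn_dilation.
have eqN : dilation_norm E a = (dilnorm a)%:E by rewrite fineK.
split=> //; split; first exact: fine_ge0.
  move=> a1; rewrite -lee_fin -eqN; apply: ub => // f [[mf _] _]; rewrite mul1e; exact: kn_dilation_ge1.
move=> f Ef; have [[mf Sf] kf] := Ef.
(* A function of norm 0 cannot be normalized; the crude bound of [kn_dilation] settles this case. *)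
have [c0|c0] := eqVneq (fine (kn f)) 0.
  apply: le_trans (kn_dilation a0 mf) _; rewrite (kfin _ Ef) c0 !mule0//.
have cp : 0 < fine (kn f) by rewrite lt_neqAle eq_sym c0 kd0.
set c := fine (kn f) in c0; pose g t := c^-1 * f t.
have ci0 : 0 <= c^-1 by rewrite invr_ge0 ltW.
have kg : (kn g <= 1)%E.
  by apply: le_trans (kn_scale ci0 mf) _; rewrite (kfin _ Ef) -EFinM mulVf.
have mg : measurable_fun halfline g by exact: measurable_funM.
have Eg : fcarrier E g.
  split; last by apply: le_lt_trans kg _; rewrite ltry.
  split=> //; have [v [v0 fin']] := Sf; exists (c^-1 * v); split; first by rewrite mulr_gt0 ?invr_gt0.
  congr (_ < _)%E : fin'; congr (leb); apply/seteqP; split=> t [ht h]; split=> //.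
    by rewrite normrM ger0_norm// ltr_pM2l ?invr_gt0.
  by move: h; rewrite normrM ger0_norm// ltr_pM2l ?invr_gt0.
have h1 : (kn (dilation a g) <= (dilnorm a)%:E)%E.
  rewrite (kfin _ (dual_dilation a0 Eg)) -eqN; apply: ereal_sup_ubound; exists g => //; split=> //=.
  by rewrite -lee_fin -kfin.
rewrite (kfin _ Ef) muleC.
apply: le_trans (lee_wpmul2l (_ : 0 <= c%:E)%E h1); last by rewrite ltW.
have -> : dilation a f = fun t => c * dilation a g t.
  by apply/funext => t; rewrite mulrA mulfV ?mul1r.
apply: kn_scale; [exact: ltW|exact: measurable_dilation].
Qed.

Lemma quotientE u : boyd_quotient E u =
  if ln (dilnorm u^-1) == 0 then +oo%E else (ln u / ln (dilnorm u^-1))%:E.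
Proof. by []. Qed.



Lemma dilnorm_ge0 a : 0 < a -> 0 <= dilnorm a.
Proof. by move=> a0; case: (dilation_norm_bounds a0) => _ []. Qed.

Lemma dilnorm_le1 a : 1 <= a -> dilnorm a <= 1.
Proof. by move=> a1; have a0 := lt_le_trans ltr01 a1; case: (dilation_norm_bounds a0) => _ [_ h _]; exact: h. Qed.

Lemma dilnormM a b : 0 < a -> 0 < b -> dilnorm (a * b) <= dilnorm a * dilnorm b.
Proof.
move=> a0 b0; have [_ [na _ ha]] := dilation_norm_bounds a0; have [_ [nb _ hb]] := dilation_norm_bounds b0.
have [e _] := dilation_norm_bounds (mulr_gt0 a0 b0); rewrite -lee_fin -e.
apply: ge_ereal_sup => _ [f [Ef n1] <-].
have h : (kn (dilation (a * b) f) <= (dilnorm a * dilnorm b)%:E)%E.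
  have -> : dilation (a * b) f = dilation b (dilation a f) by apply/funext => t; rewrite /dilation mulrA.
  apply: le_trans (hb _ (dual_dilation a0 Ef)) _; rewrite mulrC EFinM; apply: lee_wpmul2l; first by rewrite lee_fin.
  have k1 : (kn f <= 1)%E.
    have [_ kf] := Ef; have fin : kn f \is a fin_num by rewrite ge0_fin_numE// kn_ge0.
    by rewrite -(fineK fin).
  have da : (0 <= (dilnorm a)%:E)%E by rewrite lee_fin; exact: na.
  have := lee_wpmul2l da k1; rewrite mule1 => hk; exact: le_trans (ha _ Ef) hk.
rewrite lee_fin -lee_fin fineK// ge0_fin_numE ?kn_ge0//; exact: le_lt_trans h (ltry _).
Qed.

Lemma dilnorm_noninc a b : 1 <= a -> a <= b -> dilnorm b <= dilnorm a.
Proof.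
move=> a1 ab; have a0 := lt_le_trans ltr01 a1; have b0 := lt_le_trans a0 ab.
have ba : 1 <= b / a by rewrite ler_pdivlMr// mul1r.
rewrite -[b](divfK (lt0r_neq0 a0)) mulrC; apply: le_trans (dilnormM _ _) _ => //; first by rewrite divr_gt0.
by apply: ler_piMr; [exact: dilnorm_ge0|exact: dilnorm_le1].
Qed.

Lemma dilnormX a n : 1 <= a -> dilnorm (a ^+ n) <= dilnorm a ^+ n.
Proof.
move=> a1; have a0 := lt_le_trans ltr01 a1; elim: n => [|n IH]; first by rewrite dilnorm_le1.
rewrite !exprS; apply: le_trans (dilnormM a0 (exprn_gt0 _ a0)) _; apply: ler_wpM2l => //; exact: dilnorm_ge0.
Qed.

Lemma quotient_inv a : 0 < a -> boyd_quotient E a^-1 =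
  if ln (dilnorm a) == 0 then +oo%E else (ln a / - ln (dilnorm a))%:E.
Proof.
move=> a0; rewrite quotientE invrK.
by rewrite lnV// invrN mulrN mulNr.
Qed.

Lemma upper_near a (P : R -> Prop) : 0 < a -> (forall b, a <= b -> P b^-1) -> \forall u \near 0^'+, P u.
Proof.
move=> a0 h; near=> u.
rewrite -[u]invrK; apply: h; rewrite -[a]invrK lef_pV2 ?posrE ?invr_gt0//.
by near: u; apply: nbhs_right_le; rewrite invr_gt0.
Unshelve. all: by end_near. Qed.

(* Fekete: [ln (dilnorm a)] is subadditive in [ln a]. *)
Lemma upper_cvg : cvg (boyd_quotient E u @[u --> 0^'+]).
Proof.
(* [ln] vanishes at 1 and, by convention, off the positive reals; if it eventually does so along the
   dilation norms, the quotient is constantly [+oo]. *)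
have [[a0 [a00 h]]|nz] := pselect (exists a0, 0 < a0 /\ forall b, a0 <= b -> ln (dilnorm b) = 0).
  apply/cvg_ex; exists +oo%E; apply: cvg_near_cst.
  by apply: (upper_near a00) => b ab; rewrite quotient_inv ?h ?eqxx// (lt_le_trans a00).
(* Otherwise there are arbitrarily large dilations with norm strictly between 0 and 1; by
   monotonicity all norms from 1 on are positive, and those from [a1] on are less than 1. *)
have big a : 1 <= a -> exists2 b, a <= b & 0 < dilnorm b < 1.
  move=> a1; apply: contrapT => hb; apply: nz; exists a; split=> [|b ab]; first exact: lt_le_trans a1.
  have := dilnorm_le1 (le_trans a1 ab); rewrite le_eqVlt => /orP[/eqP->|d1]; first exact: ln1.
  by apply: ln0; rewrite leNgt; apply/negP => d0; apply: hb; exists b; rewrite ?d0.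
have [a1 a12 /andP[_ d11]] := big 2 (ler1n _ _).
have a11 : 1 < a1 by apply: lt_le_trans a12; rewrite ltr1n.
have a10 : 0 < a1 by exact: lt_trans a11.
have pos a : 1 <= a -> 0 < dilnorm a.
  by move=> h; have [b ab /andP[+ _]] := big a h; move/lt_le_trans; apply; exact: dilnorm_noninc.
pose Q a := ln a / - ln (dilnorm a).
have lpos a : 1 < a -> dilnorm a < 1 -> 0 < - ln (dilnorm a).
  by move=> h h1; rewrite oppr_gt0; apply: ln_lt0; rewrite pos ?ltW.
pose V := [set Q a | a in [set a | 1 < a /\ dilnorm a < 1]]; pose I := inf V.
have ne : V !=set0 by exists (Q a1), a1.
have Q0 a : 1 < a -> dilnorm a < 1 -> 0 <= Q a.
  by move=> h h1; rewrite divr_ge0 ?ln_ge0 ?ltW ?lpos.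
have hlb : has_lbound V.
  by exists 0 => _ [a [h h1] <-]; exact: Q0.
have lt1 a : a1 <= a -> 1 < a /\ dilnorm a < 1.
  by move=> h; split; [exact: lt_le_trans h|exact: le_lt_trans (dilnorm_noninc (ltW a11) h) d11].
have quo a : a1 <= a -> boyd_quotient E a^-1 = (Q a)%:E.
  move=> h; have [h1 h2] := lt1 _ h; rewrite quotient_inv; last exact: lt_trans.
  by case: eqP => // e; have := lpos _ h1 h2; rewrite e oppr0 ltxx.
apply/cvg_ex; exists I%:E; apply/fine_cvgP; split.
  by apply: (upper_near a10) => b hb; rewrite quo.
apply/cvgrPdist_le => e e0.
have [_ [a2 [a21 d21] <-] Q2] : exists2 x, V x & x < I + e / 2.
  by apply: inf_lt => //; rewrite ltrDl divr_gt0.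
have a20 : 0 < a2 by exact: lt_trans.
have l2 := lpos _ a21 d21; have ln2 : 0 < ln a2 by rewrite ln_gt0.
pose K := (Num.trunc (Q a2 * 2 / e)).+1.
apply: (@upper_near (Num.max a1 (a2 ^+ K))) => [|a]; first by rewrite lt_max a10.
rewrite ge_max => /andP[ha hK]; rewrite /= quo//=.
have [h1 h2] := lt1 _ ha; have a0 : 0 < a by exact: lt_trans.
have QI : I <= Q a by apply: ge_inf => //; exists a.
rewrite ler0_norm ?subr_le0// opprB.
(* Comparing [a] with the powers [a2^m <= a < a2^(m+1)] costs the factor [1 + 1/m]; the choice of
   [K] makes [m] large enough. *)
pose m := Num.trunc (ln a / ln a2).
have la0 : 0 <= ln a / ln a2 by rewrite divr_ge0 ?ln_ge0 ?ltW.
have m1 : m%:R * ln a2 <= ln a by rewrite -ler_pdivlMr// truncn_le.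
have m2 : ln a < m.+1%:R * ln a2 by rewrite -ltr_pdivrMr// truncnS_gt.
have Km : (K <= m)%N.
  rewrite -ltnS -(ltr_nat R) -(ltr_pM2r ln2); apply: le_lt_trans m2.
  by rewrite mulr_natl -lnXn// ler_ln ?posrE ?exprn_gt0.
have m0 : 0 < m%:R :> R by rewrite ltr0n (leq_trans _ Km).
have am : a2 ^+ m <= a by rewrite -ler_ln ?posrE ?exprn_gt0// lnXn// -mulr_natl.
have lm : m%:R * - ln (dilnorm a2) <= - ln (dilnorm a).
  have pa2 := pos _ (ltW a21); have pa := pos _ (ltW h1).
  have dm : dilnorm a <= dilnorm a2 ^+ m.
    apply: le_trans (dilnormX m (ltW a21)); apply: dilnorm_noninc am; exact: exprn_ege1 (ltW a21).
  have : ln (dilnorm a) <= ln (dilnorm a2 ^+ m).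
    by rewrite ler_ln; [exact: dm|rewrite posrE|rewrite posrE; exact: exprn_gt0 _ pa2].
  rewrite (lnXn _ pa2) => lm; rewrite mulrN lerN2 mulr_natl; exact: lm.
have la := lpos _ h1 h2.
have Qa : Q a <= Q a2 * (1 + m%:R^-1).
  rewrite ler_pdivrMr//; apply: le_trans (ltW m2) _.
  have -> : m.+1%:R * ln a2 = ln a2 / - ln (dilnorm a2) * (1 + m%:R^-1) * (m%:R * - ln (dilnorm a2)).
    by rewrite -addn1 natrD; move: (m%:R : R) m0 (- ln (dilnorm a2)) l2 => x x0 y y0; field; rewrite !gt_eqF.
  apply: ler_wpM2l => //; rewrite mulr_ge0 ?Q0//.
have Qm : Q a2 * m%:R^-1 <= e / 2.
  rewrite ler_pdivrMr// mulrC -ler_pdivrMr ?divr_gt0// invf_div mulrA.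
  apply: ltW; apply: lt_le_trans (truncnS_gt _) _; by rewrite ler_nat.
rewrite lerBlDr; apply: le_trans Qa _; rewrite mulrDr mulr1.
by have := lerD (ltW Q2) Qm; rewrite -addrA -splitr [e + I]addrC.
Qed.

(** The strict inequality leaves room for an exponent [r] between the index and [q]; taking [r] at
    least [q / 2] keeps it positive. Dilation by [2^j] corresponds to [u = 2^-j] in the quotient. *)
Lemma upper_decay q : 0 < q -> (upper_boyd E < q%:E)%E ->
  exists2 r, 0 < r < q & exists J : nat, forall j, (J <= j)%N -> dilnorm (2 ^+ j) <= (2 `^ r^-1) ^- j.
Proof.
move=> q0; rewrite /upper_boyd => hlim.
have c := upper_cvg.
set L := lim _ in hlim.
have [r /andP[r0 rq] Lr] : exists2 r, 0 < r < q & (L < r%:E)%E.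
  case: L hlim => [l| |] //=; rewrite ?lte_fin => lq.
    exists (Num.max (q / 2) ((l + q) / 2)).
      by rewrite lt_max gt_max//= ltr_pdivrMr// ltr_pMr///= ltr_pdivrMr//; lra.
    by rewrite lte_fin lt_max; apply/orP; lra.
  by exists (q / 2); rewrite ?ltNyr// divr_gt0//= ltr_pdivrMr// ltr_pMr// ltr1n.
exists r; first by rewrite r0.
have [e /= e0 he] : \forall u \near 0^'+, (boyd_quotient E u < r%:E)%E.
  by apply: (c [set y | (y < r%:E)%E]); apply: open_nbhs_nbhs; split=> //; exact: open_ereal_lt_ereal.
exists (Num.trunc e^-1).+1 => j Jj; have j0 : 0 < 2 ^+ j :> R by rewrite exprn_gt0.
have j1 : 1 <= 2 ^+ j :> R by rewrite exprn_ege1// ler1n.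
have : ((boyd_quotient E (2 ^+ j)^-1) < r%:E)%E.
  apply: he; rewrite /=// sub0r normrN gtr0_norm// invf_plt//.
  exact: pow2_gt.
rewrite quotient_inv//; case: eqP => // /eqP nz; rewrite lte_fin.
have d0 : 0 < dilnorm (2 ^+ j) by rewrite ltNge; apply/negP => h; move: nz; rewrite ln0// eqxx.
have l0 : 0 < - ln (dilnorm (2 ^+ j)) by rewrite oppr_gt0 lt_neqAle nz ln_le0// dilnorm_le1.
rewrite ltr_pdivrMr// => h.
have p0 : 0 < (2 `^ r^-1) ^+ j :> R by [].
rewrite -ler_ln ?posrE// lnV// lnXn// ln_powR.
rewrite lnXn// in h; rewrite -mulrnAr lerNr -ler_pdivlMl ?invr_gt0// invrK; exact: ltW.
Qed.

(** A missing limit takes the default value 0, which [p >= 1] excludes, so convergence comes for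
    free. For the upper index that default would be compatible with the hypothesis, and there
    convergence has to be proved ([upper_cvg]). *)
Lemma lower_decay p : 1 <= p -> (p%:E < lower_boyd E)%E ->
  exists2 r, p < r & exists J : nat, forall j, (J <= j)%N -> dilnorm (2 ^- j) <= (2 `^ r^-1) ^+ j.
Proof.
move=> p1; have p0 := lt_le_trans ltr01 p1; rewrite /lower_boyd => hlim.
have c : cvg (boyd_quotient E u @[u --> +oo%R]).
  by apply: cvgNpoint; apply/eqP => e; move: hlim; rewrite e lte_fin ltNge ltW.
set L := lim _ in hlim.
have [r pr Lr] : exists2 r, p < r & (r%:E < L)%E.
  case: L hlim => [l| |] //=; rewrite ?lte_fin => lq.
    by exists ((l + p) / 2); rewrite ?lte_fin; lra.
  by exists (p + 1); rewrite ?ltry// ltrDl.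
have r0 : 0 < r by exact: lt_trans pr.
exists r => //.
have [K [_ hK]] : \forall u \near +oo%R, (r%:E < boyd_quotient E u)%E.
  by apply: (c [set y | (r%:E < y)%E]); apply: open_nbhs_nbhs; split=> //; exact: open_ereal_gt_ereal.
exists (Num.trunc K).+1 => j Jj.
have : (r%:E < boyd_quotient E (2 ^+ j))%E.
  apply: hK; apply: lt_le_trans (truncnS_gt _) _; apply: le_trans (_ : j%:R <= _); first by rewrite ler_nat.
  by rewrite -natrX ler_nat ltnW// ltn_expl.
have p2 : 1 <= 2 `^ r^-1 :> R by rewrite -[X in X <= _](powRr0 2) ler_powR ?ler1n// invr_ge0 ltW.
have [d1|d1] := leP (dilnorm (2 ^- j)) 1; first by move=> _; apply: le_trans d1 _; exact: exprn_ege1.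
have d0 : 0 < dilnorm (2 ^- j) by exact: lt_trans d1.
have l0 : 0 < ln (dilnorm (2 ^- j)) by rewrite ln_gt0.
rewrite quotientE gt_eqF// lte_fin ltr_pdivlMr// lnXn// => h.
rewrite -ler_ln ?posrE// lnXn// ln_powR.
by rewrite -mulrnAr -ler_pdivrMl ?invr_gt0// invrK ltW.
Qed.

(** Beyond [J] the terms are dominated by a geometric series of ratio [x / y < 1]; the first [J]
    terms go into the constant as they are. *)
Lemma geo_bounded (x y : R) (u : nat -> R) J : 0 < x -> x < y -> (forall j, 0 <= u j) ->
  (forall j, (J <= j)%N -> u j <= x ^+ j) -> exists2 K, 0 < K & forall n, \sum_(0 <= j < n) y ^- j * u j <= K.
Proof.
move=> x0 xy u0 hu; have y0 := lt_trans x0 xy; set z := x / y.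
have z0 : 0 <= z by rewrite divr_ge0 ?ltW.
have z1 : z < 1 by rewrite ltr_pdivrMr// mul1r.
have yj j : 0 <= y ^- j by rewrite invr_ge0 exprn_ge0// ltW.
have S0 : 0 <= \sum_(0 <= j < J) y ^- j * u j by apply: sumr_ge0 => j _; rewrite mulr_ge0.
exists (\sum_(0 <= j < J) y ^- j * u j + (1 - z)^-1); first by rewrite ltr_wpDl// invr_gt0 subr_gt0.
have geo n : \sum_(0 <= j < n) z ^+ j <= (1 - z)^-1.
  rewrite -[X in _ <= X]mul1r ler_pdivlMr ?subr_gt0//; elim: n => [|n]; first by rewrite big_geq// mul0r.
  suff : \sum_(0 <= j < n.+1) z ^+ j * (1 - z) = 1 - z ^+ n.+1.
    by rewrite -mulr_suml => ->; rewrite lerBlDr lerDl exprn_ge0.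
  elim: n.+1 => [|m IHm]; first by rewrite big_geq// subrr.
  by rewrite big_nat_recr//= IHm exprS; ring.
move=> n; apply: le_trans (lerD (lexx _) (geo n)).
apply: le_trans (_ : _ <= \sum_(0 <= j < n) (if (j < J)%N then y ^- j * u j else 0) + \sum_(0 <= j < n) z ^+ j) _.
  rewrite -big_split /=; apply: ler_sum => j; case: ltnP => Jj; first by rewrite lerDl exprn_ge0.
  by rewrite add0r /z expr_div_n mulrC ler_wpM2r// hu.
rewrite lerD2r; elim: n => [|n IH]; first by rewrite big_geq.
rewrite big_nat_recr//=; case: ltnP => nJ; last by rewrite addr0.
have -> : \sum_(0 <= j < n) (if (j < J)%N then y ^- j * u j else 0) = \sum_(0 <= j < n) y ^- j * u j.
  by apply: eq_big_nat => j /andP[_ jn]; rewrite (ltn_trans jn).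
rewrite -big_nat_recr//= [X in _ <= X](@big_cat_nat _ _ _ n.+1)//= lerDl.
by apply: sumr_ge0 => j _; rewrite mulr_ge0.
Qed.

Lemma series_le (x : nat -> \bar R) (c : nat -> R) (K : R) (y : \bar R) : (0 <= y)%E ->
  (forall j, 0 <= x j)%E -> (forall j, 0 <= c j) -> (forall j, x j <= (c j)%:E * y)%E ->
  (forall n, \sum_(0 <= j < n) c j <= K) -> (\sum_(0 <= j <oo) x j <= K%:E * y)%E.
Proof.
move=> y0 x0 c0 xc cK; apply: lime_le; first exact: is_cvg_nneseries => *.
apply: nearW => n; apply: le_trans (_ : _ <= \sum_(0 <= j < n) ((c j)%:E * y))%E _; first exact: lee_sum.
rewrite -ge0_sume_distrl => [|j]; last by rewrite lee_fin.
by apply: lee_wpmul2r => //; rewrite sumEFin lee_fin.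
Qed.

(** The upper index gives [r < q] such that dilation by [2^j] has norm at most [2^(-j/r)]
    eventually, which beats the weight [2^(j/q)]. Below, either [p = 1] and a single term of weight
    2 occurs, coming from [avg_telescope], or the lower index gives growth [2^(j/r)] with [r > p]
    against the weight [2^(-j/p)]. *)
Lemma weights_bounded p q : 1 <= p -> 1 <= q -> (upper_boyd E < q%:E)%E -> p = 1 \/ (p%:E < lower_boyd E)%E ->
  exists (b w : nat -> R) (C : R), [/\ weights p b w, 0 < C &
    forall n, \sum_(0 <= j < n) (2 * (2 `^ q^-1) ^+ j * dilnorm (2 ^+ j) + b j * dilnorm (w j)) <= C].
Proof.
move=> p1 q1 hq hp; have p0 := lt_le_trans ltr01 p1; have q0 := lt_le_trans ltr01 q1.
have Alt r r' : 0 < r -> r < r' -> 2 `^ r'^-1 < 2 `^ r^-1 :> R.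
  by move=> r0 rr; rewrite -ltr_ln ?posrE// !ln_powR ltr_pM2r ?ln_gt0 ?ltr1n// ltf_pV2 ?posrE// (lt_trans r0).
have d0 a : 0 < a -> 0 <= dilnorm a by exact: dilnorm_ge0.
have [r /andP[r0 rq] [J hJ]] := upper_decay q0 hq.
have [K K0 hK] : exists2 K, 0 < K & forall n, \sum_(0 <= j < n) (2 `^ q^-1)^-1 ^- j * dilnorm (2 ^+ j) <= K.
  apply: (geo_bounded (x := (2 `^ r^-1)^-1) (J := J)); rewrite// ?ltf_pV2 ?posrE//.
  - exact: Alt.
  - by move=> j; exact: d0.
  - by move=> j Jj; rewrite exprVn; exact: hJ.
suff [b [w [C [W C0 hC]]]] : exists (b w : nat -> R) (C : R), [/\ weights p b w, 0 < C &
    forall n, \sum_(0 <= j < n) b j * dilnorm (w j) <= C].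
  exists b, w, (2 * K + C); split=> // [|n]; first by rewrite addr_gt0 ?mulr_gt0.
  rewrite big_split /=; apply: lerD (hC n).
  rewrite (eq_bigr (fun j => 2 * ((2 `^ q^-1)^-1 ^- j * dilnorm (2 ^+ j)))) => [|j]; last by rewrite exprVn invrK mulrA.
  by rewrite -mulr_sumr ler_pM2l//.
case: hp => [p11|hp].
  exists (fun j => if j is 0%N then 2 else 0), (fun=> 1), 2; split; [by split; [case|left]|exact: ltr0Sn|].
  case=> [|n]; first by rewrite big_geq.
  rewrite big_nat_recl//= big1 ?addr0 => [|j]; last by rewrite mul0r.
  by rewrite ler_piMr// dilnorm_le1.
have [r' pr [J' hJ']] := lower_decay p1 hp.
have [K' K'0 hK'] : exists2 K, 0 < K & forall n, \sum_(0 <= j < n) (2 `^ p^-1) ^- j * dilnorm (2 ^- j) <= K.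
  apply: (geo_bounded (x := 2 `^ r'^-1) (J := J')) => //; first exact: Alt.
  by move=> j; apply: d0.
exists (fun j => (2 `^ p^-1) ^- j), (fun j => 2 ^- j.+1), (K' * dilnorm 2^-1 + 1); split.
- by split; [move=> j|right].
- by rewrite ltr_wpDl// mulr_ge0 ?(ltW K'0)// d0//.
move=> n; apply: le_trans (_ : K' * dilnorm 2^-1 <= _); last by rewrite lerDl.
apply: le_trans (ler_wpM2r _ (hK' n)); last by rewrite d0//.
rewrite mulr_suml; apply: ler_sum => j _; rewrite -mulrA; apply: ler_wpM2l.
  by [].
by rewrite exprSr invfM; apply: (dilnormM).
Qed.

(** A nonzero element of [F] has a superlevel set of positive measure; scaled into the unit ball and
    replaced by an interval of no greater length, it tests integrals over ]0, s[. This makes the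
    terms of [kbar] finite. *)
Lemma local_integrable : exists c s, [/\ 0 < c, 0 < s & forall g, measurable_fun halfline g ->
  (\int[leb]_(t in below s%:E) (`|g t|)%:E <= c%:E * kn g)%E].
Proof.
have [f [Ff nz]] := sb_nonzero hF; have mf := F_meas Ff.
have [v v0 dv] : exists2 v, 0 < v & (0 < distribution_fun f v)%E.
  apply: contrapT => h; apply: nz.
  have n0 n : leb.-negligible [set t | halfline t /\ n.+1%:R^-1 < `|f t|].
    apply/negligibleP; first exact: measurable_super.
    apply/eqP; rewrite eq_le measure_ge0 andbT leNgt; apply/negP => hn; apply: h.
    by exists n.+1%:R^-1.
  apply: negligibleS (negligible_bigcup n0) => t /= ht.
  have : halfline t by apply: contrapT => c; apply: ht => /c.
  have nt : 0 < `|f t| by rewrite normr_gt0; exact/eqP.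
  have [n] := ltr_add_invr nt.
  by exists n => //=; rewrite -[X in X < _]add0r.
set c1 := (1 + fnorm F f)^-1.
have N1 : 0 < 1 + fnorm F f := ltr_wpDr (sb_ge0 hF Ff) ltr01.
have c10 : 0 < c1 by rewrite invr_gt0.
have e1 : c1 + c1 * fnorm F f = 1 by rewrite -[X in X + _]mulr1 -mulrDr; apply: mulVf; exact: lt0r_neq0.
pose phi t := c1 * f t.
have : fcarrier F phi by exact: sb_scale.
have : fnorm F phi <= 1.
  by rewrite (sb_normZ hF _ Ff) (gtr0_norm c10) -e1 lerDr ltW.
have [J hJ] : exists J, dy J <= c1 * v.
  by exists (Num.trunc (c1 * v)^-1).+1; rewrite /dy exprVn ltW// invf_plt ?posrE ?mulr_gt0// pow2_gt.
have dp : (0 < distribution_fun phi (dy J * 1%:R))%E.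
  apply: lt_le_trans dv _; apply: leb_sub; [exact: measurable_super|by apply: measurable_super; exact: measurable_funM|].
  by move=> t [ht]; split=> //; rewrite mulr1 normrM gtr0_norm//; apply: le_lt_trans hJ _; rewrite ltr_pM2l.
have [s s0] : exists2 s, 0 < s & (s%:E <= distribution_fun phi (dy J * 1%:R))%E.
  case: distribution_fun dp => [d| |] //=; first by rewrite lte_fin => d0; exists d.
  by exists 1; rewrite ?leey.
have [mB BE] := below_fin (ltW s0).
exists (dy J)^-1, s; split=> // [|g]; first by rewrite invr_gt0 dy_gt0.
rewrite lee_pdivlMl ?dy_gt0//.
have := @step_pair phi J 1 (fun i => if i is 0%N then below s%:E else set0) g.
rewrite big_nat1; apply => //.
- by case.
- by case=> [|i] t; [exact: below_halfline|case].
- by move=> i.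
- by case=> [|i]; rewrite ?BE// measure0.
Qed.

Variables (f : R -> R) (p q : R) (b w : nat -> R) (C : R).
Hypotheses (p1 : 1 <= p) (q1 : 1 <= q) (Ef : fcarrier E f) (f0 : forall t, 0 <= f t)
  (fd : forall s t, 0 < s -> s <= t -> f t <= f s) (W : weights p b w)
  (hC : forall n, \sum_(0 <= j < n) (2 * (2 `^ q^-1) ^+ j * dilnorm (2 ^+ j) + b j * dilnorm (w j)) <= C).

Let mf : measurable_fun halfline f. Proof. by case: Ef => -[]. Qed.
Let e2 j : 0 < 2 ^+ j :> R. Proof. by rewrite exprn_gt0. Qed.
Let w0 j : 0 < w j. Proof. by case: W => h; case: (h j). Qed.
Let b0 j : 0 <= b j. Proof. by case: W => h; case: (h j). Qed.
Let A0 j : 0 <= 2 * (2 `^ q^-1) ^+ j :> R. Proof. by []. Qed.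
Let cj0 j : 0 <= 2 * (2 `^ q^-1) ^+ j * dilnorm (2 ^+ j) + b j * dilnorm (w j).
Proof. by rewrite addr_ge0// mulr_ge0// dilnorm_ge0. Qed.

Lemma kbar_comb (y : \bar R) (x : R -> \bar R) : (0 <= y)%E -> (forall u, 0 <= x u)%E ->
  (forall u, (0 < u)%R -> x u <= (dilnorm u)%:E * y)%E ->
  (\sum_(0 <= j <oo) ((2 * (2 `^ q^-1) ^+ j)%:E * x (2 ^+ j)%R + (b j)%:E * x (w j)) <= C%:E * y)%E.
Proof.
move=> y0 x0 xy; apply: series_le hC => // j.
  by apply: adde_ge0; apply: mule_ge0 => //; rewrite lee_fin.
have s1 (a u : R) : 0 <= a -> 0 < u -> (a%:E * x u <= (a * dilnorm u)%:E * y)%E.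
  by move=> a0 u0; rewrite EFinM -muleA; apply: lee_wpmul2l; [rewrite lee_fin|exact: xy].
have s2 (a u : R) : 0 <= a -> 0 < u -> (0 <= (a * dilnorm u)%:E)%E.
  by move=> a0 u0; apply: mulr_ge0 a0 _; exact: dilnorm_ge0.
rewrite EFinD ge0_muleDl; [|exact: s2|exact: s2].
by apply: leeD; [exact: s1|exact: s1].
Qed.

Lemma kbar_fin s : 0 < s -> kbar f q b w s \is a fin_num.
Proof.
move=> s0; have [c [s' [c0 s'0 hc]]] := local_integrable.
(* [local_integrable] knows only its own interval ]0, s'[; a further dilation by [s / s'] carries
   the integral over ]0, s[ to it. *)
pose a := s / s'; have a0 : 0 < a by rewrite divr_gt0.
have [mB BE] := below_fin (ltW s0); have [mB' BE'] := below_fin (ltW s'0).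
have kf : (kn f < +oo)%E by case: Ef.
have av u : 0 < u -> (avg f u s <= (dilnorm u)%:E * ((a * c * dilnorm a)%:E * kn f))%E.
  move=> u0; have ua : 0 < u * a by rewrite mulr_gt0.
  have -> : avg f u s = (a%:E * \int[leb]_(t in below s'%:E) (`|dilation (u * a) f t|)%:E)%E.
    pose g t : \bar R := (\1_(below s%:E) t * f (u * t))%:E.
    have mg : measurable_fun halfline g.
      apply/measurable_EFinP; apply: measurable_funM; last exact: measurable_dilation.
      exact/measurable_funTS/measurable_indic.
    have g0 t : (0 <= g t)%E by rewrite lee_fin mulr_ge0.
    have := int_dilation a0 mg g0; move=> /(congr1 (fun z => a%:E * z)%E); rewrite muleA -EFinM mulfV ?gt_eqF// mul1e.
    rewrite /g int_indic//; last exact: below_halfline.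
    rewrite /avg => <-; congr (_ * _)%E; rewrite -(int_indic _ mB')//; last exact: below_halfline.
    apply: eq_integral => t _; congr (_%:E); rewrite /dilation ger0_norm// mulrA; congr (_ * _).
    rewrite !indicE; congr ((_ : bool)%:R); apply/idP/idP; rewrite !inE /below /= !lte_fin => -[h1 h2]; split.
    - by move: h1; rewrite pmulr_rgt0.
    - by move: h2; rewrite mulrC mulrA ltr_pdivrMr// [s * _]mulrC ltr_pM2r.
    - by rewrite mulr_gt0.
    - by rewrite mulrC mulrA ltr_pdivrMr// [s * _]mulrC ltr_pM2r.
  have [_ [nu _ hu]] := dilation_norm_bounds ua.
  apply: le_trans (lee_wpmul2l _ (hc _ (measurable_dilation ua mf))) _; first by rewrite ltW.
  rewrite !muleA; apply: le_trans (lee_wpmul2l _ (hu f Ef)) _; first by rewrite lee_fin mulr_ge0 ?ltW.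
  rewrite muleA; apply: lee_wpmul2r; rewrite ?kn_ge0// lee_fin.
  rewrite [leRHS]mulrCA.
  by apply: ler_wpM2l; [rewrite mulr_ge0 ?ltW|exact: dilnormM].
have y0 : (0 <= (a * c * dilnorm a)%:E * kn f)%E.
  apply: mule_ge0; [rewrite lee_fin; apply: mulr_ge0|exact: kn_ge0]; last exact: dilnorm_ge0.
  by apply: mulr_ge0; exact: ltW.
have := kbar_comb y0 (fun u => avg_ge0 f0 u s) av; rewrite -/(kbar) => h.
rewrite ge0_fin_numE; last by apply: nneseries_ge0 => j _ _; apply: kbar_term0 => //.
apply: le_lt_trans h _.
have -> : kn f = (fine (kn f))%:E by rewrite fineK// ge0_fin_numE// kn_ge0.
by rewrite ltry.
Qed.

(** The hypothesis is majorization of [h] by the Calderon operator of [f]: only integrals over sets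
    of measure [s] are compared. The layer cake of a test function [phi] reduces the pairing to such
    sets. As [kbar] is a sum of integrals over ]0, s[, the layers reassemble for each dilation,
    through [step_pair], into the pairing of a dilate of [f] with a rearranged [phi]. *)
Lemma majorized_norm h c : 0 <= c -> measurable_fun halfline h -> (forall t, 0 <= h t) ->
  (forall (X : set R) s, measurable X -> X `<=` halfline -> 0 < s -> leb X = s%:E ->
     forall K, (forall n, kpart f p q s n <= K) -> (\int[leb]_(t in X) (h t)%:E <= (c * K)%:E)%E) ->
  (kn h <= (c * C)%:E * kn f)%E.
Proof.
move=> c0 mh h0 hX; apply: kn_le => phi Fp n1.
have mp := F_meas Fp; have mn : measurable_fun halfline (fun t => `|phi t|) by exact: measurableT_comp.
have -> : (\int[leb]_(t in halfline) (`|phi t * h t|)%:E = \int[leb]_(t in halfline) (`|phi t| * h t)%:E)%E.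
  by apply: eq_integral => t; rewrite normrM (ger0_norm (h0 t)).
apply: layer_cake_le => // J S mS Sh Sd S0 hS.
have Sf i : leb (S i) \is a fin_num.
  rewrite ge0_fin_numE//; apply: le_lt_trans S0; apply: leb_sub => //.
  by elim: i => // i; exact: subset_trans.
pose s i := fine (leb (S i)); have sE i : leb (S i) = (s i)%:E by rewrite fineK.
have s0 i : 0 <= s i by exact: fine_ge0.
have dy0 : (0 <= (dy J : R)%:E)%E by rewrite lee_fin ltW// dy_gt0.
have kb0 i : (0 <= kbar f q b w (s i))%E by apply: nneseries_ge0 => j _ _; apply: kbar_term0 => //.
have hi i : (\int[leb]_(t in S i) (h t)%:E <= c%:E * kbar f q b w (s i))%E.
  have [sz|sn] := eqVneq (s i) 0.
    have -> : (\int[leb]_(t in S i) (h t)%:E = 0)%E.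
      have e0 : leb (S i) = 0%E by rewrite sE sz.
      apply: null_set_integral; [exact: mS| |exact: e0].
      by apply/measurable_EFinP; apply: measurable_funS => //; exact: measurable_halfline.
    exact: mule_ge0.
  have sp : 0 < s i by rewrite lt_neqAle eq_sym sn s0.
  have := hX (S i) (s i) (mS i) (Sh i) sp (sE i) (fine (kbar f q b w (s i))).
  rewrite EFinM fineK ?kbar_fin//; apply => n; rewrite -lee_fin fineK ?kbar_fin//.
  exact: kpart_le.
apply: le_trans (_ : _ <= c%:E * \sum_(0 <= i < 4 ^ J) (dy J)%:E * kbar f q b w (s i))%E _.
  rewrite ge0_sume_distrr => [|i _]; last exact: mule_ge0.
  by apply: lee_sum => i _; rewrite [leRHS]muleCA; apply: lee_wpmul2l => //; exact: hi.
rewrite EFinM -muleA; apply: lee_wpmul2l; first by rewrite lee_fin.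
pose x u := (\sum_(0 <= i < 4 ^ J) (dy J)%:E * avg f u (s i))%E.
(* Exchanging layers and scales isolates, for each dilation, a sum of the kind that [step_pair]
   bounds. *)
have -> : (\sum_(0 <= i < 4 ^ J) (dy J)%:E * kbar f q b w (s i) =
    \sum_(0 <= j <oo) ((2 * (2 `^ q^-1) ^+ j)%:E * x (2 ^+ j)%R + (b j)%:E * x (w j)))%E.
  have t0 i j := kbar_term0 f0 q (s i) j (fun k => conj (b0 k) (w0 k)).
  under eq_bigr do rewrite -nneseriesZl//.
  rewrite -nneseries_sum_nat => [|i j]; last exact: mule_ge0.
  apply: eq_eseriesr => j _; rewrite !ge0_sume_distrr; try by move=> i _; apply: mule_ge0 => //; exact: avg_ge0.
  rewrite -big_split; apply: eq_bigr => i _.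
  rewrite ge0_muleDr; try by apply: mule_ge0; rewrite ?lee_fin//; exact: avg_ge0.
  by congr (_ + _)%E; exact: muleCA.
apply: kbar_comb; rewrite ?kn_ge0// => u.
  by apply: sume_ge0 => i _; apply: mule_ge0 => //; exact: avg_ge0.
move=> u0; have [_ [_ _ hu]] := dilation_norm_bounds u0; apply: le_trans (hu f Ef).
have := @step_pair phi J (4 ^ J) (fun i => below (s i)%:E) (dilation u f) Fp n1.
have -> : (\sum_(0 <= i < 4 ^ J) (dy J)%:E * \int[leb]_(t in below (s i)%:E) (`|dilation u f t|)%:E = x u)%E.
  by apply: eq_bigr => i _; congr (_ * _)%E; apply: eq_integral => t; rewrite /dilation ger0_norm.
apply.
- by move=> i; case: (below_fin (s0 i)).
- by move=> i; exact: below_halfline.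
- move=> i t [t0 ts]; split=> //; apply: lt_le_trans ts _; rewrite -!sE; exact: leb_sub.
- move=> i; rewrite (below_fin (s0 i)).2 -sE; exact: hS.
- exact: measurable_dilation.
Qed.

End KotheDual.
End Boyd.

(** * The real inner product, sequences and bounded operators on the Hilbert space *)

Section HilbertBasics.
Context {R : realType} {H : hilbertSpace R}.
Implicit Types (x y z : H) (c : R) (a b : H -> H).

(** The real inner product [rd], with [rs] for real scalars and [hi] for multiplication by i,
    replaces the sesquilinear one throughout: [dotE] recovers the latter, and all estimates stay in
    [R]. *)
Definition rd x y : R := complex.Re (dot H x y).
Definition nrm x : R := complex.Re `|x|.
Definition rs c x : H := (c%:C)%C *: x.
Definition hi x : H := ('i)%C *: x.

Lemma rdDl x y z : rd (x + y) z = rd x z + rd y z.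
Proof. by rewrite /rd linearDl /=; case: (dot H x) (dot H y) => [? ?] []. Qed.

Lemma rdDr x y z : rd z (x + y) = rd z x + rd z y.
Proof. by rewrite /rd linearDr /=; case: (dot H z) (dot H z y) => [? ?] []. Qed.

Lemma rdNl x y : rd (- x) y = - rd x y.
Proof. by rewrite /rd linearNl /=; case: (dot H x). Qed.

Lemma rdNr x y : rd x (- y) = - rd x y.
Proof. by rewrite /rd linearNr /=; case: (dot H x). Qed.

Lemma rdBl x y z : rd (x - y) z = rd x z - rd y z.
Proof. by rewrite rdDl rdNl. Qed.

Lemma rdBr x y z : rd z (x - y) = rd z x - rd z y.
Proof. by rewrite rdDr rdNr. Qed.

Lemma rd0l x : rd 0 x = 0.
Proof. by rewrite /rd linear0l. Qed.

Lemma rd0r x : rd x 0 = 0.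
Proof. by rewrite /rd linear0r. Qed.

Lemma dotC x y : dot H x y = (dot H y x)^*.
Proof. by have := hermC (dot H) x y; rewrite mul1r. Qed.

Lemma rdC x y : rd x y = rd y x.
Proof. by rewrite /rd dotC; case: (dot H y). Qed.

Lemma rdZl c x y : rd (rs c x) y = c * rd x y.
Proof.
rewrite /rd linearZl_LR /=; case: (dot H x) => u v /=.
by rewrite mul0r subr0.
Qed.

Lemma rdZr c x y : rd x (rs c y) = c * rd x y.
Proof. by rewrite rdC rdZl rdC. Qed.

Lemma rdhi x y : rd (hi x) y = - rd x (hi y).
Proof.
rewrite /rd linearZl_LR linearZr_LR /=; case: (dot H x) => u v /=.
by rewrite !mul1r; lra.
Qed.

Lemma dotE x y : dot H x y = (rd x y +i* rd x (hi y))%C.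
Proof.
rewrite /rd linearZr_LR /=; case: (dot H x) => u v /=.
by congr Complex; lra.
Qed.

Lemma nrmE x : `|x| = (nrm x)%:C%C.
Proof.
rewrite /nrm; have := normr_ge0 x; case: `|x| => u v.
by move=> /andP[/eqP -> _].
Qed.

Lemma nrm_ge0 x : 0 <= nrm x.
Proof. by have := normr_ge0 x; rewrite nrmE lecR. Qed.

Lemma rdxx x : rd x x = nrm x ^+ 2.
Proof.
by rewrite /rd dot_norm nrmE -rmorphXn.
Qed.

Lemma nrm_sqrt x : nrm x = Num.sqrt (rd x x).
Proof. by rewrite rdxx sqrtr_sqr ger0_norm ?nrm_ge0. Qed.

Lemma rd_ge0 x : 0 <= rd x x.
Proof. by rewrite rdxx sqr_ge0. Qed.

Lemma rd_eq0 x : rd x x = 0 -> x = 0.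
Proof.
rewrite rdxx => /eqP; rewrite sqrf_eq0 => /eqP h.
by apply/eqP; rewrite -normr_eq0 nrmE h.
Qed.

Lemma rd_inj x y : (forall z, rd x z = rd y z) -> x = y.
Proof.
move=> h; apply/subr0_eq/rd_eq0.
by rewrite rdBl h subrr.
Qed.

Lemma nrm0 : nrm 0 = 0.
Proof. by rewrite nrm_sqrt rd0l sqrtr0. Qed.

Lemma nrm_eq0 x : nrm x = 0 -> x = 0.
Proof. by move=> h; apply: rd_eq0; rewrite rdxx h expr0n. Qed.

Lemma nrmD x y : nrm (x + y) <= nrm x + nrm y.
Proof. by have := ler_normD x y; rewrite !nrmE -rmorphD lecR. Qed.

Lemma nrmN x : nrm (- x) = nrm x.
Proof. by rewrite /nrm normrN. Qed.

Lemma nrmBC x y : nrm (x - y) = nrm (y - x).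
Proof. by rewrite -nrmN opprB. Qed.

Lemma nrm_tri y x z : nrm (x - z) <= nrm (x - y) + nrm (y - z).
Proof. by apply: le_trans (nrmD _ _); rewrite addrA subrK. Qed.

Lemma nrmZ c x : nrm (rs c x) = `|c| * nrm x.
Proof. by rewrite !nrm_sqrt rdZl rdZr mulrA sqrtrM ?sqr_ge0// sqrtr_sqr. Qed.

Lemma rsDr c x y : rs c (x + y) = rs c x + rs c y.
Proof. exact: scalerDr. Qed.
Lemma rsDl c d x : rs (c + d) x = rs c x + rs d x.
Proof. by rewrite /rs rmorphD scalerDl. Qed.
Lemma rsA c d x : rs c (rs d x) = rs (c * d) x.
Proof. by rewrite /rs rmorphM scalerA. Qed.
Lemma rs1 x : rs 1 x = x.
Proof. by rewrite /rs scale1r. Qed.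
Lemma rs0 x : rs 0 x = 0.
Proof. by rewrite /rs scale0r. Qed.
Lemma rsr0 c : rs c 0 = 0.
Proof. exact: scaler0. Qed.

Lemma rsNl c x : rs (- c) x = - rs c x.
Proof. by rewrite /rs rmorphN scaleNr. Qed.
Lemma rsB c x y : rs c (x - y) = rs c x - rs c y.
Proof. exact: scalerBr. Qed.
Lemma hihi x : hi (hi x) = - x.
Proof. by rewrite /hi scalerA -expr2 sqr_i scaleN1r. Qed.
Lemma hiD x y : hi (x + y) = hi x + hi y.
Proof. exact: scalerDr. Qed.
Lemma hiN x : hi (- x) = - hi x.
Proof. exact: scalerN. Qed.

Lemma scaleE (k : R[i]) x : k *: x = rs (complex.Re k) x + rs (complex.Im k) (hi x).
Proof.
rewrite /rs scalerA -scalerDl; congr (_ *: _).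
by apply/eqP; rewrite eq_complex /=; apply/andP; split; apply/eqP; lra.
Qed.

Lemma rdhi2 x y : rd (hi x) (hi y) = rd x y.
Proof. by rewrite rdhi hihi rdNr opprK. Qed.

Lemma nrm_le_rd x y : nrm x <= nrm y <-> rd x x <= rd y y.
Proof. by rewrite !rdxx ler_sqr ?nnegrE ?nrm_ge0. Qed.

Lemma nrm_le c x : 0 <= c -> rd x x <= c ^+ 2 -> nrm x <= c.
Proof. by move=> c0; rewrite rdxx ler_sqr ?nnegrE ?nrm_ge0. Qed.

(* [rd] is only a real inner product, but Cauchy-Schwarz needs no more. *)
Lemma CS2 x y : rd x y ^+ 2 <= rd x x * rd y y.
Proof.
have [y0|y0] := eqVneq (rd y y) 0.
  by rewrite (rd_eq0 y0) !rd0r mulr0 expr0n.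
have yp : 0 < rd y y by rewrite lt_neqAle eq_sym y0 rd_ge0.
have := rd_ge0 (rs (rd y y) x - rs (rd x y) y).
rewrite rdBl !rdBr !rdZl !rdZr (rdC y) => h.
have : 0 <= rd y y * (rd x x * rd y y - rd x y ^+ 2) by nra.
by rewrite pmulr_rge0// subr_ge0.
Qed.

Lemma CS x y : `|rd x y| <= nrm x * nrm y.
Proof.
by rewrite !nrm_sqrt -sqrtrM ?rd_ge0// -sqrtr_sqr ler_sqrt ?CS2// mulr_ge0// rd_ge0.
Qed.

Lemma rd_le x y : rd x y <= nrm x * nrm y.
Proof. exact: le_trans (ler_norm _) (CS x y). Qed.

Lemma rs2 x : rs 2 x = x + x.
Proof. by rewrite rsDl rs1. Qed.

Lemma addKC x y : x + (y - x) = y.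
Proof. by rewrite addrC subrK. Qed.

Definition rdE := (rdDl, rdDr, rdNl, rdNr).

Definition hcvg (u : nat -> H) x := nrm (u n - x) @[n --> \oo] --> (0 : R).

Lemma hcvgP (u : nat -> H) x :
  hcvg u x <-> forall e, 0 < e -> exists N, forall n, (N <= n)%N -> nrm (u n - x) <= e.
Proof.
split=> [h e e0|h].
  have /cvgrPdist_le /(_ e e0) [N _ hN] := h.
  exists N => n Nn; have := hN n Nn; rewrite sub0r normrN ger0_norm//.
  exact: nrm_ge0.
apply/cvgrPdist_le => e /h [N hN]; exists N => // n.
by rewrite sub0r normrN ger0_norm ?nrm_ge0//; apply: hN.
Qed.

Lemma inv_small (e : R) : 0 < e -> exists N, forall n, (N <= n)%N -> n.+1%:R^-1 <= e.
Proof.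
move=> e0; exists (Num.truncn e^-1) => n Nn; rewrite invf_ple ?posrE//.
by apply: le_trans (ltW (truncnS_gt _)) _; rewrite ler_nat.
Qed.

Lemma hcvg_small (u : nat -> H) x : (forall n, nrm (u n - x) <= n.+1%:R^-1) -> hcvg u x.
Proof.
move=> h; apply/hcvgP => e /inv_small[N hN]; exists N => n Nn; exact: le_trans (h n) (hN n Nn).
Qed.

Lemma pos_complex (e : R[i]) : 0 < e -> e = (complex.Re e)%:C%C /\ 0 < complex.Re e.
Proof.
by move=> e0; have er : e = (complex.Re e)%:C%C; [case: e e0 => u v /= /andP[/eqP ->]|split=> //; rewrite er ltcR in e0].
Qed.

Lemma hcvg_cvg (u : nat -> H) x : hcvg u x <-> (u @ \oo --> x).
Proof.
rewrite hcvgP; split=> [h|/cvgrPdist_le h e e0].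
  apply/cvgrPdist_le => e e0.
  have [er e0'] := pos_complex e0; have [N hN] := h _ e0'; exists N => // n.
  by rewrite er nrmE lecR nrmBC; apply: hN.
have e0' : 0 < e%:C%C :> R[i] by rewrite ltcR.
have [N _ hN] := h _ e0'; exists N => n Nn.
by have := hN n Nn; rewrite nrmE lecR nrmBC.
Qed.

Lemma hcomplete (u : nat -> H) :
  (forall e, 0 < e -> exists N, forall m n, (N <= m)%N -> (N <= n)%N -> nrm (u m - u n) <= e) ->
  exists x, hcvg u x.
Proof.
move=> h; suff /cvg_ex[x] : cvg (u @ \oo) by exists x; apply/hcvg_cvg.
apply/cauchy_cvgP/cauchy_exP => e e0.
have [er e0'] := pos_complex e0; have e2 : 0 < complex.Re e / 2 by rewrite divr_gt0.
have [N hN] := h _ e2; exists (u N), N => // n Nn.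
rewrite -ball_normE /= er nrmE ltcR.
by apply: le_lt_trans (hN _ _ (leqnn N) Nn) _; rewrite ltr_pdivrMr// ltr_pMr// ltr1n.
Qed.

Lemma hcvg_cst x : hcvg (fun=> x) x.
Proof. by rewrite /hcvg subrr nrm0; exact: cvg_cst. Qed.

Lemma hcvg_le (u v : nat -> H) x y (K : R) : hcvg u x ->
  (forall n, nrm (v n - y) <= K * nrm (u n - x)) -> hcvg v y.
Proof.
move=> ux uv; have h : K * nrm (u n - x) @[n --> \oo] --> (0 : R).
  by rewrite -[X in _ --> X](mulr0 K); apply: cvgM => //; exact: cvg_cst.
apply: squeeze_cvgr _ (cvg_cst 0) h; near=> n.
by rewrite nrm_ge0 uv.
Unshelve. all: by end_near. Qed.

Lemma hcvgD (u v : nat -> H) x y : hcvg u x -> hcvg v y -> hcvg (fun n => u n + v n) (x + y).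
Proof. by move=> /hcvg_cvg ux /hcvg_cvg vy; apply/hcvg_cvg; exact: cvgD. Qed.

Lemma hcvgN (u : nat -> H) x : hcvg u x -> hcvg (fun n => - u n) (- x).
Proof. by move=> /hcvg_cvg ux; apply/hcvg_cvg; exact: cvgN. Qed.

Lemma hcvgB (u v : nat -> H) x y : hcvg u x -> hcvg v y -> hcvg (fun n => u n - v n) (x - y).
Proof. by move=> ux vy; apply: hcvgD => //; exact: hcvgN. Qed.

Lemma hcvgZ (k : R[i]) (u : nat -> H) x : hcvg u x -> hcvg (fun n => k *: u n) (k *: x).
Proof. by move=> /hcvg_cvg ux; apply/hcvg_cvg; apply: cvgZr. Qed.

Lemma hcvg_rd (u v : nat -> H) x y : hcvg u x -> hcvg v y ->
  rd (u n) (v n) @[n --> \oo] --> rd x y.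
Proof.
move=> ux vy.
have h1 : nrm (u n - x) * nrm (v n - y) + nrm x * nrm (v n - y) + nrm (u n - x) * nrm y
    @[n --> \oo] --> (0 * 0 + nrm x * 0 + 0 * nrm y : R).
  by apply: cvgD; [apply: cvgD|]; apply: cvgM => //; exact: cvg_cst.
rewrite !mulr0 mul0r !addr0 in h1.
apply/subr_cvg0; apply/norm_cvg0P.
apply: squeeze_cvgr _ (cvg_cst 0) h1; near=> n.
rewrite normr_ge0.
have -> : rd (u n) (v n) - rd x y =
  rd (u n - x) (v n - y) + rd x (v n - y) + rd (u n - x) y.
  by rewrite !rdBl; ring.
apply: le_trans (ler_normD _ _) _; rewrite lerD ?CS//.
by apply: le_trans (ler_normD _ _) _; rewrite lerD ?CS.
Unshelve. all: by end_near. Qed.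

Lemma hcvg_nrm (u : nat -> H) x : hcvg u x -> nrm (u n) @[n --> \oo] --> nrm x.
Proof.
move=> ux; rewrite nrm_sqrt; under eq_fun do rewrite nrm_sqrt.
apply: continuous_cvg; [exact: sqrt_continuous|exact: hcvg_rd].
Qed.

Lemma hcvg_unique (u : nat -> H) x y : hcvg u x -> hcvg u y -> x = y.
Proof. by move=> /hcvg_cvg ux /hcvg_cvg uy; exact: cvg_unique uy. Qed.

Lemma hcvg_sub (u : nat -> H) x (f : nat -> nat) : (forall n, n <= f n)%N ->
  hcvg u x -> hcvg (u \o f) x.
Proof.
move=> fn /hcvgP h; apply/hcvgP => e /h [N hN]; exists N => n Nn.
by apply: hN; apply: leq_trans (fn n).
Qed.

Lemma hcvg_eqn (u v : nat -> H) x N : (forall n, (N <= n)%N -> u n = v n) ->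
  hcvg u x -> hcvg v x.
Proof.
move=> uv /hcvgP h; apply/hcvgP => e /h [M hM]; exists (maxn M N) => n.
by rewrite geq_max => /andP[Mn Nn]; rewrite -uv// hM.
Qed.

Lemma closureHP (A : set H) x : closure A x <-> exists u : nat -> H, (forall n, A (u n)) /\ hcvg u x.
Proof.
split=> [h|[u [Au /hcvg_cvg ux]]]; last first.
  move=> B /ux [N _ hN]; exists (u N); split; [exact: Au|exact: hN (leqnn N)].
have h2 n : exists y, A y /\ nrm (y - x) <= n.+1%:R^-1.
  have e0 : 0 < (n.+1%:R^-1 : R)%:C%C :> R[i] by rewrite ltcR.
  have [y [Ay By]] := h _ (nbhsx_ballx x _ e0); exists y.
  by move: By; rewrite -ball_normE /= nrmE ltcR nrmBC => /ltW.
have [u hu] := choice h2; exists u; split=> [n|]; first by have [] := hu n.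
by apply: hcvg_small => n; have [_ ->] := hu n.
Qed.

Lemma closurePairP (T : set (H * H)) x y : closure T (x, y) <->
  exists u v : nat -> H, [/\ forall n, T (u n, v n), hcvg u x & hcvg v y].
Proof.
split=> [h|[u [v [Tuv /hcvg_cvg ux /hcvg_cvg vy]]]]; last first.
  have xy : ((u n, v n) @[n --> \oo]) --> (x, y) by exact: cvg_pair.
  move=> B /xy [N _ hN]; exists (u N, v N); split; [exact: Tuv|exact: hN (leqnn N)].
have h2 n : exists p : H * H, T p /\ nrm (p.1 - x) <= n.+1%:R^-1 /\ nrm (p.2 - y) <= n.+1%:R^-1.
  have e0 : 0 < (n.+1%:R^-1 : R)%:C%C :> R[i] by rewrite ltcR.
  have [p [Tp Bp]] := h _ (nbhsx_ballx (x, y) _ e0); exists p.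
  move: Bp; rewrite /ball /= /prod_ball -!ball_normE /= !nrmE !ltcR.
  by rewrite nrmBC (nrmBC y) => -[/ltW ? /ltW].
have [u hu] := choice h2; exists (fst \o u), (snd \o u); split.
- by move=> n; rewrite -surjective_pairing; have [] := hu n.
- by apply: hcvg_small => n; have [_ [-> _]] := hu n.
- by apply: hcvg_small => n; have [_ [_ ->]] := hu n.
Qed.

Lemma denseHP (A : set H) : dense A <-> forall x, exists u : nat -> H, (forall n, A (u n)) /\ hcvg u x.
Proof.
split=> [h x|h].
  apply/closureHP => B /nbhs_interior xB.
  have [] := h (B^°) _ (open_interior _); first by exists x; exact: nbhs_singleton.
  by move=> y [/interior_subset]; exists y.
move=> O [x Ox] oO; have /closureHP hx := h x.
have [|y [Ay]] := hx O; first exact: open_nbhs_nbhs.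
by exists y.
Qed.

Definition bop := @bounded_op R H.

Lemma bopP a : bop a <-> (linear a /\ exists K, forall x, nrm (a x) <= K * nrm x).
Proof.
split=> [[la ca]|[la [K hK]]]; split=> //; last first.
  move=> x; apply/cvgrPdist_le => e e0.
  have [er e0'] := pos_complex e0; have d0 : 0 < complex.Re e / (`|K| + 1) by rewrite divr_gt0.
  have d0c : 0 < (complex.Re e / (`|K| + 1))%:C%C :> R[i] by rewrite ltcR.
  have := nbhsx_ballx x _ d0c; apply: filterS => y.
  rewrite -ball_normE /= nrmE ltcR => xy.
  have aB : a x - a y = a (x - y).
    by have := la (-1) y; rewrite !scaleN1r (addrC x) => ->; rewrite addrC.
  rewrite aB nrmE er lecR; apply: le_trans (hK _) _.
  apply: le_trans (_ : (`|K| + 1) * nrm (x - y) <= _).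
    by rewrite ler_wpM2r ?nrm_ge0// ler_wpDr// ler_norm.
  by rewrite mulrC -ler_pdivlMr// ltW.
have a0 : a 0 = 0 by have := la (-1) 0 0; rewrite !scaleN1r !addNr.
have e1 : 0 < 1 :> R[i] by [].
have /cvgrPdist_le /(_ _ e1) /nbhs_ballP [d /= d0 hd] := ca 0.
have dr : d = (complex.Re d)%:C%C.
  by move: d0; case: (d) => u1 v1; rewrite /= => /andP[/eqP ->].
have d0' := d0; rewrite dr ltcR in d0'.
have aZ c x : a (rs c x) = rs c (a x).
  by have := la c%:C%C x 0; rewrite !addr0 a0 addr0.
exists (2 / complex.Re d) => x.
have [->|x0] := eqVneq x 0; first by rewrite a0 nrm0 mulr0.
have nx : 0 < nrm x.
  by rewrite lt_neqAle nrm_ge0 andbT eq_sym; apply: contra x0 => /eqP /nrm_eq0 ->.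
pose c := complex.Re d / 2 / nrm x.
have c0 : 0 < c by rewrite !divr_gt0.
have := hd (rs c x); rewrite -ball_normE /= !sub0r !normrN a0 sub0r normrN !nrmE dr ltcR lecR aZ !nrmZ.
rewrite (gtr0_norm c0) -[_ / nrm x * nrm x]mulrA mulVf ?gt_eqF// mulr1.
rewrite ltr_pdivrMr// ltr_pMr// ltr1n => /(_ isT) h.
rewrite -ler_pdivrMl ?divr_gt0// invf_div.
by move: h => /=; rewrite mulrAC ler_pdivrMr// mul1r.
Qed.

Lemma bop_lin a : bop a -> forall (k : R[i]) x y, a (k *: x + y) = k *: a x + a y.
Proof. by case. Qed.

Lemma bop0 a : bop a -> a 0 = 0.
Proof. by move=> /bop_lin h; have := h (-1) 0 0; rewrite !scaleN1r !addNr. Qed.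

Lemma bopD a : bop a -> forall x y, a (x + y) = a x + a y.
Proof. by move=> /bop_lin h x; have := h 1 x; rewrite !scale1r. Qed.

Lemma bopZ a : bop a -> forall (k : R[i]) x, a (k *: x) = k *: a x.
Proof. by move=> ha k x; have := bop_lin ha k x 0; rewrite !addr0 (bop0 ha) addr0. Qed.

Lemma boprs a : bop a -> forall c x, a (rs c x) = rs c (a x).
Proof. by move=> ha c; exact: bopZ. Qed.

Lemma bophi a : bop a -> forall x, a (hi x) = hi (a x).
Proof. by move=> ha; exact: bopZ. Qed.

Lemma bopN a : bop a -> forall x, a (- x) = - a x.
Proof. by move=> ha x; rewrite -scaleN1r (bopZ ha) scaleN1r. Qed.

Lemma bopB a : bop a -> forall x y, a (x - y) = a x - a y.
Proof. by move=> ha x y; rewrite (bopD ha) bopN. Qed.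

Lemma bop_bnd a : bop a -> exists2 K, 0 <= K & forall x, nrm (a x) <= K * nrm x.
Proof.
move=> /bopP[_ [K hK]]; exists `|K| => // x.
by apply: le_trans (hK x) _; rewrite ler_wpM2r ?nrm_ge0// ler_norm.
Qed.

Lemma bop_cvg a u x : bop a -> hcvg u x -> hcvg (a \o u) (a x).
Proof.
move=> ha ux; have [K _ hK] := bop_bnd ha.
by apply: (@hcvg_le u _ x) => // n; rewrite -bopB.
Qed.

Lemma bop_intro a K : (forall x y, a (x + y) = a x + a y) -> (forall c x, a (rs c x) = rs c (a x)) ->
  (forall x, a (hi x) = hi (a x)) -> (forall x, nrm (a x) <= K * nrm x) -> bop a.
Proof.
move=> aD aZ ai aK; apply/bopP; split; last by exists K.
by move=> k x y; rewrite aD !scaleE aD !aZ ai.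
Qed.

Lemma bop_id : bop id.
Proof. by apply: (@bop_intro id 1) => // x; rewrite mul1r. Qed.

Lemma bop_zero : bop (fun=> 0).
Proof.
apply: (@bop_intro _ 0) => *; rewrite ?addr0 ?rsr0 ?nrm0 ?mul0r//.
by rewrite /hi scaler0.
Qed.

Lemma bop_comp a b : bop a -> bop b -> bop (a \o b).
Proof.
move=> ha hb; have [K K0 hK] := bop_bnd ha; have [L L0 hL] := bop_bnd hb.
apply: (@bop_intro _ (K * L)) => [x y|c x|x|x] /=.
- by rewrite (bopD hb) bopD.
- by rewrite (boprs hb) boprs.
- by rewrite (bophi hb) bophi.
- by apply: le_trans (hK _) _; rewrite -mulrA ler_wpM2l.
Qed.

Lemma bop_add a b : bop a -> bop b -> bop (a \+ b).
Proof.
move=> ha hb; have [K K0 hK] := bop_bnd ha; have [L L0 hL] := bop_bnd hb.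
apply: (@bop_intro _ (K + L)) => [x y|c x|x|x] /=.
- by rewrite (bopD hb) (bopD ha) addrACA.
- by rewrite (boprs hb) (boprs ha) rsDr.
- by rewrite (bophi hb) (bophi ha) hiD.
- by apply: le_trans (nrmD _ _) _; rewrite mulrDl lerD.
Qed.

Lemma bop_scale (k : R[i]) a : bop a -> bop (fun x => k *: a x).
Proof.
move=> ha; have [K K0 hK] := bop_bnd ha.
apply/bopP; split; first by move=> l x y; rewrite (bop_lin ha) scalerDr !scalerA mulrC.
exists (complex.Re `|k| * K) => x.
have nk : nrm (k *: a x) = complex.Re `|k| * nrm (a x).
  rewrite /nrm normrZ; case: `|a x| (nrmE (a x)) => u v [_ ->] /=.
  by rewrite mulr0 subr0.
rewrite nk -mulrA ler_wpM2l//.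
by have : 0 <= `|k| by []; rewrite lecE => /andP[].
Qed.

Lemma bop_rs c a : bop a -> bop (fun x => rs c (a x)).
Proof. exact: bop_scale. Qed.

Lemma bop_opp a : bop a -> bop (fun x => - a x).
Proof. by move=> /bop_scale h; rewrite (_ : (fun => _) = (fun x => -1 *: a x))//; apply/funext => x; rewrite scaleN1r. Qed.

Lemma bop_sub a b : bop a -> bop b -> bop (fun x => a x - b x).
Proof. by move=> ha /bop_opp; exact: bop_add. Qed.

Lemma bop_lim (a : nat -> H -> H) b K : (forall n, bop (a n)) ->
  (forall n x, nrm (a n x) <= K * nrm x) -> (forall x, hcvg (a^~ x) (b x)) -> bop b.
Proof.
move=> ha aK ab; apply: @bop_intro => [x y|c x|x|x].
- apply: hcvg_unique (ab _) _.
  by rewrite (_ : a^~ _ = fun n => a n x + a n y); [exact: hcvgD|apply/funext => n; exact: bopD].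
- apply: hcvg_unique (ab _) _.
  by rewrite (_ : a^~ _ = fun n => rs c (a n x)); [exact: hcvgZ|apply/funext => n; exact: boprs].
- apply: hcvg_unique (ab _) _.
  by rewrite (_ : a^~ _ = fun n => hi (a n x)); [exact: hcvgZ|apply/funext => n; exact: bophi].
- exact: (cvg_le_seq (hcvg_nrm (ab x)) (cvg_cst _)) => n.
Qed.

Definition sa a := forall x y, rd (a x) y = rd x (a y).

Lemma is_adjointE a b : bop a -> bop b -> (is_adjoint a b <-> forall x y, rd (a x) y = rd x (b y)).
Proof.
move=> ha; split=> h x y; first by rewrite /rd h.
by rewrite !dotE h; rewrite h bophi.
Qed.

Definition nonneg a := forall x, 0 <= rd (a x) x.

Lemma sa_dot a x : bop a -> sa a -> dot H (a x) x = (rd (a x) x)%:C%C.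
Proof.
move=> ha sa; rewrite dotE; suff -> : rd (a x) (hi x) = 0 by [].
have := sa x (hi x); rewrite (bophi ha) rdC rdhi; lra.
Qed.

(* Over the complex numbers an operator with real quadratic form is self-adjoint. *)
Lemma le_op0P a : bop a -> le_op (fun=> 0) a <-> (sa a /\ nonneg a).
Proof.
move=> ha; split=> [h|[sa na] x]; last first.
  by rewrite (sa_dot _ ha sa) linear0l lecR.
have im x : rd (a x) (hi x) = 0.
  by have := h x; rewrite linear0l dotE => /andP[/eqP].
split; last by move=> x; have := h x; rewrite linear0l dotE => /andP[].
move=> x y; have := im (hi x + y).
rewrite (bopD ha) (bophi ha) hiD hihi !rdDl !rdDr !rdNr.
have := im; have := im y; rewrite !rdhi hihi.
move=> e1; rewrite (rdC x)im; lra.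
Qed.

Lemma le_opP a b : bop a -> bop b -> sa a -> sa b ->
  (le_op a b <-> forall x, rd (a x) x <= rd (b x) x).
Proof.
move=> ha hb sa' sb; split=> h x; have := h x; rewrite (sa_dot _ ha sa') (sa_dot _ hb sb) lecR//.
Qed.

Lemma sa_eq a b : bop a -> bop b -> sa a -> sa b -> (forall x, rd (a x) x = rd (b x) x) -> a = b.
Proof.
move=> ha hb sa' sb h; apply/funext => x; apply: rd_inj => z.
have := h (x + z); rewrite (bopD ha) (bopD hb) !rdDl !rdDr !h.
rewrite (sa' z) (sb z x) (rdC z) (rdC z); lra.
Qed.

Lemma CS_op a x y : bop a -> sa a -> nonneg a -> rd (a x) y ^+ 2 <= rd (a x) x * rd (a y) y.
Proof.
move=> ha sa' na.
have key t : 0 <= rd (a x) x + 2 * t * rd (a x) y + t ^+ 2 * rd (a y) y.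
  have := na (x + rs t y); rewrite (bopD ha) (boprs ha) !rdDl !rdDr !rdZl !rdZr.
  rewrite (sa' y) (rdC y); nra.
have := na y; rewrite le_eqVlt => /orP[/eqP y0|y0].
  rewrite -y0 mulr0; have [->|n0] := eqVneq (rd (a x) y) 0; first by rewrite expr0n.
  (* This [t] makes the right side of [key], affine in [t] since the quadratic term vanishes, equal
     to -1. *)
  have := key (- (rd (a x) x + 1) / (2 * rd (a x) y)); rewrite -y0.
  have> : 2 * (- (rd (a x) x + 1) / (2 * rd (a x) y)) * rd (a x) y = - (rd (a x) x + 1) by field.
  by lra.
have := key (- rd (a x) y / rd (a y) y).
have -> : rd (a x) x + 2 * (- rd (a x) y / rd (a y) y) * rd (a x) y + (- rd (a x) y / rd (a y) y) ^+ 2 * rd (a y) y = rd (a x) x - rd (a x) y ^+ 2 / rd (a y) y by field; rewrite gt_eqF.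
by rewrite subr_ge0 ler_pdivrMr.
Qed.

(** Cauchy-Schwarz for the form of [a] at [x] and [a x], divided by [|a x|^2]. It converts
    convergence of forms into strong convergence. *)
Lemma form_bound a K x : bop a -> sa a -> nonneg a -> (forall z, rd (a z) z <= K * rd z z) ->
  rd (a x) (a x) <= K * rd (a x) x.
Proof.
move=> ha sa' na hK.
have := CS_op x (a x) ha sa' na; rewrite expr2 => h.
have [e0|n0] := eqVneq (rd (a x) (a x)) 0; first rewrite e0.
  have [x0|x0] := eqVneq (rd x x) 0; first by rewrite (rd_eq0 x0) rd0r mulr0.
  have K0 : 0 <= K.
    have := le_trans (na x) (hK x); rewrite pmulr_lge0// lt_neqAle eq_sym x0; exact: rd_ge0.
  by rewrite mulr_ge0.
have p : 0 < rd (a x) (a x) by rewrite lt_neqAle eq_sym n0 rd_ge0.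
rewrite -(ler_pM2r p); apply: le_trans h _.
rewrite mulrC mulrAC ler_wpM2r//.
Qed.

Lemma form_nrm a K x : bop a -> sa a -> nonneg a -> 0 <= K -> (forall z, rd (a z) z <= K * rd z z) ->
  nrm (a x) <= K * nrm x.
Proof.
move=> ha sa' na K0 hK; apply: nrm_le; first by rewrite mulr_ge0 ?nrm_ge0.
apply: le_trans (form_bound x ha sa' na hK) _.
by rewrite exprMn -rdxx -mulrA ler_wpM2l.
Qed.

Lemma bop_form_bnd a : bop a -> exists2 K, 0 <= K & forall x, `|rd (a x) x| <= K * rd x x.
Proof.
move=> /bop_bnd[K]; exists K => // x; apply: le_trans (CS _ _) _.
by rewrite rdxx mulrA ler_wpM2r ?nrm_ge0.
Qed.

End HilbertBasics.
#[global] Hint Extern 0 (is_true (@Order.le _ _ _ _)) =>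
  solve [exact: rd_ge0 | exact: nrm_ge0] : core.

(** * Closed quadratic forms, their resolvents, and operators obtained from forms *)

Section QuadraticForms.
Context {R : realType} {H : hilbertSpace R}.
Implicit Types (x y z l v : H) (a b u : H -> H) (D : set H) (q : H -> R).

Record csub (V : set H) : Prop := Csub {
  csub0 : V 0;
  csubD : forall x y, V x -> V y -> V (x + y);
  csubZ : forall c x, V x -> V (rs c x);
  csubi : forall x, V x -> V (hi x) }.

Lemma csubN V x : csub V -> V x -> V (- x).
Proof. by move=> hV /(csubZ hV (-1)); rewrite rsNl rs1. Qed.

Lemma csubB V x y : csub V -> V x -> V y -> V (x - y).
Proof. by move=> hV Vx Vy; apply: csubD => //; exact: csubN. Qed.

(* An extended-valued quadratic form, finite exactly on [D]. *)
Record qform D q : Prop := Qform {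
  qf_sub : csub D;
  qf_ge0 : forall x, D x -> 0 <= q x;
  qf_par : forall x y, D x -> D y -> q (x + y) + q (x - y) = 2 * q x + 2 * q y;
  qf_Z : forall c x, D x -> q (rs c x) = c ^+ 2 * q x;
  qf_i : forall x, D x -> q (hi x) = q x;
  qf_lsc : forall (w : nat -> H) x K, (forall n, D (w n)) -> hcvg w x ->
    (forall n, q (w n) <= K) -> D x /\ q x <= K }.

(* [x] minimizes [q z + |z - l|^2]. *)
Definition res D q l x := D x /\ forall v, D v -> q (x + v) = q x + q v + 2 * rd (l - x) v.

Lemma qf0 D q : qform D q -> q 0 = 0.
Proof. by move=> hq; have := qf_Z hq 0 (csub0 (qf_sub hq)); rewrite rs0 expr0n mul0r. Qed.

Lemma qfN D q x : qform D q -> D x -> q (- x) = q x.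
Proof. by move=> hq Dx; have := qf_Z hq (-1) Dx; rewrite rsNl rs1 sqrrN expr1n mul1r. Qed.

Lemma qform_scale D q t : qform D q -> 0 < t -> qform D (fun x => t * q x).
Proof.
move=> hq; split=> [|x Dx|x y Dx Dy|c x Dx|x Dx|w x K Dw wx qw].
- exact: qf_sub hq.
- by apply: mulr_ge0; [exact: ltW|exact: (qf_ge0 hq)].
- by rewrite -mulrDr (qf_par hq)//; ring.
- by rewrite (qf_Z hq)//; ring.
- by rewrite (qf_i hq).
- have [|Dx] := @qf_lsc _ _ hq w x (K / t) Dw wx; first by move=> n; rewrite ler_pdivlMr// mulrC.
  by split=> //; rewrite mulrC -ler_pdivlMr.
Qed.

Lemma res_unique D q l x y : qform D q -> res D q l x -> res D q l y -> x = y.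
Proof.
move=> hq [Dx hx] [Dy hy]; have hD := qf_sub hq.
have := hx (y - x) (csubB hD Dy Dx); have := hy (x - y) (csubB hD Dx Dy).
rewrite !addKC => h1 h2.
have h3 : q (x - y) = q (y - x) by rewrite -opprB (qfN hq)//; exact: csubB.
have h4 := qf_ge0 hq (csubB hD Dy Dx).
have h5 : rd (y - x) (y - x) <= 0.
  have : rd (l - x) (y - x) - rd (l - y) (y - x) = rd (y - x) (y - x).
    by rewrite !rdE; lra.
  lra.
by apply/esym/subr0_eq/rd_eq0/le_anti; rewrite h5 rd_ge0.
Qed.

(* Halving the distance to [x] repeatedly upgrades the factor given by the
   parallelogram law to the sharp one, without polarizing [q]. *)
Lemma minimizer_res D q l x : qform D q -> D x ->
  (forall z, D z -> q x + rd (x - l) (x - l) <= q z + rd (z - l) (z - l)) -> res D q l x.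
Proof.
move=> hq Dx hmin; split=> // v Dv; have hD := qf_sub hq.
pose F z := q z + rd (z - l) (z - l).
pose N z := q z + rd z z.
have Npar z w : D z -> D w -> F (z + w) + F (z - w) = 2 * F z + 2 * N w.
  move=> Dz Dw; rewrite /F /N.
  have := qf_par hq Dz Dw.
  rewrite !(rdDl, rdDr, rdNl, rdNr); lra.
have NZ c w : D w -> N (rs c w) = c ^+ 2 * N w.
  by move=> Dw; rewrite /N (qf_Z hq)// rdZl rdZr; ring.
have half w : D w -> F x + N w <= F (x + w).
  move=> Dw.
  have iter k : F (x + rs (2 ^- k) w) - F x = 4 ^- k * N w + 2 ^- k * (F (x + w) - F x - N w).
    elim: k => [|k IH].
      by rewrite invr1 rs1; ring.
    have Dk c : D (rs c w) by exact: csubZ.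
    have := Npar (x + rs (2 ^- k.+1) w) (rs (2 ^- k.+1) w) (csubD hD Dx (Dk _)) (Dk _).
    have -> : x + rs (2 ^- k.+1) w + rs (2 ^- k.+1) w = x + rs (2 ^- k.+1 + 2 ^- k.+1) w by rewrite -addrA -rsDl.
    rewrite addrK NZ//.
    have -> : 2 ^- k.+1 + 2 ^- k.+1 = 2 ^- k :> R.
      by rewrite exprS; lra.
    have -> : (2 ^- k.+1) ^+ 2 = 4 ^- k / 4 :> R.
      have -> : 4 ^- k = (2 ^- k) ^+ 2 :> R by rewrite -!exprVn -exprM mulnC exprM; congr (_ ^+ k); field.
      by rewrite (exprS 2); field.
    rewrite -!exprVn in IH *; rewrite !exprS.
    move: IH; lra.
  have lim0 : 2 ^- k * N w + (F (x + w) - F x - N w) @[k --> \oo] --> (0 * N w + (F (x + w) - F x - N w)).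
    apply: cvgD; last exact: cvg_cst.
    apply: cvgM; last exact: cvg_cst.
    under eq_fun do rewrite -exprVn.
    by apply: cvg_expr; rewrite ger0_norm// invf_lt1// ltr1n.
  rewrite mul0r add0r in lim0.
  suff : 0 <= F (x + w) - F x - N w by lra.
  apply: (cvg_le_seq (cvg_cst 0) lim0) => k.
  have h1 : 0 <= F (x + rs (2 ^- k) w) - F x.
    by rewrite subr_ge0; apply: hmin; apply: csubD => //; exact: csubZ.
  rewrite iter in h1.
  have -> : 2 ^- k * N w + (F (x + w) - F x - N w) = 2 ^+ k * (4 ^- k * N w + 2 ^- k * (F (x + w) - F x - N w)).
    have -> : 4 ^- k = (2 ^- k) ^+ 2 :> R by rewrite -!exprVn -exprM mulnC exprM; congr (_ ^+ k); field.
    have e2 : 2 ^+ k * 2 ^- k = 1 :> R by rewrite mulfV.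
    set E := F (x + w) - F x - N w.
    have> : 2 ^+ k * ((2 ^- k) ^+ 2 * N w + 2 ^- k * E) = (2 ^+ k * 2 ^- k) * (2 ^- k * N w + E) by ring.
    by rewrite e2 mul1r.
  by rewrite mulr_ge0.
have h1 := half v Dv; have h2 := half (- v) (csubN hD Dv).
have h3 := Npar x v Dx Dv.
have h4 : N (- v) = N v by rewrite /N (qfN hq)// rdNl rdNr opprK.
have : F (x + v) = F x + N v by lra.
rewrite /F /N.
rewrite !rdE rdC (rdC v l); lra.
Qed.

Lemma res_min D q l x z : qform D q -> res D q l x -> D z ->
  q x + rd (x - l) (x - l) <= q z + rd (z - l) (z - l).
Proof.
move=> hq [Dx hx] Dz; have hD := qf_sub hq.
have Dv := csubB hD Dz Dx; have := hx _ Dv; have := qf_ge0 hq Dv; have := rd_ge0 (z - x).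
rewrite addKC.
rewrite !rdE (rdC x) (rdC l) (rdC x); lra.
Qed.

Lemma res_exists D q l : qform D q -> exists x, res D q l x.
Proof.
move=> hq; have hD := qf_sub hq.
pose F z := q z + rd (z - l) (z - l).
pose A := [set F z | z in D].
have hA : has_inf A.
  split; first by exists (F 0), 0 => //; exact: csub0.
  by exists 0 => _ [z Dz <-]; apply: addr_ge0 => //; exact: (qf_ge0 hq).
have lb z : D z -> inf A <= F z by move=> Dz; apply: ge_inf; [case: hA|exists z].
have hch : forall n : nat, exists z, D z /\ F z <= inf A + n.+1%:R^-1.
  move=> n; have n0 : 0 < n.+1%:R^-1 :> R by rewrite invr_gt0.
  have [_ [z Dz <-] /ltW] := inf_adherent n0 hA.
  by exists z.
have [w hw] := choice hch.
have Dw n : D (w n) by case: (hw n).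
(* The parallelogram law, with the value at the midpoint of two near-minimizers bounded below by the
   infimum. *)
have cau m n : rd (w m - w n) (w m - w n) <= 2 * (m.+1%:R^-1 + n.+1%:R^-1).
  have Dmn := csubD hD (Dw m) (Dw n); have Dmn' := csubB hD (Dw m) (Dw n).
  have := lb (rs (2^-1) (w m + w n)) (csubZ hD _ Dmn).
  rewrite /F (qf_Z hq)//.
  have := qf_par hq (Dw m) (Dw n); have := qf_ge0 hq Dmn'.
  have := hw m; have := hw n; rewrite /F.
  rewrite !(rdBl, rdBr, rdDl, rdDr, rdZl, rdZr).
  move: (inf) m.+1%:R^-1 n.+1%:R^-1 => i a b; rewrite (_ : 2^-1 ^+ 2 = 4^-1 :> R); [lra|by field].
have [x wx] : exists x, hcvg w x.
  apply: hcomplete => e e0.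
  have e4 : 0 < e ^+ 2 / 4 by rewrite divr_gt0// exprn_gt0.
  have [N hN] := inv_small e4.
  exists N => m n Nm Nn; apply: nrm_le; first exact: ltW.
  apply: le_trans (cau m n) _.
  have := hN m Nm; have := hN n Nn; move: m.+1%:R^-1 n.+1%:R^-1 => a b t; lra.
have Fw e : 0 < e -> exists N, forall n, (N <= n)%N -> F (w n) <= inf A + e.
  move=> e0; have [N hN] := inv_small e0.
  exists N => n Nn; have := hN n Nn; have [_] := hw n.
  by move: n.+1%:R^-1 => a; lra.
have Fx e : 0 < e -> D x /\ F x <= inf A + e.
  move=> e0; have e2 : 0 < e / 2 by rewrite divr_gt0.
  have [N hN] := Fw _ e2.
  have nl : rd (w n - l) (w n - l) @[n --> \oo] --> rd (x - l) (x - l).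
    by apply: hcvg_rd; apply: hcvgB => //; exact: hcvg_cst.
  have /cvgrPdist_le /(_ _ e2) [M _ hM] := nl.
  (* Lower semicontinuity is applied along a tail, where the values [F (w n)] are near the infimum
     and the distances to [l] near their limit; hence the index [maxn]. *)
  have [|||Dx] := @qf_lsc _ _ hq (fun n => w (maxn n (maxn N M))) x (inf A + e - rd (x - l) (x - l)).
  - by [].
  - apply: @hcvg_sub => // n; exact: leq_maxl.
  - move=> n; set k := maxn _ _.
    have Nk : (N <= k)%N by rewrite /k maxnCA leq_maxl.
    have Mk : (M <= k)%N by rewrite /k maxnA leq_maxr.
    by have := hN _ Nk; have := hM _ Mk; rewrite /F ler_norml => /andP[_]; lra.
  - by split=> //; rewrite /F; lra.
have : D x by case: (Fx 1).
exists x; apply: minimizer_res => // z Dz.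
apply: le_trans (lb z Dz); apply/ler_addgt0Pr => e e0.
by case: (Fx e).
Qed.

Definition resolvent D q : H -> H := fun l => xget 0 [set x | res D q l x].

Section Resolvent.
Variables (D : set H) (q : H -> R).
Hypothesis hq : qform D q.
Local Notation G := (resolvent D q).

Lemma resolventP l : res D q l (G l).
Proof. by have [x hx] := res_exists l hq; exact: (xgetPex 0 (ex_intro _ x hx)). Qed.

Lemma resolvent_eq l x : res D q l x -> G l = x.
Proof. exact: res_unique (resolventP l). Qed.

Lemma resolvent_dom l : D (G l). Proof. by case: (resolventP l). Qed.

Lemma resolvent_val l : q (G l) = rd (l - G l) (G l).
Proof.
have [DG] := resolventP l => /(_ (- G l) (csubN (qf_sub hq) DG)).
by rewrite subrr (qf0 hq) (qfN hq)//; lra.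
Qed.

Lemma resolvent_add l l' : G (l + l') = G l + G l'.
Proof.
apply: resolvent_eq; have [Dx hx] := resolventP l; have [Dy hy] := resolventP l'.
have hD := qf_sub hq; split; first exact: csubD.
move=> v Dv; rewrite -addrA (hx _ (csubD hD Dy Dv)) (hy _ Dv) (hx _ Dy).
rewrite !rdE; lra.
Qed.

Lemma resolvent_rs c l : G (rs c l) = rs c (G l).
Proof.
have [->|c0] := eqVneq c 0.
  rewrite !rs0; apply: resolvent_eq; split; first exact: csub0 (qf_sub hq).
  by move=> v; rewrite add0r subrr rd0l (qf0 hq); lra.
apply: resolvent_eq; have [Dx hx] := resolventP l; have hD := qf_sub hq.
split; first exact: csubZ.
move=> v Dv; have -> : v = rs c (rs c^-1 v) by rewrite rsA mulfV// rs1.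
move: (rs c^-1) (csubZ hD c^-1 Dv) => w Dw.
rewrite -rsDr !(qf_Z hq)//; last exact: csubD.
rewrite (hx _ Dw) -rsB rdZl rdZr; ring.
Qed.

Lemma resolvent_hi l : G (hi l) = hi (G l).
Proof.
apply: resolvent_eq; have [Dx hx] := resolventP l; have hD := qf_sub hq.
split; first exact: csubi.
move=> v Dv; have -> : v = hi (- hi v) by rewrite hiN hihi opprK.
move: (- hi v) (csubN hD (csubi hD Dv)) => w Dw.
rewrite -hiD !(qf_i hq)//; last exact: csubD.
by rewrite (hx _ Dw) -hiN -hiD rdhi2.
Qed.

Lemma resolvent_sa : sa G.
Proof.
move=> l l'; have [Dx hx] := resolventP l; have [Dy hy] := resolventP l'.
have := hx _ Dy; have := hy _ Dx; rewrite addrC !rdBl (rdC (G l)) => h1.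
have := rdC l' (G l); lra.
Qed.

Lemma resolvent_nonneg : nonneg G.
Proof.
move=> l; have := resolvent_val l; have := qf_ge0 hq (resolvent_dom l).
rewrite rdC; have := rd_ge0 (G l); lra.
Qed.

Lemma resolvent_le l : rd (G l) l <= rd l l.
Proof.
have := resolvent_val l; have := qf_ge0 hq (resolvent_dom l).
have := rd_ge0 (l - G l); rewrite !(rdBl, rdBr); lra.
Qed.

Lemma resolvent_contr l : nrm (G l) <= nrm l.
Proof.
apply/nrm_le_rd; have := resolvent_val l; have := qf_ge0 hq (resolvent_dom l).
have := rd_ge0 (l - G l); rewrite !(rdBl, rdBr) rdC; lra.
Qed.

Lemma resolvent_bop : bop G.
Proof.
apply: (@bop_intro _ _ _ 1); [exact: resolvent_add|exact: resolvent_rs|exact: resolvent_hi|].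
by move=> l; rewrite mul1r resolvent_contr.
Qed.

Lemma resolvent_min l z : D z ->
  q (G l) + rd (G l - l) (G l - l) <= q z + rd (z - l) (z - l).
Proof. exact: res_min (resolventP l). Qed.

Lemma resolvent_polar l v : D v -> q (G l + v) = q (G l) + q v + 2 * rd (l - G l) v.
Proof. by move=> Dv; have [_ ->] := resolventP l. Qed.

Lemma resolvent_orth l : (forall v, D v -> rd l v = 0) -> G l = 0.
Proof.
move=> h; apply: resolvent_eq; split; first exact: csub0 (qf_sub hq).
by move=> v Dv; rewrite add0r subr0 h// (qf0 hq); lra.
Qed.

Lemma resolvent_ker l : G l = 0 -> forall v, D v -> rd l v = 0.
Proof.
move=> h v Dv; have := resolvent_polar l Dv.
by rewrite h add0r subr0 (qf0 hq); lra.
Qed.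

End Resolvent.

(* Moreau-Yosida: [q] is the limit of the bounded forms [(1 - G_t)/t], where
   [G_t] is the resolvent of [t q]. *)
Lemma yosida_le D q t t' x : qform D q -> 0 < t -> t <= t' ->
  t'^-1 * rd (x - resolvent D (fun z => t' * q z) x) x <=
  t^-1 * rd (x - resolvent D (fun z => t * q z) x) x.
Proof.
move=> hq t0 tt'; have t'0 : 0 < t' by exact: lt_le_trans tt'.
have ht := qform_scale hq t0; have ht' := qform_scale hq t'0.
set G := resolvent D _; set G' := resolvent D _.
have env s (s0 : 0 < s) : s^-1 * rd (x - resolvent D (fun z => s * q z) x) x =
    q (resolvent D (fun z => s * q z) x) + s^-1 * rd (resolvent D (fun z => s * q z) x - x) (resolvent D (fun z => s * q z) x - x).
  have := resolvent_val (qform_scale hq s0) x; set g := resolvent _ _ _ => h.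
  have -> : q g = s^-1 * (s * q g) by rewrite mulrA mulVf ?mul1r// gt_eqF.
  by rewrite h; rewrite !(rdBl, rdBr); lra.
rewrite (env _ t0) (env _ t'0).
have := resolvent_min ht' x (resolvent_dom ht x); rewrite -/G => h.
apply: (@le_trans _ _ (q (G' x) + t'^-1 * rd (G' x - x) (G' x - x))); last first.
  by rewrite lerD2l ler_wpM2r// lef_pV2.
rewrite -(ler_pM2l t'0) !mulrDr !mulrA mulfV ?gt_eqF// !mul1r //.
Qed.

Lemma yosida_ub D q t x : qform D q -> 0 < t -> D x ->
  t^-1 * rd (x - resolvent D (fun z => t * q z) x) x <= q x.
Proof.
move=> hq t0 Dx; have ht := qform_scale hq t0.
have := resolvent_min ht x Dx; rewrite (resolvent_val ht).
set g := resolvent => h.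
rewrite mulrC ler_pdivrMr//.
move: h; rewrite !(rdBl, rdBr); lra.
Qed.

Definition yosida D q n x := n.+1%:R * rd (x - resolvent D (fun z => n.+1%:R^-1 * q z) x) x.

Lemma yosida_mono D q m n x : qform D q -> (m <= n)%N -> yosida D q m x <= yosida D q n x.
Proof.
move=> hq mn; have := @yosida_le _ _ n.+1%:R^-1 m.+1%:R^-1 x hq.
rewrite !invrK; apply; first by rewrite invr_gt0.
by rewrite lef_pV2 ?posrE// ler_nat.
Qed.

Lemma yosida_leq D q n x : qform D q -> D x -> yosida D q n x <= q x.
Proof.
by move=> hq; have := @yosida_ub _ _ n.+1%:R^-1; rewrite invrK; apply.
Qed.

(** A bound on the envelopes at [x] bounds [(n + 1) |g n - x|^2], so the resolvents [g n] converge
    to [x] with bounded form values, and lower semicontinuity applies. *)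
Lemma yosida_lsc D q x K : qform D q ->
  (forall n, yosida D q n x <= K) ->
  D x /\ q x <= K.
Proof.
move=> hq; rewrite /yosida => hK; pose g n := resolvent D (fun z => n.+1%:R^-1 * q z) x.
have hn n : qform D (fun z => n.+1%:R^-1 * q z) by apply: qform_scale.
have id n : n.+1%:R * rd (x - g n) x = q (g n) + n.+1%:R * rd (g n - x) (g n - x).
  have := resolvent_val (hn n); rewrite -/(g) => h.
  have> : q (g n) = n.+1%:R * (n.+1%:R^-1 * q (g n)) by rewrite mulrA mulfV ?mul1r.
  by rewrite h; rewrite !(rdBl, rdBr); lra.
have qg n : 0 <= q (g n) by apply: qf_ge0 hq _ _; exact: resolvent_dom (hn n) x.
apply: (@qf_lsc _ _ hq) => [n||n].
- exact: resolvent_dom (hn n) x.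
- have K0 : 0 <= K by apply: le_trans (hK 0%N); rewrite id addr_ge0 ?mulr_ge0.
  have lim0 : K * harmonic n @[n --> \oo] --> (0 : R).
    by rewrite -(mulr0 K); apply: cvgM; [exact: cvg_cst|exact: cvg_harmonic].
  apply/hcvgP => e e0; have e2 : 0 < e ^+ 2 by rewrite exprn_gt0.
  have /cvgrPdist_le /(_ _ e2) [N _ hN] := lim0; exists N => n Nn.
  apply: nrm_le; first exact: ltW.
  have := hN n Nn; rewrite /= sub0r normrN ger0_norm; last by rewrite mulr_ge0.
  apply: le_trans; rewrite ler_pdivlMr//.
  by have := hK n; have := qg n; rewrite id; lra.
- apply: le_trans (hK n); rewrite id; have := rd_ge0.
  by rewrite lerDl => h; rewrite mulr_ge0.
Qed.

Lemma rd_lim_eq (u u' v v' : nat -> H) x x' y y' : hcvg u x -> hcvg v y -> hcvg u' x' -> hcvg v' y' ->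
  (forall n, rd (u n) (v n) = rd (u' n) (v' n)) -> rd x y = rd x' y'.
Proof.
by move=> ux vy ux' vy' e; have c := hcvg_rd ux vy; rewrite (funext e) in c; exact: cvg_unique c (hcvg_rd ux' vy').
Qed.

Lemma rd_lim0 (u : nat -> H) x y : hcvg u x -> (forall n, rd (u n) y = 0) -> rd x y = 0.
Proof.
move=> ux h; rewrite -(rd0l y); apply: (rd_lim_eq ux (hcvg_cst y) (hcvg_cst 0) (hcvg_cst y)) => n.
by rewrite rd0l h.
Qed.

Lemma form_le_mono (a : nat -> H -> H) m n x : (forall n x, rd (a n x) x <= rd (a n.+1 x) x) ->
  (m <= n)%N -> rd (a m x) x <= rd (a n x) x.
Proof. by move=> h; move: m n; apply/(nondecreasing_seqP (fun n => rd (a n x) x)). Qed.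

(** The forms increase and are bounded at each vector, so their differences tend to 0; [form_bound]
    for [a n - a m] upgrades this to norm convergence at the vector. *)
Lemma monotone_limit (a : nat -> H -> H) K : (forall n, bop (a n)) -> (forall n, sa (a n)) ->
  (forall n, nonneg (a n)) -> (forall n x, rd (a n x) x <= rd (a n.+1 x) x) ->
  (forall n x, rd (a n x) x <= K * rd x x) ->
  exists b, [/\ bop b, sa b, nonneg b & forall x, hcvg (a^~ x) (b x)].
Proof.
move=> ba sa' na inc bnd.
wlog K0 : K bnd / 0 <= K.
  move=> /(_ `|K|); apply => // n x; apply: le_trans (bnd n x) _.
  by rewrite ler_wpM2r// ler_norm.
have mono m n x : (m <= n)%N -> rd (a m x) x <= rd (a n x) x.
  exact: form_le_mono.
have cv x : exists y, hcvg (a^~ x) y.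
  apply: hcomplete => e e0.
  have : cvgn (fun n => rd (a n x) x).
    apply: nondecreasing_is_cvgn; first by move=> m n; exact: mono.
    by exists (K * rd x x) => _ [n _ <-].
  pose d := e ^+ 2 / (K + 1).
  have d0 : 0 < d by rewrite divr_gt0 ?exprn_gt0// ltr_wpDl.
  have [N hN] : exists N, forall m n, (N <= m)%N -> (m <= n)%N -> rd (a n x) x - rd (a m x) x <= d.
    have : cvgn (fun n => rd (a n x) x).
      apply: nondecreasing_is_cvgn; first by move=> m n; exact: mono.
      by exists (K * rd x x) => _ [n _ <-].
    move=> /cvg_ex[s hs]; have d2 : 0 < d / 2 by rewrite divr_gt0.
    have /cvgrPdist_le /(_ _ d2) [N _ hN] := hs.
    exists N => m n Nm mn; have := hN m Nm; have := hN n (leq_trans Nm mn).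
    by rewrite !ler_norml => /andP[? ?] /andP[? ?]; lra.
  exists N => m n Nm Nn; wlog mn : m n Nm Nn / (m <= n)%N.
    move=> w; have /orP[mn|nm] := leq_total m n; first exact: w.
    by rewrite nrmBC; exact: w.
  apply: nrm_le; first exact: ltW.
  pose b z := a n z - a m z.
  have bb : bop b by exact: bop_sub.
  have sb : sa b by move=> z w; rewrite rdBl rdBr !sa'.
  have nb : nonneg b by move=> z; rewrite rdBl subr_ge0 mono.
  have bK z : rd (b z) z <= K * rd z z.
    by rewrite rdBl; have := bnd n z; have := na m z; lra.
  have := form_bound x bb sb nb bK.
  rewrite -opprB rdNl rdNr opprK => h; apply: le_trans h _.
  apply: le_trans (_ : K * d <= _); first by rewrite ler_wpM2l// rdBl hN.
  by rewrite mulrA ler_pdivrMr ?ltr_wpDl// mulrC ler_wpM2l ?sqr_ge0// lerDl.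
have [b hb] := choice cv; exists b; split=> //.
- apply: (bop_lim ba _ hb) => n x; exact: (@form_nrm _ _ _ K).
- by move=> x y; apply: (rd_lim_eq (hb x) (hcvg_cst y) (hcvg_cst x) (hb y)) => n; exact: sa'.
- move=> x; apply: (cvg_le_seq (cvg_cst 0) (hcvg_rd (hb x) (hcvg_cst x))) => n; exact: na.
Qed.

(** Lower semicontinuity comes from midpoint convexity alone: when [x] is within [2^-k] of [w N],
    extrapolating from [w N] through [x] by the factor [2^k] stays in a bounded set, and convexity
    returns the value there with weight [2^-k]. *)
Lemma bounded_qform q K : (forall x, 0 <= q x) ->
  (forall x y, q (x + y) + q (x - y) = 2 * q x + 2 * q y) ->
  (forall c x, q (rs c x) = c ^+ 2 * q x) -> (forall x, q (hi x) = q x) ->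
  (forall x, q x <= K * rd x x) -> qform setT q.
Proof.
move=> q0 qp qZ qi qK; split=> // w x L _ wx qL; split=> //.
have mid x1 h1 k : q (x1 + h1) <= (1 - 2 ^- k) * q x1 + 2 ^- k * q (x1 + rs (2 ^+ k) h1).
  elim: k h1 => [|k IH] h1; first by rewrite rs1; lra.
  have h2 : q (x1 + h1) <= (q x1 + q (x1 + rs 2 h1)) / 2.
    have := qp (rs 2^-1 x1) (rs 2^-1 (x1 + rs 2 h1)).
    rewrite -rsDr !qZ addrA -rsB.
    have -> : x1 + x1 + rs 2 h1 = rs 2 (x1 + h1) by rewrite rsDr !rs2.
    rewrite qZ; have := q0 (rs 2^-1 (x1 - (x1 + rs 2 h1))); lra.
  apply: le_trans h2 _; have := IH (rs 2 h1); rewrite rsA -exprSr => h3.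
  move: h3; rewrite exprS; lra.
have nb : exists B, 0 <= B /\ forall n, nrm (w n) <= B.
  have /hcvgP /(_ 1 ltr01) [N hN] := wx.
  pose B := nrm x + 1 + \sum_(i < N) nrm (w i); exists B; split.
    by rewrite !addr_ge0// sumr_ge0.
  move=> n; have [nN|Nn] := ltnP n N.
    rewrite /B (bigD1 (Ordinal nN))//= addrCA lerDl !addr_ge0// sumr_ge0//.
  apply: le_trans (_ : nrm x + 1 <= _); last by rewrite lerDl sumr_ge0.
  by have := hN n Nn; have := nrm_tri x (w n) 0; rewrite !subr0; lra.
have [B [B0 hB]] := nb.
pose C := `|K| * (B + 1) ^+ 2.
have hk k : q x <= L + 2 ^- k * C.
  have t0 : 0 < 2 ^- k :> R by rewrite invr_gt0.
  have /hcvgP /(_ _ t0) [N hN] := wx.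
  have := mid (w N) (x - w N) k; rewrite addrCA subrr addr0.
  have h1 : q (w N + rs (2 ^+ k) (x - w N)) <= C.
    apply: le_trans (qK _) _; set z := w N + _.
    apply: (@le_trans _ _ (`|K| * rd z z)); first by rewrite ler_wpM2r// ler_norm.
    rewrite ler_wpM2l// rdxx ler_sqr ?nnegrE ?addr_ge0//.
    apply: le_trans (nrmD _ _) _; rewrite lerD// nrmZ ger0_norm//.
    by rewrite -ler_pdivlMl// mulr1 nrmBC hN.
  have := qL; have := q0 => h3 h4 h5.
  apply: le_trans h5 _; rewrite lerD//; last rewrite ler_wpM2l//.
  apply: le_trans (_ : q (w N) <= _) => //; rewrite ler_piMl//.
have lim0 : L + 2 ^- k * C @[k --> \oo] --> L + 0 * C.
  apply: cvgD; first exact: cvg_cst.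
  apply: cvgM; last exact: cvg_cst.
  under eq_fun do rewrite -exprVn.
  by apply: cvg_expr; rewrite ger0_norm// invf_lt1// ltr1n.
rewrite mul0r addr0 in lim0.
exact: (cvg_le_seq (cvg_cst (q x)) lim0).
Qed.

(** Adding [K |x|^2] makes the form nonnegative. Its Yosida approximations are the forms of bounded
    operators and increase to it, so their strong limit represents it; no polarized form is ever
    constructed. *)
Lemma bounded_form_op q K :
  (forall x y, q (x + y) + q (x - y) = 2 * q x + 2 * q y) ->
  (forall c x, q (rs c x) = c ^+ 2 * q x) -> (forall x, q (hi x) = q x) ->
  (forall x, `|q x| <= K * rd x x) -> exists a, [/\ bop a, sa a & forall x, rd (a x) x = q x].
Proof.
move=> qp qZ qi qK.
pose q' x := q x + K * rd x x.
have hq : qform setT q'.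
  apply: (@bounded_qform _ (2 * K)) => [x|x y|c x|x|x]; rewrite /q'.
  - by have := qK x; rewrite ler_norml => /andP[? _]; lra.
  - have := qp x y; rewrite !(rdBl, rdBr, rdDl, rdDr); lra.
  - by rewrite qZ rdZl rdZr; ring.
  - by rewrite qi rdhi2.
  - by have := qK x; rewrite ler_norml => /andP[_]; lra.
have n0 n : 0 < n.+1%:R^-1 :> R by rewrite invr_gt0.
pose a n x := rs n.+1%:R (x - resolvent setT (fun z => n.+1%:R^-1 * q' z) x).
have bG n := resolvent_bop (qform_scale hq (n0 n)).
have sG n := resolvent_sa (qform_scale hq (n0 n)).
have ba n : bop (a n) by apply: bop_rs; apply: bop_sub => //; exact: bop_id.
have aE n x : rd (a n x) x = yosida setT q' n x.
  by rewrite rdZl.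
have ub n x : rd (a n x) x <= q' x.
  by rewrite aE; exact: yosida_leq.
have [||||b [bb sb _ ab]] := @monotone_limit a (2 * K) ba.
- by move=> n x y; rewrite rdZl rdZr rdBl rdBr sG.
- by move=> n x; rewrite aE mulr_ge0// rdBl subr_ge0; exact: resolvent_le (qform_scale hq (n0 n)) _.
- by move=> n x; rewrite !aE yosida_mono.
- move=> n x; apply: le_trans (ub n x) _; rewrite /q'.
  by have := qK x; rewrite ler_norml => /andP[_]; lra.
exists (fun x => b x - rs K x); split.
- by apply: bop_sub => //; apply: bop_rs; exact: bop_id.
- by move=> x y; rewrite rdBl rdBr rdZl rdZr sb.
move=> x; have cv := hcvg_rd (ab x) (hcvg_cst x).
suff> : rd (b x - rs K x) x = q' x - K * rd x x by rewrite /q'; lra.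
rewrite rdBl rdZl; congr (_ - _); apply/le_anti/andP; split.
  exact: (cvg_le_seq cv (cvg_cst _)) => n.
have [|_ //] := @yosida_lsc _ _ x (rd (b x) x) hq.
move=> n; rewrite -aE.
apply: (@cvg_le_seq _ (fun=> rd (a n x) x) (fun m => rd (a (n + m)%N x) x)); first exact: cvg_cst.
  by apply: (cvg_comp (fun m => (n + m)%N) (fun m => rd (a m x) x) _ cv); exact: cvg_addnl.
by move=> m; rewrite !aE yosida_mono// leq_addr.
Qed.

(** The real form of [u] is represented by a self-adjoint [a], which must be half the sum of [u] and
    its adjoint; hence the witness [2 a - u]. *)
Lemma adjoint_exists u : bop u -> exists b, bop b /\ forall x y, rd (u x) y = rd x (b y).
Proof.
move=> hu; have [K K0 hK] := bop_form_bnd hu.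
have [|||a [ba sa' ha]] := @bounded_form_op (fun x => rd (u x) x) K _ _ _ hK.
- by move=> x y; rewrite (bopD hu) (bopB hu) !(rdDl, rdDr, rdNl, rdNr); lra.
- by move=> c x; rewrite (boprs hu) rdZl rdZr; ring.
- by move=> x; rewrite (bophi hu) rdhi2.
exists (fun x => rs 2 (a x) - u x); split.
  by apply: bop_sub => //; exact: bop_rs.
move=> x y; rewrite rdBr rdZr -sa'.
have := ha (x + y); rewrite (bopD ba) (bopD hu) !rdDl !rdDr !ha (sa' y) (rdC y).
rewrite (rdC x); lra.
Qed.

Definition adj u : H -> H := xget u [set b | bop b /\ forall x y, rd (u x) y = rd x (b y)].

Lemma adjP u : bop u -> bop (adj u) /\ forall x y, rd (u x) y = rd x (adj u y).
Proof. by move=> /adjoint_exists [b hb]; exact: @xgetPex _ u [set b | bop b /\ forall x y, rd (u x) y = rd x (b y)] (ex_intro _ b hb). Qed.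

Lemma adj_bop u : bop u -> bop (adj u). Proof. by case/adjP. Qed.
Lemma adjr u x y : bop u -> rd (u x) y = rd x (adj u y). Proof. by case/adjP. Qed.
Lemma adjl u x y : bop u -> rd (adj u x) y = rd x (u y).
Proof. by move=> hu; rewrite rdC -adjr// rdC. Qed.

Lemma adj_unique u b : bop u -> (forall x y, rd (u x) y = rd x (b y)) -> adj u = b.
Proof.
move=> hu h; apply/funext => y; apply: rd_inj => z; rewrite rdC -adjr// h; exact: rdC.
Qed.

Lemma adjK u : bop u -> adj (adj u) = u.
Proof. by move=> hu; apply: adj_unique; [exact: adj_bop|move=> x y; rewrite adjl]. Qed.

Lemma adj_sa u : bop u -> sa u -> adj u = u.
Proof. by move=> hu; apply: adj_unique. Qed.

Lemma adj_nrm u K : bop u -> 0 <= K -> (forall x, nrm (u x) <= K * nrm x) ->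
  forall x, nrm (adj u x) <= K * nrm x.
Proof.
move=> hu K0 hK x; have [n0|n0] := eqVneq (nrm (adj u x)) 0; first by rewrite n0 mulr_ge0.
have p : 0 < nrm (adj u x) by rewrite lt_neqAle eq_sym n0 nrm_ge0.
rewrite -(ler_pM2r p) -expr2 -rdxx adjl//.
apply: le_trans (rd_le _ _) _; rewrite mulrC -mulrA [nrm x * _]mulrC mulrA.
by rewrite ler_wpM2r.
Qed.

Definition orthoproj a := [/\ bop a, sa a & forall x, a (a x) = a x].

Lemma orthoproj_rd a x y : orthoproj a -> rd (a x) (a y) = rd (a x) y.
Proof. by move=> [ba sa' ia]; rewrite -sa' ia. Qed.

Lemma orthoproj_nonneg a : orthoproj a -> nonneg a.
Proof. by move=> ha x; rewrite -orthoproj_rd. Qed.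

Lemma orthoproj_le a x : orthoproj a -> rd (a x) x <= rd x x.
Proof.
move=> ha; have := rd_ge0 (x - a x); rewrite !(rdBl, rdBr) orthoproj_rd// rdC; lra.
Qed.

Lemma orthoprojC a : orthoproj a -> orthoproj (fun x => x - a x).
Proof.
move=> [ba sa' ia]; split.
- by apply: bop_sub => //; exact: bop_id.
- by move=> x y; rewrite rdBl rdBr sa'.
- by move=> x; rewrite (bopB ba) ia subrr subr0.
Qed.

Definition hclosed (V : set H) := forall (w : nat -> H) x, (forall n, V (w n)) -> hcvg w x -> V x.

(** The resolvent of the form that vanishes on [V] minimizes the distance to [V], so it is the
    orthogonal projection once [V] is a closed subspace. *)
Definition proj (V : set H) : H -> H := resolvent V (fun=> 0).

Lemma proj_qform V : csub V -> hclosed V -> qform V (fun=> 0).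
Proof.
move=> hV cV; split=> // [x|c|w x K Vw wx /(_ 0%N)]; rewrite ?mulr0//.
by split=> //; exact: cV wx.
Qed.

Lemma projP V : csub V -> hclosed V -> [/\ orthoproj (proj V), forall x, V (proj V x),
  forall x, V x -> proj V x = x & forall x v, V v -> rd (x - proj V x) v = 0].
Proof.
move=> hV cV; have hq := proj_qform hV cV.
have o x v : V v -> rd (x - proj V x) v = 0.
  by move=> Vv; have := resolvent_polar hq x Vv; lra.
have m x : V (proj V x) by exact: resolvent_dom.
have i x : V x -> proj V x = x.
  move=> Vx; apply/esym/subr0_eq/rd_eq0; apply: o.
  exact: csubB.
split=> //; split; [exact: resolvent_bop|exact: resolvent_sa|].
by move=> x; apply: i.
Qed.

Lemma orthoproj_eq0 a x : orthoproj a -> rd (a x) x <= 0 -> a x = 0.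
Proof. by move=> ha h; apply: rd_eq0; apply/le_anti; rewrite rd_ge0 orthoproj_rd// h. Qed.

(* Spectral square root of a positive contraction, as [1 - X] where [X] is the
   increasing limit of [X' = (c + X^2)/2], [c = 1 - a]. *)
Inductive nnpoly (c : H -> H) : (H -> H) -> Prop :=
| nnpoly0 : nnpoly c (fun=> 0)
| nnpolyS t n b : 0 <= t -> nnpoly c b -> nnpoly c (fun x => rs t (iter n c x) + b x).

Section Sqrt.
Variable c : H -> H.
Hypotheses (bc : bop c) (sc : sa c) (nc : nonneg c) (c1 : forall x, rd (c x) x <= rd x x).

Let bit n : bop (iter n c).
Proof. by elim: n => [|n]; [exact: bop_id|exact: bop_comp]. Qed.

Let sit n : sa (iter n c).
Proof. by elim: n => [|n IH] x y //; rewrite [in RHS]iterSr sc IH. Qed.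

Lemma nnpoly_pos b : nnpoly c b -> [/\ bop b, sa b & nonneg b].
Proof.
elim=> [|t n d t0 _ [bd sd]].
  split; [exact: bop_zero|by move=> x y; rewrite rd0l rd0r|by move=> x; rewrite rd0l].
split.
- by apply: bop_add => //; exact: bop_rs.
- by move=> x y; rewrite rdDl rdDr rdZl rdZr sit sd.
move=> x; rewrite rdDl rdZl addr_ge0 ?mulr_ge0//.
rewrite -(odd_double_half n) addnC iterD; case: odd => /=.
  by rewrite -iterSr -addnn -addnS iterD sit iterS.
by rewrite -addnn iterD sit.
Qed.

Lemma nnpoly_add a b : nnpoly c a -> nnpoly c b -> nnpoly c (fun x => a x + b x).
Proof.
move=> ha hb; elim: ha => [|t n d t0 _ IH].
  by rewrite (_ : (fun => _) = b)//; apply/funext => x; rewrite add0r.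
rewrite (_ : (fun => _) = (fun x => rs t (iter n c x) + (d x + b x))); first exact: nnpolyS.
by apply/funext => x; rewrite addrA.
Qed.

Lemma nnpoly_scale s b : 0 <= s -> nnpoly c b -> nnpoly c (fun x => rs s (b x)).
Proof.
move=> s0; elim=> [|t n d t0 _ IH].
  by rewrite (_ : (fun => _) = fun=> 0)//; [exact: nnpoly0|apply/funext => x; rewrite rsr0].
rewrite (_ : (fun => _) = (fun x => rs (s * t) (iter n c x) + rs s (d x))); first by apply: nnpolyS; rewrite ?mulr_ge0.
by apply/funext => x; rewrite rsDr rsA.
Qed.

Lemma nnpoly_iter m b : nnpoly c b -> nnpoly c (fun x => b (iter m c x)).
Proof.
elim=> [|t n d t0 _ IH]; first exact: nnpoly0.
rewrite (_ : (fun => _) = (fun x => rs t (iter (n + m) c x) + d (iter m c x))); first exact: nnpolyS.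
by apply/funext => x; rewrite iterD.
Qed.

Lemma nnpoly_comp a b : nnpoly c a -> nnpoly c b -> nnpoly c (fun x => a (b x)).
Proof.
move=> ha; have [ba _ _] := nnpoly_pos ha; elim=> [|t n d t0 _ IH].
  by rewrite (bop0 ba); exact: nnpoly0.
rewrite (_ : (fun => _) = (fun x => rs t (a (iter n c x)) + a (d x))).
  by apply: nnpoly_add => //; apply: nnpoly_scale => //; exact: nnpoly_iter.
by apply/funext => x; rewrite (bopD ba) boprs.
Qed.

Fixpoint sqrt_iter n : H -> H :=
  if n is m.+1 then fun x => rs 2^-1 (c x + sqrt_iter m (sqrt_iter m x)) else fun=> 0.

Let half0 : 0 <= 2^-1 :> R. Proof. by rewrite invr_ge0. Qed.

Lemma nnpoly_c : nnpoly c c.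
Proof.
rewrite [X in _ X](_ : _ = (fun x => rs 1 (iter 1 c x) + 0)); first by apply: nnpolyS; [exact: ler01|exact: nnpoly0].
by apply/funext => x; rewrite rs1 addr0.
Qed.

(** Monotonicity of the iteration requires positive increments. They are polynomials in [c] with
    nonnegative coefficients, and such polynomials are positive because [c] is. *)
Lemma sqrt_iter_poly n : nnpoly c (sqrt_iter n) /\
  exists2 d, nnpoly c d & forall x, sqrt_iter n.+1 x = sqrt_iter n x + d x.
Proof.
elim: n => [|n [pn [d pd hd]]].
  split; first exact: nnpoly0.
  exists (fun x => rs 2^-1 (c x)); first exact: nnpoly_scale half0 nnpoly_c.
  by move=> x /=; rewrite addr0 add0r.
have [bn] := nnpoly_pos pn; have [bd] := nnpoly_pos pd.
have : nnpoly c (sqrt_iter n.+1).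
  by rewrite (_ : sqrt_iter _ = (fun x => sqrt_iter n x + d x)); [exact: nnpoly_add|exact/funext].
split=> //.
exists (fun x => rs 2^-1 (sqrt_iter n (d x) + (d (sqrt_iter n x) + d (d x)))).
  apply: nnpoly_scale => //; apply: nnpoly_add; first exact: nnpoly_comp.
  by apply: nnpoly_add; exact: nnpoly_comp.
move=> x; have e1 : sqrt_iter n.+2 x = rs 2^-1 (c x + sqrt_iter n.+1 (sqrt_iter n.+1 x)) by [].
have e2 : sqrt_iter n.+1 x = rs 2^-1 (c x + sqrt_iter n (sqrt_iter n x)) by [].
rewrite e1 [in RHS]e2 !hd -rsDr.
by rewrite (bopD bn) (bopD bd) -!addrA.
Qed.

Lemma sqrt_iter_nrm n x : nrm (sqrt_iter n x) <= nrm x.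
Proof.
elim: n x => [|n IH] x; first by rewrite nrm0.
rewrite nrmZ ger0_norm// ler_pdivrMl//; apply: le_trans (nrmD _ _) _.
have : nrm (c x) <= 1 * nrm x by apply: form_nrm => // z; rewrite mul1r.
have := IH (sqrt_iter n x); have := IH x; lra.
Qed.

End Sqrt.

Lemma sqrt_contraction a : bop a -> sa a -> nonneg a -> (forall x, rd (a x) x <= rd x x) ->
  exists b, [/\ bop b, sa b, nonneg b, forall x, b (b x) = a x &
    forall u, bop u -> (forall x, a (u x) = u (a x)) -> forall x, b (u x) = u (b x)].
Proof.
move=> ba sa' na a1; pose c x := x - a x.
have bc : bop c by apply: bop_sub => //; exact: bop_id.
have sc : sa c by move=> x y; rewrite rdBl rdBr sa'.
have nc : nonneg c by move=> x; rewrite rdBl subr_ge0.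
have c1 x : rd (c x) x <= rd x x by rewrite rdBl; have := na x; lra.
pose X := sqrt_iter c.
have pX n := proj1 (sqrt_iter_poly bc sc nc n).
have bX n : bop (X n) by have [] := nnpoly_pos bc sc nc (pX n).
have X1 n x : rd (X n x) x <= 1 * rd x x.
  apply: le_trans (rd_le _ _) _; rewrite mul1r rdxx ler_wpM2r//.
  exact: sqrt_iter_nrm.
have [|||Y [bY sY nY hY]] := @monotone_limit X 1 bX _ _ _ X1.
- by move=> n; have [] := nnpoly_pos bc sc nc (pX n).
- by move=> n; have [] := nnpoly_pos bc sc nc (pX n).
- move=> n x; have [_ [d pd hd]] := sqrt_iter_poly bc sc nc n.
  by rewrite /X hd rdDl lerDl; have [_] := nnpoly_pos bc sc nc pd.
have YY x : Y x = rs 2^-1 (c x + Y (Y x)).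
  apply: @hcvg_unique.
    exact: (@hcvg_sub _ _ (X^~ x)).
  apply: hcvgZ; apply: hcvgD; first exact: hcvg_cst.
  rewrite (_ : (fun => _) = (fun n => X n (X n x - Y x) + X n (Y x))); last first.
    by apply/funext => n; rewrite -(bopD (bX n)) subrK.
  rewrite -[Y (Y x)]add0r; apply: hcvgD => //.
  apply: (@hcvg_le _ _ (X^~ x) _ (Y x) _ 1) => // n.
  by rewrite subr0 mul1r; exact: sqrt_iter_nrm.
exists (fun x => x - Y x); split.
- by apply: bop_sub => //; exact: bop_id.
- by move=> x y; rewrite rdBl rdBr sY.
- move=> x; rewrite rdBl subr_ge0 -[rd x]mul1r.
  exact: (cvg_le_seq (hcvg_rd (hY x) (hcvg_cst x)) (cvg_cst _)) => n.
- move=> x; rewrite (bopB bY); have := YY => h.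
  have h2 : Y x + Y x = c x + Y (Y x).
    by rewrite {1 2}h -rsDl (_ : 2^-1 + 2^-1 = 1) ?rs1//; lra.
  apply: rd_inj => z; have := congr1 (fun t => rd t z) h2; rewrite !rdE; lra.
- move=> u bu au; have cu x : c (u x) = u (c x) by rewrite /c (bopB bu) au.
  have Xu n x : X n (u x) = u (X n x).
    elim: n x => [|n IH] x; first by rewrite bop0.
    by rewrite /= -/(X) cu !IH (boprs bu) (bopD bu).
  have Yu x : Y (u x) = u (Y x).
    apply: hcvg_unique (hY _) _; rewrite (_ : X^~ _ = u \o X^~ x); first exact: bop_cvg.
    exact/funext => n.
  by move=> x; rewrite Yu bopB.
Qed.

Lemma sqrt_exists a : bop a -> sa a -> nonneg a ->
  exists b, [/\ bop b, sa b, nonneg b, forall x, b (b x) = a x &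
    forall u, bop u -> (forall x, a (u x) = u (a x)) -> forall x, b (u x) = u (b x)].
Proof.
move=> ba sa' na; have [K K0 hK] := bop_form_bnd ba.
have K1 : 0 < K + 1 by rewrite ltr_wpDl.
pose a' x := rs (K + 1)^-1 (a x).
have [||||b [bb sb nb hb cb]] := @sqrt_contraction a'.
- exact: bop_rs.
- by move=> x y; rewrite rdZl rdZr sa'.
- by move=> x; rewrite rdZl mulr_ge0// invr_ge0 ltW.
- move=> x; rewrite rdZl mulrC ler_pdivrMr//.
  apply: le_trans (ler_norm _) _; apply: le_trans (hK x) _.
  by rewrite mulrC ler_wpM2l// lerDl.
exists (fun x => rs (Num.sqrt (K + 1)) (b x)); split.
- exact: bop_rs.
- by move=> x y; rewrite rdZl rdZr sb.
- by move=> x; rewrite rdZl mulr_ge0.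
- move=> x; rewrite (boprs bb) rsA -expr2 sqr_sqrtr ?ltW// hb rsA mulfV ?rs1//.
  by rewrite gt_eqF.
- by move=> u bu au x; rewrite cb ?boprs// => y; rewrite /a' au boprs.
Qed.

Lemma inv1p_exists a : bop a -> sa a -> nonneg a -> exists G, [/\ bop G, sa G, nonneg G,
  forall x, G x + a (G x) = x & forall x, G (x + a x) = x].
Proof.
move=> ba sa' na; have [K K0 hK] := bop_form_bnd ba.
have hq : qform setT (fun x => rd (a x) x).
  apply: @bounded_qform => //.
  - by move=> x y; rewrite (bopD ba) (bopB ba) !(rdDl, rdDr, rdNl, rdNr); lra.
  - by move=> t x; rewrite (boprs ba) rdZl rdZr; ring.
  - by move=> x; rewrite (bophi ba) rdhi2.
  - by move=> x; apply: le_trans (ler_norm _) (hK x).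
exists (resolvent setT (fun x => rd (a x) x)); split.
- exact: resolvent_bop.
- exact: resolvent_sa.
- exact: resolvent_nonneg.
- move=> l; apply: rd_inj => z; have := @resolvent_polar _ _ hq l z I.
  set g := resolvent; rewrite (bopD ba) !rdE (sa' z) (rdC z); lra.
- move=> x; apply: (resolvent_eq hq); split=> // v.
  rewrite (addrC x (a x)) addrK (bopD ba) !(rdDl, rdDr) (sa' v) (rdC v); lra.
Qed.

End QuadraticForms.

(** * Uniqueness of finite set functions on the line *)

Section SetFunctions.
Context {R : realType}.
Implicit Types (nu : set R -> R) (B C : set R).

(* Finite signed measures, in the form closed under linear combinations. *)
Definition dyn nu :=
  (forall B C, measurable B -> measurable C -> B `&` C = set0 -> nu (B `|` C) = nu B + nu C) /\
  (forall F : nat -> set R, (forall n, measurable (F n)) -> nondecreasing_seq F ->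
     nu (F n) @[n --> \oo] --> nu (\bigcup_n F n)).

Lemma dynD nu nu' : dyn nu -> dyn nu' -> dyn (fun B => nu B + nu' B).
Proof.
move=> [a c] [a' c']; split=> [B C mB mC BC|F mF ndF].
  by rewrite a// a'// addrACA.
by apply: cvgD; [exact: c|exact: c'].
Qed.

Lemma dynZ (k : R) nu : dyn nu -> dyn (fun B => k * nu B).
Proof.
move=> [a c]; split=> [B C mB mC BC|F mF ndF]; first by rewrite a// mulrDr.
by apply: cvgM; [exact: cvg_cst|exact: c].
Qed.

Lemma dynB nu nu' : dyn nu -> dyn nu' -> dyn (fun B => nu B - nu' B).
Proof.
move=> h /(dynZ) h'; rewrite (_ : (fun => _) = (fun B => nu B + -1 * nu' B)); first exact: dynD.
by apply/funext => B; rewrite mulN1r.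
Qed.

Lemma dynI nu C : measurable C -> dyn nu -> dyn (fun B => nu (B `&` C)).
Proof.
move=> mC [a c]; split=> [A B mA mB AB|F mF ndF].
  rewrite setIUl a//; [exact: measurableI|exact: measurableI|].
  by rewrite setIACA AB set0I.
rewrite setI_bigcupl; apply: c => [n|]; first exact: measurableI.
by move=> m n mn; apply/subsetPset; apply: setSI; apply/subsetPset/ndF.
Qed.

Lemma dyn_eq nu nu' : (forall B, measurable B -> nu B = nu' B) -> dyn nu -> dyn nu'.
Proof.
move=> e [a c]; split=> [A B mA mB AB|F mF ndF].
  by rewrite -!e ?a//; exact: measurableU.
rewrite -e; last exact: bigcupT_measurable.
by under eq_fun do rewrite -e//; exact: c.
Qed.

Lemma dyn0 nu : dyn nu -> nu set0 = 0.
Proof. by move=> [a]; have := a set0 set0 measurable0 measurable0 (setI0 _); rewrite setU0; lra. Qed.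

Definition ray (a : R) : set R := [set x | a < x].

Lemma rayE a : ray a = `]a, +oo[%classic.
Proof. by apply/seteqP; split=> x; rewrite /= in_itv andbT. Qed.

Lemma measurable_ray a : measurable (ray a).
Proof. by rewrite rayE. Qed.

Lemma rayI a b : ray a `&` ray b = ray (Num.max a b).
Proof. by apply/seteqP; split=> x; rewrite /ray /= gt_max => /andP. Qed.

Lemma ray_cover : \bigcup_n ray (- n%:R) = setT.
Proof.
apply/seteqP; split=> // x; exists (Num.truncn `|x|).+1 => //=.
rewrite /ray /= ltrNl.
by apply: le_lt_trans (truncnS_gt _); rewrite -normrN ler_norm.
Qed.

Lemma ray_ndseq : nondecreasing_seq (fun n => ray (- n%:R)).
Proof.
move=> m n mn; apply/subsetPset => x; apply: le_lt_trans.
by rewrite lerN2 ler_nat.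
Qed.

Lemma dyn_vanish nu : dyn nu -> (forall a, nu (ray a) = 0) ->
  forall B, measurable B -> nu B = 0.
Proof.
move=> h h0; have [ha hc] := h.
move=> B0 mB0.
have mB0' : <<s @measurable_realfun.RGenOInfty.G R >> B0.
  have <- : @measurable _ (measurableTypeR R) = <<s @measurable_realfun.RGenOInfty.G R >>.
    exact: measurable_realfun.RGenOInfty.measurableE.
  exact: mB0.
apply: (@dynkin_induction _ (measurableTypeR R) (@measurable_realfun.RGenOInfty.G R) [set B | nu B = 0]) mB0'.
- exact: measurable_realfun.RGenOInfty.measurableE.
- by move=> _ _ [a ->] [b ->]; exists (Num.max a b); rewrite -!rayE rayI.
- rewrite -ray_cover.
  have := hc _ (fun => measurable_ray _) ray_ndseq.
  rewrite (_ : (fun => _) = fun=> 0); last exact/funext => n.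
  by move=> hl; apply/esym; exact: cvg_unique (cvg_cst 0) hl.
- by move=> _ [a ->]; rewrite -rayE.
- move=> S mS /= S0; have := ha S (~` S) mS (measurableC mS) (setICr S).
  rewrite setUCr S0 add0r => <-.
  have := hc _ (fun => measurable_ray _) ray_ndseq; rewrite ray_cover.
  rewrite (_ : (fun => _) = fun=> 0); last exact/funext => n.
  by move=> hl; apply/esym; exact: cvg_unique (cvg_cst 0) hl.
- move=> F mF tF F0.
  pose U n := \big[setU/set0]_(i < n) F i.
  have mU n : measurable (U n) by apply: bigsetU_measurable.
  have U0 n : nu (U n) = 0.
    elim: n => [|n]; first by rewrite /U big_ord0 dyn0.
    rewrite /U big_ord_recr ha; [by have := F0; rewrite /= => ->; rewrite addr0|exact: mU|exact: mF|].
    apply/seteqP; split=> x []; rewrite -bigcup_mkord => -[i /= ltin Fi] Fn.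
    by have := tF i n I I (ex_intro _ x (conj Fi Fn)) => ein; rewrite ein ltnn in ltin.
  have ndU : nondecreasing_seq U.
    by move=> m n mn; apply/subsetPset; exact: subset_bigsetU.
  have := hc _ mU ndU; rewrite (_ : \bigcup_n U n = \bigcup_n F n); last first.
    apply/seteqP; split=> [x [n _]|x [n]].
      by rewrite /U -bigcup_mkord => -[i _]; exists i.
    by exists n.+1 => //; rewrite /U big_ord_recr; right.
  rewrite (_ : (fun => _) = fun=> 0); last exact/funext.
  by move=> hl; apply/esym; exact: cvg_unique (cvg_cst 0) hl.
Qed.

Lemma dyn_unique nu nu' : dyn nu -> dyn nu' -> (forall a, nu (ray a) = nu' (ray a)) ->
  forall B, measurable B -> nu B = nu' B.
Proof.
move=> h h' e B mB; apply: subr0_eq.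
by apply: (dyn_vanish (dynB h h')) => // a; rewrite e subrr.
Qed.

Lemma dyn_measure (m : {measure set (measurableTypeR R) -> \bar R}) : (m setT < +oo)%E ->
  dyn (fun B => fine (m B)).
Proof.
move=> mT.
have fin (B : set R) : measurable B -> m B \is a fin_num.
  move=> mB; rewrite ge0_fin_numE//; apply: le_lt_trans mT; apply: le_measure; rewrite ?inE//.
split=> [B C mB mC BC|F mF ndF].
  by rewrite measureU// fineD ?fin.
apply: fine_cvg; rewrite fineK; last by apply: fin; exact: bigcupT_measurable.
by apply: nondecreasing_cvg_mu => //; exact: bigcupT_measurable.
Qed.

End SetFunctions.

(** * Spectral projections of a positive contraction *)

Section Spectral.
Context {R : realType} {H : hilbertSpace R}.
Implicit Types (x y z : H) (u G : H -> H) (k c : R) (B C : set R) (f g : R -> R) (e : set R -> H -> H).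
Implicit Types (T A : set (H * H)) (D : set H).

(** Countable additivity is asked of the scalar set functions only, in the form [dyn]; strong
    convergence follows ([pvm_cvg]) because the values are projections. *)
Record pvm (e : set R -> H -> H) : Prop := Pvm {
  pvm_proj : forall B, measurable B -> orthoproj (e B);
  pvm_T : forall x, e setT x = x;
  pvm_I : forall B C x, measurable B -> measurable C -> e (B `&` C) x = e B (e C x);
  pvm_dyn : forall x, dyn (fun B => rd (e B x) x) }.

Lemma proj_commute (V : set H) u : csub V -> hclosed V -> bop u ->
  (forall x, V x -> V (u x)) -> (forall x, V x -> V (adj u x)) ->
  forall x, proj V (u x) = u (proj V x).
Proof.
move=> hV cV bu Vu Vu' x; have [[bP sP _] PV Pid Por] := projP hV cV.
have h : proj V (u (x - proj V x)) = 0.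
  apply: rd_inj => z; rewrite rd0l sP adjr//; exact/Por/Vu'/PV.
move: h; rewrite (bopB bu) (bopB bP) => /eqP; rewrite subr_eq0 => /eqP ->.
exact/Pid/Vu/PV.
Qed.

(* [slow G k] projects onto the kernel of the positive part of [G - k]. *)
Section Slow.
Variable G : H -> H.
Hypotheses (bG : bop G) (sG : sa G).

Let d k x := G x - rs k x.

Let bd k : bop (d k). Proof. by apply: bop_sub => //; apply: bop_rs; exact: bop_id. Qed.
Let sd k : sa (d k). Proof. by move=> x y; rewrite rdBl rdBr rdZl rdZr sG. Qed.

Let abspec k (b : H -> H) := [/\ bop b, sa b, nonneg b, forall x, b (b x) = d k (d k x) &
    forall u, bop u -> (forall x, d k (d k (u x)) = u (d k (d k x))) -> forall x, b (u x) = u (b x)].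

Let absd k : exists b, abspec k b.
Proof.
apply: @sqrt_exists; first exact: bop_comp.
- by move=> x y; rewrite !sd.
- by move=> x; rewrite sd.
Qed.

Let ab k : H -> H := xget G [set b | abspec k b].

Let abP k : abspec k (ab k).
Proof. by have [b hb] := absd k; exact: @xgetPex _ G [set b | abspec k b] (ex_intro _ b hb). Qed.

Let V k : set H := [set x | ab k x + d k x = 0].

Definition slow k : H -> H := proj (V k).

Let csV k : csub (V k).
Proof.
have [ba] := abP k; split; rewrite /V /=.
- by rewrite (bop0 ba) (bop0 (bd k)) addr0.
- by move=> x y hx hy; rewrite (bopD ba) (bopD (bd k)) addrACA hy addr0.
- by move=> c x hx; rewrite (boprs ba) (boprs (bd k)) -rsDr hx rsr0.
- by move=> x hx; rewrite (bophi ba) (bophi (bd k)) -hiD hx /hi scaler0.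
Qed.

Let clV k : hclosed (V k).
Proof.
move=> w x Vw wx; have [ba _ _ _ _] := abP k.
apply: (@hcvg_unique _ _ (fun n => ab k (w n) + d k (w n))).
  by apply: hcvgD; exact: bop_cvg.
by rewrite (_ : (fun => _) = fun=> 0); [exact: hcvg_cst|apply/funext => n; exact: Vw].
Qed.

Lemma slow_proj k : orthoproj (slow k).
Proof. by case: (projP (@csV k)). Qed.

Let slowV k x : V k (slow k x). Proof. by case: (projP (@csV k) (@clV k)) => _ /(_ x). Qed.
Let slow_id k x : V k x -> slow k x = x. Proof. by case: (projP (@csV k) (@clV k)) => _ _ /(_ x). Qed.

Let dcomm k u : bop u -> (forall x, G (u x) = u (G x)) -> forall x, d k (u x) = u (d k x).
Proof. by move=> bu Gu x; rewrite /d (bopB bu) Gu (boprs bu). Qed.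

Let abcomm k u : bop u -> (forall x, G (u x) = u (G x)) -> forall x, ab k (u x) = u (ab k x).
Proof.
move=> bu Gu; have [_ _ _ _] := abP k; apply=> // x.
by rewrite !(dcomm _ bu).
Qed.

Lemma slow_comm k u : bop u -> (forall x, G (u x) = u (G x)) -> forall x, slow k (u x) = u (slow k x).
Proof.
move=> bu Gu; have Gu' x : G (adj u x) = adj u (G x).
  by apply: rd_inj => z; rewrite sG !adjl// -Gu.
apply: proj_commute => //.
- by move=> x; rewrite /V /= (abcomm _ bu Gu) (dcomm _ bu Gu) -(bopD bu) => ->; exact: bop0.
- have bu' := adj_bop bu.
  by move=> x; rewrite /V /= (abcomm _ bu' Gu') (dcomm _ bu' Gu') -(bopD bu') => ->; exact: bop0.
Qed.

Lemma slow_le k x : slow k x = x -> rd (G x) x <= k * rd x x.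
Proof.
move=> <-; move: (slow k x) (slowV k x) => {}x; rewrite /V => Vx.
have [_ _ na] := abP k.
have : rd (ab k x) x + rd (d k x) x = 0 by rewrite -rdDl Vx rd0l.
have := na x; rewrite rdBl rdZl; lra.
Qed.

(** [ab k - d k] maps into [V k], since the two operators commute and have the same square. Where
    [slow k] vanishes one thus has [ab k x = d k x], and the assumed inequality forces
    [ab k x = 0]. *)
Lemma slow_gt k x : slow k x = 0 -> rd (G x) x <= k * rd x x -> x = 0.
Proof.
move=> Px xk; have [ba sab na a2 acm] := abP k.
have ad y : ab k (d k y) = d k (ab k y).
  by apply: abcomm => // z; rewrite (bopB bG) boprs.
have e : ab k x = d k x.
  apply/eqP; rewrite -subr_eq0; set z := _ - _.
  have Vz : V k z by rewrite /V /= /z (bopB ba) (bopB (bd k)) a2 ad addrA subrK subrr.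
  rewrite -(slow_id Vz).
  have [bP] := slow_proj k.
  have Gd y : G (d k y) = d k (G y) by rewrite (bopB bG) boprs.
  have Gab y : G (ab k y) = ab k (G y) by apply/esym/abcomm.
  by rewrite (bopB bP) (@slow_comm k _ ba Gab) (@slow_comm k _ (bd k) Gd) Px (bop0 ba) (bop0 (bd k)) subrr.
have ab0 : rd (ab k x) x <= 0 by rewrite e rdBl rdZl; lra.
have abx : ab k x = 0.
  have [K K0 hK] := bop_form_bnd ba.
  apply: rd_eq0; apply/le_anti; rewrite rd_ge0 andbT.
  apply: le_trans (form_bound x ba sab na _) _.
    by move=> y; apply: le_trans (ler_norm _) (hK y).
  by rewrite mulr_ge0_le0.
by rewrite -Px; apply/esym/slow_id; rewrite /V /= -e abx addr0.
Qed.

Let slow_self k x : G (slow k x) = slow k (G x).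
Proof. exact/esym/slow_comm. Qed.

Lemma slow_mono k k' x : k <= k' -> slow k' (slow k x) = slow k x.
Proof.
move=> kk; have [bP sP iP] := slow_proj k; have [bP' sP' iP'] := slow_proj k'.
apply/esym/subr0_eq; set y := _ - _.
have Py : slow k y = y.
  by rewrite (bopB bP) (@slow_comm k _ bP' (slow_self k')) iP.
apply: (@slow_gt k'); first by rewrite (bopB bP') iP' subrr.
by apply: le_trans (slow_le Py) _; rewrite ler_wpM2r.
Qed.

(** The part of [x] outside [slow k] satisfies the form bound for every [k' > k], hence for [k], and
    [slow_gt] kills it. This is what makes the functions [F x] right continuous. *)
Lemma slow_right k x : (forall k', k < k' -> slow k' x = x) -> slow k x = x.
Proof.
move=> h; have [bP sP iP] := slow_proj k.
apply/esym/subr0_eq; set y := _ - _.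
apply: (@slow_gt k); first by rewrite (bopB bP) iP subrr.
apply/ler_addgt0Pr => e e0.
have [bP' sP' iP'] := slow_proj (k + e / (rd y y + 1)).
have p0 : 0 < rd y y + 1 by rewrite ltr_wpDl.
have d0 : 0 < e / (rd y y + 1) by rewrite divr_gt0.
have Py : slow (k + e / (rd y y + 1)) y = y.
  have kk : k < k + e / (rd y y + 1) by rewrite ltrDl.
  by rewrite (bopB bP') slow_mono ?ltW// h.
apply: le_trans (slow_le Py) _; rewrite mulrDl lerD2l mulrAC ler_pdivrMr//.
by rewrite ler_wpM2l ?ltW// ltrDl.
Qed.

Hypotheses (nG : nonneg G) (G1 : forall x, rd (G x) x <= rd x x).

Lemma slow0 k x : k < 0 -> slow k x = 0.
Proof.
move=> k0; have [bP sP iP] := slow_proj k; apply: rd_eq0; apply/le_anti.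
have := slow_le (iP x); have := nG (slow k x) => h1 h2.
by rewrite rd_ge0 -(nmulr_rge0 _ k0) (le_trans h1).
Qed.

Lemma slow1 k x : 1 <= k -> slow k x = x.
Proof.
move=> k1; have [bP sP iP] := slow_proj k.
apply/esym/subr0_eq; apply: (@slow_gt k).
  by rewrite (bopB bP) iP subrr.
by apply: le_trans (G1 _) _; rewrite ler_peMl.
Qed.

Let F x k := rd (slow k x) x.

Let F_nd x : nondecreasing (F x).
Proof.
move=> k k' kk; have [_ sP'] := slow_proj k'.
have : rd (slow k' x) (slow k x) = rd (slow k x) x by rewrite sP' slow_mono// rdC.
have := rd_ge0 (slow k' x - slow k x); rewrite !rdE (rdC (slow k x)).
rewrite (orthoproj_rd _ _ (slow_proj k)) (orthoproj_rd _ _ (slow_proj k')); lra.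
Qed.

Let F_rc x : right_continuous (F x).
Proof.
move=> k; pose s n := k + n.+1%:R^-1.
have ks n : k < s n by rewrite ltrDl.
pose a n y := y - slow (s n) y.
have pa n : orthoproj (a n) by apply: orthoprojC; exact: slow_proj.
have [|||||b [bb sb nb hb]] := @monotone_limit _ _ a 1.
- by move=> n; case: (pa n).
- by move=> n; case: (pa n).
- by move=> n; apply: orthoproj_nonneg.
- move=> n y; rewrite !rdBl lerD2l lerN2; apply: F_nd.
  by rewrite lerD2l lef_pV2 ?posrE// ler_nat.
- by move=> n y; rewrite mul1r; apply: orthoproj_le.
have cv : hcvg (fun n => slow (s n) x) (x - b x).
  rewrite (_ : (fun => _) = fun n => x - a n x); last first.
    by apply/funext => n; rewrite opprB addrC subrK.
  by apply: hcvgB => //; exact: hcvg_cst.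
have e : slow k x = x - b x.
  have [bP _ _] := slow_proj k.
  rewrite -(@slow_right k (x - b x)) => [|k' kk'].
    apply: hcvg_unique (bop_cvg bP cv); rewrite (_ : _ \o _ = fun=> slow k x); first exact: hcvg_cst.
    apply/funext => n /=; rewrite (@slow_comm)//.
      by rewrite slow_mono// ltW.
    by case: (slow_proj (s n)).
  have [bP' _ _] := slow_proj k'.
  apply: hcvg_unique (bop_cvg bP' cv) _.
  have k'0 : 0 < k' - k by rewrite subr_gt0.
  have [N hN] := inv_small k'0.
  apply: (@hcvg_eqn _ _ (fun n => slow (s n) x)) => // n Nn /=.
  by rewrite slow_mono//; have := hN n Nn; rewrite -lerBrDl.
apply/cvgrPdist_le => eps eps0.
have /cvgrPdist_le /(_ _ eps0) [N _ hN] := hcvg_rd cv (hcvg_cst x).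
rewrite /at_right; near=> t.
have kt : k < t by near: t; exact: nbhs_right_gt.
have ts : t <= s N by near: t; apply: nbhs_right_le.
have := hN N (leqnn N) => /=; rewrite -e.
have := F_nd x (ltW kt); have := F_nd x ts.
by move=> h1 h2; rewrite !ler_norml => /andP[h3]; lra.
Unshelve. all: by end_near. Qed.

Let Fc x : cumulative R R := HB.pack (F x) (isCumulative.Build R _ R (F x) (@F_nd x) (@F_rc x)).

Let m x : {measure set (measurableTypeR R) -> \bar R} := lebesgue_stieltjes_measure (Fc x).

Let m_ray x a : m x (ray a) = (rd x x - F x a)%:E.
Proof.
have c : m x `]a, (a + n%:R)]%classic @[n --> \oo] --> m x (\bigcup_n `]a, (a + n%:R)]%classic).
  apply: nondecreasing_cvg_mu; [by move=> n|by apply: bigcupT_measurable => n|].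
  move=> i j ij; apply/subsetPset => z /=; rewrite !in_itv /= => /andP[-> /le_trans ->//].
  by rewrite lerD2l ler_nat.
have -> : ray a = \bigcup_n `]a, (a + n%:R)]%classic.
  apply/seteqP; split=> z.
    move=> az; exists (Num.truncn `|z - a|).+1 => //=.
    rewrite in_itv /= az /= addrC -lerBlDr ltW//.
    by apply: le_lt_trans (truncnS_gt _); rewrite ler_norm.
  by move=> [n _] /=; rewrite /= => /andP[].
have v n : m x `]a, (a + n%:R)]%classic = (F x (a + n%:R) - F x a)%:E.
  suff : lebesgue_stieltjes_measure (Fc x) `]a, (a + n%:R)]%classic = (F x (a + n%:R) - F x a)%:E by [].
  rewrite /lebesgue_stieltjes_measure /measure_extension measurable_mu_extE /=; last exact: is_ocitv.
  by rewrite wlength_itv_bnd// lerDl.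
apply: (cvg_unique _ c) => //.
apply: cvg_near_cst; near=> n; rewrite v.
rewrite /F slow1//; have : (Num.truncn `|1 - a|).+1%:R <= n%:R :> R.
  by rewrite ler_nat; near: n.
move=> h; rewrite addrC -lerBlDr; apply: le_trans h.
by rewrite ltW//; apply: le_lt_trans (truncnS_gt _); rewrite ler_norm.
Unshelve. all: by end_near. Qed.

Let m_T x : m x setT = (rd x x)%:E.
Proof.
have c := @nondecreasing_cvg_mu _ _ _ (m x) (fun n => ray (- n%:R)) (fun => measurable_ray _)
   (bigcupT_measurable _ (fun => measurable_ray _)) ray_ndseq.
rewrite ray_cover in c; apply: (cvg_unique _ c) => //.
apply: cvg_near_cst; near=> n; rewrite /= m_ray /F slow0 ?rd0l ?subr0//.
by rewrite oppr_lt0 ltr0n; near: n.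
Unshelve. all: by end_near. Qed.

Let mass x (B : set R) := fine (m x B).

Let mass_dyn x : dyn (mass x).
Proof. by apply: dyn_measure; apply: (@le_lt_trans _ _ (rd x x)%:E); [rewrite -m_T|exact: ltry]. Qed.

Let mass_ray x a : mass x (ray a) = rd (x - slow a x) x.
Proof. by rewrite /mass m_ray rdBl. Qed.

Let mass_ge0 x B : 0 <= mass x B. Proof. exact: fine_ge0. Qed.

Let mass_le x B : measurable B -> mass x B <= rd x x.
Proof.
move=> mB; have [ha] := mass_dyn x.
have := ha B (~` B) mB (measurableC mB) (setICr B); rewrite setUCr {1}/mass m_T /= => ->.
by rewrite lerDl.
Qed.

(** Each Stieltjes mass is quadratic in [x]: the parallelogram law and homogeneity hold on rays,
    where the masses come from operators, and [dyn_unique] carries them to all measurable [B]. A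
    bounded quadratic form is then represented by an operator. *)
Let e_exists B : exists a, measurable B -> [/\ bop a, sa a & forall x, rd (a x) x = mass x B].
Proof.
have [mB|] := pselect (measurable B); last by exists id.
have [|||x|a] := @bounded_form_op _ _ (fun x => mass x B) 1; last by exists a.
- move=> x y; apply: (@dyn_unique _ (fun B => mass (x + y) B + mass (x - y) B) (fun B => 2 * mass x B + 2 * mass y B)) => //.
  + exact: dynD.
  + by apply: dynD; apply: dynZ.
  + move=> a; rewrite !mass_ray; have [bP] := slow_proj a.
    by rewrite (bopD bP) (bopB bP) !rdE; lra.
- move=> c x; apply: (@dyn_unique _ (mass (rs c x)) (fun B => c ^+ 2 * mass x B)) => //; first exact: dynZ.
  move=> a; rewrite !mass_ray; have [bP sP _] := slow_proj a.
  by rewrite (boprs bP) -rsB rdZl rdZr; ring.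
- move=> x; apply: @dyn_unique => // a.
  rewrite !mass_ray; have [bP] := slow_proj a.
  by rewrite (bophi bP) -hiN -hiD rdhi2.
- by rewrite mul1r ger0_norm ?mass_le.
Qed.

Let e B : H -> H := xget G [set a | measurable B -> [/\ bop a, sa a & forall x, rd (a x) x = mass x B]].

Let eP B : measurable B -> [/\ bop (e B), sa (e B) & forall x, rd (e B x) x = mass x B].
Proof. by have [a ha] := e_exists B; exact: @xgetPex _ G [set a | measurable B -> [/\ bop a, sa a & forall x, rd (a x) x = mass x B]] (ex_intro _ a ha). Qed.

Let e_ray a x : e (ray a) x = x - slow a x.
Proof.
have mI := @measurable_ray R a.
have [b s h] := eP mI; have [bP sP] := orthoprojC (slow_proj a).
by rewrite (sa_eq b bP)// => y; rewrite h.
Qed.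

Let e_polar B x y : measurable B -> rd (e B x) y = 4^-1 * (mass (x + y) B - mass (x - y) B).
Proof.
move=> mB; have [b s h] := eP mB; rewrite -!h (bopD b) (bopB b) !rdE (s) rdC; lra.
Qed.

Let e_dyn2 x y : dyn (fun B => rd (e B x) y).
Proof.
apply: @dyn_eq.
  by move=> B mB; rewrite e_polar.
by apply: dynZ; exact: dynB.
Qed.

(** Two uniqueness arguments: first in [B] with [C] a ray, then in [C] with [B] arbitrary. *)
Let e_I B C x : measurable B -> measurable C -> e (B `&` C) x = e B (e C x).
Proof.
have st1 a (B' : set R) z : measurable B' -> e (B' `&` (ray a)) z = e B' (e (ray a) z).
  move=> mB; apply: rd_inj => y.
  apply: (@dyn_unique _ (fun B => rd (e (B `&` (ray a)) z) y) (fun B => rd (e B (e (ray a) z)) y)) => //.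
    exact: dynI (measurable_ray a) (e_dyn2 z y).
  move=> c; rewrite rayI !e_ray; have [bc] := slow_proj c; have [ba] := slow_proj a.
  rewrite (bopB bc); have [ac|ca] := leP.
    have -> : slow c (slow a z) = slow c z.
      by rewrite (@slow_comm)// slow_mono.
    by rewrite subrr subr0.
  by rewrite slow_mono ?ltW// opprB addrA subrK.
move=> mB mC; apply: rd_inj => y; have [bB sB _] := eP mB.
rewrite sB setIC.
apply: (@dyn_unique _ (fun C => rd (e (C `&` B) x) y) (fun C => rd (e C x) (e B y))) => //.
  exact: dynI mB (e_dyn2 x y).
by move=> a; rewrite setIC st1.
Qed.

Lemma pvm_exists : exists2 e, pvm e & forall a x, e (ray a) x = x - slow a x.
Proof.
exists e => //; split.
- move=> B mB; have [b] := eP mB; split=> // x; by rewrite -e_I// setIid.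
- move=> x; have [b s h] := eP (@measurableT _ R).
  by rewrite (sa_eq b (@bop_id _ _))// => y; rewrite h /mass m_T.
- by move=> B; exact: e_I.
- by move=> x.
Qed.

End Slow.

(** The numerical radius bounds the norm: polarize at [x + y] and [x - y], where [y] is [a x]
    rescaled to the length of [x]. *)
Lemma sa_nrm (a : H -> H) K x : bop a -> sa a -> (forall z, `|rd (a z) z| <= K * rd z z) ->
  nrm (a x) <= K * nrm x.
Proof.
move=> ba sa' hK.
have [x0|x0] := eqVneq (nrm x) 0; first by rewrite (nrm_eq0 x0) (bop0 ba) nrm0 mulr0.
have [a0|a0] := eqVneq (nrm (a x)) 0.
  rewrite a0; have := le_trans (normr_ge0 _) (hK x); rewrite rdxx mulrA pmulr_lge0//.
  by rewrite lt_neqAle eq_sym x0 nrm_ge0.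
have xp : 0 < nrm x by rewrite lt_neqAle eq_sym x0 nrm_ge0.
pose y := rs (nrm x / nrm (a x)) (a x).
have := hK (x + y); have := hK (x - y); rewrite !ler_norml => /andP[h1 h2] /andP[h3 h4].
have e : rd (a x) y = nrm x * nrm (a x).
  by rewrite rdZr rdxx; field.
have e2 : rd y y = nrm x ^+ 2.
  by rewrite rdZr rdZl rdxx; field.
move: h1 h4; rewrite !(bopD ba) !(bopN ba) !rdE (sa' y) (rdC y (a x)) e2 => h1 h4.
have : 4 * (nrm x * nrm (a x)) <= 4 * (nrm x * (K * nrm x)).
  have> : nrm x * (K * nrm x) = K * rd x x by rewrite rdxx; ring.
  lra.
by rewrite ler_pM2l// ler_pM2l.
Qed.

(** * Functional calculus for bounded measurable functions *)

Section Calculus.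
Variables (e : set R -> H -> H) (he : pvm e).

Lemma pvm_bop B : measurable B -> bop (e B). Proof. by move=> mB; case: (pvm_proj he mB). Qed.
Lemma pvm_sa B : measurable B -> sa (e B). Proof. by move=> mB; case: (pvm_proj he mB). Qed.
Lemma pvm_id B x : measurable B -> e B (e B x) = e B x.
Proof. by move=> mB; case: (pvm_proj he mB). Qed.

Lemma pvm_rd B x : measurable B -> rd (e B x) (e B x) = rd (e B x) x.
Proof. by move=> mB; rewrite (orthoproj_rd _ _ (pvm_proj he mB)). Qed.

Lemma pvm_comm B C x : measurable B -> measurable C -> e B (e C x) = e C (e B x).
Proof. by move=> mB mC; rewrite -!pvm_I// setIC. Qed.

Lemma pvm_U B C x : measurable B -> measurable C -> B `&` C = set0 -> e (B `|` C) x = e B x + e C x.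
Proof.
move=> mB mC BC; have mU := measurableU _ _ mB mC.
suff -> : e (B `|` C) = (fun x => e B x + e C x) by [].
apply: sa_eq; [exact: pvm_bop|by apply: bop_add; exact: pvm_bop|exact: pvm_sa| |].
  by move=> y z; rewrite rdDl rdDr !pvm_sa.
by move=> y; have [h] := pvm_dyn he y; rewrite h// rdDl.
Qed.

Lemma pvm0 x : e set0 x = 0.
Proof. by have := pvm_U x measurable0 measurable0 (setI0 _); rewrite setU0 -{1}[e]addr0 => /addrI. Qed.

Lemma pvm_C B x : measurable B -> e (~` B) x = x - e B x.
Proof.
move=> mB; have := pvm_U x mB (measurableC mB) (setICr B); rewrite setUCr (pvm_T he) => h.
by rewrite {2}h addrC addKr.
Qed.

Lemma pvm_D B C x : measurable B -> measurable C -> C `<=` B -> e (B `\` C) x = e B x - e C x.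
Proof.
move=> mB mC CB; have := pvm_U x mC (measurableD mB mC); rewrite setDIK => /(_ erefl).
by rewrite setDUK// => ->; rewrite addrC addKr.
Qed.

Lemma pvm_sub B C x : measurable B -> measurable C -> B `<=` C -> e C (e B x) = e B x.
Proof. by move=> mB mC BC; rewrite -pvm_I// setIC setIidl. Qed.

Lemma pvm_cvg (F : nat -> set R) x : (forall n, measurable (F n)) -> nondecreasing_seq F ->
  hcvg (fun n => e (F n) x) (e (\bigcup_n F n) x).
Proof.
move=> mF ndF; have mU : measurable (\bigcup_n F n) by exact: bigcupT_measurable.
have [_ hc] := pvm_dyn he x; have := hc _ mF ndF => h.
have h2 : rd (e (\bigcup_n F n) x) x - rd (e (F n) x) x @[n --> \oo] --> (0 : R).
  by rewrite -[X in _ --> X](subrr (rd (e (\bigcup_n F n) x) x)); apply: cvgB => //; exact: cvg_cst.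
apply/hcvgP => eps eps0; have e2 : 0 < eps ^+ 2 by rewrite exprn_gt0.
have /cvgrPdist_le /(_ _ e2) [N _ hN] := h2; exists N => n Nn.
rewrite nrmBC; apply: nrm_le; first exact: ltW.
have sub : F n `<=` \bigcup_n F n by move=> t; exists n.
rewrite -(pvm_D _ mU (mF n) sub) pvm_rd; last exact: measurableD.
rewrite (pvm_D _ mU (mF n) sub) rdBl.
by have := hN n Nn; rewrite sub0r normrN; apply: le_trans; exact: ler_norm.
Qed.

(** The spectral mass, with the proof of [pvm e] among its arguments so that a measure structure can
    be attached to the term. *)
Definition pmass x (_ : pvm e) : set R -> \bar R := spectral_mass e x.

Lemma pmassE x B : measurable B -> pmass x he B = (rd (e B x) x)%:E.
Proof. by move=> mB; rewrite /pmass /spectral_mass -rdxx pvm_rd. Qed.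

Let pmass0 x : pmass x he set0 = 0%E.
Proof. by rewrite pmassE// pvm0 rd0l. Qed.

Let pmass_ge0 x B : (0 <= pmass x he B)%E.
Proof. by rewrite lee_fin sqr_ge0. Qed.

Let pmass_sigma x : semi_sigma_additive (pmass x he).
Proof.
move=> F mF tF mUF.
pose U n := \big[setU/set0]_(i < n) F i.
have mU n : measurable (U n) by apply: bigsetU_measurable.
have UE n : \sum_(0 <= i < n) pmass x he (F i) = (rd (e (U n) x) x)%:E.
  rewrite big_mkord; elim: n => [|n IH]; first by rewrite big_ord0 /U big_ord0 pvm0 rd0l.
  have US : U n.+1 = U n `|` F n by rewrite /U big_ord_recr.
  rewrite US pvm_U; [|exact: mU|exact: mF|].
    by rewrite rdDl big_ord_recr IH pmassE.
  rewrite /U.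
  apply/seteqP; split=> t []; rewrite -bigcup_mkord => -[i /= ltin Fi] Fn.
  by have := tF i n I I (ex_intro _ t (conj Fi Fn)) => ein; rewrite ein ltnn in ltin.
have ndU : nondecreasing_seq U by move=> m n mn; apply/subsetPset; exact: subset_bigsetU.
have eU : \bigcup_n U n = \bigcup_n F n.
  apply/seteqP; split=> [t [n _]|t [n]].
    by rewrite /U -bigcup_mkord => -[i _]; exists i.
  by exists n.+1 => //; rewrite /U big_ord_recr; right.
rewrite pmassE// -eU; under eq_fun do rewrite UE.
apply: cvg_EFin; first exact: nearW.
by have [_ hc] := pvm_dyn he x; exact: hc.
Qed.

HB.instance Definition _ x := isMeasure.Build _ _ _ (pmass x he) (pmass0 x) (pmass_ge0 x) (@pmass_sigma x).

Let pm x : {measure set R -> \bar R} := pmass x he.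

Lemma pmassT x : pm x setT = (rd x x)%:E.
Proof. by have := pmassE x measurableT; rewrite pvm_T. Qed.

Definition bfun f := measurable_fun setT f /\ exists K, forall l, `|f l| <= K.

Definition pint x f : R := fine (\int[pmass x he]_l (f l)%:E)%E.

Lemma bfun_integrable x f : bfun f -> (pm x).-integrable setT (EFin \o f).
Proof.
move=> [mf [K hK]]; apply: measurable_bounded_integrable => //.
  by rewrite pmassT ltry.
exists `|K|; split=> // M KM l _; apply: le_trans (hK l) _.
by apply: le_trans (ltW KM); exact: ler_norm.
Qed.

Lemma bfunD f g : bfun f -> bfun g -> bfun (fun l => f l + g l).
Proof.
move=> [mf [K hK]] [mg [L]]; split; first exact: measurable_funD.
by exists (K + L) => l; apply: le_trans (ler_normD _ _) _; exact: lerD.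
Qed.

Lemma bfunZ c f : bfun f -> bfun (fun l => c * f l).
Proof.
move=> [mf [K]]; split; first exact: measurable_funM.
by exists (`|c| * K) => l; rewrite normrM ler_wpM2l.
Qed.

Lemma bfunB f g : bfun f -> bfun g -> bfun (fun l => f l - g l).
Proof.
move=> [mf [K hK]] [mg [L]]; split; first exact: measurable_funB.
by exists (K + L) => l; apply: le_trans (ler_normB _ _) _; exact: lerD.
Qed.

Lemma bfunM f g : bfun f -> bfun g -> bfun (fun l => f l * g l).
Proof.
move=> [mf [K hK]] [mg [L]]; split; first exact: measurable_funM.
by exists (K * L) => l; rewrite normrM ler_pM.
Qed.

Lemma bfun_cst c : bfun (fun=> c).
Proof. by split; [exact: measurable_cst|exists `|c|]. Qed.

Lemma bfun_indic B : measurable B -> bfun (\1_B : R -> R).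
Proof.
move=> mB; split; first exact: measurable_indic.
by exists 1 => l; rewrite indicE; case: (l \in B) => /=; rewrite ?normr1 ?normr0.
Qed.

Lemma pintD x f g : bfun f -> bfun g -> pint x (fun l => f l + g l) = pint x f + pint x g.
Proof. by move=> bf bg; apply: RintegralD => //; exact: bfun_integrable. Qed.

Lemma pintZ x c f : bfun f -> pint x (fun l => c * f l) = c * pint x f.
Proof. by move=> bf; apply: RintegralZl => //; exact: bfun_integrable. Qed.

Lemma le_pint x f g : bfun f -> bfun g -> (forall l, f l <= g l) -> pint x f <= pint x g.
Proof. by move=> bf bg fg; apply: le_Rintegral => //; exact: bfun_integrable. Qed.

Lemma pint_indic x B : measurable B -> pint x \1_B = rd (e B x) x.
Proof.
move=> mB; rewrite /pint integral_indic// setIT.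
by rewrite [X in fine X]pmassE.
Qed.

Lemma pint_cst x c : pint x (fun=> c) = c * rd x x.
Proof.
rewrite (_ : (fun=> c) = (fun l => c * \1_(setT : set R) l)); last first.
  by apply/funext => l; rewrite indicE in_setT mulr1.
by rewrite pintZ ?pint_indic ?pvm_T//; exact: bfun_indic.
Qed.

Definition sfun := seq (R * set R).
Definition smeas (s : sfun) := forall p, List.In p s -> measurable p.2.
Definition sval (s : sfun) (l : R) : R := foldr (fun p v => p.1 * \1_(p.2) l + v) 0 s.
Definition sop (s : sfun) x : H := foldr (fun p v => rs p.1 (e p.2 x) + v) 0 s.

Lemma sop_bop s : smeas s -> [/\ bop (sop s), sa (sop s) & bfun (sval s)].
Proof.
elim: s => [|p s IH] ms.
  split; [exact: bop_zero|by move=> x y; rewrite rd0l rd0r|exact: bfun_cst].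
have : measurable p.2 by apply: ms; left.
have [|b s'] := IH; first by move=> r hr; apply: ms; right.
split.
- by apply: bop_add => //; apply: bop_rs; exact: pvm_bop.
- by move=> x y; rewrite rdDl rdDr rdZl rdZr pvm_sa// s'.
- by apply: bfunD => //; apply: bfunZ; exact: bfun_indic.
Qed.

Lemma sop_pint s x : smeas s -> pint x (sval s) = rd (sop s x) x.
Proof.
elim: s => [|p s IH] ms; first by rewrite rd0l pint_cst mul0r.
have mp : measurable p.2 by apply: ms; left.
have ms' : smeas s by move=> r hr; apply: ms; right.
have [_ _ bs] := sop_bop ms'.
rewrite rdDl rdZl -IH// -pint_indic//.
rewrite(pintD x (bfunZ p.1 (bfun_indic mp)) bs).
by rewrite pintZ//; exact: bfun_indic.
Qed.

Lemma sop_comm s u : smeas s -> bop u -> (forall B x, measurable B -> e B (u x) = u (e B x)) ->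
  forall x, sop s (u x) = u (sop s x).
Proof.
move=> ms bu eu x; elim: s ms => [|p s IH] ms; first by rewrite bop0.
have mp : measurable p.2 by apply: ms; left.
rewrite /= (bopD bu) (boprs bu) eu// IH//.
by move=> r hr; apply: ms; right.
Qed.

Definition smul1 (p : R * set R) (s : sfun) : sfun := [seq (p.1 * r.1, p.2 `&` r.2) | r <- s].
Definition smul (s t : sfun) : sfun := foldr (fun p v => smul1 p t ++ v) [::] s.

Lemma smeas_cat s t : smeas s -> smeas t -> smeas (s ++ t).
Proof. by move=> ms mt p hp; case: (List.in_app_or _ _ _ hp) => [/ms|/mt]. Qed.

Lemma smul1P p t : measurable p.2 -> smeas t -> [/\ smeas (smul1 p t),
  forall l, sval (smul1 p t) l = p.1 * \1_(p.2) l * sval t l &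
  forall x, sop (smul1 p t) x = rs p.1 (e p.2 (sop t x))].
Proof.
move=> mp; elim: t => [|r t IH] mt.
  by split=> // [l|x]; rewrite ?mulr0// (bop0 (pvm_bop mp)) rsr0.
have : measurable r.2 by apply: mt; left.
have [|m v o] := IH; first by move=> w hw; apply: mt; right.
split.
- by move=> w [<-|/m//]; exact: measurableI.
- by move=> l; rewrite /= v indicI /=; ring.
- by move=> x; rewrite /= o (bopD (pvm_bop mp)) (boprs (pvm_bop mp)) rsDr rsA pvm_I.
Qed.

Lemma smulP s t : smeas s -> smeas t -> [/\ smeas (smul s t),
  forall l, sval (smul s t) l = sval s l * sval t l &
  forall x, sop (smul s t) x = sop s (sop t x)].
Proof.
move=> ms mt; elim: s ms => [|p s IH] ms.
  by split=> // l; rewrite mul0r.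
have mp : measurable p.2 by apply: ms; left.
have [|m v o] := IH; first by move=> w hw; apply: ms; right.
have [m1 v1 o1] := smul1P mp mt.
have vcat s1 s2 l : sval (s1 ++ s2) l = sval s1 l + sval s2 l.
  by elim: s1 => [|w s1 IH1] /=; rewrite ?add0r// IH1 addrA.
have ocat s1 s2 x : sop (s1 ++ s2) x = sop s1 x + sop s2 x.
  by elim: s1 => [|w s1 IH1] /=; rewrite ?add0r// IH1 addrA.
split.
- exact: smeas_cat.
- by move=> l; rewrite vcat v1 v mulrDl.
- by move=> x; rewrite ocat o1 o.
Qed.

(** The simple function is stacked from superlevel sets of [f] in steps of [eps], starting at [-K],
    which avoids handling partitions. *)
Lemma sfun_approx f eps : bfun f -> 0 < eps ->
  exists2 s, smeas s & forall l, `|f l - sval s l| <= eps.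
Proof.
move=> [mf [K hK]] e0.
pose B i := [set l | - K + i.+1%:R * eps <= f l].
have mB i : measurable (B i).
  rewrite (_ : B i = setT `&` f @^-1` `[(- K + i.+1%:R * eps), +oo[%classic).
    by apply: mf => //.
  by rewrite setTI; apply/seteqP; split=> l; rewrite /= in_itv andbT.
pose st n : sfun := rcons [seq (eps, B i) | i <- iota 0 n] (- K, setT).
have mst n : smeas (st n).
  rewrite /st -cats1; apply: smeas_cat; last by move=> p [<-|[]] /=.
  elim: iota => [|i r IH] p //= [<-|]; [exact: mB|exact: IH].
have vst n l : sval (st n) l = - K + eps * \sum_(i < n) \1_(B i) l.
  rewrite /st -(big_mkord xpredT (fun i => \1_(B i) l)) /index_iota subn0.
  elim: iota => [|i r IH]; first by rewrite /= big_nil indicE in_setT !mulr1 mulr0.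
  by rewrite /= IH big_cons; ring.
have key n l : f l <= - K + n.+1%:R * eps -> `|f l - sval (st n) l| <= eps.
  rewrite vst; elim: n => [|n IH] h.
    rewrite big_ord0; have := hK l; rewrite ler_norml => /andP[h1].
    by rewrite ger0_norm; lra.
  have [g|g] := leP (- K + n.+1%:R * eps) (f l).
    have -> : \sum_(i < n.+1) \1_(B i) l = n.+1%:R :> R.
      rewrite -[RHS]mulr_natl -[n.+1 in RHS]card_ord mulr_natl -sumr_const; apply: eq_bigr => i.
      rewrite indicE mem_set//= /B; apply: le_trans g.
      by rewrite lerD2l ler_pM2r// ler_nat.
    rewrite ger0_norm; first by move: h; lra.
    by move: g; lra.
  rewrite big_ord_recr /= [\1_(B n) l]indicE memNset ?addr0; last first.
    by rewrite /B => h3; move: g; rewrite ltNge h3.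
  by apply: IH; exact: ltW.
pose n := Num.truncn ((K + K) / eps); exists (st n) => // l; apply: key.
have := hK l; rewrite ler_norml => /andP[h1].
have : (K + K) / eps <= n.+1%:R by rewrite ltW// truncnS_gt.
by rewrite ler_pdivrMr; lra.
Qed.

Lemma pint_dist x f g eps : bfun f -> bfun g -> (forall l, `|f l - g l| <= eps) ->
  `|pint x f - pint x g| <= eps * rd x x.
Proof.
move=> bf bg fg; rewrite -pint_cst ler_norml.
have h1 : pint x f <= pint x (fun=> eps) + pint x g.
  rewrite -pintD//; last exact: bfun_cst.
  apply: le_pint => //; first by apply: bfunD => //; exact: bfun_cst.
  by move=> l; have := fg l; rewrite ler_norml => /andP[]; lra.
have h2 : pint x g <= pint x (fun=> eps) + pint x f.
  rewrite -pintD//; last exact: bfun_cst.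
  apply: le_pint => //; first by apply: bfunD => //; exact: bfun_cst.
  by move=> l; have := fg l; rewrite ler_norml => /andP[]; lra.
by apply/andP; lra.
Qed.

(** Uniformly close simple functions have operators close in norm, by [sa_nrm] on the difference, so
    the approximating operators converge. *)
Lemma Phi_exists f : bfun f -> exists a, [/\ bop a, sa a & forall x, rd (a x) x = pint x f].
Proof.
move=> bf.
have hch : forall n : nat, exists s : sfun, smeas s /\ forall l, `|f l - sval s l| <= n.+1%:R^-1.
  by move=> n; have [|s ms hs] := @sfun_approx f n.+1%:R^-1 bf; [rewrite invr_gt0|exists s].
have [s hs] := choice hch.
have ms n : smeas (s n) by case: (hs n).
have bs n : bop (sop (s n)) by case: (sop_bop (ms n)).
have ss n : sa (sop (s n)) by case: (sop_bop (ms n)).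
have fs n : bfun (sval (s n)) by case: (sop_bop (ms n)).
have dist n m x : nrm (sop (s n) x - sop (s m) x) <= (n.+1%:R^-1 + m.+1%:R^-1) * nrm x.
  apply: (@sa_nrm (fun x => sop (s n) x - sop (s m) x)).
  - exact: bop_sub.
  - by move=> y z; rewrite rdBl rdBr !ss.
  - move=> z; rewrite rdBl -!sop_pint//; apply: pint_dist => // l.
    have [_ h1] := hs n; have [_ h2] := hs m.
    have -> : sval (s n) l - sval (s m) l = (f l - sval (s m) l) - (f l - sval (s n) l) by ring.
    by apply: le_trans (ler_normB _ _) _; rewrite addrC lerD.
have cv x : exists y, hcvg (fun n => sop (s n) x) y.
  apply: hcomplete => eps eps0.
  have d0 : 0 < eps / (2 * (nrm x + 1)) by rewrite divr_gt0// mulr_gt0// ltr_wpDl.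
  have [N hN] := inv_small d0.
  exists N => m n Nm Nn; apply: le_trans (dist m n x) _.
  have := hN m Nm; have := hN n Nn; move: (m.+1%:R^-1) (n.+1%:R^-1) => a b ha hb.
  apply: (@le_trans _ _ (eps / (2 * (nrm x + 1)) * 2 * nrm x)); first by rewrite ler_wpM2r//; lra.
  have p0 : 0 < nrm x + 1 by rewrite ltr_wpDl.
  have -> : eps / (2 * (nrm x + 1)) * 2 * nrm x = eps * (nrm x / (nrm x + 1)) by field; rewrite gt_eqF.
  by rewrite ler_piMr ?ltW// ltr_pdivrMr// mul1r ltrDl.
have [a ha] := choice cv; exists a.
have bnd n x : nrm (sop (s n) x - a x) <= n.+1%:R^-1 * nrm x.
  have h1 : nrm (sop (s n) x - sop (s m) x) @[m --> \oo] --> nrm (sop (s n) x - a x).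
    by apply: hcvg_nrm; apply: hcvgB => //; exact: hcvg_cst.
  have h2 : (n.+1%:R^-1 + m.+1%:R^-1) * nrm x @[m --> \oo] --> (n.+1%:R^-1 + 0) * nrm x.
    by apply: cvgM; [apply: cvgD; [exact: cvg_cst|exact: cvg_harmonic]|exact: cvg_cst].
  by rewrite addr0 in h2; exact: (cvg_le_seq h1 h2).
have [K K0 hK] := bop_bnd (bs 0%N).
have ba : bop a.
  apply: (bop_lim bs _ ha (K := 2 + K)) => n x.
  have -> : sop (s n) x = (sop (s n) x - sop (s 0%N) x) + sop (s 0%N) x by rewrite subrK.
  apply: le_trans (nrmD _ _) _; rewrite mulrDl lerD//.
  apply: le_trans (dist n 0%N x) _; rewrite ler_wpM2r//.
  have : n.+1%:R^-1 <= 1 :> R by rewrite invf_le1// ler1n.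
  by move: n.+1%:R^-1 => t; lra.
split=> //.
  by move=> x y; apply: (rd_lim_eq (ha x) (hcvg_cst y) (hcvg_cst x) (ha y)) => n; exact: ss.
move=> x; have h1 := hcvg_rd (ha x) (hcvg_cst x).
apply: cvg_unique h1 _ => //.
have hz : harmonic n * rd x x @[n --> \oo] --> (0 : R).
  by rewrite -(mul0r (rd x x)); apply: cvgM; [exact: cvg_harmonic|exact: cvg_cst].
apply/subr_cvg0; apply/norm_cvg0P; apply: (squeeze_cvgr _ (cvg_cst 0) hz); apply: nearW => n.
rewrite normr_ge0 /= -sop_pint// distrC; apply: pint_dist => //.
by have [_] := hs n.
Qed.

Definition Phi f : H -> H := xget (id : H -> H) [set a : H -> H | [/\ bop a, sa a & forall x, rd (a x) x = pint x f]].

Lemma PhiP f : bfun f -> [/\ bop (Phi f), sa (Phi f) & forall x, rd (Phi f x) x = pint x f].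
Proof. by move=> /Phi_exists [a ha]; exact: @xgetPex _ (id : H -> H) [set a : H -> H | [/\ bop a, sa a & forall x, rd (a x) x = pint x f]] (ex_intro _ a ha). Qed.

Lemma Phi_bop f : bfun f -> bop (Phi f). Proof. by case/PhiP. Qed.
Lemma Phi_sa f : bfun f -> sa (Phi f). Proof. by case/PhiP. Qed.
Lemma Phi_rd f x : bfun f -> rd (Phi f x) x = pint x f. Proof. by case/PhiP. Qed.

Lemma Phi_unique f a : bfun f -> bop a -> sa a -> (forall x, rd (a x) x = pint x f) -> Phi f = a.
Proof. by move=> /PhiP[b s h] ba sa' ha; apply: sa_eq => // x; rewrite h. Qed.

Lemma Phi_sop s : smeas s -> Phi (sval s) = sop s.
Proof. by move=> ms; have [b s' f] := sop_bop ms; apply: Phi_unique => // x; rewrite sop_pint. Qed.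

Lemma Phi_indic B : measurable B -> Phi \1_B = e B.
Proof.
move=> mB; apply: Phi_unique; [exact: bfun_indic|exact: pvm_bop|exact: pvm_sa|].
by move=> x; rewrite pint_indic.
Qed.

Lemma PhiD f g x : bfun f -> bfun g -> Phi (fun l => f l + g l) x = Phi f x + Phi g x.
Proof.
move=> bf bg; have [b s h] := PhiP bf; have [b' s' h'] := PhiP bg.
rewrite (Phi_unique (a := fun x => Phi f x + Phi g x))//; [exact: bfunD|exact: bop_add| |].
  by move=> y z; rewrite rdDl rdDr s s'.
by move=> y; rewrite rdDl h h' pintD.
Qed.

Lemma PhiZ c f x : bfun f -> Phi (fun l => c * f l) x = rs c (Phi f x).
Proof.
move=> bf; have [b s h] := PhiP bf.
rewrite (Phi_unique (a := fun x => rs c (Phi f x)))//; [exact: bfunZ|exact: bop_rs| |].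
  by move=> y z; rewrite rdZl rdZr s.
by move=> y; rewrite rdZl h pintZ.
Qed.

Lemma PhiB f g x : bfun f -> bfun g -> Phi (fun l => f l - g l) x = Phi f x - Phi g x.
Proof.
move=> bf bg; have [b s h] := PhiP bf; have [b' s' h'] := PhiP bg.
rewrite (Phi_unique (a := fun x => Phi f x - Phi g x))//; [exact: bfunB|exact: bop_sub| |].
  by move=> y z; rewrite rdBl rdBr s s'.
move=> y; rewrite rdBl h h'.
have -> : (fun l => f l - g l) = (fun l => f l + (-1) * g l) by apply/funext => l; rewrite mulN1r.
by rewrite pintD ?pintZ ?mulN1r//; exact: bfunZ.
Qed.

Lemma Phi_cst c x : Phi (fun=> c) x = rs c x.
Proof.
rewrite (Phi_unique (a := rs c))//; [exact: bfun_cst|exact: (bop_rs c (@bop_id _ _))| |].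
  by move=> y z; rewrite rdZl rdZr.
by move=> y; rewrite pint_cst rdZl.
Qed.

Lemma Phi_dist f g x eps : bfun f -> bfun g -> (forall l, `|f l - g l| <= eps) ->
  nrm (Phi f x - Phi g x) <= eps * nrm x.
Proof.
move=> bf bg fg; have [b s h] := PhiP bf; have [b' s' h'] := PhiP bg.
apply: (@sa_nrm (fun x => Phi f x - Phi g x)); first exact: bop_sub.
  by move=> y z; rewrite rdBl rdBr s s'.
by move=> z; rewrite rdBl h h'; exact: pint_dist.
Qed.

Lemma Phi_le f x K : bfun f -> (forall l, `|f l| <= K) -> nrm (Phi f x) <= K * nrm x.
Proof.
move=> bf fK; rewrite -[Phi]subr0.
have := @Phi_dist f (fun=> 0) x K bf (bfun_cst 0); rewrite Phi_cst rs0; apply=> l.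
by rewrite subr0.
Qed.

Lemma Phi_mono f g x : bfun f -> bfun g -> (forall l, f l <= g l) -> rd (Phi f x) x <= rd (Phi g x) x.
Proof. by move=> bf bg; rewrite !Phi_rd//; exact: le_pint. Qed.

Lemma Phi_nonneg f : bfun f -> (forall l, 0 <= f l) -> nonneg (Phi f).
Proof.
move=> bf f0 x; have := @Phi_mono (fun=> 0) f x (bfun_cst 0) bf f0.
by rewrite Phi_cst rs0 rd0l.
Qed.

Lemma nrm_eps0 x K : 0 <= K -> (forall eps, 0 < eps -> nrm x <= eps * K) -> x = 0.
Proof.
move=> K0 h; apply: nrm_eq0; apply/le_anti; rewrite nrm_ge0 andbT.
apply/ler_addgt0Pr => eps eps0; rewrite add0r.
have K1 : 0 < K + 1 by rewrite ltr_wpDl.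
apply: le_trans (h (eps / (K + 1)) _) _; first by rewrite divr_gt0.
by rewrite mulrAC ler_pdivrMr// ler_wpM2l ?ltW// ltrDl.
Qed.

Lemma Phi_mul f g x : bfun f -> bfun g -> Phi (fun l => f l * g l) x = Phi f (Phi g x).
Proof.
move=> bf bg; have [_ [K hK]] := bf; have [_ [L hL]] := bg.
have K0 : 0 <= K by apply: le_trans (hK 0).
have L0 : 0 <= L by apply: le_trans (hL 0).
apply: subr0_eq.
apply: (@nrm_eps0 _ ((2 * (K + L + 1)) * nrm x)); first by rewrite !mulr_ge0 ?addr_ge0.
move=> eps' eps'0.
(* With [eps <= 1] the approximant of [g] is bounded by [L + 1], a bound that does not depend on
   [eps]. *)
wlog [eps0 eps1] : / exists eps, [/\ 0 < eps, eps <= 1 & eps <= eps'].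
  by apply; exists (Num.min 1 eps'); rewrite lt_min ge_min ltr01 lexx /= ge_min lexx orbT.
move: eps1 => [e0 e1 ee]; apply: (@le_trans _ _ (eps0 * (2 * (K + L + 1) * nrm x))); last first.
  by rewrite ler_wpM2r// !mulr_ge0 ?addr_ge0.
have [s ms hs] := sfun_approx bf e0; have [t mt ht] := sfun_approx bg e0.
have [m v o] := smulP ms mt; have [bs ss fs] := sop_bop ms; have [bt st ft] := sop_bop mt.
have [_ _ fm] := sop_bop m; have [bPf _ _] := PhiP bf.
have tL l : `|sval t l| <= L + 1.
  have -> : sval t l = g l - (g l - sval t l) by ring.
  by apply: le_trans (ler_normB _ _) _; rewrite lerD// (le_trans (ht l)).
have d1 : nrm (Phi (fun l => f l * g l) x - Phi (sval (smul s t)) x) <= (eps0 * (K + (L + 1))) * nrm x.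
  apply: Phi_dist => //; first exact: bfunM.
  move=> l; rewrite v.
  have -> : f l * g l - sval s l * sval t l = f l * (g l - sval t l) + (f l - sval s l) * sval t l by ring.
  apply: le_trans (ler_normD _ _) _; rewrite !normrM mulrDr lerD//.
    by rewrite mulrC ler_pM.
  by rewrite ler_pM.
have d2 : nrm (Phi f (Phi g x) - sop s (sop t x)) <= (eps0 * (K + (L + 1))) * nrm x.
  have -> : Phi f (Phi g x) - sop s (sop t x) = Phi f (Phi g x - Phi (sval t) x) + (Phi f (Phi (sval t) x) - Phi (sval s) (Phi (sval t) x)).
    by rewrite (bopB bPf) !Phi_sop// addrA subrK.
  apply: le_trans (nrmD _ _) _; rewrite mulrDr mulrDl lerD//.
    apply: le_trans (@Phi_le _ _ K bf hK) _; rewrite [eps0 * K]mulrC -mulrA ler_wpM2l//.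
    exact: Phi_dist.
  apply: le_trans (Phi_dist _ bf fs hs) _; rewrite -mulrA ler_pM2l//.
  exact: Phi_le.
rewrite Phi_sop// o in d1.
apply: le_trans (nrm_tri (sop s (sop t x)) _ _) _; rewrite [nrm (sop _ _ - _)]nrmBC.
by lra.
Qed.

Lemma Phi_e f B x : bfun f -> measurable B -> Phi (fun l => f l * \1_B l) x = Phi f (e B x).
Proof. by move=> bf mB; rewrite Phi_mul ?Phi_indic//; exact: bfun_indic. Qed.

Lemma Phi_comm f u : bfun f -> bop u -> (forall B x, measurable B -> e B (u x) = u (e B x)) ->
  forall x, Phi f (u x) = u (Phi f x).
Proof.
move=> bf bu eu x; have [K K0 hK] := bop_bnd bu.
apply: subr0_eq.
apply: (@nrm_eps0 _ (2 * K * nrm x)); first by rewrite !mulr_ge0.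
move=> eps e0; have [s ms hs] := sfun_approx bf e0.
have [_ _ fs] := sop_bop ms.
apply: le_trans (nrm_tri (u (sop s x)) _ _) _.
have -> : eps * (2 * K * nrm x) = eps * (K * nrm x) + K * (eps * nrm x) by ring.
rewrite lerD//.
  rewrite -sop_comm// -Phi_sop//; apply: le_trans (Phi_dist _ bf fs hs) _.
  by rewrite ler_pM2l.
rewrite -(bopB bu); apply: le_trans (hK _) _; rewrite ler_wpM2l// nrmBC -Phi_sop//.
exact: Phi_dist.
Qed.

End Calculus.

Definition half : set R := [set l | 0 <= l].

Lemma measurable_half : measurable half.
Proof.
by rewrite (_ : half = `[0, +oo[%classic)//; apply/seteqP; split=> l; rewrite /half /= in_itv /= andbT.
Qed.

Lemma Phi_eq_on e (he : pvm e) f g B x : bfun f -> bfun g -> measurable B -> (forall l, B l -> f l = g l) ->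
  e B x = x -> Phi he f x = Phi he g x.
Proof.
move=> bf bg mB fg <-; rewrite -!Phi_e//; congr (Phi).
by apply/funext => l; rewrite indicE; case: (boolP (l \in B)) => [/set_mem/fg ->|]; rewrite ?mulr0.
Qed.

Lemma Phi_bounds e (he : pvm e) f B x c k : bfun f -> measurable B -> (forall l, B l -> c <= f l <= k) ->
  e B x = x -> c * rd x x <= rd (Phi he f x) x /\ rd (Phi he f x) x <= k * rd x x.
Proof.
move=> bf mB fB ex.
have E h (bh : bfun h) : rd (Phi he h x) x = rd (Phi he (fun l => h l * \1_B l) x) x by rewrite Phi_e// ex.
have := @bfun_indic B mB.
have ec t : t * rd x x = rd (Phi he (fun=> t) x) x by rewrite Phi_cst rdZl.
have bc t := @bfun_cst t.
rewrite !ec (E _ bf) (E _ (bc c)) (E _ (bc k)).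
split; apply: Phi_mono; try exact: bfunM;
  by move=> l; rewrite indicE; case: (boolP (l \in B)) => [/set_mem/fB/andP[? ?]|_]; rewrite ?mulr1 ?mulr0.
Qed.

Section OfContraction.
Variable G : H -> H.
Hypotheses (bG : bop G) (sG : sa G) (nG : nonneg G) (G1 : forall x, rd (G x) x <= rd x x).

(** On the range of [e] over a slab of width [d], the forms of [G] and of [Phi he f] both lie in the
    slab, so they differ by at most [d]. The slabs are orthogonal and reduce both operators, so the
    errors add up to at most [d |x|^2], with [d] arbitrarily small. *)
Lemma spectral_contraction : exists e (he : pvm e), [/\ forall a x, e (ray a) x = x - slow G a x,
  forall x, e `[0, 1]%classic x = x &
  forall f, bfun f -> (forall l, 0 <= l <= 1 -> f l = l) -> forall x, Phi he f x = G x].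
Proof.
have [e he er] := pvm_exists bG sG nG G1; exists e, he.
have mI : measurable (`[0, 1]%classic : set R) by exact: measurable_itv.
have e01 x : e `[0, 1]%classic x = x.
  have h1 : e (ray 1) x = 0 by rewrite er slow1// subrr.
  have hneg : e (~` half) x = 0.
    have -> : ~` half = \bigcup_n ~` ray (- n.+1%:R^-1 : R).
      apply/seteqP; split=> l.
        move/negP; rewrite -ltNge => l0.
        have l0' : 0 < - l by rewrite oppr_gt0.
        have [N hN] := inv_small l0'.
        exists N => //=; apply/negP; rewrite -leNgt lerNr; exact: hN.
      move=> [n _]; move/negP; rewrite -leNgt => h; apply/negP; rewrite -ltNge.
      exact: le_lt_trans h _.
    have mr n : measurable (~` ray (- n.+1%:R^-1 : R)) by apply: measurableC; exact: measurable_ray.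
    have nd : nondecreasing_seq (fun n => ~` ray (- n.+1%:R^-1 : R)).
      move=> m n mn; apply/subsetPset => l; rewrite /ray => /negP; rewrite -leNgt => h.
      apply/negP; rewrite -leNgt; apply: le_trans h _.
      by rewrite lerN2 lef_pV2 ?posrE// ler_nat.
    apply: hcvg_unique (pvm_cvg he x mr nd) _.
    rewrite (_ : (fun => _) = fun=> 0); first exact: hcvg_cst.
    apply/funext => n; rewrite pvm_C//; last exact: measurable_ray.
    by rewrite er slow0 ?subr0 ?subrr.
  have -> : (`[0, 1]%classic : set R) = ~` (~` half `|` ray 1).
    apply/seteqP; split=> l; rewrite /ray /= in_itv /=.
      by move=> /andP[l0 l1] [//|]; rewrite ltNge l1.
    by move=> h; apply/andP; split; apply: contrapT => h2; apply: h; [left|right; rewrite ltNge; apply/negP].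
  have mh := measurable_half; have mr := @measurable_ray R.
  rewrite (pvm_C he); last by apply: measurableU => //; exact: measurableC.
  rewrite pvm_U//; [by rewrite hneg h1 addr0 subr0|exact: measurableC|].
  apply/seteqP; split=> // l; rewrite /half => -[h1' h2]; apply: h1'.
  by apply: ltW; apply: lt_trans.
split=> // f bf fl.
suff : Phi he f = G by move=> ->.
apply: (Phi_unique bf bG sG) => x; apply: subr0_eq.
pose a y := G y - Phi he f y.
have bP := Phi_bop he bf.
have ba : bop a by exact: bop_sub.
have -> : rd (G x) x - pint he x f = rd (a x) x by rewrite rdBl Phi_rd.
apply/eqP; rewrite -normr_le0; apply/ler_addgt0Pr => eps eps0; rewrite add0r.
have [n hn] : exists n : nat, rd x x / n.+1%:R <= eps.
  exists (Num.truncn (rd x x / eps)); rewrite ler_pdivrMr// mulrC -ler_pdivrMr//.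
  by rewrite ltW// truncnS_gt.
apply: le_trans hn.
pose d : R := n.+1%:R^-1.
have d0 : 0 < d by rewrite invr_gt0.
pose s j := slow G (j%:R * d - d).
have comm j y : a (s j y) = s j (a y).
  have [bs ss _] := slow_proj bG sG (j%:R * d - d).
  have Gs z : G (s j z) = s j (G z) by apply/esym; exact: slow_comm.
  have bsj : bop (s j) by [].
  rewrite /a (bopB bsj) Gs; congr (_ - _); apply: Phi_comm => // B z mB.
  have srE w : s j w = w - e (ray (j%:R * d - d)) w by rewrite er opprB addrC subrK.
  have mr := @measurable_ray.
  by rewrite !srE (bopB (pvm_bop he mB)) pvm_comm.
have step j y : s j.+1 y = y -> s j y = 0 -> `|rd (a y) y| <= d * rd y y.
  move=> h1 h0.
  have k1 : j.+1%:R * d - d = j%:R * d by rewrite -natr1 mulrDl mul1r addrK.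
  have : rd (G y) y <= (j%:R * d) * rd y y by rewrite -k1; apply: slow_le.
  have : (j%:R * d - d) * rd y y <= rd (G y) y.
    have [h|/ltW//] := leP (rd (G y) y) ((j%:R * d - d) * rd y y).
    by rewrite (slow_gt bG sG h0 h) rd0r mulr0.
  have mB : measurable (ray (j%:R * d - d) `\` ray (j%:R * d) : set R) by apply: measurableD; exact: measurable_ray.
  have eB : e ((ray (j%:R * d - d) `\` ray (j%:R * d)) `&` `[0, 1]) y = y.
    rewrite pvm_I// e01 (pvm_D he); [|exact: measurable_ray|exact: measurable_ray|].
      by rewrite !er -{2}k1 -/(s j) -/(s j.+1) h0 h1 subr0 subrr subr0.
    by move=> l; apply: lt_trans; rewrite ltrBlDr ltrDl.
  have [|h2] := @Phi_bounds e he f _ y (j%:R * d - d) (j%:R * d) bf (measurableI _ _ mB mI) _ eB.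
    move=> l [[]]; rewrite /= in_itv => r1 /negP r2 /fl ->.
    by rewrite (ltW r1) leNgt.
  by rewrite rdBl ler_norml; lra.
have main j : `|rd (a (s j x)) (s j x)| <= d * rd (s j x) (s j x).
  elim: j => [|j IH].
    by rewrite /s mul0r sub0r slow0 ?oppr_lt0// (bop0 ba) rd0l mulr0 normr0.
  have jj : j%:R * d - d <= j.+1%:R * d - d by rewrite lerD2r ler_pM2r// ler_nat.
  have [bj sj ij] : orthoproj (s j) := slow_proj bG sG _.
  have [bj1 sj1 ij1] : orthoproj (s j.+1) := slow_proj bG sG _.
  have ss : s j (s j.+1 x) = s j x.
    rewrite /s (@slow_comm G bG sG _ _ bj1); last by move=> z; apply/esym/slow_comm.
    exact: slow_mono.
  have ss' : s j.+1 (s j x) = s j x by exact: slow_mono.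
  have [w [wE w0 w1]] : exists w, [/\ s j.+1 x = s j x + w, s j w = 0 & s j.+1 w = w].
    exists (s j.+1 x - s j x); split; first by rewrite addKC.
      by rewrite (bopB bj) ss ij subrr.
    by rewrite (bopB bj1) ij1 ss'.
  have hw := step j w w1 w0.
  have adD (u v : H) : rd (a (u + v)) (u + v) = (rd (a u) u + rd (a u) v) + (rd (a v) u + rd (a v) v).
    by rewrite (bopD ba) rdDl !rdDr.
  have sD (u v : H) : rd (u + v) (u + v) = (rd u u + rd u v) + (rd v u + rd v v) by rewrite rdDl !rdDr.
  rewrite wE adD sD.
  have -> : rd (s j x) w = 0 by rewrite sj w0 rd0r.
  have -> : rd w (s j x) = 0 by rewrite rdC sj w0 rd0r.
  have -> : rd (a (s j x)) w = 0 by rewrite comm sj w0 rd0r.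
  have -> : rd (a w) (s j x) = 0 by rewrite -sj -comm w0 (bop0 ba) rd0l.
  by rewrite !add0r !addr0 mulrDr; apply: le_trans (ler_normD _ _) _; exact: lerD.
have k1 : n.+2%:R * d - d = 1 by rewrite -natr1 mulrDl mul1r addrK mulfV.
have sx : s n.+2 x = x by rewrite /s k1 slow1.
by have := main n.+2; rewrite sx mulrC.
Qed.

End OfContraction.

Section PushForward.
Variables (e : set R -> H -> H) (he : pvm e) (g : R -> R).
Hypothesis mg : measurable_fun setT g.

Definition pushp B : H -> H := e (g @^-1` B).

Let mpre B : measurable B -> measurable (g @^-1` B).
Proof. by move=> mB; rewrite -[X in measurable X]setTI; exact: mg. Qed.

Lemma push_pvm : pvm pushp.
Proof.
split=> [B mB|x|B C x mB mC|x]; rewrite /pushp.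
- exact: (pvm_proj he (mpre mB)).
- by rewrite pvm_T.
- by rewrite pvm_I//; exact: mpre.
have [ha hc] := pvm_dyn he x; split=> [B C mB mC BC|F mF ndF].
  rewrite ha//; [exact: mpre|exact: mpre|].
  by rewrite -preimage_setI BC.
rewrite preimage_bigcup; apply: hc => [n|m n mn]; first exact: mpre.
by apply/subsetPset; apply: preimage_subset; apply/subsetPset/ndF.
Qed.

Lemma bfun_comp f : bfun f -> bfun (f \o g).
Proof. by move=> [mf [K]]; split; [exact: measurableT_comp|exists K => l /=]. Qed.

Lemma push_Phi f x : bfun f -> Phi push_pvm f x = Phi he (f \o g) x.
Proof.
move=> bf; apply: subr0_eq.
apply: (@nrm_eps0 _ (2 * nrm x)); first by rewrite mulr_ge0.
move=> eps e0; have [s ms hs] := sfun_approx bf e0.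
have [_ _ fs] := sop_bop push_pvm ms.
pose s' : @sfun := [seq (p.1, g @^-1` p.2) | p <- s].
have [ms' vs' os'] : [/\ smeas s', forall l, sval s' l = sval s (g l) & forall y, sop e s' y = sop pushp s y].
  rewrite /s'; elim: (s) ms => [|p r IH] ms1; first by split.
  have [|m v o] := IH; first by move=> q hq; apply: ms1; right.
  split=> [q [<-|/m//]|l|y] /=; first by apply: mpre; apply: ms1; left.
    by rewrite v.
  by rewrite o.
have [_ _ fs'] := sop_bop he ms'.
apply: le_trans (nrm_tri (sop pushp s x) _ _) _.
have -> : eps * (2 * nrm x) = eps * nrm x + eps * nrm x by ring.
rewrite lerD//; first by rewrite -(Phi_sop push_pvm)//; exact: Phi_dist.
rewrite nrmBC -os' -Phi_sop//; apply: Phi_dist => //; first exact: bfun_comp.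
by move=> l; rewrite /= vs'.
Qed.

End PushForward.

(* [slow (Phi g) k] is the spectral projection of [g <= k]; in particular it
   depends on [Phi g] only. *)
Lemma slow_Phi e (he : pvm e) g k x : bfun g -> slow (Phi he g) k x = e [set l | g l <= k] x.
Proof.
move=> bg; have [bG sG] := PhiP he bg; set G := Phi he g in bG *.
have mB : measurable [set l | g l <= k].
  rewrite (_ : [set l | _] = setT `&` g @^-1` `]-oo, k]%classic).
    by case: bg => mg _; apply: mg => //.
  by rewrite setTI.
set B := [set l | _] in mB *.
have eG C y : measurable C -> G (e C y) = e C (G y).
  move=> mC; apply: (Phi_comm he bg (pvm_bop he mC)) => B' z mB'; exact: pvm_comm.
have [bs ss iss] := slow_proj bG sG k.
have be := pvm_bop he mB; have ie y := pvm_id he y mB.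
have se C y : measurable C -> slow G k (e C y) = e C (slow G k y).
  by move=> mC; apply: (slow_comm bG sG k (pvm_bop he mC)) => z; exact: eG.
have [mg [K hK]] := bg.
have h1 y : e B y = y -> slow G k y = y.
  move=> ey; apply/esym/subr0_eq; set w := _ - _.
  have ew : e B w = w by rewrite (bopB be) -se// ey.
  apply: (@slow_gt G bG sG k); first by rewrite (bopB bs) iss subrr.
  have [|_ //] := @Phi_bounds e he g B w (- K) k bg mB _ ew.
  by move=> l Bl; rewrite Bl andbT; have := hK l; rewrite ler_norml => /andP[].
(* The complement of [B] is exhausted by the sets where [g] is at least [k + 1/(n+1)]; there the
   form strictly exceeds the bound that [slow_le] gives. *)
have h2 y : e B y = 0 -> slow G k y = 0.
  move=> ey; set w := slow G k y.
  have ew : e B w = 0 by rewrite -se// ey bop0.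
  pose C n := [set l | k + n.+1%:R^-1 <= g l].
  have mC n : measurable (C n).
    rewrite (_ : C n = setT `&` g @^-1` `[(k + n.+1%:R^-1), +oo[%classic).
      exact: mg => //.
    by rewrite setTI; apply/seteqP; split=> l; rewrite /= in_itv andbT.
  have ndC : nondecreasing_seq C.
    move=> m n mn; apply/subsetPset => l; apply: le_trans.
    by rewrite lerD2l lef_pV2 ?posrE// ler_nat.
  have CU : \bigcup_n C n = ~` B.
    apply/seteqP; split=> [l [n _]|l].
      by move=> h; apply/negP; rewrite -ltNge; apply: lt_le_trans h; rewrite ltrDl.
    move/negP; rewrite -ltNge => h; have h0 : 0 < g l - k by rewrite subr_gt0.
    have [N hN] := inv_small h0.
    by exists N => //=; have := hN N (leqnn N); rewrite lerBrDl.
  have C0 n : e (C n) w = 0.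
    set v := e _ w; have vv : e (C n) v = v by rewrite pvm_id.
    have sv : slow G k v = v by rewrite se// iss.
    have [|lo _] := @Phi_bounds e he g (C n) v (k + n.+1%:R^-1) K bg (mC n) _ vv.
      by move=> l Cl; rewrite Cl; have := hK l; rewrite ler_norml => /andP[].
    have := slow_le bG sG sv => up; apply: rd_eq0; apply/le_anti; rewrite rd_ge0 andbT.
    have : n.+1%:R^-1 * rd v v <= 0 by rewrite -/G in lo; move: lo; move: n.+1%:R^-1 => t; lra.
    by rewrite pmulr_rle0.
  have ewC : e (~` B) w = w by rewrite pvm_C// ew subr0.
  rewrite -ewC -CU; apply: hcvg_unique (pvm_cvg he w mC ndC) _.
  by rewrite (_ : (fun => _) = fun=> 0); [exact: hcvg_cst|exact/funext].
rewrite -[x in slow G k x](addKC (e B x)) (bopD bs) h1// h2 ?addr0//.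
by rewrite (bopB be) ie subrr.
Qed.

(** * Closed operators and their spectral representation *)

Lemma closed_pairP T : closed T <-> forall (u v : nat -> H) x y, (forall n, T (u n, v n)) ->
  hcvg u x -> hcvg v y -> T (x, y).
Proof.
split=> [cT u v x y Tuv ux vy|h].
  by apply: cT; apply/closurePairP; exists u, v.
by move=> [x y] /closurePairP [u [v [Tuv vy]]]; exact: h vy.
Qed.

Lemma closed_opP T : closed_op T <-> [/\ csub (domain_op T), (forall x y y', T (x, y) -> T (x, y') -> y = y'),
   (forall x y x' y', T (x, y) -> T (x', y') -> T (x + x', y + y')) /\
   (forall c x y, T (x, y) -> T (rs c x, rs c y)) /\ (forall x y, T (x, y) -> T (hi x, hi y)),
   dense (domain_op T) & closed T].
Proof.
split=> [[T0 Tl Tf]|[[D0 _ _ _] Tf [TD [TZ Ti]]]].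
  have TD x y x' y' : T (x, y) -> T (x', y') -> T (x + x', y + y').
    by move=> h h'; have := Tl 1 _ _ h h'; rewrite !scale1r.
  have TZ' (c : R[i]) x y : T (x, y) -> T (c *: x, c *: y).
    by move=> h; have := Tl c _ _ h T0; rewrite !addr0.
  split=> //.
  - split=> [|x x' [[? y] h <-] [[? y'] h' <-]|c x [[x1 y] h <-]|x [[x1 y] h <-]].
    + by exists (0, 0).
    + by eexists; [exact: TD h h'|].
    + by exists (rs c x1, rs c y) => //; exact: TZ'.
    + by exists (hi x1, hi y) => //; exact: TZ'.
  - move=> x y y' h h'; have := TD _ _ _ _ h (TZ' (-1) _ _ h'); rewrite !scaleN1r subrr.
    by move=> /Tf /eqP; rewrite subr_eq0 => /eqP.
  - by split=> //; split=> *; exact: TZ'.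
have [[? y0] /= T0 e0] := D0; rewrite e0 in T0.
have y00 : y0 = 0.
  have := TZ 0 _ _ T0; rewrite !rs0 => T00; exact: Tf T00.
rewrite y00 in T0; split=> //.
- move=> c [x y] [x' y'] h; rewrite !scaleE; apply: (TD) => //; apply: TD; apply: TZ => //.
  exact: Ti.
- by move=> y h; exact: Tf T0.
Qed.

Section Closed.
Variable T : set (H * H).
Hypothesis cT : closed_op T.

Lemma cl0 : T (0, 0). Proof. by case: cT. Qed.
Lemma cl_fun x y y' : T (x, y) -> T (x, y') -> y = y'. Proof. by move/closed_opP : cT => [_ h _ _ _]; exact: h. Qed.
Lemma clD x y x' y' : T (x, y) -> T (x', y') -> T (x + x', y + y').
Proof. by move/closed_opP : cT => [_ _ [h _] _ _]; exact: h. Qed.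
Lemma clZ c x y : T (x, y) -> T (rs c x, rs c y).
Proof. by move/closed_opP : cT => [_ _ [_ [h _]] _ _]; exact: h. Qed.
Lemma cli x y : T (x, y) -> T (hi x, hi y).
Proof. by move/closed_opP : cT => [_ _ [_ [_ h]] _ _]; exact: h. Qed.
Lemma clB x y x' y' : T (x, y) -> T (x', y') -> T (x - x', y - y').
Proof. by move=> h /(clZ (-1)); rewrite !rsNl !rs1; exact: clD. Qed.
Lemma cl_sub : csub (domain_op T). Proof. by case/closed_opP : cT. Qed.
Lemma cl_lim (u v : nat -> H) x y : (forall n, T (u n, v n)) -> hcvg u x -> hcvg v y -> T (x, y).
Proof. by move/closed_opP : cT => [_ _ _ _ /closed_pairP h]; exact: h. Qed.
Lemma cl_dense x : exists u : nat -> H, (forall n, domain_op T (u n)) /\ hcvg u x.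
Proof. by move/closed_opP : cT => [_ _ _ /denseHP]. Qed.

Definition app x : H := xget 0 [set y | T (x, y)].
Lemma appP x : domain_op T x -> T (x, app x).
Proof. by move=> [[? y] h <-]; exact: @xgetPex _ 0 [set y | T (_, y)] (ex_intro _ y h). Qed.
Lemma appE x y : T (x, y) -> app x = y.
Proof. by move=> h; apply: (cl_fun (appP _) h); exists (x, y). Qed.

Lemma adjointP x y : adjoint_op T (x, y) <-> forall v w, T (v, w) -> rd w x = rd v y.
Proof.
split=> [h v w Tvw|h [v w] Tvw]; first by have := h _ Tvw; rewrite /rd => ->.
by rewrite !dotE (h _ _ Tvw); congr Complex; have := h _ _ (cli Tvw); rewrite !rdhi => /oppr_inj.
Qed.

Inductive midp (S : set H) : H -> Prop :=
| midp0 z : S z -> midp S z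
| midpS z w : midp S z -> midp S w -> midp S (rs 2^-1 (z + w)).

(* Lower semicontinuity: near-minimizers of [|T z|] among iterated midpoints
   of a tail have convergent images. *)
Lemma qform_cl : qform (domain_op T) (fun x => rd (app x) (app x)).
Proof.
have aD x y (Dx : domain_op T x) (Dy : domain_op T y) := appE (clD (appP Dx) (appP Dy)).
have aB x y (Dx : domain_op T x) (Dy : domain_op T y) := appE (clB (appP Dx) (appP Dy)).
have aZ c x (Dx : domain_op T x) := appE (clZ c (appP Dx)).
have hD := cl_sub.
split=> [|x _|x y Dx Dy|c x Dx|x Dx|w x K Dw wx qw] //.
- by rewrite aD// aB// !rdE; lra.
- by rewrite aZ// rdZl rdZr; ring.
- by rewrite (appE (cli (appP Dx))) rdhi2.
pose q z := rd (app z) (app z).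
pose A N := midp [set w n | n in [set n | (N <= n)%N]].
have AD N z : A N z -> domain_op T z.
  elim=> [_ [n _ <-]|z1 z2 _ D1 _ D2] //.
  by apply: (csubZ hD); exact: (csubD hD).
have Aq N z : A N z -> q z <= K.
  elim=> [_ [n _ <-]|z1 z2 h1 q1 h2 q2]; first exact: qw.
  have D1 := AD _ _ h1; have D2 := AD _ _ h2.
  rewrite /q aZ ?aD//; last exact: (csubD).
  have := rd_ge0 (app z1 - app z2); rewrite /q !(rdZl, rdZr, rdDl, rdDr, rdNl, rdNr); lra.
have Ax N z eps : (forall n, (N <= n)%N -> nrm (w n - x) <= eps) -> A N z -> nrm (z - x) <= eps.
  move=> hN; elim=> [_ [n Nn <-]|z1 z2 _ h1 _ h2]; first exact: hN.
  have -> : rs 2^-1 (z1 + z2) - x = rs 2^-1 ((z1 - x) + (z2 - x)).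
    by apply: rd_inj => t; rewrite !(rdZl, rdDl, rdNl); lra.
  rewrite nrmZ ger0_norm//; have := nrmD (z1 - x) (z2 - x); lra.
have Amono M N z : (M <= N)%N -> A N z -> A M z.
  move=> MN; elim=> [_ [n Nn <-]|z1 z2 _ h1 _ h2]; last exact: midpS.
  by apply: midp0; exists n => //=; exact: leq_trans Nn.
pose V N := [set q z | z in A N].
have hV N : has_inf (V N).
  split; first by exists (q (w N)), (w N) => //; apply: midp0; exists N => /=.
  by exists 0 => _ [z _ <-].
pose a N := inf (V N).
have alb N z : A N z -> a N <= q z by move=> Az; apply: ge_inf; [case: (hV N)|exists z].
have aK N : a N <= K by apply: le_trans (Aq N (w N) _); [apply: alb|]; apply: midp0; exists N => /=.
have and' : nondecreasing_seq a.
  move=> M N MN; apply: lb_le_inf; first by case: (hV N).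
  by move=> _ [z Az <-]; apply: alb; exact: Amono Az.
have hch : forall N : nat, exists z, A N z /\ q z <= a N + N.+1%:R^-1.
  move=> N; have n0 : 0 < N.+1%:R^-1 :> R by rewrite invr_gt0.
  by have [_ [z Az <-] /ltW h] := inf_adherent n0 (hV N); exists z.
have [s hs] := choice hch.
have sA N : A N (s N) by case: (hs N).
have sD N := AD _ _ (sA N).
have sx : hcvg s x.
  move/hcvgP : wx => wx; apply/hcvgP => eps /wx [N hN]; exists N => n Nn.
  by apply: (Ax N) => //; exact: (Amono _ _ _ Nn (sA n)).
have par M N : (M <= N)%N -> rd (app (s M) - app (s N)) (app (s M) - app (s N)) <= 2 * (a N - a M) + 2 * (M.+1%:R^-1 + N.+1%:R^-1).
  move=> MN; have Am : A M (rs 2^-1 (s M + s N)) by apply: midpS; [exact: sA|exact: (Amono _ _ _ MN (sA N))].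
  have := alb _ _ Am; have [_ hM] := hs M; have [_ hN] := hs N.
  move: hM hN; rewrite /q aZ ?aD//; last exact: (csubD).
  rewrite !(rdZl, rdZr, rdDl, rdDr, rdNl, rdNr).
  move: (a N) (a M) (M.+1%:R^-1) (N.+1%:R^-1) => ? ? ? ?; lra.
have [y sy] : exists y, hcvg (fun n => app (s n)) y.
  apply: hcomplete => eps eps0.
  have d0 : 0 < eps ^+ 2 / 8 by rewrite divr_gt0// exprn_gt0.
  have : cvgn a by apply: nondecreasing_is_cvgn => //; exists K => _ [n _ <-].
  move=> /cvg_ex[t ht].
  have /cvgrPdist_le /(_ _ d0) [N1 _ hN1] := ht.
  have [N2 hN2] := inv_small d0.
  exists (maxn N1 N2) => m n; rewrite !geq_max => /andP[m1 m2] /andP[n1 n2].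
  wlog mn : m n m1 m2 n1 n2 / (m <= n)%N.
    by move=> W; have /orP[?|?] := leq_total m n; [exact: W|rewrite nrmBC; exact: W].
  apply: nrm_le; first exact: ltW.
  apply: le_trans (par _ _ mn) _.
  have := hN1 m m1; have := hN1 n n1; have := hN2 m m2; have := hN2 n n2.
  rewrite !ler_norml; move: (a) (a) (m.+1%:R^-1) (n.+1%:R^-1) (eps ^+ 2) => ? ? ? ? ? ? ? /andP[? ?] /andP[? ?]; lra.
have Txy := cl_lim (fun n => appP (sD n)) sx sy.
split; first by exists (x, y).
rewrite (appE Txy); apply: (cvg_le_seq (hcvg_rd sy sy) (cvg_cst K)) => n.
exact: Aq (sA n).
Qed.

End Closed.

(** The relation [T^* T] is read off from the resolvent of the closed form [|T x|^2], an everywhere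
    defined operator, so the domain of the composite never has to be described. *)
Lemma adjoint_res T x y : closed_op T ->
  comp_op (adjoint_op T) T (x, y) <-> resolvent (domain_op T) (fun x => rd (app T x) (app T x)) (x + y) = x.
Proof.
move=> cT; have hq := qform_cl cT; set q := fun => _ in hq *; set G := resolvent.
have Tapp v : domain_op T v -> T (v, app T v) by exact: appP.
split=> [[z [ Txz aT]]|h].
  apply: (resolvent_eq hq); split; first by exists (x, z).
  move=> v Dv; have Tv := Tapp _ Dv; rewrite /q (appE cT (clD cT Txz Tv)) (appE cT Txz).
  have := (adjointP cT z y).1 aT _ _ Tv; rewrite !rdE (rdC y) rdC; lra.
have Dx : domain_op T x by rewrite -h; exact: resolvent_dom.
exists (app T x); split=> /=; first exact: Tapp.
apply/(adjointP cT) => v w Tvw; have Dv : domain_op T v by exists (v, w).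
have := resolvent_polar hq (x + y) Dv; rewrite -/G h /q (appE cT (clD cT (Tapp _ Dx) Tvw)) (appE cT Tvw).
rewrite !rdE (rdC y) rdC; lra.
Qed.

Lemma incr_cauchy (s : nat -> R) K : nondecreasing_seq s -> (forall n, s n <= K) ->
  forall d, 0 < d -> exists N, forall m n, (N <= m)%N -> (m <= n)%N -> s n - s m <= d.
Proof.
move=> si sK d d0.
have : cvgn s by apply: nondecreasing_is_cvgn => //; exists K => _ [n _ <-].
move=> /cvg_ex[t ht]; have d2 : 0 < d / 2 by rewrite divr_gt0.
have /cvgrPdist_le /(_ _ d2) [N _ hN] := ht.
exists N => m n Nm mn; have := hN m Nm; have := hN n (leq_trans Nm mn).
by rewrite !ler_norml => /andP[? ?] /andP[? ?]; lra.
Qed.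

Definition band (m : nat) : set R := [set l | `|l| <= m%:R].

Lemma measurable_band m : measurable (band m).
Proof.
rewrite (_ : band m = `[(- m%:R), m%:R]%classic); first exact: measurable_itv.
by apply/seteqP; split=> l; rewrite /band /= in_itv ler_norml.
Qed.

Lemma band_sub m n : (m <= n)%N -> band m `<=` band n.
Proof. by move=> mn l; rewrite /band => h; apply: le_trans h _; rewrite ler_nat. Qed.

Lemma band_nd : nondecreasing_seq band.
Proof. by move=> m n mn; apply/subsetPset; exact: band_sub. Qed.

Lemma band_cover : \bigcup_n band n = setT.
Proof.
apply/seteqP; split=> // l; exists (Num.truncn `|l|).+1 => //.
by rewrite /band /= ltW// truncnS_gt.
Qed.

Lemma bandE m l : (l \in band m) = (`|l| <= m%:R).
Proof. by apply/idP/idP; rewrite inE. Qed.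

Definition cutf m (l : R) : R := l * \1_(band m) l.

Lemma bfun_id_on f K B : measurable_fun setT f -> measurable B -> (forall l, B l -> `|f l| <= K) -> 0 <= K ->
  bfun (fun l => f l * \1_B l).
Proof.
move=> mf mB fK; split; first exact: measurable_funM => //.
exists K => l; rewrite indicE; case: (boolP (l \in B)) => [/set_mem/fK|_]; rewrite ?mulr1 ?mulr0 ?normr0//.
Qed.

Lemma bfun_cutf m : bfun (cutf m).
Proof. by apply: (@bfun_id_on id m%:R) => //; exact: measurable_band. Qed.

Section SpecOp.
Variables (e : set R -> H -> H) (he : pvm e).
Local Notation P := (Phi he).
Local Notation eb m := (e (band m)).

(** The unbounded integral of [l] against [e]: [y] is determined by its truncations to the bands,
    and belonging to the domain means that such a [y] exists. *)
Definition spec_op : set (H * H) := [set p | forall m, eb m p.2 = P (cutf m) p.1].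

Lemma eb_bop m : bop (eb m). Proof. exact: (pvm_bop he (measurable_band m)). Qed.

Lemma eb_cvg x : hcvg (fun m => eb m x) x.
Proof.
have := pvm_cvg he x measurable_band band_nd.
by rewrite band_cover pvm_T.
Qed.

Lemma eb_inj x y : (forall m, eb m x = eb m y) -> x = y.
Proof.
move=> h; apply: hcvg_unique (eb_cvg x) _.
by rewrite (_ : (fun => _) = fun m => eb m y); [exact: eb_cvg|exact/funext].
Qed.

Lemma eb_Phi f m x : bfun f -> eb m (P f x) = P (fun l => f l * \1_(band m) l) x.
Proof.
move=> bf; rewrite (Phi_e he _ bf (measurable_band m)); apply/esym; apply: (Phi_comm he bf (eb_bop m)) => B z mB.
exact: (pvm_comm he z mB (measurable_band m)).
Qed.

Lemma Phi_eb f m x : bfun f -> P f (eb m x) = P (fun l => f l * \1_(band m) l) x.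
Proof. by move=> bf; rewrite (Phi_e he _ bf (measurable_band m)). Qed.

Lemma band_mul m n l : (m <= n)%N -> \1_(band n) l * \1_(band m) l = \1_(band m) l :> R.
Proof.
move=> mn; rewrite !indicE; case: (boolP (l \in band m)) => h; rewrite ?mulr0// mulr1.
by rewrite (mem_set (band_sub mn (set_mem h))).
Qed.

Lemma eb_cutf m n x : (m <= n)%N -> eb m (P (cutf n) x) = P (cutf m) x.
Proof.
move=> mn; rewrite eb_Phi; last exact: bfun_cutf.
by congr (P); apply/funext => l; rewrite -mulrA band_mul.
Qed.

Lemma spec_cvg x y : spec_op (x, y) -> hcvg (fun m => P (cutf m) x) y.
Proof. by move=> h; rewrite (_ : (fun => _) = (fun m => eb m y)); [exact: eb_cvg|apply/funext => m]. Qed.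

(** The increments of [P (cutf m) x] in [m] are orthogonal, so bounded norms make these vectors
    converge. *)
Lemma spec_domP x K : (forall m, rd (P (cutf m) x) (P (cutf m) x) <= K) -> domain_op spec_op x.
Proof.
move=> hK; pose s m := P (cutf m) x.
have es m n : (m <= n)%N -> eb m (s n) = s m by move=> mn; rewrite eb_cutf.
have dist m n : (m <= n)%N -> rd (s n - s m) (s n - s m) = rd (s n) (s n) - rd (s m) (s m).
  move=> mn; have : rd (s n) (s m) = rd (s m) (s m).
    by rewrite -{1}(es m m (leqnn m)) -(pvm_sa he (measurable_band m)) es.
  have dE (u v : H) : rd u v = rd v v -> rd (u - v) (u - v) = rd u u - rd v v.
    by move=> uv; rewrite !rdE (rdC v) uv; ring.
  exact: dE.
have inc : nondecreasing_seq (fun m => rd (s m) (s m)).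
  by move=> m n mn; rewrite -subr_ge0 -dist.
have [y sy] : exists y, hcvg s y.
  apply: hcomplete => eps e0; have e2 : 0 < eps ^+ 2 by rewrite exprn_gt0.
  have [N hN] := incr_cauchy inc hK e2; exists N => m n Nm Nn.
  wlog mn : m n Nm Nn / (n <= m)%N.
    by move=> W; have /orP[?|?] := leq_total m n; [rewrite nrmBC|]; exact: W.
  by apply: nrm_le; [exact: ltW|rewrite dist//; exact: hN].
exists (x, y) => // m.
apply: hcvg_unique (bop_cvg (eb_bop m) sy) _.
by apply: (@hcvg_eqn _ _ (fun=> s m) _ _ m); [move=> n mn /=; rewrite es|exact: hcvg_cst].
Qed.

Lemma spec_eb m x : spec_op (eb m x, P (cutf m) x).
Proof.
move=> n; rewrite eb_Phi ?Phi_eb; try exact: bfun_cutf.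
by congr (P); apply/funext => l; rewrite mulrAC.
Qed.

Lemma spec_closed : closed_op spec_op.
Proof.
have bP m := Phi_bop he (bfun_cutf m).
apply/closed_opP; split.
- split=> [|x x' [[x1 y] h <-] [[x2 y'] h' <-]|c x [[x1 y] h <-]|x [[x1 y] h <-]].
  + by exists (0, 0) => // m; rewrite (bop0 (bP m)) (bop0 (eb_bop m)).
  + by exists (x1 + x2, y + y') => // m; rewrite (bopD (bP m)) (bopD (eb_bop m)) h h'.
  + by exists (rs c x1, rs c y) => // m; rewrite (boprs (bP m)) (boprs (eb_bop m)) h.
  + by exists (hi x1, hi y) => // m; rewrite (bophi (bP m)) (bophi (eb_bop m)) h.
- by move=> x y y' h h'; apply: eb_inj => m; rewrite (h).
- split; [|split].
  + by move=> x y x' y' h h' m; rewrite (bopD (bP m)) (bopD (eb_bop m)) (h) (h').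
  + by move=> c x y h m; rewrite (boprs (bP m)) (boprs (eb_bop m)) (h).
  + by move=> x y h m; rewrite (bophi (bP m)) (bophi (eb_bop m)) (h).
- apply/denseHP => x; exists (fun m => eb m x); split; last exact: eb_cvg.
  by move=> m; exists (eb m x, P (cutf m) x) => //; exact: spec_eb.
- apply/closed_pairP => u v x y Tuv ux vy m.
  apply: hcvg_unique (bop_cvg (eb_bop m) vy) _.
  by rewrite (_ : _ \o _ = P (cutf m) \o u); [exact: bop_cvg|apply/funext => n; exact: Tuv].
Qed.

Lemma spec_adjoint : adjoint_op spec_op = spec_op.
Proof.
apply/seteqP; split=> [[x y] /(adjointP spec_closed) h m|[x y] h].
  apply: rd_inj => z; rewrite (pvm_sa he (measurable_band m)) rdC -(h _ _ (spec_eb m z)).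
  by rewrite (Phi_sa he (bfun_cutf m)) rdC.
apply/(adjointP spec_closed) => v w hv.
apply: (rd_lim_eq (spec_cvg hv) (hcvg_cst x) (hcvg_cst v) (spec_cvg h)) => m.
exact: (Phi_sa he (bfun_cutf m)).
Qed.

(** [res2] and [res1] are the symbols of [(1 + A^2)^-1] and [(1 + |A|)^-1]. Through them the square
    of [A] and, for positive [A], the operator [A] itself become equations between bounded operators
    ([spec_comp], [spec_res1]). *)
Definition res2 (l : R) : R := (1 + l ^+ 2)^-1.
Definition res1 (l : R) : R := (1 + `|l|)^-1.

Lemma measurable_inv_pos f : measurable_fun setT f -> (forall l, 0 < f l) -> measurable_fun setT (fun l => (f l)^-1).
Proof.
move=> mf f0; rewrite (_ : (fun => _) = (fun l => f l `^ (-1))); last by apply/funext => l; rewrite powR_inv1 ?ltW.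
exact: (measurableT_comp (measurable_powR _)).
Qed.

Lemma res2_gt0 (l : R) : 0 < 1 + l ^+ 2 :> R. Proof. by rewrite ltr_wpDr ?sqr_ge0. Qed.
Lemma res1_gt0 (l : R) : 0 < 1 + `|l| :> R. Proof. by rewrite ltr_wpDr. Qed.

Lemma bfun_res2 : bfun res2.
Proof.
split; first by apply: measurable_inv_pos => [|l]; [apply: measurable_funD => //|exact: res2_gt0].
by exists 1 => l; rewrite ger0_norm ?invr_ge0 ?invf_le1 ?res2_gt0 ?lerDl ?sqr_ge0// ltW// res2_gt0.
Qed.

Lemma bfun_res1 : bfun res1.
Proof.
split; first by apply: measurable_inv_pos => [|l]; [apply: measurable_funD => //|exact: res1_gt0].
by exists 1 => l; rewrite ger0_norm ?invr_ge0 ?invf_le1 ?lerDl.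
Qed.

Lemma spec_comp x y : comp_op spec_op spec_op (x, y) <-> P res2 (x + y) = x.
Proof.
have b2 := bfun_res2; have bi m := @bfun_indic _ (measurable_band m).
have := bfun_cutf.
have ebP m v : eb m v = P \1_(band m) v by rewrite Phi_indic//; exact: measurable_band.
have bP := Phi_bop he b2.
split=> [[z [ h1 h2]]|h].
  apply: eb_inj => m; rewrite (bopD bP) (bopD (eb_bop m)).
  have -> : eb m (P res2 y) = P res2 (P (cutf m) (P (cutf m) x)).
    rewrite eb_Phi// -Phi_eb// (h2) -(h1) Phi_eb//.
    by congr (P res2 (P _ z)); apply/funext => l; rewrite -mulrA band_mul.
  rewrite eb_Phi// ebP -!Phi_mul//; try (apply: bfunM => //).
  rewrite -PhiD; try (apply: bfunM => //; exact: bfunM).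
  congr (P); apply/funext => l; rewrite /cutf /res2 indicE.
  by case: (l \in band m) => /=; field; rewrite gt_eqF ?res2_gt0.
have : bfun (fun l : R => l * res2 l).
  have [m2] := b2; split; first exact: measurable_funM.
  exists 1 => l; rewrite normrM [`|res2 l|]ger0_norm ?invr_ge0; last exact/ltW/res2_gt0.
  rewrite ler_pdivrMr ?res2_gt0// -(real_normK (num_real l)).
  by have := sqr_ge0; move: `|l| => t; nra.
exists (P (fun l => l * res2 l) (x + y)); split=> m.
  rewrite eb_Phi// -[in RHS]h -Phi_mul//; congr (P).
  by apply/funext => l; rewrite mulrAC.
have yE : y = P (fun=> 1) (x + y) - P res2 (x + y) by rewrite Phi_cst rs1 h addrAC subrr add0r.
rewrite [in LHS]yE -PhiB//; last exact: bfun_cst.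
rewrite eb_Phi; last by apply: bfunB => //; exact: bfun_cst.
rewrite -Phi_mul//; congr (P); apply/funext => l; rewrite /cutf /res2.
by field; rewrite gt_eqF ?res2_gt0.
Qed.

Hypothesis hpos : forall x, e half x = x.

Lemma spec_res1 x y : spec_op (x, y) <-> P res1 (x + y) = x.
Proof.
have b1 := bfun_res1; have bi m := @bfun_indic _ (measurable_band m).
have := bfun_cutf; have := @measurable_half.
have ebP m v : eb m v = P \1_(band m) v by rewrite Phi_indic//; exact: measurable_band.
have bP := Phi_bop he b1.
split=> h.
  apply: eb_inj => m; rewrite (bopD bP) (bopD (eb_bop m)).
  have -> : eb m (P res1 y) = P res1 (P (cutf m) x).
    by rewrite eb_Phi// -Phi_eb// (h).
  rewrite eb_Phi// ebP -!Phi_mul// -PhiD; try exact: bfunM.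
  apply: (Phi_eq_on he (B := half)) => //; first by apply: bfunD; exact: bfunM.
  move=> l l0; rewrite /cutf /res1 (ger0_norm l0).
  by case: (l \in band m) => /=; field; rewrite -(ger0_norm l0).
move=> m.
have -> : y = P (fun=> 1) (x + y) - P res1 (x + y) by rewrite Phi_cst rs1 h addrAC subrr add0r.
rewrite -[in RHS]h -PhiB//; last exact: bfun_cst.
rewrite eb_Phi; last by apply: bfunB => //; exact: bfun_cst.
rewrite -Phi_mul//; apply: (Phi_eq_on he (B := half)) => //.
- by apply: bfunM => //; apply: bfunB => //; exact: bfun_cst.
- exact: bfunM.
move=> l l0; rewrite /cutf /res1 (ger0_norm l0).
by field; rewrite -(ger0_norm l0).
Qed.

Lemma cutf_nonneg m : nonneg (P (cutf m)).
Proof.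
move=> x; rewrite (Phi_eq_on he (g := fun l => cutf m l * \1_half l) (B := half))//.
- apply: Phi_nonneg => [|l]; first by apply: bfunM; [exact: bfun_cutf|apply: bfun_indic; exact: measurable_half].
  rewrite !indicE; case: (boolP (l \in half)) => [/set_mem l0|_]; rewrite ?mulr0// mulr1 mulr_ge0//.
- exact: bfun_cutf.
- by apply: bfunM; [exact: bfun_cutf|apply: bfun_indic; exact: measurable_half].
- exact: measurable_half.
- by move=> l l0; rewrite indicE (mem_set l0) mulr1.
Qed.

Lemma spec_positive : positive_op spec_op.
Proof.
split; [exact: spec_closed|exact: spec_adjoint|].
move=> [x y] h; rewrite dotE.
have sym v w : spec_op (v, w) -> rd y v = rd x w.
  move=> hv; have : adjoint_op spec_op (x, y) by rewrite spec_adjoint.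
    by move=> /(adjointP spec_closed) /(_ _ _ hv); rewrite (rdC y) rdC => ->.
have -> : rd y (hi x) = 0.
  have := sym _ _ (cli spec_closed h).
  by have := rdhi x y; rewrite rdC; lra.
rewrite lecR.
apply: (cvg_le_seq (cvg_cst 0) (hcvg_rd (spec_cvg h) (hcvg_cst x))) => m.
exact: cutf_nonneg.
Qed.

End SpecOp.

Implicit Types (t : R).

(** [G] is to be [f] of the operator sought. Its own spectral measure lives on ]0, 1], the point 0
    being null by injectivity; [g] is a right inverse of [f] there, so pushing forward by [g] gives
    the required measure on the half-line. *)
Lemma ppvm_of (G : H -> H) f g : bop G -> sa G -> nonneg G -> (forall x, rd (G x) x <= rd x x) ->
  (forall x, G x = 0 -> x = 0) -> measurable_fun setT g -> (forall l, 0 <= g l) -> bfun f ->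
  (forall l, 0 < l <= 1 -> f (g l) = l) ->
  exists e (he : pvm e), (forall x, e half x = x) /\ forall x, Phi he f x = G x.
Proof.
move=> bG sG nG G1 Gi mg g0 bf fg.
have [e0 [he0 [_ e01 hP]]] := spectral_contraction bG sG nG G1.
pose id1 (l : R) := l * \1_(`[0, 1]%classic) l.
have bi : bfun id1.
  apply: (@bfun_id_on id 1) => // l; rewrite /= in_itv => /andP[l0].
  by rewrite ger0_norm.
have PG : forall x, Phi he0 id1 x = G x.
  by apply: hP => // l l01; rewrite /id1 indicE mem_set ?mulr1 //= in_itv.
have z0 x : e0 [set 0] x = 0.
  apply: Gi; rewrite -PG -Phi_e// (_ : (fun => _) = fun=> 0) ?Phi_cst ?rs0//.
  by apply/funext => l; rewrite /id1 !indicE; case: (boolP (l \in [set 0])) => [/set_mem ->|]; rewrite ?mul0r ?mulr0.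
have e1 x : e0 `]0, 1]%classic x = x.
  have -> : `]0, 1]%classic = (`[0, 1]%classic : set R) `\` [set 0].
    apply/seteqP; split=> l; rewrite /= !in_itv /=.
      by move=> /andP[l0 ->]; rewrite (ltW l0); split=> // l00; rewrite l00 ltxx in l0.
    by move=> [/andP[l0 ->] /eqP l00]; rewrite lt_neqAle eq_sym l00 l0.
  rewrite pvm_D//; first by rewrite z0 subr0.
  by move=> l /= ->; rewrite in_itv /= lexx ler01.
exists (pushp e0 g), (push_pvm he0 mg); split=> x.
  rewrite /pushp (_ : g @^-1` half = setT) ?pvm_T//.
  by apply/seteqP; split=> l // _; exact: g0.
rewrite push_Phi// -PG; apply: (Phi_eq_on he0 (B := `]0, 1]%classic)) => //.
  exact: bfun_comp.
move=> l; rewrite /= in_itv => l01; rewrite fg// /id1 indicE mem_set ?mulr1//=.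
by rewrite in_itv /=; case/andP: l01 => /ltW> ->.
Qed.

Lemma ppvm_res1 (G : H -> H) : bop G -> sa G -> nonneg G -> (forall x, rd (G x) x <= rd x x) ->
  (forall x, G x = 0 -> x = 0) ->
  exists e (he : pvm e), (forall x, e half x = x) /\ forall x, Phi he res1 x = G x.
Proof.
(* The absolute value changes nothing on ]0, 1]; it keeps the image in the half-line elsewhere. *)
move=> bG sG nG G1 Gi; apply: (ppvm_of (g := fun l => `|l `^ (-1) - 1|)) => //.
- apply: measurableT_comp => //; apply: measurable_funB => //.
- exact: bfun_res1.
move=> l /andP[l0 l1]; rewrite /res1 normr_id powR_inv1 ?ltW// ger0_norm.
  by rewrite addrC subrK invrK.
by rewrite subr_ge0 invf_ge1.
Qed.

Lemma ppvm_res2 (G : H -> H) : bop G -> sa G -> nonneg G -> (forall x, rd (G x) x <= rd x x) ->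
  (forall x, G x = 0 -> x = 0) ->
  exists e (he : pvm e), (forall x, e half x = x) /\ forall x, Phi he res2 x = G x.
Proof.
move=> bG sG nG G1 Gi; apply: (ppvm_of (g := fun l => `|l `^ (-1) - 1| `^ 2^-1)) => //.
- apply: (measurableT_comp (measurable_powR _)).
  apply: measurableT_comp => //; apply: measurable_funB => //.
- exact: bfun_res2.
move=> l /andP[l0 l1]; rewrite /res2 powR12_sqrt// sqr_sqrtr// powR_inv1 ?ltW// ger0_norm.
  by rewrite addrC subrK invrK.
by rewrite subr_ge0 invf_ge1.
Qed.

Lemma res_scale D (q : H -> R) t l x : 0 < t -> res D (fun z => t * q z) l x <-> res D q (x + rs t^-1 (l - x)) x.
Proof.
move=> t0; have tn : t != 0 by rewrite gt_eqF.
split=> -[Dx h]; split=> // v Dv; have := h v Dv; rewrite [x + rs _ _]addrC addrK rdZl => e1.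
  by apply: (mulfI tn); rewrite e1; field.
by rewrite e1; field.
Qed.

(* A closed form is determined by the resolvent at one point, since the
   resolvent equation yields the others. *)
Lemma qform_eq D D' (q q' : H -> R) x : qform D q -> qform D' q' ->
  (forall l, resolvent D q l = resolvent D' q' l) -> D x -> D' x /\ q' x <= q x.
Proof.
move=> hq hq' e Dx; apply: (yosida_lsc hq') => n.
have t0 : 0 < n.+1%:R^-1 :> R by rewrite invr_gt0.
suff -> : yosida D' q' n x = yosida D q n x by exact: yosida_leq.
rewrite /yosida; congr (_ * rd (_ - _)).
have h := resolventP (qform_scale hq t0) x.
have /(res_scale _ _ _ _ t0) h1 := h.
apply: (resolvent_eq (qform_scale hq' t0)); apply/(res_scale _ _ _ _ t0).
have e1 := resolvent_eq hq h1; rewrite -[X in _ X]e1 e; exact: resolventP.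
Qed.

(** Positivity gives [|x|^2 + |T x|^2 <= |x + T x|^2], so the range of [1 + T] is closed. A vector
    [w] orthogonal to it yields the pair [(w, - w)] in the graph of the adjoint, which is [T], and
    positivity gives [w = 0]. Thus [G = (1 + T)^-1] is an everywhere defined injective
    contraction. *)
Lemma positive_spectral T : positive_op T ->
  exists e (he : pvm e), (forall x, e half x = x) /\ T = spec_op he.
Proof.
move=> [cX aX pX].
have pos x y : T (x, y) -> 0 <= rd y x.
  by move=> h; have := pX _ h; rewrite /= dotE /= => /andP[_].
have mono x y : T (x, y) -> rd x x + rd y y <= rd (x + y) (x + y).
  by move=> h; rewrite !rdE rdC; have := pos _ _ h; lra.
pose V : set H := [set z | exists x y, T (x, y) /\ z = x + y].
have sV : csub V.
  split=> [|_ _ [x [y [h ->]]] [x' [y' [h' ->]]]|c _ [x [y [h ->]]]|_ [x [y [h ->]]]].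
  - by exists 0, 0; split; [exact: cl0|rewrite addr0].
  - by exists (x + x'), (y + y'); split; [exact: clD|rewrite addrACA].
  - by exists (rs c x), (rs c y); split; [exact: clZ|rewrite rsDr].
  - by exists (hi x), (hi y); split; [exact: cli|rewrite hiD].
have cV : hclosed V.
  move=> w z hw wz.
  have hch : forall n : nat, exists v, T (v, w n - v).
    by move=> n; have [x [y [h ->]]] := hw n; exists x; rewrite addrAC subrr add0r.
  have [v hv] := choice hch.
  have [x vx] : exists x, hcvg v x.
    apply: hcomplete => eps e0; have e2 : 0 < eps / 2 by rewrite divr_gt0.
    move/hcvgP : wz => /(_ _ e2) [N hN]; exists N => m n Nm Nn.
    apply: (@le_trans _ _ (nrm (w m - w n))).
      apply/nrm_le_rd; have := mono _ _ (clB cX (hv m) (hv n)).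
      have -> : v m - v n + (w m - v m - (w n - v n)) = w m - w n.
        by apply: rd_inj => t; rewrite !rdE; lra.
      have := rd_ge0 (w m - v m - (w n - v n)); lra.
    have := nrm_tri z (w m) (w n); have := hN m Nm; have := hN n Nn; rewrite nrmBC; lra.
  exists x, (z - x); split; last by rewrite addKC.
  exact: (@cl_lim _ cX v (fun n => w n - v n) _ _ hv vx (hcvgB wz vx)).
have full z : V z.
  have [[bp sp ip] pV pid po] := projP sV cV.
  suff w0 : z - proj V z = 0 by rewrite (subr0_eq w0).
  have o (v u : H) : T (v, u) -> rd (z - proj V z) (v + u) = 0 by move=> h; apply: po; exists v, u.
  move: (z - proj V z) o => w o.
  have : adjoint_op T (w, - w).
    apply/(adjointP cX) => v u h; have := o _ _ h; rewrite rdDr rdC (rdC w); lra.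
  rewrite aX => /pos; rewrite rdNl => h; apply: rd_eq0; apply/le_anti.
  by rewrite rd_ge0; lra.
have hch z : exists x, T (x, z - x).
  by have [x [y [h ->]]] := full z; exists x; rewrite addrAC subrr add0r.
have [G hG] := choice hch.
have Gu z x y : T (x, y) -> z = x + y -> G z = x.
  move=> h ->; have := mono _ _ (clB cX (hG (x + y)) h).
  rewrite (_ : G (x + y) - x + _ = 0); last by apply: rd_inj => t; rewrite rd0l !rdE; lra.
  rewrite rd0l => h1; apply: subr0_eq; apply: rd_eq0; apply/le_anti.
  by rewrite rd_ge0; have := rd_ge0 (x + y - G (x + y) - y); lra.
have GE x y : T (x, y) <-> G (x + y) = x.
  split=> [h|e]; first exact: Gu h _.
  by have := hG (x + y); rewrite e addrAC subrr add0r.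
have bG : bop G.
  apply: (@bop_intro _ _ _ 1) => [x y|c x|x|x].
  - by apply: (Gu _ _ _ (clD cX (hG x) (hG y))); rewrite addrACA !addKC.
  - by apply: (Gu _ _ _ (clZ cX c (hG x))); rewrite -rsDr addKC.
  - by apply: (Gu _ _ _ (cli cX (hG x))); rewrite -hiD addKC.
  - rewrite mul1r; apply/nrm_le_rd; have := mono _ _ (hG x); rewrite addKC.
    by have := rd_ge0 (x - G x); lra.
have sG : sa G.
  move=> x y; have : adjoint_op T (G y, y - G y) by rewrite aX.
  by move=> /(adjointP cX) /(_ _ _ (hG x)); rewrite rdBl; lra.
have nG : nonneg G.
  by move=> x; have := pos _ _ (hG x); rewrite rdBl rdC; have := rd_ge0 (G x); lra.
have G1 x : rd (G x) x <= rd x x.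
  have := pos _ _ (hG x); have := rd_ge0 (x - G x); rewrite !rdE; lra.
have Gi x : G x = 0 -> x = 0.
  by move=> e; have := hG x; rewrite e subr0; case: cX => _ _ h _ _; exact: h.
have [e [he [e0 hP]]] := ppvm_res1 bG sG nG G1 Gi; exists e, he; split=> //.
by apply/seteqP; split=> -[x y]; rewrite GE spec_res1// hP.
Qed.

(** * Spectral measures of positive operators, and absolute values *)

Section SpectralMeasure.
Variables (e : set R -> H -> H) (he : pvm e).
Local Notation pm x := (pmass x he : {measure set (R) -> \bar R}).

Lemma pint_EFin x f : bfun f -> (\int[pmass x he]_l (f l)%:E)%E = (pint he x f)%:E.
Proof. by move=> bf; rewrite fineK//; exact: (integrable_fin_num measurableT (bfun_integrable he x bf)). Qed.

Lemma cutf_sq x m : rd (Phi he (@cutf m) x) (Phi he (cutf m) x) = pint he x (fun l => cutf m l ^+ 2).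
Proof.
have b := @bfun_cutf m; have b2 : bfun (fun l : R => cutf m l ^+ 2) by exact: bfunM.
by rewrite -(Phi_rd he x b2) (Phi_mul he x b b) (Phi_sa he b) rdC.
Qed.

Lemma cutf_sqE m (l : R) : cutf m l ^+ 2 = l ^+ 2 * \1_(band m) l.
Proof. by rewrite exprMn indicE; case: (l \in band m); rewrite ?expr1n ?expr0n. Qed.

Lemma cutf_cvg (l : R) : cutf m l @[m --> \oo] --> l.
Proof.
apply/cvgrPdist_le => eps; exists (Num.truncn `|l|).+1 => // m hm.
have h : `|l| <= m%:R by apply: le_trans (ltW (truncnS_gt _)) _; rewrite ler_nat.
by rewrite /cutf indicE bandE h mulr1 subrr normr0; exact: ltW.
Qed.

Lemma spec_domE x : domain_op (spec_op he) x <-> (\int[spectral_mass e x]_l (l ^+ 2)%:E < +oo)%E.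
Proof.
have nd (l : R) m n : (m <= n)%N -> cutf m l ^+ 2 <= cutf n l ^+ 2.
  move=> mn; rewrite !cutf_sqE ler_wpM2l ?sqr_ge0// !indicE !bandE.
  by case: (leP `|l| m%:R) => h; rewrite// (le_trans h) ler_nat.
have msq : measurable_fun setT (fun l : R => (l ^+ 2)%:E).
  exact/measurable_EFinP.
have mc m : measurable_fun setT (fun l : R => (cutf m l ^+ 2)%:E).
  by apply/measurable_EFinP; apply: measurable_funX; case: (@bfun_cutf m).
have le_m m : ((pint he x (fun l => cutf m l ^+ 2))%:E <= \int[pmass x he]_l (l ^+ 2)%:E)%E.
  rewrite -pint_EFin; last by apply: bfunM; exact: bfun_cutf.
  apply: ge0_le_integral => //= [l|l]; rewrite lee_fin ?sqr_ge0//.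
  by rewrite cutf_sqE ler_piMr ?sqr_ge0.
split=> [[[x0 y] h <-]|h]; last first.
  apply: (@spec_domP _ he _ (fine (\int[pmass x he]_l (l ^+ 2)%:E)%E)) => m.
  rewrite cutf_sq -lee_fin [X in (_ <= X)%E]fineK; first exact: le_m.
  by rewrite ge0_fin_numE// ; apply: integral_ge0 => l; rewrite lee_fin sqr_ge0.
have [K hK] : exists K, forall m, pint he x0 (fun l => cutf m l ^+ 2) <= K.
  exists (rd y y) => m; rewrite -cutf_sq -(h) pvm_rd//; last exact: measurable_band.
  exact: orthoproj_le (pvm_proj he (measurable_band m)).
apply: le_lt_trans (ltry K).
have g0 : forall (n : nat) (l : R), setT l -> (0 <= (cutf n l ^+ 2)%:E)%E.
  by move=> n l; rewrite lee_fin sqr_ge0.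
have gnd : forall l : R, setT l -> {homo (fun m => (cutf m l ^+ 2)%:E) : n m / (n <= m)%N >-> (n <= m)%E}.
  by move=> l _ m n mn; rewrite lee_fin nd.
have := @cvg_monotone_convergence _ _ _ (pm x0) _ measurableT (fun m l => (cutf m l ^+ 2)%:E) mc g0 gnd.
rewrite (eq_integral (fun l : R => ((l : R) ^+ 2)%:E)); last first.
  move=> l _; apply/cvg_lim => //; apply: cvg_EFin; first exact: nearW.
  by apply: cvgM; exact: cutf_cvg.
move=> cv; apply: (cvge_to_le cv) => //; apply: nearW => m.
by rewrite pint_EFin ?lee_fin//; apply: bfunM; exact: bfun_cutf.
Qed.

(** The truncations [cutf m] converge and are dominated by [1 + l^2], which is integrable because
    [x] lies in the domain. *)
Lemma spec_formE x y : spec_op he (x, y) -> rd y x = fine (\int[spectral_mass e x]_l l%:E)%E.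
Proof.
move=> h; have /spec_domE dx : domain_op (spec_op he) x by exists (x, y).
have mi : measurable_fun setT (fun l : R => l%:E) by exact/measurable_EFinP.
have b1 := bfun_integrable he x (@bfun_cst 1).
have i2 : (pm x).-integrable setT (fun l => (l ^+ 2)%:E).
  apply/integrableP; split; first exact/measurable_EFinP.
  rewrite (eq_integral (fun l : R => ((l : R) ^+ 2)%:E)); first exact: dx.
  by move=> l; rewrite gee0_abs// lee_fin sqr_ge0.
have ig := integrableD measurableT b1 i2.
have le_g (l : R) : `|l| <= 1 + l ^+ 2.
  by rewrite -(real_normK (num_real l)); move: `|l| normr_ge0 => t; nra.
have cv := @dominated_cvg _ _ _ (pm x) _ measurableT (fun m l => (cutf m l)%:E) (fun l => l%:E) _
  (fun m => (iffRL (measurable_EFinP _ _) (proj1 (@bfun_cutf m)))) _ _ ig.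
have c2 : (\int[pmass x he]_l (cutf m l)%:E)%E @[m --> \oo] --> (\int[pmass x he]_l l%:E)%E.
  apply: cv => [l _|l|m l _] //.
    by apply: cvg_EFin; [exact: nearW|exact: cutf_cvg].
  rewrite lee_fin; apply: le_trans (le_g l).
  by rewrite normrM normr_nat ler_piMr// lern1 leq_b1.
have li : (pm x).-integrable setT (fun l => l%:E).
  apply: le_integrable ig => // l _; apply: le_trans (le_g l) _.
  exact: ler_norm.
have fi := integrable_fin_num measurableT li.
have c4 : (fine \o (fun => (\int[pmass x he]_l (cutf m l)%:E)%E)) m @[m --> \oo] --> fine (\int[pmass x he]_l l%:E)%E.
  by apply: fine_cvg; rewrite fineK.
apply: cvg_unique (hcvg_rd (spec_cvg h) (hcvg_cst x)) _ => //.
rewrite (_ : (fun => _) = fine \o (fun m => (\int[pmass x he]_l (cutf m l)%:E)%E))//.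
by apply/funext => m; rewrite ?Phi_rd//; exact: bfun_cutf.
Qed.

Lemma hcvg_series (u : nat -> H) x : (series u @ \oo --> x) <-> hcvg (series u) x.
Proof. exact: iff_sym (hcvg_cvg _ _). Qed.

Lemma spec_measure : positive_op (spec_op he) -> spectral_measure (spec_op he) e.
Proof.
move=> hp; split.
- by move=> B; exact: pvm_bop.
- by move=> B mB; apply/funext => x; exact: pvm_id.
- by move=> B mB; apply/(is_adjointE (pvm_bop he mB) (pvm_bop he mB)); exact: pvm_sa.
- by apply/funext => x; exact: pvm_T.
- by move=> B C mB mC; apply/funext => x; exact: pvm_I.
- move=> F mF tF x; apply/hcvg_series.
  pose U n := \big[setU/set0]_(i < n) F i.
  have mU n : measurable (U n) by apply: bigsetU_measurable.
  have UE n : series (fun n => e (F n) x) n = e (U n) x.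
    rewrite /series /= big_mkord /U; elim: n => [|n IH]; first by rewrite !big_ord0 pvm0.
    rewrite !big_ord_recr IH pvm_U//; first exact: mU.
    apply/seteqP; split=> t []; rewrite -bigcup_mkord => -[i /= ltin Fi] Fn.
    by have := tF i n I I (ex_intro _ t (conj Fi Fn)) => ein; rewrite ein ltnn in ltin.
  have -> : \bigcup_n F n = \bigcup_n U n.
    apply/seteqP; split=> [t [n]|t [n _]]; first by exists n.+1 => //; rewrite /U big_ord_recr; right.
    by rewrite /U -bigcup_mkord => -[i _]; exists i.
  rewrite (_ : series _ = fun n => e (U n) x); last exact/funext.
  by apply: pvm_cvg => // m n mn; apply/subsetPset; exact: subset_bigsetU.
- by move=> x; exact: spec_domE.
- move=> [x y] h; rewrite dotE (spec_formE h); have := positive_op_ge0 hp h.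
  by rewrite dotE => /andP[/eqP h0 _]; congr Complex.
Qed.

End SpectralMeasure.

Lemma pvm_of_measure T e : spectral_measure T e -> pvm e.
Proof.
move=> [bB iB aB eT eI eS _ _].
have pB B : measurable B -> orthoproj (e B).
  move=> mB; split; [exact: bB|exact/(is_adjointE (bB _ mB) (bB _ mB))/aB|].
  by move=> x; exact: (congr1 (@^~ x) (iB _ mB)).
have idB x B : measurable B -> rd (e B x) (e B x) = rd (e B x) x by move=> mB; apply/orthoproj_rd/pB.
have s0 x : e set0 x = 0.
  have h := eS (fun=> set0) (fun=> measurable0) (fun i j _ _ => ltac:(by move=> [t []])) x.
  have h2 : series (fun=> e set0 x) @ \oo --> e set0 x by rewrite bigcup0 in h.
  have := @cvg_series_cvg_0 _ _ (fun=> e set0 x); move=> /(_ (cvgP _ h2)) h3.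
  by apply: hcvg_unique (hcvg_cst _) _; exact/hcvg_cvg.
have m0 x : spectral_mass e x set0 = 0%E by rewrite /spectral_mass s0 normr0 expr0n.
have mE x B : measurable B -> spectral_mass e x B = (rd (e B x) x)%:E.
  by move=> mB; rewrite /spectral_mass -/(nrm _) -rdxx idB.
have mge x B : (0 <= spectral_mass e x B)%E by rewrite lee_fin sqr_ge0.
have msig x : semi_sigma_additive (spectral_mass e x : set (measurableTypeR R) -> \bar R).
  move=> F mF tF mU; have /hcvg_series h := eS F mF tF x.
  rewrite mE//; apply: (@cvg_trans _ ((rd (series (fun n => e (F n) x) n) x)%:E @[n --> \oo])); last first.
    by apply: cvg_EFin; [exact: nearW|exact: hcvg_rd h (hcvg_cst x)].
  apply: near_eq_cvg; apply: nearW => n; rewrite /series /=.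
  elim: n => [|n IH]; first by rewrite !big_geq// rd0l.
  by rewrite !big_nat_recr//= rdDl EFinD IH (mE _ _ (mF n)).
split=> // [x|B C x mB mC|x]; [by rewrite eT|by rewrite eI|].
pose M := isMeasure.Build _ _ _ (spectral_mass e x : set (measurableTypeR R) -> \bar R) (m0 x) (mge x) (@msig x).
pose mu : {measure set (measurableTypeR R) -> \bar R} := HB.pack (spectral_mass e x : set (measurableTypeR R) -> \bar R) M.
have mT : (mu setT < +oo)%E by rewrite /mu /= mE// ltry.
have muE B : mu B = spectral_mass e x B by [].
by apply: dyn_eq (dyn_measure mT) => B mB; rewrite muE mE.
Qed.

(** [spectral_proj] picks some spectral measure, so every possible choice must be identified. Domain
    and quadratic form agree with those of [spec_op he]; polarization of symmetric operators and
    density of the domain give equality, and positivity of [T] makes the negative half-line null. *)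
Lemma spec_of_measure T e : positive_op T -> spectral_measure T e ->
  exists he : pvm e, (forall x, e half x = x) /\ T = spec_op he.
Proof.
move=> hT hs; have he := pvm_of_measure hs; exists he.
have [cT aT _] := hT; have cS := spec_closed he; have aS := spec_adjoint he.
have dE x : domain_op T x <-> domain_op (spec_op he) x.
  by apply: iff_trans (spectral_domain hs x) _; apply: iff_sym; exact: spec_domE.
have fE x : domain_op T x -> rd (app T x) x = rd (app (spec_op he) x) x.
  move=> Dx; have /dE Dx' := Dx; rewrite (spec_formE (appP Dx')).
  by have := spectral_form hs (appP Dx); rewrite dotE => -[].
have symE A : closed_op A -> adjoint_op A = A -> forall x v, domain_op A x -> domain_op A v ->
    4 * rd (app A x) v = rd (app A (x + v)) (x + v) - rd (app A (x - v)) (x - v).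
  move=> cA aA x v Dx Dv.
  rewrite (appE cA (clD cA (appP Dx) (appP Dv))) (appE cA (clB cA (appP Dx) (appP Dv))) !rdE.
  have : adjoint_op A (x, app A x) by rewrite aA; exact: appP.
  by move=> /(adjointP cA) /(_ _ _ (appP Dv)); rewrite (rdC v); lra.
have TE x : domain_op T x -> app T x = app (spec_op he) x.
  move=> Dx; have /dE Dx' := Dx; apply: rd_inj => v.
  have [w [Dw wv]] := cl_dense cT v.
  apply: cvg_unique (hcvg_rd (hcvg_cst _) wv) _ => //.
  rewrite (_ : (fun => _) = fun n => rd (app (spec_op he) x) (w n)); first exact: hcvg_rd (hcvg_cst _) wv.
  apply/funext => n; have Dn := Dw n; have /dE Dn' := Dn; have hD := cl_sub cT.
  have := symE _ cT aT _ _ Dx Dn; have := symE _ cS aS _ _ Dx' Dn'.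
  by rewrite !fE; [lra|exact: csubB|exact: csubD].
have TS : T = spec_op he.
  apply/seteqP; split=> -[x y] h.
    have Dx : domain_op T x by exists (x, y).
    by rewrite -(appE cT h) TE//; apply: appP; apply/dE.
  have Dx : domain_op T x by apply/dE; exists (x, y).
  by rewrite -(appE cS h) -TE//; exact: appP.
split=> // x.
(* Bounded sets exhausting the negative reals: on the range of [e (B n)] the form is at most
   [- |z|^2 / (n + 1)], against positivity. *)
pose B n : set R := `[- n%:R, - n.+1%:R^-1]%classic.
have mB n : measurable (B n) by exact: measurable_itv.
have B0 n z : e (B n) z = z -> z = 0.
  move=> ez; have Bb : B n `<=` band n.
    move=> l; rewrite /B /= in_itv /band /= => /andP[l1 l2].
    have : 0 < n.+1%:R^-1 :> R by rewrite invr_gt0.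
    by rewrite ler_norml; move: l2; move: (n.+1%:R^-1) => t; lra.
  have bz : e (band n) z = z by rewrite -ez (pvm_sub he _ (mB n) (@measurable_band n)).
  have := spec_eb he n z; rewrite bz -TS => /(positive_op_ge0 hT); rewrite dotE => /andP[_ h1].
  have [|_ h2] := @Phi_bounds e he (@cutf n) (B n) z (- n%:R) (- n.+1%:R^-1) (@bfun_cutf n) (mB n) _ ez.
    by move=> l Bl; rewrite /cutf indicE (mem_set (Bb _ Bl)) mulr1.
  have := le_trans h1 h2; rewrite mulNr oppr_ge0 pmulr_rle0// => h3.
  by apply: rd_eq0; apply/le_anti; rewrite rd_ge0 h3.
have Bz n z : e (B n) z = 0 by apply: (B0 n); rewrite pvm_id.
have nd : nondecreasing_seq B.
  move=> m n mn; apply/subsetPset => l; rewrite /B /= !in_itv => /andP[l1 l2]; apply/andP; split.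
    by apply: le_trans l1; rewrite lerN2 ler_nat.
  by apply: le_trans l2 _; rewrite lerN2 lef_pV2 ?posrE// ler_nat.
have BU : \bigcup_n B n = ~` half.
  apply/seteqP; split=> [l [n _]|l]; rewrite /B /= ?in_itv.
    move=> /andP[_ h]; apply/negP; rewrite -ltNge; apply: le_lt_trans h _.
    by rewrite oppr_lt0.
  move/negP; rewrite -ltNge => l0; have l0' : 0 < - l by rewrite oppr_gt0.
  have [N hN] := inv_small l0'.
  exists (maxn N (Num.truncn `|l|).+1) => //=; rewrite in_itv /=; apply/andP; split.
    rewrite lerNl; apply: le_trans (_ : `|l| <= _); first by rewrite -normrN ler_norm.
    by apply: le_trans (ltW (truncnS_gt _)) _; rewrite ler_nat leq_maxr.
  by rewrite lerNr; exact/hN/leq_maxl.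
have : e (~` half) x = 0.
  rewrite -BU; apply: hcvg_unique (pvm_cvg he x mB nd) _.
  by rewrite (_ : (fun => _) = fun=> 0); [exact: hcvg_cst|exact/funext].
by rewrite (pvm_C he x (@measurable_half)) => /subr0_eq.
Qed.

Lemma dyn_rd e x y : pvm e -> dyn (fun B => rd (e B x) y).
Proof.
move=> he; have h := pvm_dyn he.
apply: dyn_eq (dynZ 4^-1 (dynB (h (x + y)) (h (x - y)))) => B mB.
have b := pvm_bop he mB; rewrite (bopD b) (bopB b) !rdE (rdC (e B y)) -(pvm_sa he mB).
by move: (rd (e B x)) (rd (e B x)) (rd) => ? ? ?; lra.
Qed.

(** [slow_Phi] reaches sublevel sets of [res2], which on the half-line are closed half-lines; an
    open ray is their increasing limit. *)
Lemma ray_limit e v x : pvm e -> (forall z, e half z = z) -> 0 <= v ->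
  hcvg (fun n => e [set l | res2 l <= res2 (v + n.+1%:R^-1)] x) (e (ray v) x).
Proof.
move=> he e0 v0; pose C n : set R := [set l | res2 l <= res2 (v + n.+1%:R^-1)].
have mC n : measurable (C n).
  rewrite (_ : C n = setT `&` res2 @^-1` `]-oo, res2 (v + n.+1%:R^-1)]%classic).
    by case: (@bfun_res2) => mg _; apply: mg => //.
  by rewrite setTI.
have CE n l : 0 <= l -> C n l <-> v + n.+1%:R^-1 <= l.
  move=> l0; rewrite /C /= /res2 lef_pV2 ?posrE ?res2_gt0// lerD2l ler_sqr ?nnegrE//.
  by rewrite addr_ge0.
have : nondecreasing_seq C.
  move=> m n mn; apply/subsetPset => l; rewrite /C => h; apply: le_trans h _.
  rewrite lef_pV2 ?posrE ?res2_gt0// lerD2l ler_sqr ?nnegrE ?addr_ge0// lerD2l.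
  by rewrite lef_pV2 ?posrE// ler_nat.
have mh := @measurable_half; have mr := @measurable_ray.
have -> : e (ray v) x = e (\bigcup_n C n) x.
  have mU : measurable (\bigcup_n C n) by exact: bigcupT_measurable.
  rewrite -[x in e (ray v) x]e0 -[x in e (\bigcup_n _) x]e0 -!pvm_I//; congr (e).
  apply/seteqP; split=> l [h l0]; split=> //; last first.
    by case: h => n _ /(CE n _ l0); apply: lt_le_trans; rewrite ltrDl.
  have lv : 0 < l - v by rewrite subr_gt0.
  have [N hN] := inv_small lv.
  by exists N => //; apply/(CE N _ l0); rewrite -lerBrDl; exact: hN.
exact: pvm_cvg.
Qed.

Lemma ray_neg e v x : pvm e -> (forall z, e half z = z) -> v < 0 -> e (ray v) x = x.
Proof.
move=> he e0 v0; rewrite -[x in LHS]e0 pvm_sub//; [exact: measurable_half|exact: measurable_ray|].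
by move=> l; exact: lt_le_trans.
Qed.

(** What commutes with the resolvent commutes with its projections [slow], hence with the
    projections of rays, and uniqueness of set functions extends this to all measurable sets. *)
Lemma res2_comm e (he : pvm e) u : (forall z, e half z = z) -> bop u ->
  (forall z, Phi he res2 (u z) = u (Phi he res2 z)) ->
  forall B x, measurable B -> e B (u x) = u (e B x).
Proof.
move=> e0 bu hc B x mB; have b2 := @bfun_res2; have [bG sG _] := PhiP he b2.
apply: rd_inj => y; rewrite (adjr _ _ bu).
apply: (dyn_unique (dyn_rd (u x) y he) (dyn_rd x (adj u y) he)) mB => v.
rewrite -(adjr _ _ bu); congr (rd).
have [v0|v0] := ltP v 0; first by rewrite !ray_neg.
apply: hcvg_unique (ray_limit (u x) he e0 v0) _.
rewrite (_ : (fun => _) = u \o (fun n => e [set l | res2 l <= res2 (v + n.+1%:R^-1)] x)).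
  by apply: (bop_cvg bu); exact: ray_limit.
by apply/funext => n /=; rewrite -!(slow_Phi he _ _ b2); apply: (slow_comm bG sG _ bu) => z.
Qed.

Lemma res2_unique e e' (he : pvm e) (he' : pvm e') : (forall z, e half z = z) ->
  (forall z, e' half z = z) -> (forall z, Phi he res2 z = Phi he' res2 z) ->
  forall B x, measurable B -> e B x = e' B x.
Proof.
move=> e0 e0' hP B x mB; have b2 := @bfun_res2.
apply: rd_inj => y; apply: (dyn_unique (dyn_rd x y he) (dyn_rd x y he')) mB => v.
congr (rd); have [v0|v0] := ltP v 0; first by rewrite !ray_neg.
apply: hcvg_unique (ray_limit x he e0 v0) _.
rewrite (_ : (fun => _) = (fun n => e' [set l | res2 l <= res2 (v + n.+1%:R^-1)] x)); first exact: ray_limit.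
apply/funext => n; rewrite -(slow_Phi he _ _ b2) -(slow_Phi he' _ _ b2); by rewrite (funext hP).
Qed.

Local Notation qT T := (fun x => rd (app T x) (app T x)).

Lemma spec_abs e (he : pvm e) A : (forall z, e half z = z) -> positive_op A ->
  comp_op A A = comp_op (spec_op he) (spec_op he) ->
  forall B x, measurable B -> spectral_proj A B x = e B x.
Proof.
move=> e0 hA AA B x mB.
have [e1 [he1 [e10 A1]]] := positive_spectral hA.
have ex : exists e', spectral_measure A e' by exists e1; rewrite A1; apply: spec_measure; rewrite -A1.
have hs : spectral_measure A (spectral_proj A) by exact: xgetPex.
have [he2 [e20 A2]] := spec_of_measure hA hs.
apply/esym; apply: (@res2_unique _ _ he he2 e0 e20 _ B x mB) => z.
have h : comp_op (spec_op he) (spec_op he) (Phi he res2 z, z - Phi he res2 z) by apply/spec_comp; rewrite addKC.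
have h2 : comp_op (spec_op he2) (spec_op he2) (Phi he res2 z, z - Phi he res2 z) by rewrite -A2 AA.
by move/spec_comp : h2; rewrite addKC.
Qed.

(** [abs_op T] is a chosen positive square root of [T^* T], but the resolvent of [|T x|^2]
    determines its spectral projections. Distribution functions are therefore computed from that
    resolvent. *)
Lemma abs_spectral T : closed_op T ->
  exists e (he : pvm e), [/\ forall z, e half z = z,
    forall z, Phi he res2 z = resolvent (domain_op T) (qT T) z &
    forall tau v, distribution_op tau T v = tau (e (ray v))].
Proof.
move=> cT; have hq := qform_cl cT.
have dD x : domain_op T x -> resolvent (domain_op T) (qT T) x = 0 -> x = 0.
  move=> Dx e; apply: rd_eq0; exact: (resolvent_ker hq).
have Gi x : resolvent (domain_op T) (qT T) x = 0 -> x = 0.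
  move=> e; have [w [Dw wx]] := cl_dense cT x; apply: rd_eq0.
  by apply: (rd_lim0 wx) => n; rewrite rdC; exact: (resolvent_ker hq).
have [e [he [e0 hP]]] := ppvm_res2 (resolvent_bop hq) (resolvent_sa hq) (resolvent_nonneg hq)
  (resolvent_le hq) Gi.
have cE : comp_op (spec_op he) (spec_op he) = comp_op (adjoint_op T) T.
  by apply/seteqP; split=> -[x y]; rewrite spec_comp adjoint_res// hP.
have ex : exists A, positive_op A /\ comp_op A A = comp_op (adjoint_op T) T.
  by exists (spec_op he); split=> //; exact: spec_positive.
have [hA AA] : positive_op (abs_op T) /\ comp_op (abs_op T) (abs_op T) = comp_op (adjoint_op T) T.
  exact: (xgetPex set0 ex).
exists e, he; split=> // tau v; rewrite /distribution_op -rayE; congr tau; apply/funext => x.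
by apply: spec_abs => //; [rewrite AA|exact: measurable_ray].
Qed.

Lemma spec_resolvent e (he : pvm e) z :
  resolvent (domain_op (spec_op he)) (qT (spec_op he)) z = Phi he res2 z.
Proof.
have cS := spec_closed he.
have h : comp_op (adjoint_op (spec_op he)) (spec_op he) (Phi he res2 z, z - Phi he res2 z).
  by rewrite spec_adjoint; apply/spec_comp; rewrite addKC.
by move/(adjoint_res _ _ cS) : h; rewrite addKC.
Qed.

Lemma spec_distribution e (he : pvm e) tau v : (forall z, e half z = z) ->
  distribution_op tau (spec_op he) v = tau (e (ray v)).
Proof.
move=> e0; have [e' [he' [e0' hP' ->]]] := abs_spectral (spec_closed he).
congr tau; apply/funext => x; apply: (@res2_unique _ _ he' he e0' e0 _ _ x (measurable_ray v)) => z.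
by rewrite hP' spec_resolvent.
Qed.

Lemma abs_form T e (he : pvm e) x : closed_op T ->
  (forall z, Phi he res2 z = resolvent (domain_op T) (qT T) z) ->
  (domain_op T x <-> domain_op (spec_op he) x) /\
  (domain_op T x -> rd (app T x) (app T x) = rd (app (spec_op he) x) (app (spec_op he) x)).
Proof.
move=> cT hP; have hq := qform_cl cT; have hq' := qform_cl (spec_closed he).
have e1 l : resolvent (domain_op T) (qT T) l = resolvent (domain_op (spec_op he)) (qT (spec_op he)) l.
  by rewrite spec_resolvent.
have h1 := qform_eq hq hq' e1; have h2 := qform_eq hq' hq (fun l => esym (e1 l)).
split=> [|Dx]; first by split=> [/h1[]|/h2[]].
by apply/le_anti; rewrite (h2 _ (h1 _ Dx).1).2 (h1 _ Dx).2.
Qed.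

Implicit Types (a b : H -> H).

(** The left side is the minimum over [z] of the right side, attained at [G x] ([inv1p_eq]).
    Comparing minima shows that larger forms have smaller resolvents. *)
Lemma inv1p_min a G x z : bop a -> sa a -> nonneg a -> (forall x, G x + a (G x) = x) ->
  rd (x - G x) x <= rd (a z) z + rd (z - x) (z - x).
Proof.
move=> ba sa' na hG; move: (G x) (hG x) => g <-; rewrite -(addKC g z); move: (z - g) => v.
have := na v; have := rd_ge0 v; rewrite (bopD ba).
rewrite !rdE (sa' v g); lra.
Qed.

Lemma inv1p_eq a G x : (forall x, G x + a (G x) = x) ->
  rd (x - G x) x = rd (a (G x)) (G x) + rd (G x - x) (G x - x).
Proof. by move=> hG; move: (G x) (hG x) => g <-; rewrite !rdE; lra. Qed.

Lemma inv1p_anti a a' G G' x : bop a -> sa a -> nonneg a -> bop a' -> sa a' ->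
  (forall x, G x + a (G x) = x) -> (forall x, G' x + a' (G' x) = x) ->
  (forall x, rd (a x) x <= rd (a' x) x) -> rd (G' x) x <= rd (G x) x.
Proof.
move=> ba sa1 na ba' sa2 hG hG' aa'.
have h1 := inv1p_min x (G' x) ba sa1 na hG; have h2 := inv1p_eq x hG'.
by have := aa' (G' x); rewrite rdBl in h1; rewrite rdBl in h2; lra.
Qed.

End Spectral.

Section Semifinite.
Context {R : realType} {H : hilbertSpace R}.
Variables (M : set (H -> H)) (tau : (H -> H) -> \bar R).
Hypotheses (hM : von_neumann_algebra M) (htau : nsf_trace M tau).
Local Notation leb := (@lebesgue_measure R).

(** * The algebra, its positive cone and the trace *)

Section Trace.
Implicit Types (x y z : H) (a b u : H -> H) (e : set R -> H -> H).

Definition cM u := bop u /\ forall a, M a -> forall x, u (a x) = a (u x).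

Lemma commutantE u : commutant M u <-> cM u.
Proof.
split=> -[bu h]; split=> // a Ma; last by apply/funext => x /=; rewrite h.
by move=> x; have := congr1 (@^~ x) (h a Ma).
Qed.

Lemma inM a : M a <-> bop a /\ forall u, cM u -> forall x, a (u x) = u (a x).
Proof.
rewrite -{1}(vN_bicommutant hM); split=> -[ba h]; split=> // u hu.
  by move=> x; move/commutantE : hu => /h /(congr1 (@^~ x)) /= ->.
by apply/funext => x /=; rewrite h//; exact/commutantE.
Qed.

Lemma M_bop a : M a -> bop a. Proof. by case/inM. Qed.

Lemma M_adj a : M a -> M (adj a).
Proof.
move=> Ma; have ba := M_bop Ma; have [b [Mb ab]] := vN_star hM Ma.
by rewrite (@adj_unique _ _ a b ba (proj1 (is_adjointE ba (M_bop Mb)) ab)).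
Qed.

Lemma cM_adj u : cM u -> cM (adj u).
Proof.
move=> [bu h]; split; first exact: adj_bop.
move=> a Ma x; apply: rd_inj => z; have Ma' := M_adj Ma; have ba := M_bop Ma.
by rewrite (adjl _ _ bu) !(adjr _ _ ba) -h// adjl.
Qed.

Lemma M_id : M id. Proof. by apply/inM; split=> //; exact: bop_id. Qed.
Lemma M_zero : M (fun=> 0).
Proof. by apply/inM; split=> [|u [bu]]; [exact: bop_zero|rewrite bop0]. Qed.

Lemma M_add a b : M a -> M b -> M (fun x => a x + b x).
Proof.
move=> /inM[ba ha] /inM[bb hb]; apply/inM; split; first exact: bop_add.
by move=> u hu x; rewrite ha// hb// (bopD (proj1 hu)).
Qed.

Lemma M_rs c a : M a -> M (fun x => rs c (a x)).
Proof.
move=> /inM[ba ha]; apply/inM; split; first exact: bop_rs.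
by move=> u hu x; rewrite ha// (boprs (proj1 hu)).
Qed.

Lemma M_sub a b : M a -> M b -> M (fun x => a x - b x).
Proof.
move=> Ma /(M_rs) /(M_add Ma) h; rewrite (_ : (fun => _) = (fun x => a x + rs (-1) (b x)))//.
by apply/funext => x; rewrite rsNl rs1.
Qed.

Lemma M_comp a b : M a -> M b -> M (fun x => a (b x)).
Proof.
move=> /inM[ba ha] /inM[bb hb]; apply/inM; split; first exact: bop_comp.
by move=> u hu x; rewrite hb// ha.
Qed.

Lemma M_lim (a : nat -> H -> H) b K : (forall n, M (a n)) ->
  (forall n x, nrm (a n x) <= K * nrm x) -> (forall x, hcvg (a^~ x) (b x)) -> M b.
Proof.
move=> Ma aK ab; apply/inM; split; first by apply: bop_lim aK ab => n; exact: M_bop.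
move=> u hu x; apply: hcvg_unique (ab _) _.
rewrite (_ : (fun => _) = u \o (a^~ x)); first exact: (bop_cvg (proj1 hu)).
by apply/funext => n; case/inM : (Ma n) => _ ->.
Qed.

Lemma M_proj (V : set H) : csub V -> hclosed V -> (forall u x, cM u -> V x -> V (u x)) -> M (proj V).
Proof.
move=> sV cV hV; have [[bP _ _] _ _ _] := projP sV cV; apply/inM; split=> // u hu.
by apply: proj_commute => // [|z|z]; [exact: proj1 hu|exact: hV|apply/hV/cM_adj].
Qed.

Definition Mp a := [/\ M a, sa a & nonneg a].

Lemma MpE a : positive_part M a <-> Mp a.
Proof.
split=> [[Ma]|[Ma]].
  by move/(proj1 (le_op0P (M_bop Ma))) => [].
by split=> //; apply/(le_op0P (M_bop Ma)).
Qed.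

Lemma Mp0 : Mp (fun=> 0).
Proof. by split=> [|x y|x]; rewrite ?rd0l ?rd0r//; exact: M_zero. Qed.

Lemma Mp_id : Mp id.
Proof. by split=> [|//|x]; [exact: M_id|exact: rd_ge0]. Qed.

Lemma Mp_add a b : Mp a -> Mp b -> Mp (fun x => a x + b x).
Proof.
move=> [Ma sa' na] [Mb sb]; split; first exact: M_add.
  by move=> x y; rewrite rdDl rdDr sa' sb.
by move=> x; rewrite rdDl addr_ge0.
Qed.

Lemma Mp_rs c a : 0 <= c -> Mp a -> Mp (fun x => rs c (a x)).
Proof.
move=> c0 [Ma sa']; split; first exact: M_rs.
  by move=> x y; rewrite rdZl rdZr sa'.
by move=> x; rewrite rdZl mulr_ge0.
Qed.

Lemma Mp_sub a b : Mp a -> Mp b -> (forall x, rd (a x) x <= rd (b x) x) -> Mp (fun x => b x - a x).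
Proof.
move=> [Ma sa' na] [Mb sb]; split; first exact: M_sub.
  by move=> x y; rewrite rdBl rdBr sa' sb.
by move=> x; rewrite rdBl subr_ge0.
Qed.

Lemma Mp_proj (p : H -> H) : M p -> orthoproj p -> Mp p.
Proof. by move=> Mp' hp; split=> //; [case: hp|exact: orthoproj_nonneg]. Qed.

Lemma Mp_adj a : M a -> Mp (fun x => adj a (a x)).
Proof.
move=> Ma; have ba := M_bop Ma; split; first by apply: M_comp => //; exact: M_adj.
  by move=> x y; rewrite (adjl _ _ ba) adjr.
by move=> x; rewrite adjl.
Qed.

Lemma Mp_adj' a : M a -> Mp (fun x => a (adj a x)).
Proof.
by move=> Ma; have := Mp_adj (M_adj Ma); rewrite (adjK (M_bop Ma)).
Qed.

Lemma Mp_conj a b : Mp a -> M b -> Mp (fun x => adj b (a (b x))).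
Proof.
move=> [Ma sa' na] Mb; have bb := M_bop Mb; split; first by apply: M_comp; [exact: M_adj|exact: M_comp].
  by move=> x y; rewrite (adjl _ _ bb) sa' adjr.
by move=> x; rewrite adjl.
Qed.

Lemma Mp_cut a p : Mp a -> M p -> orthoproj p -> Mp (fun x => p (a (p x))).
Proof. by move=> ha hp [bp sp]; have := Mp_conj ha hp; rewrite adj_sa. Qed.

Lemma tr_ge0 a : Mp a -> (0 <= tau a)%E.
Proof. by move/MpE; exact: trace_ge0. Qed.

Lemma tr_add a b : Mp a -> Mp b -> tau (fun x => a x + b x) = (tau a + tau b)%E.
Proof. by move=> /MpE ha /MpE; exact: (trace_add htau). Qed.

Lemma tr_scale c a : 0 <= c -> Mp a -> tau (fun x => rs c (a x)) = (c%:E * tau a)%E.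
Proof. by move=> c0 /MpE; exact: (trace_scale htau). Qed.

Lemma tr0 : tau (fun=> 0) = 0%E.
Proof.
have := tr_scale (lexx 0) Mp0; rewrite mul0e (_ : (fun x : H => rs 0 0) = fun=> 0)//.
by apply/funext => x; rewrite rsr0.
Qed.

Lemma tr_mono a b : Mp a -> Mp b -> (forall x, rd (a x) x <= rd (b x) x) -> (tau a <= tau b)%E.
Proof.
move=> ha hb ab; have hc := Mp_sub ha hb ab.
have -> : b = (fun x => a x + (b x - a x)) by apply/funext => x; rewrite addKC.
by rewrite tr_add// leeDl// tr_ge0.
Qed.

Lemma tr_cyc a : M a -> tau (fun x => adj a (a x)) = tau (fun x => a (adj a x)).
Proof.
move=> Ma; have ba := M_bop Ma; apply: (trace_cyclic htau Ma).
by apply/(is_adjointE ba (adj_bop ba)) => x y; rewrite adjr.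
Qed.

(** The range of an increasing sequence is directed, and its least upper bound in the positive part
    is [b] because the forms converge to that of [b]; normality then applies. *)
Lemma tr_lim (a : nat -> H -> H) b (K : \bar R) : (forall n, Mp (a n)) -> Mp b ->
  (forall n x, rd (a n x) x <= rd (a n.+1 x) x) ->
  (forall x, rd (a n x) x @[n --> \oo] --> rd (b x) x) ->
  (forall n, (tau (a n) <= K)%E) -> (tau b <= K)%E.
Proof.
move=> ha hb inc lim hK.
have leE c d : Mp c -> Mp d -> (le_op c d <-> forall x, rd (c x) x <= rd (d x) x).
  by move=> [Mc sc _] [Md sd _]; apply: le_opP => //; exact: M_bop.
rewrite (@trace_normal _ _ _ _ htau [set a n | n in setT]).
- by apply: ub_ereal_sup => _ [_ [n _ <-] <-].
- by move=> _ [n _ <-]; exact/MpE.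
- by exists (a 0), 0.
- move=> _ _ [m _ <-] [n _ <-]; exists (a (maxn m n)); split; first by exists (maxn m n).
    by apply/leE => // x; apply: form_le_mono => //; rewrite leq_maxl.
  by apply/leE => // x; apply: form_le_mono => //; rewrite leq_maxr.
- exact/MpE.
- move=> _ [n _ <-]; apply/leE => // x.
  by apply: (ler_cvg_to (cvg_cst _) (lim x)); exists n => // nk; exact: form_le_mono.
- move=> c /MpE hc h; apply/leE => // x.
  apply: (cvg_le_seq (lim x) (cvg_cst _)) => n.
  have hn : le_op (a n) c by apply: h.
  exact: (leE _ _ (ha n) hc).1.
Qed.

Lemma M_sqrt a : Mp a -> exists b, [/\ Mp b, forall x, b (b x) = a x &
  forall u, bop u -> (forall x, a (u x) = u (a x)) -> forall x, b (u x) = u (b x)].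
Proof.
move=> [Ma sa' na]; have ba := M_bop Ma; have [b [bb sb nb hb cb]] := sqrt_exists ba sa' na.
exists b; split=> //; split=> //; apply/inM; split=> // u hu; apply: cb; first exact: proj1 hu.
by move=> x; case/inM : Ma => _ ->.
Qed.

(** Let [s] be the square root of [a] and [b'] the adjoint of [b]. Cyclicity for [s b] replaces
    [b' s s b] by [s b b' s], which is at most [K a]. *)
Lemma tr_conj a b K : Mp a -> M b -> 0 <= K -> (forall x, rd (adj b x) (adj b x) <= K * rd x x) ->
  (tau (fun x => adj b (a (b x))) <= K%:E * tau a)%E.
Proof.
move=> ha Mb K0 hK; have bb := M_bop Mb; have [s [[Ms ss ns] hs _]] := M_sqrt ha.
have Msb := M_comp Ms Mb; have bsb := M_bop Msb.
have aE : adj (fun x => s (b x)) = fun x => adj b (s x).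
  by apply: adj_unique => // x y; rewrite ss adjr.
have -> : (fun x => adj b (a (b x))) = (fun x => adj (fun x => s (b x)) (s (b x))).
  by apply/funext => x; rewrite aE hs.
rewrite (tr_cyc Msb) -tr_scale//; apply: (tr_mono (Mp_adj' Msb) (Mp_rs K0 ha)) => x.
by rewrite aE rdZl -hs ss (adjr _ _ bb) ss.
Qed.

Lemma tr_cut a (p : H -> H) : Mp a -> M p -> orthoproj p -> (tau (fun x => p (a (p x))) <= tau a)%E.
Proof.
move=> ha Mp' hp; have [bp sp ip] := hp; have := @tr_conj a p 1 ha Mp' ler01.
rewrite (adj_sa bp sp) mul1e; apply => x; rewrite mul1r orthoproj_rd//; exact: orthoproj_le.
Qed.

Lemma M_inv1p a : Mp a -> exists G, [/\ Mp G, forall x, G x + a (G x) = x, forall x, G (x + a x) = x &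
  forall x, rd (G x) x <= rd x x].
Proof.
move=> [Ma sa' na]; have ba := M_bop Ma; have [G [bG sG nG hG]] := inv1p_exists ba sa' na.
exists G; split=> //; last first.
  by move=> x; have h := inv1p_eq x hG; rewrite rdBl in h; have := na (G x); have := rd_ge0 (G x - x); lra.
split=> //; apply/inM; split=> // u hu x; case/inM : Ma => _ ca.
by rewrite -{1}(hG x) (bopD (proj1 hu)) -ca.
Qed.

(* With [T = z pi], the operators [n T^* T (1 + n T^* T)^-1 = a_n^* a_n]
   increase to [pi], and [a_n a_n^* <= p]. *)
Lemma tr_inj (pi p z : H -> H) : M pi -> orthoproj pi -> M p -> orthoproj p -> M z ->
  (forall x, p (z x) = z x) -> (forall x, pi x = x -> z x = 0 -> x = 0) -> (tau pi <= tau p)%E.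
Proof.
move=> Mpi hpi Mp' hp Mz pz inj; have [bpi spi ipi] := hpi; have [bp sp ip] := hp.
pose T x := z (pi x); have MT : M T by exact: M_comp.
have bT := M_bop MT; have bz := M_bop Mz.
pose c x := adj T (T x); have hc : Mp c := Mp_adj MT; have [Mc sc nc] := hc; have bc := M_bop Mc.
have hch : forall n : nat, exists G, [/\ Mp G, forall x, G x + rs n.+1%:R (c (G x)) = x,
    forall x, G (x + rs n.+1%:R (c x)) = x & forall x, rd (G x) x <= rd x x].
  by move=> n; apply: (@M_inv1p (fun x => rs n.+1%:R (c x))); exact: Mp_rs.
have [G hG] := choice hch.
have MG n : Mp (G n) by case: (hG n).
have GE n x : x - G n x = rs n.+1%:R (c (G n x)).
  by have [_ h _ _] := hG n; rewrite -{1}(h x) addrC addKr.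
have G1 n x : rd (G n x) x <= rd x x by case: (hG n).
have Mid := Mp_id.
have Gc n x : G n (c x) = c (G n x).
  have [_ h1 h2 _] := hG n; have [Gn _ _] := MG n; have bG := M_bop Gn.
  have : rs n.+1%:R (G n (c x)) = rs n.+1%:R (c (G n x)).
    by rewrite -GE -(boprs bG); have := h2 x; rewrite (bopD bG) => /(canRL (addKr _)) ->; rewrite addrC.
  by move=> /(congr1 (rs n.+1%:R^-1)); rewrite !rsA mulVf ?rs1.
pose h n x := x - G n x.
have Mh n : Mp (h n) by apply: Mp_sub => // x; exact: G1.
(* [h n] is the adjoint of [T s] times [T s], where [s] squares to [(n + 1) G n]; in the opposite
   order the product is a contraction living under [p]. *)
have hle n : (tau (h n) <= tau p)%E.
  have n0 : 0 <= n.+1%:R :> R by [].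
  have [s [[Ms ss ns] hs cs]] := M_sqrt (Mp_rs n0 (MG n)); have bs := M_bop Ms.
  have sc' x : s (c x) = c (s x).
    by apply: cs => // y; rewrite Gc (boprs bc).
  have Ma := M_comp MT Ms; have ba := M_bop Ma.
  have aE : adj (fun x => T (s x)) = fun x => s (adj T x).
    by apply: adj_unique => // x y; rewrite (adjr _ _ bT) ss.
  have hE x : h n x = adj (fun x => T (s x)) (T (s x)).
    by rewrite aE -/(c (s x)) sc' hs (boprs bc) -GE.
  rewrite (_ : h n = fun x => adj (fun x => T (s x)) (T (s x))); last by apply/funext => x; exact: hE.
  rewrite (tr_cyc Ma); apply: (tr_mono (Mp_adj' Ma) (Mp_proj Mp' hp)) => x.
  have pa y : p (T (s y)) = T (s y) by exact: pz.
  have ap y : adj (fun x => T (s x)) (p y) = adj (fun x => T (s x)) y.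
    by apply: rd_inj => w; rewrite !(adjl _ _ ba) sp pa.
  rewrite (adjr _ _ ba) -ap -(orthoproj_rd _ _ hp).
  apply/nrm_le_rd; rewrite -[nrm (p x)]mul1r; apply: (@adj_nrm _ _ (fun x => T (s x)) 1 ba ler01) => y; rewrite mul1r; apply/nrm_le_rd.
  have -> : rd (T (s y)) (T (s y)) = rd y (h n y) by rewrite hE; exact: (adjr y (T (s y)) ba).
  by rewrite rdC /h rdBl; have [_ _ nG] := MG n; have := nG y; lra.
have inc n x : rd (h n x) x <= rd (h n.+1 x) x.
  rewrite /h !rdBl lerD2l lerN2.
  have r0 (k : nat) : 0 <= k%:R :> R by []; have [Mr sr nr] := Mp_rs (r0 n.+1) hc; have [Mr' sr' nr'] := Mp_rs (r0 n.+2) hc.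
  apply: (inv1p_anti x (M_bop Mr) sr nr (M_bop Mr') sr'); [by case: (hG n)|by case: (hG n.+1)|].
  by move=> y; rewrite !rdZl ler_wpM2r// ler_nat.
have [||||b [bb sb nb lim]] := @monotone_limit _ _ h 1 _ _ _ inc.
- by move=> n; case: (Mh n) => /M_bop.
- by move=> n; case: (Mh n).
- by move=> n; case: (Mh n).
- by move=> n x; rewrite mul1r /h rdBl; have [_ _ nG] := MG n; have := nG x; lra.
have hn n x : nrm (h n x) <= 1 * nrm x.
  have [Mn sn nn] := Mh n; apply: form_nrm => //; first exact: M_bop.
  by move=> y; rewrite mul1r /h rdBl; have [_ _ nG] := MG n; have := nG y; lra.
have Mb : M b by apply: (M_lim _ hn lim) => n; case: (Mh n).
(* Since [c (G n x) = h n x / (n + 1)] tends to 0, the limit [x - b x] of the [G n x] lies in the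
   kernel of [T], and injectivity of [z] on the range of [pi] applies. *)
have pb x : pi (b x) = pi x.
  apply/esym/eqP; rewrite -subr_eq0 -(bopB bpi); apply/eqP; apply: inj; first by rewrite ipi.
  have c0 : c (x - b x) = 0.
    apply: (hcvg_unique (u := fun n => c (G n x))).
      rewrite (_ : (fun n => _) = c \o (fun n => x - h n x)); last by apply/funext => n /=; rewrite /h subKr.
      by apply: (bop_cvg bc); apply: hcvgB => //; exact: hcvg_cst.
    apply/hcvgP => eps e0; have e1 : 0 < eps / (nrm x + 1) by rewrite divr_gt0// ltr_wpDl// nrm_ge0.
    have /cvgrPdist_le /(_ _ e1) [N _ hN] := @cvg_harmonic R.
    exists N => n Nn; rewrite subr0.
    have -> : c (G n x) = rs n.+1%:R^-1 (h n x) by rewrite /h GE rsA mulVf ?rs1.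
    rewrite nrmZ ger0_norm ?invr_ge0//; have := hN n Nn; rewrite /= sub0r normrN /harmonic ger0_norm ?invr_ge0//.
    rewrite ler_pdivlMr ?ltr_wpDl ?nrm_ge0// => h1; apply: le_trans h1; rewrite ler_wpM2l ?invr_ge0//.
    by apply: le_trans (hn n x) _; rewrite mul1r lerDl.
  apply: rd_eq0; have := congr1 (fun w => rd w (x - b x)) c0.
  by rewrite /c (adjl _ _ bT) rd0l.
apply: (@le_trans _ _ (tau b)); last first.
  by apply: (tr_lim Mh _ inc) => // x; exact: (hcvg_rd (lim x) (hcvg_cst x)).
apply: tr_mono; [exact: Mp_proj|by split|] => x.
have := nb (x - pi x); rewrite (bopB bb) !rdE.
have -> : rd (b (pi x)) (pi x) = rd (pi x) x by rewrite -spi pb ipi.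
have -> : rd (b x) (pi x) = rd (pi x) x by rewrite -spi pb.
have -> : rd (b (pi x)) x = rd (pi x) x by rewrite sb spi pb -spi.
lra.
Qed.

Lemma proj_sub (pi p : H -> H) : M pi -> orthoproj pi -> M p -> orthoproj p -> (forall x, pi (p x) = p x) ->
  [/\ M (fun x => pi x - p x), orthoproj (fun x => pi x - p x) & tau pi = (tau p + tau (fun x => pi x - p x)%R)%E].
Proof.
move=> Mpi hpi Mp' hp pp; have [bpi spi ipi] := hpi; have [bp sp ip] := hp.
have pp' x : p (pi x) = p x by apply: rd_inj => y; rewrite sp spi pp.
have : orthoproj (fun x => pi x - p x).
  split; [exact: bop_sub|by move=> x y; rewrite rdBl rdBr spi sp|].
  by move=> x; rewrite (bopB bpi) (bopB bp) ipi pp pp' ip subrr subr0.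
have := M_sub Mpi Mp'; split=> //.
by rewrite -tr_add; [congr tau; apply/funext => x; rewrite addKC|exact: Mp_proj..].
Qed.

Lemma ker_csub (z : H -> H) : bop z -> csub [set x | z x = 0].
Proof.
move=> bz; split=> [|x y|c x|x] /=; first exact: bop0.
- by rewrite (bopD bz) => -> ->; rewrite addr0.
- by rewrite (boprs bz) => ->; rewrite rsr0.
- by rewrite (bophi bz) => ->; rewrite /hi scaler0.
Qed.

Lemma ker_hclosed (z : H -> H) : bop z -> hclosed [set x | z x = 0].
Proof.
move=> bz w x h wx; apply: hcvg_unique (bop_cvg bz wx) _.
by rewrite (_ : z \o w = fun=> 0); [exact: hcvg_cst|exact/funext].
Qed.

Lemma csubI (V W : set H) : csub V -> csub W -> csub (V `&` W).
Proof. by move=> [a b c d] [a']; split=> // [x y [] ? ? []|? ? []|? []] *; split; auto. Qed.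

Lemma hclosedI (V W : set H) : hclosed V -> hclosed W -> hclosed (V `&` W).
Proof. by move=> h h' w x hw wx; split; [apply: h wx|apply: h' wx] => n; case: (hw n). Qed.

(** Split [pi] along the kernel of [z1]: on the part in the kernel [z2] is injective, on the rest of
    [pi] so is [z1], and [tr_inj] bounds the two traces separately. *)
Lemma tr_inj2 (pi p p' z1 z2 : H -> H) : M pi -> orthoproj pi -> M p -> orthoproj p ->
  M p' -> orthoproj p' -> M z1 -> M z2 ->
  (forall x, p (z1 x) = z1 x) -> (forall x, p' (z2 x) = z2 x) ->
  (forall x, pi x = x -> z1 x = 0 -> z2 x = 0 -> x = 0) -> (tau pi <= tau p + tau p')%E.
Proof.
move=> Mpi hpi Mp' hp Mp2 hp2 M1 M2 p1 p2 inj; have [bpi spi ipi] := hpi; have b1 := M_bop M1.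
have MC := M_sub M_id Mpi; have bC := M_bop MC.
pose V := [set x | x - pi x = 0] `&` [set x | z1 x = 0].
have sV : csub V by apply: csubI; [exact: ker_csub|exact: ker_csub].
have cV : hclosed V by apply: hclosedI; [exact: ker_hclosed|exact: ker_hclosed].
have [hP PV Pid Por] := projP sV cV.
have MP : M (proj V).
  apply: M_proj => // u x hu [ h1 h2]; case/inM : M1 => _ c1; case/inM : MC => _ cC.
  by split; [rewrite /= cC// h1 (bop0 (proj1 hu))|rewrite /= c1// h2 (bop0 (proj1 hu))].
have [Md hd ->] := proj_sub Mpi hpi MP hP (fun x => esym (subr0_eq (proj1 (PV x)))).
rewrite addeC; apply: leeD; last first.
  apply: (tr_inj MP hP Mp2 hp2 M2 p2) => x px; have [h1 h2] := PV x; rewrite px in h1 h2.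
  by apply: inj => //; apply/esym/subr0_eq.
apply: (tr_inj Md hd Mp' hp M1 p1) => x dx z1x.
have := hP; have pix : pi x = x.
  have e2 : pi (proj V x) = proj V x by exact: esym (subr0_eq (proj1 (PV x))).
  by have := congr1 pi dx; rewrite (bopB bpi) ipi e2 dx.
have Vx : V x by split=> //=; rewrite pix subrr.
by move: dx; rewrite pix Pid// subrr.
Qed.

Lemma dense_orth (D : set H) x : csub D -> (forall y, (forall v, D v -> rd y v = 0) -> y = 0) ->
  exists u : nat -> H, (forall n, D (u n)) /\ hcvg u x.
Proof.
move=> sD oD.
pose W : set H := [set y | exists u : nat -> H, (forall n, D (u n)) /\ hcvg u y].
have W0 y : D y -> W y by move=> Dy; exists (fun=> y); split=> //; exact: hcvg_cst.
have sW : csub W.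
  split=> [|y y' [u [hu uy]] [u' [hu']]|c y [u [hu uy]]|y [u [hu uy]]].
  - exact: (W0 _ (csub0 sD)).
  - by exists (fun n => u n + u' n); split; [move=> n; exact: csubD|exact: hcvgD].
  - by exists (fun n => rs c (u n)); split; [move=> n; exact: csubZ|exact: hcvgZ].
  - by exists (fun n => hi (u n)); split; [move=> n; exact: csubi|exact: hcvgZ].
have cW : hclosed W.
  move=> w y hw wy; apply/closureHP; apply: (@closed_closure _ D); apply/closureHP.
  by exists w; split=> // n; apply/closureHP; exact: hw.
have [_ PW _ oW] := projP sW cW.
have : x - proj W x = 0 by apply: oD => v Dv; apply: oW; exact: W0.
by move=> /subr0_eq ->; exact: PW.
Qed.

(* Two conditions of the form [z x = 0], each with left support of arbitrarily
   small trace, still hold on a dense set. *)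
Lemma joint_dense (z1 z2 q1 q2 : nat -> H -> H) x : (forall m, M (z1 m)) -> (forall m, M (z2 m)) ->
  (forall m, M (q1 m)) -> (forall m, orthoproj (q1 m)) -> (forall m, M (q2 m)) -> (forall m, orthoproj (q2 m)) ->
  (forall m x, q1 m (z1 m x) = z1 m x) -> (forall m x, q2 m (z2 m x) = z2 m x) ->
  (forall m x, z1 m x = 0 -> z2 m x = 0 -> z1 m.+1 x = 0 /\ z2 m.+1 x = 0) ->
  (forall eps, 0 < eps -> exists m, (tau (q1 m) + tau (q2 m) <= eps%:E)%E) ->
  exists u : nat -> H, (forall n, exists m, z1 m (u n) = 0 /\ z2 m (u n) = 0) /\ hcvg u x.
Proof.
move=> M1 M2 Mq hq Mq' hq' qz1 qz2 inc small.
pose K m := [set x | z1 m x = 0] `&` [set x | z2 m x = 0].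
have sK m : csub (K m) by apply: csubI; apply: ker_csub; apply: M_bop.
have uK m u y : cM u -> K m y -> K m (u y).
  move=> hu [ h1 h2]; have [_ c1] := (inM _).1 (M1 m); have [_ c2] := (inM _).1 (M2 m).
  by split; [rewrite /= c1// h1 (bop0 (proj1 hu))|rewrite /= c2// h2 (bop0 (proj1 hu))].
have Kmono m n y : (m <= n)%N -> K m y -> K n y.
  elim: n => [|n IH]; first by rewrite leqn0 => /eqP ->.
  by rewrite leq_eqVlt => /orP[/eqP ->//|/IH h] /h [ h1 h2]; have := inc n y h1 h2.
apply: (@dense_orth [set y | exists m, K m y]).
  split=> [|y y' [m h] [m' h']|c y [m]|y [m]].
  - by exists 0; exact: csub0.
  - by exists (maxn m m'); apply: csubD; [exact: sK|apply: Kmono h; rewrite leq_maxl|apply: Kmono h'; rewrite leq_maxr].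
  - by exists m; exact: csubZ.
  - by exists m; exact: csubi.
pose V : set H := [set x | forall m v, K m v -> rd x v = 0].
have sV : csub V.
  split=> [m v|y y' h h' m v Kv|c y h m v Kv|y h m v Kv]; first by rewrite rd0l.
  - by rewrite rdDl (h m)// (h' m)// addr0.
  - by rewrite rdZl (h m)// mulr0.
  - by rewrite rdhi (h m) ?oppr0//; exact: csubi.
have cV : hclosed V.
  move=> w y h wy m v Kv; apply: (rd_lim0 wy) => n; exact: h _ _ _ Kv.
have [hP PV Pid Por] := projP sV cV.
have MP : M (proj V).
  by apply: M_proj => // u y hu h m v Kv; rewrite (adjr _ _ (proj1 hu)); apply/(h m)/uK => //; exact: cM_adj.
(* The range of this projection is orthogonal to every [K m], hence meets it only in 0, and
   [tr_inj2] puts its trace below every positive number; faithfulness makes it zero. *)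
have P0 : proj V = fun=> 0.
  apply: (trace_faithful htau); first exact/MpE/Mp_proj.
  apply/le_anti; rewrite tr_ge0 ?andbT; last exact: Mp_proj.
  apply/lee_addgt0Pr => eps e0; rewrite add0e.
  have [m hm] := small _ e0.
  apply: le_trans (tr_inj2 MP hP (Mq m) (hq m) (Mq' m) (hq' m) (M1 m) (M2 m) (qz1 m) (qz2 m) _) hm.
  move=> y Py h1 h2; apply: rd_eq0; rewrite -{1}Py; apply: (PV y m); exact: conj.
by move=> y h; rewrite -(Pid y) ?P0// => m v Kv; apply: h; exists m.
Qed.

Section Affiliated.
Variables (e : set R -> H -> H) (he : pvm e).
Hypothesis Me : forall B, measurable B -> M (e B).

Lemma M_Phi f : bfun f -> M (Phi he f).
Proof.
move=> bf; apply/inM; split; first exact: Phi_bop.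
move=> u hu; apply: (Phi_comm he bf (proj1 hu)) => B y mB.
by case/inM : (Me mB) => _ ->.
Qed.

Lemma Mp_e B : measurable B -> Mp (e B).
Proof. by move=> mB; apply: Mp_proj; [exact: Me|exact: pvm_proj]. Qed.

Lemma tr_sub B C : measurable B -> measurable C -> B `<=` C -> (tau (e B) <= tau (e C))%E.
Proof.
move=> mB mC BC; apply: tr_mono; [exact: Mp_e..|] => x.
rewrite -(pvm_rd he x mB) -(pvm_rd he x mC) -(pvm_sub he _ mB mC BC).
by rewrite pvm_comm //; rewrite (pvm_rd he _ mB); exact: orthoproj_le _ (pvm_proj he mB).
Qed.

Lemma tr_U B C : measurable B -> measurable C -> B `&` C = set0 -> tau (e (B `|` C)) = (tau (e B) + tau (e C))%E.
Proof.
move=> mB mC BC; rewrite -tr_add; [|exact: Mp_e..].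
by congr tau; apply/funext => x; exact: pvm_U.
Qed.

Lemma tr_bigcup (F : nat -> set R) K : (forall n, measurable (F n)) -> nondecreasing_seq F ->
  (forall n, (tau (e (F n)) <= K)%E) -> (tau (e (\bigcup_n F n)) <= K)%E.
Proof.
move=> mF ndF hK; have mU : measurable (\bigcup_n F n) by exact: bigcupT_measurable.
apply: tr_lim _ _ _ _ hK => [n||n x|x]; [exact: Mp_e|exact: Mp_e| |].
  have sub : F n `<=` F n.+1 by exact/subsetPset/ndF.
  rewrite -(pvm_rd he x (mF n)) -(pvm_rd he x (mF n.+1)) -(pvm_sub he _ (mF n) (mF n.+1) sub).
  by rewrite pvm_comm // (pvm_rd he _ (mF n)); exact: orthoproj_le _ (pvm_proj he (mF n)).
exact: hcvg_rd (pvm_cvg he x mF ndF) (hcvg_cst x).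
Qed.

(** Were all tails at least [eps], the parts between [v] and [v + n] would have trace at most the
    total minus [eps], and normality would pass this bound to the total. *)
Lemma tr_tail v : (tau (e (ray v)) < +oo)%E -> forall eps, 0 < eps ->
  exists n : nat, (tau (e (ray (v + n%:R))) <= eps%:E)%E.
Proof.
move=> fin eps; apply: contrapT => h.
have big n : (eps%:E <= tau (e (ray (v + n%:R))))%E.
  by rewrite leNgt; apply/negP => /ltW hn; apply: h; exists n.
pose F n : set R := ray v `\` ray (v + n%:R).
have mr w := @measurable_ray R w.
have mF n : measurable (F n) by exact: measurableD.
have ndF : nondecreasing_seq F.
  move=> m n mn; apply/subsetPset => l [h1 h2]; split=> // h3; apply: h2.
  by move: h3; apply: le_lt_trans; rewrite lerD2l ler_nat.
have FU : \bigcup_n F n = ray v.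
  apply/seteqP; split=> [l [n _ []]//|l].
  exists (Num.truncn `|l - v|).+1 => //; split=> //; apply/negP; rewrite -leNgt.
  by rewrite -lerBlDl; apply: le_trans (ler_norm _) (ltW (truncnS_gt _)).
have fine0 : tau (e (ray v)) \is a fin_num by rewrite ge0_fin_numE// tr_ge0//; exact: Mp_e.
have split' n : (tau (e (F n)) + tau (e (ray (v + n%:R))))%E = tau (e (ray v)).
  rewrite -tr_U//; last by apply/seteqP; split=> // l [[]].
  congr (tau (e _)); apply/seteqP; split=> l; first by move=> [[]//|]; apply: le_lt_trans; rewrite lerDl.
  by move=> lv; have [h1|h1] := boolP (v + n%:R < l); [right|left; split=> //; apply/negP].
have : (tau (e (ray v)) <= tau (e (ray v)) - eps%:E)%E.
  rewrite -{1}FU; apply: tr_bigcup => // n; rewrite leeBrDr//.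
  by rewrite -(split' n); exact: leeD2l.
by rewrite -(fineK fine0) lee_fin; lra.
Qed.

End Affiliated.

Lemma aff_comm T u : affiliated M T -> cM u -> forall x y, T (x, y) -> T (u x, u y).
Proof. by move=> [_ h] /commutantE hu x y; exact: h. Qed.

(** Operators of the commutant preserve the graphs of [T] and of its adjoint, hence commute with the
    resolvent of [|T x|^2] and with its spectral projections. *)
Lemma M_abs T e (he : pvm e) : affiliated M T -> (forall z, e (@half R) z = z) ->
  (forall z, Phi he (@res2 R) z = resolvent (domain_op T) (fun x => rd (app T x) (app T x)) z) ->
  forall B, measurable B -> M (e B).
Proof.
move=> aT e0 hP B mB; have [cT _] := aT; apply/inM; split; first exact: pvm_bop.
move=> u hu x; apply: (@res2_comm _ _ e he u e0 (proj1 hu) _ B x mB) => z; rewrite !hP.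
set G := resolvent _ _.
have /(adjoint_res _ _ cT) [y [ h1 h2]] : resolvent (domain_op T) (fun x => rd (app T x) (app T x)) (G z + (z - G z)) = G z by rewrite addKC.
have : comp_op (adjoint_op T) T (u (G z), u (z - G z)).
  exists (u y); split=> /=; first exact: (aff_comm aT).
  apply/(adjointP cT) => v w Tvw; have Tvw' := aff_comm aT (cM_adj hu) Tvw.
  by have := (adjointP cT _ _).1 h2 _ _ Tvw'; rewrite !(adjl _ _ (proj1 hu)).
by move/(adjoint_res _ _ cT); rewrite -(bopD (proj1 hu)) addKC.
Qed.

Lemma aff_spec e (he : pvm e) : (forall B, measurable B -> M (e B)) -> affiliated M (spec_op he).
Proof.
move=> Me; split; first exact: spec_closed.
move=> u /commutantE hu [x y] h m.
have [_ c1] := (inM _).1 (Me _ (@measurable_band R m)); have [_ c2] := (inM _).1 (M_Phi he Me (@bfun_cutf R m)).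
by rewrite c1// c2// (h).
Qed.

Lemma M_spec e (he : pvm e) : (forall z, e (@half R) z = z) -> affiliated M (spec_op he) ->
  forall B, measurable B -> M (e B).
Proof.
move=> e0 aS B mB; apply: (@M_abs _ e he aS e0 _ B mB) => z; exact/esym/spec_resolvent.
Qed.

End Trace.

(** * Monotone sequences of forms and their K-functional *)

Section Forms.
Implicit Types (x y z : H) (A B U : nat -> H -> H) (e : set R -> H -> H) (s k t v : R).

Lemma form_par (a : H -> H) x y : bop a ->
  rd (a (x + y)) (x + y) + rd (a (x - y)) (x - y) = 2 * rd (a x) x + 2 * rd (a y) y.
Proof. by move=> ba; rewrite (bopD ba) (bopB ba) !rdE; lra. Qed.

Lemma cvg_mulc (c l : R) (u : nat -> R) : u n @[n --> \oo] --> l -> c * u n @[n --> \oo] --> c * l.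
Proof. by move=> ul; apply: cvgM => //; exact: cvg_cst. Qed.

Lemma Phi_le_on e (he : pvm e) f g C x : bfun f -> bfun g -> measurable C ->
  (forall l, C l -> f l <= g l) -> e C x = x -> rd (Phi he f x) x <= rd (Phi he g x) x.
Proof.
move=> bf bg mC fg ex; have bi := @bfun_indic R C mC.
have E h (bh : bfun h) : rd (Phi he h x) x = rd (Phi he (fun l => h l * \1_C l) x) x by rewrite Phi_e// ex.
rewrite (E _ bf) (E _ bg); apply: Phi_mono; try exact: bfunM.
by move=> l; rewrite indicE; case: (boolP (l \in C)) => [/set_mem/fg|_]; rewrite ?mulr1 ?mulr0.
Qed.

(* An increasing sequence of bounded positive forms, standing for its
   supremum, a closed form with domain [mdom]. *)
Definition mform A := (forall n, Mp (A n)) /\ (forall n x, rd (A n x) x <= rd (A n.+1 x) x).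
Definition mdom A : set H := [set x | exists K, forall n, rd (A n x) x <= K].
Definition mq A x : R := limn (fun n => rd (A n x) x).
(** Transferring every bound from [B] to [A] states at once the inclusion of domains and the
    inequality of the suprema. *)
Definition mle A B := forall x K, (forall n, rd (B n x) x <= K) -> forall n, rd (A n x) x <= K.
Definition madd A B : nat -> H -> H := fun n x => A n x + B n x.
Definition mscale t A : nat -> H -> H := fun n x => rs t (A n x).
Definition mres A := resolvent (mdom A) (mq A).

Lemma mf_bop A n : mform A -> bop (A n).
Proof. by move=> [/(_ n)[Ma _ _] _]; exact: M_bop. Qed.

Lemma mf_le A m n x : mform A -> (m <= n)%N -> rd (A m x) x <= rd (A n x) x.
Proof. by move=> [_]; exact: form_le_mono. Qed.

Lemma mq_cvg A x : mform A -> mdom A x -> rd (A n x) x @[n --> \oo] --> mq A x.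
Proof.
move=> hA [K hK]; apply: nondecreasing_is_cvgn; first by move=> m n; exact: mf_le.
by exists K => _ [n _ <-].
Qed.

Lemma mq_ub A n x : mform A -> mdom A x -> rd (A n x) x <= mq A x.
Proof.
move=> hA Dx; apply: (ler_cvg_to (cvg_cst _) (mq_cvg hA Dx)).
by exists n => // nm; exact: mf_le.
Qed.

Lemma mq_le A x K : mform A -> (forall n, rd (A n x) x <= K) -> mdom A x /\ mq A x <= K.
Proof.
move=> hA hK; have Dx : mdom A x by exists K.
by split=> //; exact: (cvg_le_seq (mq_cvg hA Dx) (cvg_cst K)).
Qed.

Lemma mq_qform A : mform A -> qform (mdom A) (mq A).
Proof.
move=> hA; have [hA1] := hA; have bA n := mf_bop n hA.
have nA n x : 0 <= rd (A n x) x by case: (hA1 n).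
have sub : csub (mdom A).
  split=> [|x y [K hK] [L hL]|c x [K]|x [K]].
  - by exists 0 => n; rewrite (bop0 (bA n)) rd0l.
  - exists (2 * K + 2 * L) => n; have := form_par x y (bA n); have := nA n (x - y).
    by have := hK n; have := hL n; lra.
  - exists (c ^+ 2 * K) => n; rewrite (boprs (bA n)) rdZl rdZr mulrA.
    by rewrite ler_wpM2l ?sqr_ge0.
  - by exists K => n; rewrite (bophi (bA n)) rdhi2.
split=> // [x Dx|x y Dx Dy|c x Dx|x Dx|w x K Dw wx qw].
- exact: (cvg_le_seq (cvg_cst 0) (mq_cvg hA Dx)).
- have h1 : rd (A n (x + y)) (x + y) + rd (A n (x - y)) (x - y) @[n --> \oo] --> mq A (x + y) + mq A (x - y).
    by apply: cvgD; apply: mq_cvg => //; [exact: csubD|exact: csubB].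
  have h2 : 2 * rd (A n x) x + 2 * rd (A n y) y @[n --> \oo] --> 2 * mq A x + 2 * mq A y.
    by apply: cvgD; apply: cvg_mulc; exact: mq_cvg.
  apply: cvg_unique h1 _ => //.
  by rewrite (_ : (fun => _) = (fun n => 2 * rd (A n x) x + 2 * rd (A n y) y))//; apply/funext => n; exact: form_par.
- apply: cvg_unique (mq_cvg hA (csubZ sub c Dx)) _ => //.
  rewrite (_ : (fun => _) = fun n => c ^+ 2 * rd (A n x) x).
    exact: @cvg_mulc _ _ _ (mq_cvg hA Dx).
  by apply/funext => n; rewrite (boprs (bA n)) rdZl rdZr mulrA.
- apply: cvg_unique (mq_cvg hA (csubi sub Dx)) _ => //.
  rewrite (_ : (fun => _) = fun n => rd (A n x) x); first exact: mq_cvg.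
  by apply/funext => n; rewrite (bophi (bA n)) rdhi2.
- apply: mq_le => // n; apply: (cvg_le_seq (hcvg_rd (bop_cvg (bA n) wx) wx) (cvg_cst K)) => m.
  exact: (le_trans (mq_ub n hA (Dw m))).
Qed.

(** The resolvents of the bounded forms decrease and so converge strongly. The limit minimizes the
    problem for the supremum, because the minimum for [A m] with [m >= N] controls the form of
    [A N]. This places the resolvent of the supremum in the algebra. *)
Lemma mres_lim A : mform A -> exists G : nat -> H -> H, [/\ forall n, Mp (G n),
  forall n x, G n x + A n (G n x) = x, forall n x, rd (G n.+1 x) x <= rd (G n x) x,
  forall n x, rd (G n x) x <= rd x x & forall x, hcvg (G^~ x) (mres A x)].
Proof.
move=> hA; have [hA1 hA2] := hA; have bA n := mf_bop n hA; have hq := mq_qform hA.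
have hch : forall n : nat, exists G, [/\ Mp G, forall x, G x + A n (G x) = x & forall x, rd (G x) x <= rd x x].
  by move=> n; have [G [MG]] := M_inv1p (hA1 n); exists G.
have [G hG] := choice hch.
have MG n : Mp (G n) by case: (hG n).
have GE n : forall x, G n x + A n (G n x) = x by case: (hG n).
have G1 n x : rd (G n x) x <= rd x x by case: (hG n).
have sA n : sa (A n) by case: (hA1 n).
have nA n : nonneg (A n) by case: (hA1 n).
have dec n x : rd (G n.+1 x) x <= rd (G n x) x.
  exact: inv1p_anti.
have hb n : bop (G n) by case: (MG n) => /M_bop.
have [|||||b [bb sb nb lim]] := @monotone_limit _ _ (fun n x => x - G n x) 1.
- by move=> n; apply: bop_sub; [exact: bop_id|exact: hb].
- by move=> n x y; rewrite rdBl rdBr; case: (MG n) => _ ->.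
- by move=> n x; rewrite rdBl subr_ge0.
- by move=> n x; rewrite !rdBl lerD2l lerN2.
- by move=> n x; rewrite rdBl; case: (MG n) => _ _ /(_ x); lra.
exists G; split=> // x.
have lx : hcvg (G^~ x) (x - b x).
  have := hcvgB (hcvg_cst x) (lim x); rewrite (_ : (fun => _) = G^~ x)//.
  by apply/funext => n; rewrite subKr.
suff -> : mres A x = x - b x by [].
move: (x - b x) lx => g lx; apply: (resolvent_eq hq).
have key N z : mdom A z -> rd (A N g) g + rd (g - x) (g - x) <= mq A z + rd (z - x) (z - x).
  move=> Dz; have gx := hcvgB lx (hcvg_cst x).
  apply: (ler_cvg_to (cvgD (hcvg_rd (bop_cvg (bA N) lx) lx) (hcvg_rd gx gx)) (cvg_cst _)).
  exists N => // m Nm; suff : rd (A N (G m x)) (G m x) + rd (G m x - x) (G m x - x) <= mq A z + rd (z - x) (z - x) by [].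
  have := inv1p_min x z (bA m) (sA m) (nA m) (GE m).
  rewrite (inv1p_eq x (GE m)); have := mq_ub m hA Dz; have := mf_le (G m x) hA Nm; lra.
have D0 : mdom A 0 by exists 0 => n; rewrite (bop0 (bA n)) rd0l.
have Dg : mdom A g.
  exists (mq A 0 + rd (0 - x) (0 - x)) => N; have := key N _ D0; have := rd_ge0 (g - x); lra.
apply: minimizer_res => // z Dz; rewrite -lerBrDr; apply: proj2 (mq_le hA _) => N.
by have := key N _ Dz; lra.
Qed.

Lemma M_mres A : mform A -> Mp (mres A).
Proof.
move=> hA; have := mq_qform hA; have [G [MG _ _ G1 lim]] := mres_lim hA.
split; [|exact: resolvent_sa|exact: resolvent_nonneg].
apply: M_lim _ _ lim => n; first by case: (MG n).
move=> x; have [Mn sn nn] := MG n; apply: form_nrm => //; first exact: M_bop.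
by move=> z; rewrite mul1r.
Qed.

(** Taking [z = x] in the variational formula gives [1 - G n <= A n]; the bound on the traces
    survives the monotone limit. *)
Lemma mres_tau A (K : \bar R) : mform A -> (forall n, (tau (A n) <= K)%E) ->
  (tau (fun x => x - mres A x)%R <= K)%E.
Proof.
move=> hA hK; have hq := mq_qform hA; have [G [MG GE dec G1 lim]] := mres_lim hA; have [hA1 _] := hA.
have Mid := Mp_id.
apply: (tr_lim (a := fun n x => x - G n x)).
- by move=> n; apply: Mp_sub.
- by apply: Mp_sub => //; [exact: M_mres|move=> x; exact: resolvent_le].
- by move=> n x; rewrite !rdBl lerD2l lerN2.
- by move=> x; apply: hcvg_rd; [apply: hcvgB => //|]; exact: hcvg_cst.
move=> n; apply: le_trans (hK n); apply: tr_mono => [||x]; [exact: Mp_sub|exact: hA1|].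
have [_ sn nn] := hA1 n.
by have := inv1p_min x x (mf_bop n hA) sn nn (GE n); rewrite subrr rd0l addr0.
Qed.

Lemma mscale_form t A : 0 <= t -> mform A -> mform (mscale t A).
Proof.
move=> t0 [h1]; split=> [n|n x]; first exact: Mp_rs.
by rewrite !rdZl ler_wpM2l.
Qed.

Lemma mscale_dom t A x : 0 < t -> mdom (mscale t A) x <-> mdom A x.
Proof.
move=> t0; split=> -[K hK]; last by exists (t * K) => n; rewrite rdZl ler_pM2l.
by exists (K / t) => n; rewrite ler_pdivlMr// mulrC -rdZl; exact: hK.
Qed.

Lemma mscale_q t A x : mform A -> mdom A x -> 0 < t -> mq (mscale t A) x = t * mq A x.
Proof.
move=> hA Dx t0; apply: cvg_unique (mq_cvg (mscale_form (ltW t0) hA) (iffRL (mscale_dom A x t0) Dx)) _ => //.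
rewrite (_ : (fun => _) = fun n => t * rd (A n x) x); first exact: @cvg_mulc _ _ _ (mq_cvg hA Dx).
by apply/funext => n; rewrite rdZl.
Qed.

Lemma madd_form A B : mform A -> mform B -> mform (madd A B).
Proof.
move=> [h1 h2] [h3]; split=> [n|n x]; first exact: Mp_add.
by rewrite !rdDl lerD.
Qed.

(* It suffices to compare two forms on the ranges of the resolvents [(1 + t B)^-1],
   up to a dense set of arguments. *)
Lemma mle_dense A B : mform A -> mform B ->
  (forall t x, 0 < t -> exists u : nat -> H, hcvg u x /\ forall n N,
     let y := mres (mscale t B) (u n) in rd (A N y) y <= mq B y) -> mle A B.
Proof.
move=> hA hB dns x K hK N; have [Dx qK] := mq_le hB hK.
have K0 : 0 <= K := le_trans (qf_ge0 (mq_qform hB) Dx) qK.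
pose t n : R := n.+1%:R^-1.
have t0 n : 0 < t n by rewrite invr_gt0.
have t1 n : t n <= 1 by rewrite invf_le1// ler1n.
have hch : forall n : nat, exists y, rd (A N y) y <= K + t n /\ rd (y - x) (y - x) <= t n * (2 * K + 4).
  (* The vector [y] minimizes [t] times the form of [B] plus the squared distance to [u m]. Testing
     the minimum at [x] shows that its form is at most [K + t] and that it is close to [x]. *)
  move=> n; have [u [ux hu]] := dns (t n) x (t0 n).
  move/hcvgP : ux => /(_ _ (t0 n)) [m /(_ m (leqnn m)) um].
  have hT := mscale_form (ltW (t0 n)) hB; have hqT := mq_qform hT.
  have := hu m N; set y := mres _ _; move=> /= hy; exists y.
  have Dy : mdom B y by apply/(mscale_dom B y (t0 n)); exact: (resolvent_dom hqT _).
  have := resolvent_min hqT (u m) (iffRL (mscale_dom B x (t0 n)) Dx); rewrite -/(mres _) -/y.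
  rewrite !mscale_q// => hmin.
  have ux2 : rd (x - u m) (x - u m) <= t n ^+ 2.
    by rewrite rdxx nrmBC lerXn2r ?nnegrE ?nrm_ge0// ltW.
  have h1 : t n * mq B y + rd (y - u m) (y - u m) <= t n * K + t n ^+ 2.
    apply: le_trans hmin _; apply: lerD => //; rewrite ler_wpM2l// ltW//.
  have q0 := qf_ge0 (mq_qform hB) Dy; have r0 := rd_ge0 (y - u m).
  have h2 : t n * mq B y <= t n * (K + t n) by move: h1; rewrite mulrDr -expr2; lra.
  rewrite ler_pM2l// in h2; split; first exact: (le_trans hy h2).
  have tq : 0 <= t n * mq B y by rewrite mulr_ge0// ltW.
  have t2 : t n ^+ 2 <= t n by rewrite expr2 ler_piMl// ltW.
  have : rd (y - x) (y - x) <= 2 * rd (y - u m) (y - u m) + 2 * rd (x - u m) (x - u m).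
    have -> : y - x = (y - u m) - (x - u m) by rewrite opprB addrA subrK.
    have := form_par (y - u m) (x - u m) (@bop_id R H); have := rd_ge0 ((y - u m) + (x - u m)); rewrite /=; lra.
  rewrite mulrDr; move: h1 ux2; lra.
have [y hy] := choice hch.
have yx : hcvg y x.
  apply/hcvgP => eps e0; have e2 : 0 < eps ^+ 2 / (2 * K + 4) by rewrite divr_gt0 ?exprn_gt0//; lra.
  have [n0 hn] := inv_small e2.
  exists n0 => n nn; apply: nrm_le; first exact: ltW.
  apply: le_trans (proj2 (hy n)) _; have := hn n nn.
  by rewrite ler_pdivlMr//; lra.
have bA := mf_bop N hA.
have c : K + t n @[n --> \oo] --> K.
  by rewrite -[X in _ --> X]addr0; apply: cvgD; [exact: cvg_cst|exact: cvg_harmonic].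
by apply: (cvg_le_seq (hcvg_rd (bop_cvg bA yx) yx) c) => n; case: (hy n).
Qed.

Lemma mle_trans A B U : mle A B -> mle B U -> mle A U.
Proof. by move=> h1 h2 x K hK; apply: h1; exact: h2. Qed.

Lemma mle_pt A B : (forall n x, rd (A n x) x <= rd (B n x) x) -> mle A B.
Proof. by move=> h x K hK n; exact: le_trans. Qed.

(** A bound on the sum bounds each summand, so both suprema are finite; they add up to at most the
    bound because the two sums of forms converge together. *)
Lemma mle_add A B A' B' : mform A' -> mform B' -> mle A A' -> mle B B' -> mle (madd A B) (madd A' B').
Proof.
move=> hA hB hA' hB' x K hK n; rewrite rdDl; have [hA1 _] := hA; have [hB1 _] := hB.
have dA : mdom A' x.
  by exists K => m; have := hK m; rewrite rdDl; have [_ _ /(_ x)] := hB1 m; lra.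
have dB : mdom B' x.
  by exists K => m; have := hK m; rewrite rdDl; have [_ _ /(_ x)] := hA1 m; lra.
have h1 := hA' x _ (fun m => mq_ub m hA dA) n; have h2 := hB' x _ (fun m => mq_ub m hB dB) n.
apply: le_trans (lerD h1 h2) _.
apply: (cvg_le_seq (cvgD (mq_cvg hA dA) (mq_cvg hB dB)) (cvg_cst K)) => m.
by have := hK m; rewrite rdDl.
Qed.

(* Up to constants, [K(s) = inf (tau U + s |A - U|) <= k], the K-functional
   between L^1 and L^oo. *)
Definition Kfun A s k := exists U, [/\ mform U, forall n x, rd (U n x) x <= rd (A n x) x,
  forall n x, rd (A n x) x <= rd (U n x) x + k / s * rd x x & forall n, (tau (U n) <= k%:E)%E].

Lemma Kfun_le A s k k' : 0 < s -> k <= k' -> Kfun A s k -> Kfun A s k'.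
Proof.
move=> s0 kk [U [hU h1 h2]]; exists U; split=> // [n x|n].
  by apply: le_trans (h2 n x) _; rewrite lerD2l ler_wpM2r// ler_pM2r// invr_gt0.
exact: le_trans.
Qed.

Lemma Kfun_add A B s k k' : Kfun A s k -> Kfun B s k' -> Kfun (madd A B) s (k + k').
Proof.
move=> [U [hU h1 h2 h3]] [V [hV g1 g2]]; exists (madd U V); split.
- exact: madd_form.
- by move=> n x; rewrite !rdDl lerD.
- by move=> n x; rewrite !rdDl; have := h2 n x; have := g2 n x; lra.
- move=> n; rewrite tr_add; [|by case: hU|by case: hV].
  by rewrite EFinD leeD.
Qed.

Lemma Kfun_scale A s k c : 0 <= c -> Kfun A s k -> Kfun (mscale c A) s (c * k).
Proof.
move=> c0 [U [hU]]; exists (mscale c U); split.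
- exact: mscale_form.
- by move=> n x; rewrite !rdZl ler_wpM2l.
- by move=> n x; rewrite !rdZl -!mulrA -mulrDr ler_wpM2l// mulrA.
- move=> n; rewrite tr_scale//; last by case: hU.
  by rewrite EFinM lee_wpmul2l.
Qed.

Definition mcut (p : H -> H) A : nat -> H -> H := fun n x => p (A n (p x)).

Lemma mcut_form p A : M p -> orthoproj p -> mform A -> mform (mcut p A).
Proof.
move=> Mp' hp [h1]; have [_ sp] := hp; split=> [n|n x]; first exact: (Mp_cut (h1 n)).
by rewrite !sp.
Qed.

Lemma Kfun_cut p A s k : M p -> orthoproj p -> 0 < s -> 0 <= k -> Kfun A s k -> Kfun (mcut p A) s k.
Proof.
move=> Mp' hp s0 k0 [U [hU h1 h2 h3]]; have [_ sp] := hp; exists (mcut p U).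
have : 0 <= k / s by rewrite divr_ge0// ltW.
split.
- exact: mcut_form.
- by move=> n x; rewrite !sp.
- move=> n x; rewrite !sp; apply: le_trans (h2 n _) _; rewrite lerD2l ler_wpM2l//.
  by rewrite orthoproj_rd//; exact: orthoproj_le.
- by move=> n; apply: le_trans (h3 n); apply: tr_cut; case: hU.
Qed.

(** Let [P] project onto the kernel of the resolvent of [U], that is, onto the vectors orthogonal to
    the domain of [U]. For each [eps], [P] is below 1 minus the resolvent of [eps U], so its trace
    is at most [eps k], and faithfulness gives [P = 0]. *)
Lemma mdom_dense A s k x : mform A -> 0 < s -> Kfun A s k ->
  exists u : nat -> H, (forall n, mdom A (u n)) /\ hcvg u x.
Proof.
move=> hA s0 [U [hU h1 h2 h3]]; apply: dense_orth; first exact: qf_sub (mq_qform hA).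
move=> y hy; have hqU := mq_qform hU.
have DU z : mdom U z -> mdom A z.
  move=> [K]; exists (K + k / s * rd z z) => n; apply: le_trans (h2 n z) _.
  by rewrite lerD2r.
have MG := M_mres hU; have bG : bop (mres U) by case: MG => /M_bop.
have [hP PV Pid] := projP (ker_csub bG) (ker_hclosed bG); set P := proj _ in Pid.
have MP : M P.
  apply: M_proj => //; [exact: ker_csub|exact: ker_hclosed|].
  by move=> u z hu /= h; case: MG => /inM [_ ->]//; rewrite h (bop0 (proj1 hu)).
have tP eps : 0 < eps -> (tau P <= (eps * k)%:E)%E.
  move=> e0; have hE := mscale_form (ltW e0) hU; have hq := mq_qform hE.
  have [ME sE nE] := M_mres hE; have bE := M_bop ME.
  apply: le_trans (mres_tau hE _); last first.
    move=> n; have hn : Mp (U n) by case: hU.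
    rewrite (tr_scale (ltW e0) hn) EFinM; apply: lee_wpmul2l; last exact: h3.
    by rewrite ltW.
  apply: tr_mono => [||z]; first exact: Mp_proj.
    by apply: Mp_sub => //; [exact: Mp_id|exact: resolvent_le].
  have GP w : mres (mscale eps U) (P w) = 0.
    apply: (resolvent_orth hq) => v /(mscale_dom _ _ e0).
    exact: (resolvent_ker hqU (PV w)).
  have := hP; have : mres (mscale eps U) z = mres (mscale eps U) (z - P z).
    by rewrite (bopB bE) GP subr0.
  have := resolvent_le hq (z - P z); rewrite -/(mres _) (bopB bE) GP subr0 !rdE.
  have> : rd (mres (mscale eps U) z) (P z) = 0 by rewrite sE GP rd0r.
  by rewrite (rdC z) (orthoproj_rd _ _ hP); lra.
have P0 : P = fun=> 0.
  apply: (trace_faithful htau); first exact/MpE/Mp_proj.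
  apply/le_anti; rewrite tr_ge0 ?andbT; last exact: Mp_proj.
  apply/lee_addgt0Pr => eps e0; rewrite add0e.
  have k1 : 0 < `|k| + 1 by rewrite ltr_wpDl.
  apply: le_trans (tP (eps / (`|k| + 1)) (divr_gt0 e0 k1)) _; rewrite lee_fin mulrAC ler_pdivrMr//.
  by rewrite ler_pM2l//; apply: le_trans (ler_norm _) _; rewrite lerDl.
rewrite -(Pid y) ?P0//=; apply: (resolvent_orth hqU) => v /DU; exact: hy.
Qed.

(** [spec_op he] is the square root of the supremum of the forms. Its spectral variable [l]
    corresponds to the value [l^2] of the form, whence the sets [lev]. *)
Definition mrep A e (he : pvm e) := (forall x, domain_op (spec_op he) x <-> mdom A x) /\
  forall x, mdom A x -> rd (app (spec_op he) x) (app (spec_op he) x) = mq A x.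

Lemma mform_pvm A : mform A -> (forall x, exists u : nat -> H, (forall n, mdom A (u n)) /\ hcvg u x) ->
  exists e (he : pvm e), [/\ forall z, e (@half R) z = z, forall C, measurable C -> M (e C) & mrep A he].
Proof.
move=> hA dns; have hq := mq_qform hA; have [MG sG nG] := M_mres hA; have bG := M_bop MG.
have Gi x : mres A x = 0 -> x = 0.
  move=> e; have [w [Dw wx]] := dns x; apply: rd_eq0.
  by apply: (rd_lim0 wx) => n; rewrite rdC; exact: (resolvent_ker hq).
have [e [he [e0 hP]]] := ppvm_res2 bG sG nG (resolvent_le hq) Gi.
exists e, he; split=> //.
  move=> C mC; apply/inM; split; first exact: pvm_bop.
  move=> u hu x; apply: (@res2_comm _ _ e he u e0 (proj1 hu) _ C x mC) => z.
  by rewrite !hP; case/inM : MG => _ ->.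
have hS := qform_cl (spec_closed he).
have e1 l : resolvent (domain_op (spec_op he)) (fun x => rd (app (spec_op he) x) (app (spec_op he) x)) l = resolvent (mdom A) (mq A) l.
  by rewrite spec_resolvent.
have q1 := qform_eq hS hq e1; have q2 := qform_eq hq hS (fun l => esym (e1 l)).
split=> x; first by split=> [/q1[]|/q2[]].
by move=> Dx; apply/le_anti; rewrite (q2 _ Dx).2 (q1 _ (q2 _ Dx).1).2.
Qed.

Lemma mrep_band A e (he : pvm e) n x : mrep A he -> e (band n) x = x ->
  mdom A x /\ mq A x = rd (Phi he (fun l => cutf n l ^+ 2) x) x.
Proof.
move=> [hD hq] ex; have h := spec_eb he n x; rewrite ex in h.
have : mdom A x by apply/hD; exists (x, Phi he (@cutf R n) x).
split=> //; rewrite -hq// (appE (spec_closed he) h) cutf_sq Phi_rd//.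
by apply: bfunM; exact: bfun_cutf.
Qed.

Definition lev v : set R := [set l | v < l ^+ 2].

Lemma measurable_lev v : measurable (lev v).
Proof.
rewrite (_ : lev v = setT `&` (fun l : R => l ^+ 2) @^-1` ray v); last by rewrite setTI.
by apply: measurable_funX => //; exact: measurable_ray.
Qed.

Definition lay v (s : seq (R * R)) : @sfun R := [seq (p.1, lev (v + p.2)) | p <- s].

Lemma lay_facts e (he : pvm e) v (s : seq (R * R)) : (forall C, measurable C -> M (e C)) ->
  all (fun p => (0 <= p.1) && (0 <= p.2)) s ->
  [/\ smeas (lay v s), Mp (sop e (lay v s)),
      tau (sop e (lay v s)) = (\sum_(p <- s) (p.1%:E * tau (e (lev (v + p.2)))))%E &
      forall l, sval (lay v s) l = \sum_(p <- s) p.1 * \1_(lev (v + p.2)) l].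
Proof.
move=> Me; elim: s => [|p s IH].
  by split=> //; rewrite ?big_nil; [exact: Mp0|exact: tr0|move=> l; rewrite big_nil].
move=> /andP[/andP[p1 p2]] /IH[ms Ms ts vs].
have ml := @measurable_lev (v + p.2).
have : Mp (fun x => rs p.1 (e (lev (v + p.2)) x)) by apply: Mp_rs => //; exact: Mp_e.
have he' : Mp (e (lev (v + p.2))) by exact: Mp_e.
split.
- by move=> q [<-//|]; exact: ms.
- exact: Mp_add.
- by rewrite big_cons -ts -(tr_scale p1 he') -tr_add.
- by move=> l; rewrite big_cons -vs.
Qed.

(** Above the level [v = k / s] the form minus [v] is at most that of [U], whose trace is at most
    [k]. The weighted sum of projections is a function of the spectral variable lying below
    [l^2 - v]; the comparison is made on the bounded parts [B n], which exhaust [lev v]. *)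
Lemma tr_layers A e (he : pvm e) s k (c : seq (R * R)) : mform A -> (forall C, measurable C -> M (e C)) ->
  mrep A he -> 0 < s -> 0 <= k -> Kfun A s k ->
  all (fun p => (0 <= p.1) && (0 <= p.2)) c ->
  (forall l, 0 <= l -> \sum_(p <- c) p.1 * (p.2 < l)%R%:R <= l) ->
  (\sum_(p <- c) (p.1%:E * tau (e (lev (k / s + p.2)))) <= k%:E)%E.
Proof.
move=> hA Me hrep s0 k0 [U [hU hUA hAU tU]] hc hl; set v := k / s.
have v0 : 0 <= v by rewrite divr_ge0// ltW.
have [ms [ML sL nL] <- vs] := lay_facts he v Me hc; set L := sop e _ in ML sL nL *.
have bL := M_bop ML; have [_ _ bfs] := sop_bop he ms.
have LE : L = Phi he (sval (lay v c)) by rewrite (Phi_sop he).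
have mv := measurable_lev v.
have sv0 l : ~ lev v l -> sval (lay v c) l = 0.
  rewrite /lev /= => /negP; rewrite -leNgt => lv; rewrite vs big_seq big1// => p pc.
  move/allP : hc => /(_ _ pc) /andP[_ p2]; rewrite indicE memNset ?mulr0// /lev /=; apply/negP; rewrite -leNgt.
  by apply: le_trans lv _; rewrite lerDl.
have svl l : lev v l -> sval (lay v c) l <= l ^+ 2 - v.
  rewrite /lev /= => lv; rewrite vs; have lv' : 0 <= l ^+ 2 - v by rewrite subr_ge0 ltW.
  apply: le_trans (hl _ lv'); rewrite ler_sum// => p _; rewrite indicE.
  by rewrite ltrBrDl; case: (boolP (l \in _)) => [/set_mem|/negP h]; [rewrite /lev /= => ->|case: ltP => // h2; case: h; exact/mem_set].
pose B n : set R := lev v `&` band n.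
have mB n : measurable (B n) by apply: measurableI => //; exact: measurable_band.
have hp n := pvm_proj he (mB n).
have ndB : nondecreasing_seq B by move=> m n mn; apply/subsetPset; apply: setIS; exact: band_sub.
pose a n x := e (B n) (L (e (B n) x)).
have Ma n : Mp (a n) by apply: Mp_cut => //; exact: Me.
have aE n x : rd (a n x) x = rd (Phi he (fun l => sval (lay v c) l * \1_(B n) l) x) x.
  have LB y : L (e (B n) y) = e (B n) (L y).
    by rewrite LE; apply: (Phi_comm he bfs (pvm_bop he (mB n))) => C z mC; exact: (pvm_comm he z mC (mB n)).
  by have [_ _ ip] := hp n; rewrite /a -LB ip Phi_e// -LE.
apply: (tr_lim Ma) => // [n x|x|n].
- rewrite !aE; apply: Phi_mono; try by apply: bfunM => //; exact: bfun_indic.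
  move=> l; have [lv|lv] := pselect (lev v l); last by rewrite sv0// !mul0r.
  apply: ler_wpM2l.
    rewrite vs big_seq; apply: sumr_ge0 => p pc; move/allP : hc => /(_ _ pc) /andP[p1 _].
    by rewrite mulr_ge0.
  rewrite !indicE ler_nat; case: (boolP (l \in B n)) => //= /set_mem h.
  by rewrite mem_set//; have /subsetPset := ndB _ _ (leqnSn n); apply.
- have c1 := pvm_cvg he x mB ndB.
  have BU : \bigcup_n B n = lev v by rewrite /B -setI_bigcupr band_cover setIT.
  rewrite BU in c1.
  have -> : rd (L x) x = rd (L (e (lev v) x)) (e (lev v) x).
    have E1 : L (e (lev v) x) = L x.
      rewrite LE -Phi_e//; congr (Phi he _ x); apply/funext => l; rewrite indicE.
      by have [lv|lv] := pselect (lev v l); [rewrite mem_set// mulr1|rewrite sv0// mul0r].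
    by rewrite E1 (sL x (e (lev v) x)) E1 -sL.
  rewrite (_ : (fun n => _) = fun n => rd (L (e (B n) x)) (e (B n) x)).
    by apply: hcvg_rd => //; exact: (bop_cvg bL c1).
  by apply/funext => n; rewrite /a; have [_ -> _] := hp n.
have [hU1 hU2] := hU; have eb x : e (band n) (e (B n) x) = e (B n) x.
  by apply: pvm_sub => //; [exact: measurable_band|exact: subIsetr].
have hr x := mrep_band hrep (eb x).
have cb := @bfun_cutf R n.
have bnd x : mq A (e (B n) x) <= n%:R ^+ 2 * rd x x.
  have [_ ->] := hr x.
  have [|_ h2] := @Phi_bounds _ _ e he (fun l => cutf n l ^+ 2) (B n) (e (B n) x) 0 (n%:R ^+ 2) (bfunM cb cb) (mB n) _ (pvm_id he _ (mB n)).
    move=> l [_ h]; rewrite sqr_ge0 cutf_sqE indicE (mem_set h) mulr1 /= -(real_normK (num_real l)).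
    by rewrite lerXn2r ?nnegrE.
  apply: le_trans h2 _; rewrite ler_wpM2l ?sqr_ge0// orthoproj_rd//; exact: orthoproj_le.
have hV := mcut_form (Me _ (mB n)) (hp n) hU; have [hV1 hV2] := hV.
have VE j x : rd (mcut (e (B n)) U j x) x = rd (U j (e (B n) x)) (e (B n) x) by rewrite /mcut; have [_ -> _] := hp n.
(* Cut down to [B n] the forms [U j] are bounded by [n^2], so their supremum is a genuine operator
   [W] of the algebra, with trace at most [k]. *)
have [||||W [bW sW nW limW]] := @monotone_limit _ _ (mcut (e (B n)) U) (n%:R ^+ 2) _ _ _ hV2.
- by move=> j; case: (hV1 j) => /M_bop.
- by move=> j; case: (hV1 j).
- by move=> j; case: (hV1 j).
- by move=> j x; rewrite VE; apply: le_trans (hUA _ _) _; apply: le_trans (bnd x); apply: mq_ub => //; case: (hr x).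
have MW : Mp W.
  split=> //; apply: (M_lim (K := n%:R ^+ 2) _ _ limW) => j; first by case: (hV1 j).
  move=> x; have [Vj sj nj] := hV1 j; apply: form_nrm; rewrite ?sqr_ge0//; first exact: (M_bop Vj).
  by move=> z; rewrite VE; apply: le_trans (hUA _ _) _; apply: le_trans (bnd z); apply: mq_ub => //; case: (hr z).
apply: (@le_trans _ _ (tau W)); last first.
  apply: (tr_lim hV1 MW hV2) => [x|j]; first exact: (hcvg_rd (limW x) (hcvg_cst x)).
  apply: le_trans (tr_cut (hU1 j) (Me _ (mB n)) (hp n)) (tU j).
apply: tr_mono => // x; rewrite /a; have [_ -> _] := hp n; set y := e (B n) x.
have [Dy qy] := hr x; rewrite -/y in Dy qy.
have bc2 : bfun (fun l : R => cutf n l ^+ 2 - v) by apply: bfunB; [exact: bfunM|exact: bfun_cst].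
have h1 : rd (L y) y <= mq A y - v * rd y y.
  rewrite qy -rdZl -rdBl -(Phi_cst he v y) -(PhiB he y (bfunM cb cb) (@bfun_cst R v)) LE.
  apply: (@Phi_le_on e he _ _ (B n) y bfs bc2 (mB n)); last by rewrite /y (pvm_id he).
  by move=> l [lv lb]; rewrite cutf_sqE indicE (mem_set lb) mulr1; exact: svl.
apply: le_trans h1 _; rewrite lerBlDr.
apply: (cvg_le_seq (mq_cvg hA Dy) (cvgD (hcvg_rd (limW x) (hcvg_cst x)) (cvg_cst (v * rd y y)))) => j.
suff : rd (A j y) y <= rd (mcut (e (B n)) U j x) x + v * rd y y by [].
by rewrite VE; exact: hAU.
Qed.

End Forms.

(** * Spectral measures of positive tau-measurable operators *)

Section TauSpectral.
Implicit Types (x y z : H) (A U : nat -> H -> H) (B C : set R) (e : set R -> H -> H) (s k t v w : R).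

(** The spectral measures of the positive operators of S(tau): tau-measurability becomes the
    vanishing of the traces of the tails ([positive_tspec], [ts_stau]). *)
Record tspec e : Prop := Tspec {
  ts_pvm :> pvm e;
  ts_half : forall x, e (@half R) x = x;
  ts_M : forall B, measurable B -> M (e B);
  ts_tail : forall eps, 0 < eps -> exists m : nat, (tau (fun x => x - e (band m) x)%R <= eps%:E)%E }.

Lemma half_eq e B C x : pvm e -> (forall z, e (@half R) z = z) -> measurable B -> measurable C ->
  (forall l, 0 <= l -> B l <-> C l) -> e B x = e C x.
Proof.
move=> he e0 mB mC BC; have mh := @measurable_half.
rewrite -(e0 x) -!pvm_I//; congr (e).
by apply/seteqP; split=> l [h1]; split=> //; apply/(BC).
Qed.

Lemma compl_band e m x : pvm e -> (forall z, e (@half R) z = z) -> x - e (band m) x = e (ray m%:R) x.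
Proof.
move=> he e0; have mb := @measurable_band R m.
rewrite -(pvm_C he x mb); apply: half_eq => //; [exact: measurableC|exact: measurable_ray|].
by move=> l l0; rewrite /band /ray /= (ger0_norm l0) ltNge; split=> /negP.
Qed.

Lemma tspec_fin e v : pvm e -> (forall z, e (@half R) z = z) -> (forall B, measurable B -> M (e B)) ->
  (tau (e (ray v)) < +oo)%E -> tspec e.
Proof.
move=> he e0 Me fin; split=> // eps eps0.
have [n hn] := tr_tail he Me fin eps0.
exists (Num.truncn `|v + n%:R|).+1; set m := _.+1.
rewrite (_ : (fun => _) = e (ray m%:R)); last by apply/funext => x; exact: compl_band.
apply: le_trans hn; apply: (tr_sub he Me); [exact: measurable_ray..|].
move=> l; apply: le_lt_trans.
exact: le_trans (ler_norm _) (ltW (truncnS_gt _)).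
Qed.

Section OfTspec.
Variables (e : set R -> H -> H) (h : tspec e).
Local Notation he := (ts_pvm h).

Lemma ts_tail_ray eps : 0 < eps -> exists m : nat, (tau (e (ray m%:R)) <= eps%:E)%E.
Proof.
move=> /(ts_tail h) [m hm]; exists m; apply: le_trans hm; rewrite (_ : (fun => _) = e (ray m%:R))//.
by apply/funext => x; exact: compl_band _ _ he (ts_half h).
Qed.

Lemma ts_small m n eps : (m <= n)%N -> (tau (fun x => x - e (band m) x)%R <= eps%:E)%E ->
  (tau (fun x => x - e (band n) x)%R <= eps%:E)%E.
Proof.
move=> mn; have E (k : nat) : (fun x : H => x - e (band k) x) = e (ray k%:R).
  by apply/funext => x; exact: compl_band _ _ he (ts_half h).
rewrite !E; apply: le_trans; apply: (tr_sub he (ts_M h)); [exact: measurable_ray..|].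
by move=> l; apply: le_lt_trans; rewrite ler_nat.
Qed.

Lemma ts_stau : Stau M tau (spec_op he).
Proof.
split; first exact: aff_spec he (ts_M h).
have [m hm] := ts_tail_ray ltr01; exists m.+1%:R; split=> //.
rewrite spec_distribution; last exact: ts_half.
apply: le_lt_trans (ltry 1); apply: le_trans hm; apply: (tr_sub he (ts_M h)); [exact: measurable_ray..|].
by move=> l; apply: le_lt_trans; rewrite ler_nat.
Qed.

(** The form of the operator itself, as the increasing sequence of its truncations; [mrep] concerns
    the square of an operator instead. *)
Definition Lm : nat -> H -> H := fun n => Phi he (@cutf R n).

Lemma Lm_form : mform Lm.
Proof.
have b n := @bfun_cutf n; split=> [n|n x].
  split; [exact: (M_Phi he (ts_M h))|exact: Phi_sa|exact: (cutf_nonneg he (ts_half h))].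
apply: @Phi_le_on; [exact: b|exact: b|exact: measurable_half| |exact: ts_half].
move=> l l0; rewrite ler_wpM2l// !indicE !bandE ler_nat.
by case: leP => //= hl; rewrite (le_trans hl)// ler_nat.
Qed.

Lemma Lm_at x y : spec_op he (x, y) -> mdom Lm x /\ mq Lm x = rd y x.
Proof.
move=> hxy; have c := hcvg_rd (spec_cvg hxy) (hcvg_cst x).
have nd : nondecreasing_seq (fun n => rd (Lm n x) x) by move=> m n; exact: mf_le x Lm_form.
have Dx : mdom Lm x.
  exists (rd y x) => n; have := nondecreasing_cvgn_le nd (cvgP _ c).
  by rewrite (cvg_lim _ c).
split=> //; have c' : rd (Lm n x) x @[n --> \oo] --> rd y x := c.
exact: cvg_unique (mq_cvg Lm_form Dx) c'.
Qed.

End OfTspec.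

Lemma positive_tspec T : Stau M tau T -> positive_op T ->
  exists e (h : tspec e), T = spec_op h /\ forall v, distribution_op tau T v = tau (e (ray v)).
Proof.
move=> [aT [v [_ fin]]] pT; have [e [he [e0 TE]]] := positive_spectral pT.
rewrite TE in aT fin *; have Me := M_spec e0 aT.
rewrite (spec_distribution he tau v e0) in fin.
by exists e, (tspec_fin he e0 Me fin); split=> // w; exact: spec_distribution.
Qed.

Lemma abs_tspec T : Stau M tau T -> exists e (h : tspec e),
  [/\ forall v, distribution_op tau T v = tau (e (ray v)),
      forall x, domain_op T x <-> domain_op (spec_op h) x &
      forall x, domain_op T x -> rd (app T x) (app T x) = rd (app (spec_op h) x) (app (spec_op h) x)].
Proof.
move=> [aT [v [_ fin]]]; have [cT] := aT; have [e [he [e0 hP dE]]] := abs_spectral cT.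
have Me := M_abs aT e0 hP; rewrite dE in fin.
exists e, (tspec_fin he e0 Me fin); split=> // x; [exact: (abs_form x cT hP).1|exact: (abs_form x cT hP).2].
Qed.

(** The case of a single layer of height and weight [w] in [tr_layers], a Chebyshev inequality above
    the level [k / s]. *)
Lemma lev_bound A e (he : pvm e) s k w : mform A -> (forall C, measurable C -> M (e C)) -> mrep A he ->
  0 < s -> 0 <= k -> Kfun A s k -> 0 < w -> (tau (e (lev (k / s + w))) <= (k / w)%:E)%E.
Proof.
move=> hA Me hr s0 k0 hK w0.
have := @tr_layers A e he s k [:: (w, w)] hA Me hr s0 k0 hK.
rewrite /= ltW// => /(_ isT) hl; have := hl; rewrite big_seq1 => {}hl.
have {hl} : (w%:E * tau (e (lev (k / s + w))) <= k%:E)%E.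
  apply: hl => l; rewrite big_seq1; case: ltP => [/ltW|_]; rewrite ?mulr1 ?mulr0//.
by rewrite [k / w]mulrC EFinM lee_pdivlMl.
Qed.

Lemma mform_tspec A s k : mform A -> 0 < s -> 0 <= k -> Kfun A s k ->
  exists e (h : tspec e), mrep A h.
Proof.
move=> hA s0 k0 hK; have [e [he [e0 Me hr]]] := mform_pvm hA (fun x => mdom_dense x hA s0 hK).
have hl := lev_bound hA Me hr s0 k0 hK ltr01.
suff h : (tau (e (ray (k / s + 1 + 1))) < +oo)%E by exists e, (tspec_fin he e0 Me h).
apply: le_lt_trans (ltry (k / 1)); apply: le_trans hl; apply: (tr_sub he Me).
- exact: measurable_ray.
- exact: measurable_lev.
by move=> l; rewrite /ray /lev /=; nra.
Qed.

Lemma lev_low A e (he : pvm e) v x : 0 <= v -> mrep A he -> e (~` lev v) x = x ->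
  mdom A x /\ mq A x <= v * rd x x.
Proof.
move=> v0 hr Cx; have mC : measurable (~` lev v) by apply: measurableC; exact: measurable_lev.
pose n0 := (Num.truncn `|v + 1|).+1.
have sub : ~` lev v `<=` @band R n0.
  move=> l /negP; rewrite -leNgt => lv.
  apply: le_trans; last exact: le_trans (ler_norm _) (ltW (truncnS_gt _)).
  by move: lv; rewrite -(real_normK (num_real l)); move: `|l| normr_ge0 => a; nra.
have bx : e (band n0) x = x by rewrite -Cx pvm_sub//; exact: measurable_band.
have [Dx ->] := mrep_band hr bx.
have b2 : bfun (fun l : R => cutf n0 l ^+ 2) by apply: bfunM; exact: bfun_cutf.
have [|_ //] := @Phi_bounds _ _ e he _ (~` lev v) x 0 v b2 mC _ Cx.
by move=> l lv; rewrite sqr_ge0 cutf_sqE indicE mem_set ?mulr1; [rewrite leNgt; exact/negP|exact: sub].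
Qed.

(** By [tr_inj] it suffices that no nonzero vector in the range of [e (ray v)] is killed by
    [e' (lev v)]. At such a vector the first form would exceed [v |x|^2], while that of [A], which
    dominates it, is at most [v |x|^2]. *)
Lemma tr_level e e' (h : tspec e) (h' : tspec e') A v : mform A -> mrep A h' -> mle (Lm h) A ->
  0 <= v -> (tau (e (ray v)) <= tau (e' (lev v)))%E.
Proof.
move=> hA hr hle v0; have he := ts_pvm h; have he' := ts_pvm h'.
have mr w := @measurable_ray R w; have ml := measurable_lev.
apply: (tr_inj (z := fun x => e' (lev v) (e (ray v) x))).
- exact: ts_M.
- exact: pvm_proj.
- exact: ts_M.
- exact: pvm_proj.
- by apply: M_comp; [exact: ts_M|exact: ts_M].
- by move=> x; rewrite pvm_id.
move=> x pix; rewrite pix => px.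
have Cx : e' (~` lev v) x = x by rewrite pvm_C// px subr0.
have [Dx qx] := lev_low v0 hr Cx.
have up n : rd (Lm h n x) x <= v * rd x x.
  by apply: hle => m; exact: (le_trans (mq_ub m hA Dx)).
pose t m : R := m.+1%:R^-1.
have t0 m : 0 < t m by rewrite invr_gt0.
(* The strict inequality has no uniform margin on [ray v]; these smaller rays have one, and they
   exhaust it. *)
pose C m : set R := ray (v + t m).
have C0 m : e (C m) x = 0.
  apply: (orthoproj_eq0 (pvm_proj he (mr _))); rewrite -(pmulr_rle0 _ (t0 m)).
  have key n : v * rd (e (band n) x) x + t m * rd (e (band n) (e (C m) x)) x <= v * rd x x.
    apply: le_trans (up n); have mb := @measurable_band.
    have bi B := @bfun_indic R B.
    have mI1 : measurable (ray v `&` band n) by exact: measurableI.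
    have mI2 : measurable (band n `&` C m) by apply: measurableI => //; exact: mr.
    have -> : e (band n) x = e (ray v `&` band n) x by rewrite setIC pvm_I// pix.
    have -> : e (band n) (e (C m) x) = e (band n `&` C m) x by rewrite pvm_I//; exact: mr.
    rewrite -!Phi_indic// -!rdZl -!PhiZ; try exact: bi.
    rewrite -rdDl -PhiD; try (apply: bfunZ; exact: bi).
    apply: @Phi_le_on; [|exact: bfun_cutf|exact: measurable_half| |exact: ts_half].
      by apply: bfunD; apply: bfunZ; exact: bi.
    move=> l; rewrite /cutf !indicE !in_setI; case: (boolP (l \in band n)) => hb; rewrite ?andbF ?mulr0//=.
    rewrite andbT; case: (boolP (l \in C m)) => hC.
      have lC : v + t m < l by move/set_mem : hC.
      by rewrite mem_set ?mulr1 ?ltW//; apply: lt_trans lC; rewrite ltrDl.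
    by rewrite mulr0 addr0; case: (boolP (l \in ray v)) => [/set_mem/ltW|_]; rewrite ?mulr1 ?mulr0.
  have c1 := hcvg_rd (eb_cvg he x) (hcvg_cst x); have c2 := hcvg_rd (eb_cvg he (e (C m) x)) (hcvg_cst x).
  have c3 : v * rd (e (band n) x) x + t m * rd (e (band n) (e (C m) x)) x @[n --> \oo] --> v * rd x x + t m * rd (e (C m) x) x.
    by apply: cvgD; apply: cvg_mulc.
  have h3 := cvg_le_seq c3 (cvg_cst (v * rd x x)).
  by move: h3; rewrite gerDl => h3; exact: h3.
have nd : nondecreasing_seq C.
  move=> m n mn; apply/subsetPset => l; apply: le_lt_trans.
  by rewrite lerD2l lef_pV2 ?posrE// ler_nat.
have CU : \bigcup_m C m = ray v.
  apply/seteqP; split=> [l [m _]|l lv]; first by rewrite /C; apply: lt_trans; rewrite ltrDl.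
  have lv0 : 0 < (l - v) / 2 by rewrite divr_gt0// subr_gt0.
  have /cvgrPdist_le /(_ _ lv0) [N _ hN] := @cvg_harmonic R.
  exists N => //; have := hN N (leqnn N); rewrite /= sub0r normrN ger0_norm//.
  by rewrite /C /ray /= /t; move: N.+1%:R^-1 => a; lra.
rewrite -pix -CU; apply: hcvg_unique (pvm_cvg he x (fun => mr _) nd) _.
by rewrite (_ : (fun => _) = fun=> 0); [exact: hcvg_cst|exact/funext].
Qed.

(** Vectors whose images under [G] and [G'] have bounded spectral support are dense, because what
    the bands cut off has small trace. [G'] may depend on the cutoff for [G], as when an unbounded
    operator is applied in between; the last hypothesis says that it stabilizes. *)
Lemma ts_joint e e' (h : tspec e) (h' : tspec e') (G : H -> H) (G' : nat -> H -> H) x : M G -> (forall m, M (G' m)) ->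
  (forall m x, e (band m) (G x) = G x -> G' m.+1 x = G' m x) ->
  exists u : nat -> H, hcvg u x /\ forall n, exists m, e (band m) (G (u n)) = G (u n) /\ e' (band m) (G' m (u n)) = G' m (u n).
Proof.
move=> MG MG' hG; have mb m := @measurable_band R m.
have up e0 (h0 : tspec e0) m y : e0 (band m) y = y -> e0 (band m.+1) y = y.
  by move=> ey; rewrite -ey (pvm_sub h0)//; exact: band_sub.
have q e0 (h0 : tspec e0) m : orthoproj (fun y => y - e0 (band m) y) /\ M (fun y => y - e0 (band m) y).
  by split; [exact: orthoprojC (pvm_proj h0 (mb m))|apply: M_sub; [exact: M_id|exact: ts_M]].
have qi e0 (h0 : tspec e0) m y : y - e0 (band m) y - e0 (band m) (y - e0 (band m) y) = y - e0 (band m) y.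
  by have [[_ _ ->]] := q e0 h0 m.
have small eps : 0 < eps -> exists m, (tau (fun y => y - e (band m) y)%R + tau (fun y => y - e' (band m) y)%R <= eps%:E)%E.
  move=> eps0; have e2 : 0 < eps / 2 by rewrite divr_gt0.
  have [m1 h1] := ts_tail h e2; have [m2 h2] := ts_tail h' e2; exists (maxn m1 m2).
  apply: le_trans (leeD (ts_small h (leq_maxl m1 m2) h1) (ts_small h' (leq_maxr m1 m2) h2)) _.
  by rewrite lee_fin; lra.
have inc m y : G y - e (band m) (G y) = 0 -> G' m y - e' (band m) (G' m y) = 0 ->
    G y - e (band m.+1) (G y) = 0 /\ G' m.+1 y - e' (band m.+1) (G' m.+1 y) = 0.
  move=> /subr0_eq/esym e1 /subr0_eq/esym e2; rewrite (up)// (hG)// (up)//.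
  by rewrite !subrr.
have [u [hu]] := @joint_dense (fun m y => G y - e (band m) (G y)) (fun m y => G' m y - e' (band m) (G' m y))
  _ _ x (fun m => M_comp (proj2 (q e h m)) MG) (fun m => M_comp (proj2 (q e' h' m)) (MG' m))
  (fun m => proj2 (q e h m)) (fun m => proj1 (q e h m)) (fun m => proj2 (q e' h' m)) (fun m => proj1 (q e' h' m))
  (fun m y => qi e h m (G y)) (fun m y => qi e' h' m (G' m y)) inc small.
by exists u; split=> // n; have [m [/subr0_eq/esym h1 /subr0_eq/esym]] := hu n; exists m.
Qed.

(** At a vector with bounded spectral support for both summands the strong sum is the algebraic one
    and the forms add. [mle_dense] asks for no other vectors. *)
Lemma mle_strong_add e1 e2 e3 (h1 : tspec e1) (h2 : tspec e2) (h3 : tspec e3) :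
  spec_op h3 = strong_add (spec_op h1) (spec_op h2) ->
  mle (Lm h3) (madd (Lm h1) (Lm h2)).
Proof.
move=> E; have f1 := Lm_form h1; have f2 := Lm_form h2; have f3 := Lm_form h3.
have f12 := madd_form f1 f2; apply: (mle_dense f3 f12) => t x t0.
have [MG] := M_mres (mscale_form (ltW t0) f12).
have [u [ux hu]] := ts_joint h1 h2 x MG (fun=> MG) (fun _ _ _ => erefl).
exists u; split=> // n N; set y := mres _ (u n); have [m [y1 y2]] := hu n.
have s1 := spec_eb h1 m y; have s2 := spec_eb h2 m y; rewrite y1 in s1; rewrite y2 in s2.
have s3 : spec_op h3 (y, Lm h1 m y + Lm h2 m y).
  rewrite E; apply: subset_closure; exists (Lm h1 m y), (Lm h2 m y); split=> //.
have [d1 q1] := Lm_at s1; have [d2 q2] := Lm_at s2; have [d3 q3] := Lm_at s3.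
apply: le_trans (mq_ub N f3 d3) _; rewrite q3 rdDl -q1 -q2.
have d12 : mdom (madd (Lm h1) (Lm h2)) y.
  exists (mq (Lm h1) y + mq (Lm h2) y) => i; rewrite rdDl; apply: lerD; [exact: (mq_ub i f1 d1)|exact: mq_ub].
have c : rd (Lm h1 i y) y + rd (Lm h2 i y) y @[i --> \oo] --> mq (Lm h1) y + mq (Lm h2) y.
  by apply: cvgD; [exact: mq_cvg f1 d1|exact: mq_cvg].
apply: (cvg_le_seq c (mq_cvg f12 d12)) => i; by rewrite rdDl.
Qed.

End TauSpectral.


(** * A common majorant from a factorization *)

Section Majorant.
Implicit Types (x y z : H) (A U : nat -> H -> H) (C : set R) (e : set R -> H -> H) (s k t v w : R).

Lemma Phi_cut e (he : pvm e) f C x : bfun f -> measurable C ->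
  rd (Phi he f (e C x)) (e C x) = rd (Phi he (fun l => f l * \1_C l) x) x.
Proof.
move=> bf mC; rewrite Phi_e// -[in RHS](pvm_id he x mC).
have -> : Phi he f (e C (e C x)) = e C (Phi he f (e C x)).
  by apply: (Phi_comm he bf (pvm_bop he mC)) => B z mB; exact: pvm_comm.
by rewrite pvm_sa.
Qed.

Lemma cutf_bnd n (l : R) : `|cutf n l| <= n%:R.
Proof.
rewrite /cutf indicE; case: (boolP (l \in band n)) => [/set_mem|_]; rewrite ?mulr1//.
by rewrite mulr0 normr0.
Qed.

Section OfTspec.
Variables (e : set R -> H -> H) (h : tspec e).
Local Notation he := (ts_pvm h).

Definition ts_dist v := tau (e (ray v)).

Lemma ts_noninc : noninc ts_dist.
Proof.
move=> v w vw; apply: (tr_sub he (ts_M h)); [exact: measurable_ray..|].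
by move=> l; exact: le_lt_trans.
Qed.

Lemma ts_dist_ge0 v : (0 <= ts_dist v)%E.
Proof. by apply: tr_ge0; apply: (Mp_e he (ts_M h)); exact: measurable_ray. Qed.

Lemma ts_mu_fin t : 0 < t -> rearrangement ts_dist t \is a fin_num.
Proof.
move=> t0; rewrite ge0_fin_numE ?rearr_ge0//; have [m hm] := ts_tail_ray h t0.
apply: le_lt_trans (ltry m.+1%:R); apply: rearr_le => //; apply: le_trans hm.
by apply: ts_noninc; rewrite ler_nat.
Qed.

Definition lcut (th : R) n (l : R) := cutf n l ^+ 2 * \1_(lev th) l.

Lemma bfun_lcut th n : bfun (lcut th n).
Proof. by apply: bfunM; [apply: bfunM; exact: bfun_cutf|apply: bfun_indic; exact: measurable_lev]. Qed.

Lemma lcut_ge0 th n l : 0 <= lcut th n l.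
Proof. by rewrite mulr_ge0 ?sqr_ge0. Qed.

(** States that [c] bounds the norm in the 2-convexification of L^r of the operator with generalized
    singular values [g]. *)
Definition sq_lr r c (g : R -> \bar R) := measurable_fun halfline (fun t => `|fine (g t)| ^+ 2) /\
  (Lr_int r (fun t => (`|fine (g t)| ^+ 2)%R) <= ((c ^+ 2) `^ r)%:E)%E.

(** Chebyshev at exponent [r]: above [th] one has [l^2 <= th (l^2 / th)^r]. The square is dominated
    by layers at the levels [4^j th], whose sum overshoots it by a factor of at most 16/3; the
    constant 6 absorbs this. *)
Lemma lev_trace th r al n : 0 < th -> 1 <= r -> sq_lr r al (rearrangement ts_dist) ->
  (tau (Phi he (lcut th n)) <= (6 * th * ((al ^+ 2) `^ r / th `^ r))%:E)%E.
Proof.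
set I := (al ^+ 2) `^ r; move=> th0 r1 [mmu hI]; have mh := @measurable_halfline R.
have p0 : 0 < th `^ r by exact: powR_gt0.
pose lv j : R := 4 ^+ j * th.
have lv0 j : 0 < lv j by rewrite mulr_gt0// exprn_gt0.
have lvS j : lv j.+1 = 4 * lv j by rewrite /lv exprS -mulrA.
pose J := (Num.truncn (n%:R ^+ 2 / th)).+1.
have hJ : n%:R ^+ 2 <= lv J.
  rewrite -ler_pdivrMr//; apply: le_trans (ltW (truncnS_gt _)) _; rewrite -/J -natrX ler_nat.
  by apply: ltnW; apply: ltn_expl.
pose c : seq (R * R) := [seq (4 * lv j, lv j) | j <- index_iota 0 J].
have hc : all (fun p => (0 <= p.1) && (0 <= p.2)) c.
  by apply/allP => p /mapP[j _ ->] /=; rewrite mulr_ge0//= ltW.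
have [ms ML tL vL] := lay_facts he 0 (ts_M h) hc; have [_ _ bv] := sop_bop he ms.
have h1 : (tau (Phi he (lcut th n)) <= tau (sop e (lay 0 c)))%E.
  have b := bfun_lcut th n.
  apply: (tr_mono _ ML) => [|x].
    by split; [exact: (M_Phi he (ts_M h) b)|exact: Phi_sa|apply: Phi_nonneg => // l; exact: lcut_ge0].
  rewrite -(Phi_sop he ms); apply: Phi_mono => // l; rewrite vL big_map.
  have step m : (l ^+ 2 <= lv m)%R%:R * (l ^+ 2 * \1_(lev th) l) <= \sum_(0 <= j < m) 4 * lv j * \1_(lev (0 + lv j)) l.
    elim: m => [|m IH].
      rewrite big_geq// /lv expr0 mul1r indicE; case: (leP (l ^+ 2) th) => h0; rewrite ?mul0r//= mul1r.
      by rewrite memNset ?mulr0// /lev /=; apply/negP; rewrite -leNgt.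
    rewrite big_nat_recr//=; have [hm|hm] := leP (l ^+ 2) (lv m).
      rewrite hm mul1r in IH; apply: le_trans (_ : l ^+ 2 * \1_(lev th) l <= _); last first.
        by apply: le_trans IH _; rewrite lerDl mulr_ge0// mulr_ge0// ltW.
      by apply: ler_piMl; [rewrite mulr_ge0// sqr_ge0|rewrite lern1 leq_b1].
    have hs : 0 <= \sum_(0 <= j < m) 4 * lv j * \1_(lev (0 + lv j)) l.
      by apply: sumr_ge0 => j _; rewrite mulr_ge0// mulr_ge0// ltW.
    rewrite [in X in _ <= _ + X]indicE (mem_set (_ : lev (0 + lv m) l)) ?mulr1; last by rewrite /lev /= add0r.
    apply: le_trans (_ : 4 * lv m <= _); last by rewrite lerDr.
    case: (leP (l ^+ 2) (lv m.+1)) => h2; last by rewrite mul0r mulr_ge0// ltW.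
    rewrite mul1r; apply: le_trans (_ : l ^+ 2 <= _).
      by apply: ler_piMr; [rewrite sqr_ge0|rewrite indicE lern1 leq_b1].
    by rewrite -lvS.
  apply: le_trans (step J); rewrite /lcut cutf_sqE.
  rewrite (_ : _ * _ * _ = \1_(band n) l * (l ^+ 2 * \1_(lev th) l)); last by ring.
  apply: ler_wpM2r; first by rewrite mulr_ge0// sqr_ge0.
  rewrite indicE; case: (boolP (l \in band n)) => [/set_mem ln|_]; last by rewrite ler0n.
  suff -> : l ^+ 2 <= lv J by [].
  apply: le_trans hJ; rewrite -(real_normK (num_real l)); have ln' : `|l| <= n%:R := ln.
  by rewrite lerXn2r ?nnegrE.
apply: le_trans h1 _; rewrite tL.
pose c' : seq (R * R) := [seq (4 * lv j, Num.sqrt (lv j)) | j <- index_iota 0 J].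
have -> : (\sum_(p <- c) (p.1%:E * tau (e (lev (0 + p.2)))) = \sum_(p <- c') (p.1%:E * ts_dist p.2))%E.
  rewrite !big_map; apply: eq_bigr => j _ /=; congr (_ * tau _)%E; apply/funext => x.
  apply: (half_eq x he (ts_half h) (measurable_lev _) (@measurable_ray R _)) => l l0.
  rewrite /lev /ray /= add0r -{1}(sqr_sqrtr (ltW (lv0 j))).
  by rewrite ltr_sqr ?nnegrE ?sqrtr_ge0.
pose phi (l : R) := 6 * th / th `^ r * `| `|l| ^+ 2 | `^ r.
have k0 : 0 <= 6 * th / th `^ r by rewrite divr_ge0 ?powR_ge0// mulr_ge0// ltW.
have mpw : measurable_fun halfline (fun t => `| `|fine (rearrangement ts_dist t)| ^+ 2 | `^ r).
  by apply: (measurableT_comp (measurable_powR _)); exact: measurableT_comp.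
apply: le_trans (@layer_int R ts_dist phi c' ts_noninc ts_dist_ge0 ts_mu_fin _ _ _ _) _.
- by apply: measurable_funM.
- by apply/allP => p /mapP[j _ ->] /=; rewrite sqrtr_gt0 lv0 andbT mulr_ge0// ltW.
- by move=> l; rewrite mulr_ge0// powR_ge0.
- move=> l l0; rewrite big_map /phi (ger0_norm l0) (ger0_norm (sqr_ge0 l)) /=.
  have cj j : (Num.sqrt (lv j) <= l) = (lv j <= l ^+ 2).
    by rewrite -{2}(sqr_sqrtr (ltW (lv0 j))) ler_sqr ?nnegrE ?sqrtr_ge0.
  have S1 m : \sum_(0 <= j < m) 4 * lv j * (Num.sqrt (lv j) <= l)%R%:R <= 4 / 3 * lv m.
    elim: m => [|m IH]; first by rewrite big_geq// mulr_ge0// ltW.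
    rewrite big_nat_recr//=; apply: le_trans (lerD IH (_ : _ <= 4 * lv m)) _.
      by apply: ler_piMr; [rewrite mulr_ge0// ltW|rewrite lern1 leq_b1].
    by rewrite lvS; lra.
  have S2 m : \sum_(0 <= j < m) 4 * lv j * (Num.sqrt (lv j) <= l)%R%:R <= (th <= l ^+ 2)%R%:R * (16 / 3 * l ^+ 2).
    elim: m => [|m IH]; first by rewrite big_geq// mulr_ge0// mulr_ge0// sqr_ge0.
    have [hm|hm] := leP (lv m) (l ^+ 2).
      have -> : th <= l ^+ 2.
        by apply: le_trans hm; apply: ler_peMl; [exact: ltW|rewrite exprn_ege1// ler1n].
      rewrite mul1r; apply: le_trans (S1 m.+1) _; rewrite lvS; lra.
    have cm : (Num.sqrt (lv m) <= l) = false by rewrite cj leNgt hm.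
    by rewrite big_nat_recr//= cm mulr0 addr0.
  apply: le_trans (S2 J) _; case: (leP th (l ^+ 2)) => h0; last by rewrite mul0r mulr_ge0// powR_ge0.
  rewrite mul1r; have l20 : 0 < l ^+ 2 := lt_le_trans th0 h0.
  have -> : 6 * th / th `^ r * (l ^+ 2) `^ r = 6 * th * ((l ^+ 2) / th) `^ r.
    have e1 : (l ^+ 2) `^ r = (l ^+ 2 / th) `^ r * th `^ r.
      by rewrite -powRM ?divfK ?gt_eqF ?divr_ge0 ?(ltW l20) ?(ltW th0).
    by rewrite e1; move: (th `^ r) p0 => P P0; field; rewrite gt_eqF.
  have u1 : 1 <= l ^+ 2 / th by rewrite ler_pdivlMr// mul1r.
  apply: le_trans (_ : 6 * th * (l ^+ 2 / th) <= _); last first.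
    by rewrite ler_pM2l ?mulr_gt0// -{1}(powRr1 (le_trans ler01 u1)) ler_powR.
  have -> : 6 * th * (l ^+ 2 / th) = 6 * l ^+ 2 by field; rewrite gt_eqF.
  by move: (l ^+ 2) l20 => q q0; lra.
rewrite /phi; under eq_integral do rewrite EFinM.
rewrite (ge0_integralZl_EFin leb mh)//; last exact/measurable_EFinP.
  apply: le_trans (lee_wpmul2l _ hI) _; first by rewrite lee_fin.
  by rewrite -EFinM lee_fin -!mulrA [_^-1 * I]mulrC.
Qed.

End OfTspec.
Section OfOperator.
Variables (T : set (H * H)) (e : set R -> H -> H) (h : tspec e).
Local Notation he := (ts_pvm h).
Hypotheses (aT : affiliated M T) (hD : forall x, domain_op T x <-> domain_op (spec_op he) x)
  (hN : forall x, domain_op T x -> rd (app T x) (app T x) = rd (app (spec_op he) x) (app (spec_op he) x)).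

(** [T] on the spectral subspace where its absolute value is at most [n]: a bounded operator of the
    algebra. *)
Definition Tn n x := app T (e (band n) x).

Let cT : closed_op T. Proof. by case: aT. Qed.
Let mb n := @measurable_band R n.

Lemma Tn_at n x : T (e (band n) x, Tn n x).
Proof. by apply: appP; apply/hD; exists (e (band n) x, Phi he (@cutf R n) x) => //; exact: spec_eb. Qed.

Lemma Tn_nrm n x : rd (Tn n x) (Tn n x) = rd (Phi he (fun l => cutf n l ^+ 2) x) x.
Proof.
rewrite hN; last by exists (e (band n) x, Tn n x) => //; exact: Tn_at.
rewrite (appE (spec_closed he) (spec_eb he n x)) cutf_sq Phi_rd//.
by apply: bfunM; exact: bfun_cutf.
Qed.

Lemma Tn_M n : M (Tn n).
Proof.
have be := pvm_bop he (mb n); apply/inM; split.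
  apply: (@bop_intro _ _ _ n%:R) => [x y|c x|x|x].
  - by apply: (appE cT); rewrite (bopD be); exact: (clD cT (Tn_at n x) (Tn_at n y)).
  - by apply: (appE cT); rewrite (boprs be); exact: (clZ cT c (Tn_at n x)).
  - by apply: (appE cT); rewrite (bophi be); exact: (cli cT (Tn_at n x)).
  - apply: nrm_le; first by rewrite mulr_ge0.
    have b : bfun (fun l : R => cutf n l ^+ 2) by apply: bfunM; exact: bfun_cutf.
    rewrite Tn_nrm; apply: le_trans (rd_le _ _) _; rewrite exprMn mulrA.
    rewrite ler_wpM2r//; apply: Phi_le => // l.
    by rewrite ger0_norm ?sqr_ge0// -(real_normK (num_real _)) lerXn2r ?nnegrE//; exact: cutf_bnd.
move=> u hu x; apply: (appE cT); have [_ ce] := (inM _).1 (ts_M h (mb n)).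
by rewrite ce//; exact: (aff_comm aT hu (Tn_at n x)).
Qed.

Lemma Tn_sub m n x : (m <= n)%N -> Tn n (e (band m) x) = Tn m x.
Proof. by move=> mn; rewrite /Tn (pvm_sub he)//; exact: band_sub. Qed.

Lemma Tn_cvg x : domain_op T x -> hcvg (fun n => Tn n x) (app T x).
Proof.
move=> Dx; have cS := spec_closed he; have Sx := appP (iffLR (hD x) Dx); set y := app (spec_op he) x in Sx.
apply: (hcvg_le (K := 1) (eb_cvg he y)) => n; rewrite mul1r.
have h1 := clB cT (Tn_at n x) (appP Dx); have h2 := clB cS (spec_eb he n x) Sx.
rewrite -(Sx) in h2; rewrite -(appE cT h1) -(appE cS h2); apply/nrm_le_rd; rewrite hN//.
by exists (e (band n) x - x, Tn n x - app T x).
Qed.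

Definition Fb n x := adj (Tn n) (Tn n x).

Lemma Fb_rd n x : rd (Fb n x) x = rd (Phi he (fun l => cutf n l ^+ 2) x) x.
Proof. by rewrite (adjl _ _ (M_bop (Tn_M n))) Tn_nrm. Qed.

Let bc2 n : bfun (fun l : R => cutf n l ^+ 2). Proof. by apply: bfunM; exact: bfun_cutf. Qed.

Lemma cutf_sq_mono n (l : R) : cutf n l ^+ 2 <= cutf n.+1 l ^+ 2.
Proof.
rewrite !cutf_sqE ler_wpM2l ?sqr_ge0// !indicE !bandE.
by case: (leP `|l| n%:R) => hl; rewrite// (le_trans hl) ler_nat.
Qed.

Lemma Fb_form : mform Fb.
Proof.
split=> [n|n x]; first exact: Mp_adj (Tn_M n).
by rewrite !Fb_rd; apply: Phi_mono => //; exact: cutf_sq_mono.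
Qed.

Lemma Fb_dom x : mdom Fb x -> domain_op T x /\ mq Fb x = rd (app T x) (app T x).
Proof.
move=> Dx; have Tx : domain_op T x.
  have [K hK] := Dx; apply/hD; apply: @spec_domP => m.
  by rewrite cutf_sq -(Phi_rd he _ (bc2 m)) -Fb_rd.
split=> //; apply: cvg_unique (mq_cvg Fb_form Dx) _ => //.
rewrite (_ : (fun => _) = fun n => rd (Tn n x) (Tn n x)); first exact: hcvg_rd (Tn_cvg Tx) (Tn_cvg Tx).
by apply/funext => n; rewrite Fb_rd Tn_nrm.
Qed.

(** [Fb] is the form of [T^* T], and [Fa setT] that of [T T^*]. The spectral set [C] of the absolute
    value sits between the factors, so that cyclicity ([Fa_tau]) turns the trace into that of a
    function of the absolute value. *)
Definition Fa C n x := Tn n (e C (adj (Tn n) x)).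

Lemma Fa_rd C n x : measurable C -> rd (Fa C n x) x = rd (e C (adj (Tn n) x)) (e C (adj (Tn n) x)).
Proof. by move=> mC; rewrite (adjr _ _ (M_bop (Tn_M n))) (pvm_rd he). Qed.

Lemma adj_Tn m n x : (m <= n)%N -> adj (Tn m) x = e (band m) (adj (Tn n) x).
Proof.
move=> mn; have b1 := M_bop (Tn_M m); have b2 := M_bop (Tn_M n).
by apply: rd_inj => z; rewrite (adjl _ _ b1) (pvm_sa he (mb m)) (adjl _ _ b2) Tn_sub.
Qed.

Lemma Fa_form C : measurable C -> mform (Fa C).
Proof.
move=> mC; split=> [n|n x].
  have := Mp_conj (Mp_e he (ts_M h) mC) (M_adj (Tn_M n)).
  by rewrite (adjK (M_bop (Tn_M n))).
rewrite !Fa_rd// (adj_Tn x (leqnSn n)) (pvm_comm he)// orthoproj_rd; last exact: (pvm_proj he).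
exact: orthoproj_le _ (pvm_proj he (mb n)).
Qed.

Lemma Fa_tau C n : measurable C -> (tau (Fa C n) <= tau (Phi he (fun l => (cutf n l ^+ 2 * \1_C l)%R)))%E.
Proof.
move=> mC; have bT := M_bop (Tn_M n); have Mc := M_comp (Tn_M n) (ts_M h mC); have bc := M_bop Mc.
have aE : adj (fun x => Tn n (e C x)) = fun x => e C (adj (Tn n) x).
  by apply: adj_unique => // x y; rewrite (adjr _ _ bT) (pvm_sa he).
have bf : bfun (fun l => cutf n l ^+ 2 * \1_C l) by apply: bfunM => //; exact: bfun_indic.
have -> : Fa C n = (fun x => (fun x => Tn n (e C x)) (adj (fun x => Tn n (e C x)) x)).
  by apply/funext => x; rewrite aE (pvm_id he).
rewrite -(tr_cyc Mc); apply: (tr_mono (Mp_adj Mc)) => [|x].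
  split; [exact: (M_Phi he (ts_M h))|exact: Phi_sa|apply: Phi_nonneg => // l].
  by rewrite mulr_ge0 ?sqr_ge0.
by rewrite (adjl _ _ bc) Tn_nrm Phi_cut.
Qed.

(** The absolute value is split at [l^2 = th]: the upper part has trace at most [k], and the lower
    part is bounded by [th], since an operator and its adjoint have the same norm. *)
Lemma Fa_K s th k : 0 < s -> 0 < th -> th <= k / s ->
  (forall n, (tau (Phi he (lcut th n)) <= k%:E)%E) -> Kfun (Fa setT) s k.
Proof.
move=> s0 th0 thk htr; have ml := measurable_lev th; exists (Fa (lev th)); split.
- exact: Fa_form.
- move=> n x; rewrite !Fa_rd// !(pvm_T he); rewrite (pvm_rd he)//.
  exact: orthoproj_le _ (pvm_proj he ml).
- move=> n x; rewrite !Fa_rd// (pvm_T he); set w := adj _ _.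
  have -> : rd w w = rd (e (lev th) w) (e (lev th) w) + rd (e (~` lev th) w) (e (~` lev th) w).
    rewrite !(pvm_rd he)//; last exact: measurableC.
    by rewrite (pvm_C he)// rdBl addrC subrK.
  rewrite lerD2l; apply: le_trans (_ : th * rd x x <= _); last by rewrite ler_wpM2r.
  have mC : measurable (~` lev th) by exact: measurableC.
  have bT := M_bop (Tn_M n); have Mc := M_comp (Tn_M n) (ts_M h mC); have bc := M_bop Mc.
  have aE : adj (fun x => Tn n (e (~` lev th) x)) = fun x => e (~` lev th) (adj (Tn n) x).
    by apply: adj_unique => // y z; rewrite (adjr _ _ bT) (pvm_sa he).
  have sq0 := sqrtr_ge0 th.
  have := @adj_nrm _ _ _ (Num.sqrt th) bc sq0; rewrite aE => hn.
  apply: le_trans (_ : _ <= Num.sqrt th ^+ 2 * rd x x) _; last by rewrite sqr_sqrtr// ltW.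
  rewrite !rdxx -exprMn lerXn2r ?nnegrE ?mulr_ge0//.
  apply: hn => z; apply: nrm_le; first by rewrite mulr_ge0.
  rewrite Tn_nrm Phi_cut// exprMn (sqr_sqrtr (ltW th0)) -rdxx.
  have bi := @bfun_indic R _ mC; have bf : bfun (fun l => cutf n l ^+ 2 * \1_(~` lev th) l) by exact: bfunM.
  rewrite -rdZl -(Phi_cst he); apply: Phi_mono => //; first exact: bfun_cst.
  move=> l; rewrite [\1_(_) l]indicE; case: (boolP (l \in ~` lev th)) => [/set_mem hl|_]; last by rewrite mulr0 ltW.
  rewrite mulr1 cutf_sqE; apply: le_trans (_ : l ^+ 2 <= _); last by rewrite leNgt; apply/negP.
  by apply: ler_piMr; [rewrite sqr_ge0|rewrite lern1 leq_b1].
- by move=> n; apply: le_trans (Fa_tau n ml) (htr n).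
Qed.

Lemma Fb_K s th k : 0 < s -> 0 < th -> th <= k / s ->
  (forall n, (tau (Phi he (lcut th n)) <= k%:E)%E) -> Kfun Fb s k.
Proof.
move=> s0; have bl n := @bfun_lcut th n; have l0 n l := @lcut_ge0 n l.
exists (fun n => Phi he (lcut th n)); split=> //.
- split=> [n|n x].
    by split; [exact: (M_Phi he (ts_M h))|exact: Phi_sa|exact: Phi_nonneg].
  by apply: Phi_mono => // l; rewrite ler_wpM2r//; exact: cutf_sq_mono.
- move=> n x; rewrite Fb_rd; apply: Phi_mono => // l.
  by apply: ler_piMr; [rewrite sqr_ge0|rewrite lern1 leq_b1].
- move=> n x; rewrite Fb_rd; apply: le_trans (_ : _ <= rd (Phi he (lcut th n) x) x + th * rd x x) _; last first.
    by rewrite lerD2l ler_wpM2r.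
  have bt := @bfun_cst R th; rewrite -[th * _]rdZl -(Phi_cst he) -rdDl -(PhiD he x (bl n) bt).
  apply: Phi_mono => //; first exact: bfunD.
  move=> l; rewrite /lcut [\1_(lev th) l]indicE; case: (boolP (l \in lev th)) => [_|/negP hl].
    by rewrite mulr1 lerDl ltW.
  rewrite mulr0 add0r cutf_sqE; apply: le_trans.
    by apply: ler_piMr; [rewrite sqr_ge0|rewrite lern1 leq_b1].
  by rewrite leNgt; apply/negP => hl2; apply: hl; exact/mem_set.
Qed.

End OfOperator.

(** With [a'] the adjoint of [a], the form of [a y b] at [x] is at most [Y |b x| |a' x|], and the
    inequality of arithmetic and geometric means bounds this by a combination of the forms of [a a']
    and of the adjoint of [b] times [b]. The result does not involve [k], so one form dominates the
    whole sequence. *)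
Lemma factor_majorant r al be Y (eX : nat -> set R -> H -> H) (hX : forall k : nat, tspec (eX k))
    (a b : set (H * H)) (y : nat -> H -> H) :
  1 <= r -> 0 < al -> 0 < be -> 0 < Y -> Stau M tau a -> Stau M tau b ->
  sq_lr r al (mu_op tau a) -> sq_lr r be (mu_op tau b) ->
  (forall k : nat, M (y k)) -> (forall (k : nat) x, nrm (y k x) <= Y * nrm x) ->
  (forall k : nat, spec_op (hX k) = strong_mul (strong_mul a (graph_op (y k))) b) ->
  exists A, [/\ mform A, forall k : nat, mle (Lm (hX k)) A &
    forall s, 0 < s -> Kfun A s (6 * (al * Y * be) * s `^ (1 - r^-1))].
Proof.
move=> r1 al0 be0 Y0 Sa Sb Ia Ib My yY XE.
have [ea [ha [dA DA NA]]] := abs_tspec Sa; have [eb [hb [dB DB NB]]] := abs_tspec Sb.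
have [aa _] := Sa; have [ab _] := Sb; have [ca _] := aa; have [cb _] := ab.
have muE T e (dE : forall v, distribution_op tau T v = tau (e (ray v))) :
    mu_op tau T = rearrangement (ts_dist e) by rewrite /mu_op; congr rearrangement; exact/funext.
rewrite (muE _ _ dA) in Ia; rewrite (muE _ _ dB) in Ib.
have r0 : r != 0 by rewrite gt_eqF// (lt_le_trans ltr01).
(* The threshold [t^2 s^(-1/r)] balances the two parts of the K-functional: above it [lev_trace]
   gives trace at most [6 t^2 s^(1 - 1/r)]. *)
have Kk t e (h : tspec e) s n : 0 < t -> 0 < s -> sq_lr r t (rearrangement (ts_dist e)) ->
    [/\ 0 < t ^+ 2 * s `^ (- r^-1), t ^+ 2 * s `^ (- r^-1) <= 6 * t ^+ 2 * s `^ (1 - r^-1) / s &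
     (tau (Phi h (lcut (t ^+ 2 * s `^ (- r^-1)) n)) <= (6 * t ^+ 2 * s `^ (1 - r^-1))%:E)%E].
  move=> t0 s0 It; have t2 : 0 < t ^+ 2 by rewrite exprn_gt0.
  have p0 : 0 < s `^ (- r^-1) by exact: powR_gt0.
  have ps : s `^ (1 - r^-1) = s * s `^ (- r^-1) by rewrite powRD ?(gt_eqF s0) ?implybT// powRr1 ?(ltW s0).
  have th0 : 0 < t ^+ 2 * s `^ (- r^-1) by rewrite mulr_gt0.
  split=> //.
    rewrite ps; have -> : 6 * t ^+ 2 * (s * s `^ (- r^-1)) / s = 6 * (t ^+ 2 * s `^ (- r^-1)) by field; rewrite gt_eqF.
    by move: (_ * _) th0 => q q0; lra.
  apply: le_trans (lev_trace h n th0 r1 It) _; rewrite lee_fin powRM ?(ltW t2) ?(ltW p0)// -powRrM mulNr mulVf//.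
  rewrite powR_inv1 ?(ltW s0)// ps; have := powR_gt0 r t2; move: ((t ^+ 2) `^ r) (s `^ _) p0 => P Q Q0 P0.
  by apply: le_of_eq; field; rewrite !gt_eqF.
(* This weight makes the two halves of the K-functional equal, whence the product [al * Y * be]. *)
pose rho := be / al; have rho0 : 0 < rho by rewrite divr_gt0.
pose A := madd (mscale (Y / 2 * rho) (Fa a ea setT)) (mscale (Y / 2 * rho^-1) (Fb b eb)).
have c1 : 0 < Y / 2 * rho by rewrite mulr_gt0// divr_gt0.
have c2 : 0 < Y / 2 * rho^-1 by rewrite mulr_gt0 ?divr_gt0 ?invr_gt0.
have fa := Fa_form aa DA NA measurableT; have fb := Fb_form ab DB NB.
have hA : mform A by apply: madd_form; apply: mscale_form => //; exact: ltW.
exists A; split=> // [k|s s0]; last first.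
  have [h1 h2 _] := Kk al _ ha s 0%N al0 s0 Ia; have [h3 h4 _] := Kk be _ hb s 0%N be0 s0 Ib.
  have K1 := Fa_K aa DA NA s0 h1 h2 (fun n => let: And3 _ _ h := Kk al _ ha s n al0 s0 Ia in h).
  have K2 := Fb_K ab DB NB s0 h3 h4 (fun n => let: And3 _ _ h := Kk be _ hb s n be0 s0 Ib in h).
  have := Kfun_add (Kfun_scale (ltW c1) K1) (Kfun_scale (ltW c2) K2).
  congr (Kfun A s _); rewrite /rho; move: (s `^ _) => P; field; rewrite !gt_eqF//.
apply: (mle_dense (Lm_form (hX k)) hA) => t x t0.
have hT := mscale_form (ltW t0) hA; have hq := mq_qform hT; have [MG sG nG] := M_mres hT.
set G := mres _ in MG sG nG *.
have GA z : mdom A (G z) by apply/(mscale_dom A _ t0); exact: (resolvent_dom hq).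
have dom z : mdom A z -> mdom (Fa a ea setT) z /\ mdom (Fb b eb) z.
  move=> [K hK]; have pa n : 0 <= rd (Fa a ea setT n z) z by case: (proj1 fa n).
  have pb n : 0 <= rd (Fb b eb n z) z by case: (proj1 fb n).
  split; [exists (K / (Y / 2 * rho))|exists (K / (Y / 2 * rho^-1))] => n; rewrite ler_pdivlMr// mulrC;
    have := hK n; rewrite /A /madd /mscale rdDl !rdZl.
    by have := mulr_ge0 (ltW c2) (pb n); lra.
  by have := mulr_ge0 (ltW c1) (pa n); lra.
have qE z : mdom A z -> mq A z = Y / 2 * rho * mq (Fa a ea setT) z + Y / 2 * rho^-1 * mq (Fb b eb) z.
  move=> Az; have [d1 d2] := dom z Az.
  have c : Y / 2 * rho * rd (Fa a ea setT n z) z + Y / 2 * rho^-1 * rd (Fb b eb n z) z @[n --> \oo] -->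
      Y / 2 * rho * mq (Fa a ea setT) z + Y / 2 * rho^-1 * mq (Fb b eb) z.
    by apply: cvgD; apply: cvg_mulc; [exact: (mq_cvg fa)|exact: (mq_cvg fb)].
  have e1 : (fun n => rd (A n z) z) = (fun n => Y / 2 * rho * rd (Fa a ea setT n z) z + Y / 2 * rho^-1 * rd (Fb b eb n z) z).
    by apply/funext => n; rewrite /A /madd /mscale rdDl !rdZl.
  by have := mq_cvg hA Az; rewrite e1 => c'; exact: cvg_unique c' c.
have bD z : domain_op b (G z) by case: (Fb_dom ab DB NB (proj2 (dom _ (GA z)))).
(* [G] maps into the domain of the form, so [b G] is everywhere defined; the value of the form at
   the resolvent bounds it. *)
have Mb : M (fun z => app b (G z)).
  apply: (M_lim (a := fun n z => Tn b eb n (G z)) (K := Num.sqrt ((t * (Y / 2 * rho^-1))^-1))) => [n|n z|z].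
  - by apply: M_comp => //; exact: (Tn_M ab DB NB).
  - have K0 : 0 < t * (Y / 2 * rho^-1) by rewrite mulr_gt0.
    apply: nrm_le; first by rewrite mulr_ge0 ?sqrtr_ge0 ?nrm_ge0.
    rewrite exprMn sqr_sqrtr ?invr_ge0 ?(ltW K0)// -rdxx [X in _ <= X]mulrC ler_pdivlMr//.
    have -> : rd (Tn b eb n (G z)) (Tn b eb n (G z)) = rd (Fb b eb n (G z)) (G z).
      by rewrite (Fb_rd ab DB NB) (Tn_nrm DB NB).
    have [d1 d2] := dom _ (GA z); have h1 := mq_ub n fb d2; have q1 := qf_ge0 (mq_qform fa) d1.
    have := resolvent_val hq z; rewrite -/(mres (mscale t A)) -/G (mscale_q hA (GA z) t0) qE// => hv.
    have := rd_ge0 (z - G z); have : rd (z - G z) (G z) + rd (z - G z) (z - G z) <= rd z z.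
      by have := nG z; rewrite !rdE (rdC z (G z)); have := rd_ge0 (G z); lra.
    rewrite -hv => h2 h3; have h4 : t * (Y / 2 * rho^-1 * mq (Fb b eb) (G z)) <= rd z z.
      by have := mulr_ge0 (ltW t0) (mulr_ge0 (ltW c1) q1); lra.
    by apply: le_trans h4; rewrite mulrC [X in _ <= X]mulrA; apply: ler_wpM2l => //; exact: ltW.
  - exact: (Tn_cvg ab DB NB).
(* On these vectors [y k (b xi)] lies in a spectral subspace on which [a] is bounded, so the
   product, although a closure, can be evaluated at [xi]. *)
have [u [ux hu]] := ts_joint ha ha x (M_comp (My k) Mb) (fun=> M_zero) (fun _ _ _ => erefl).
exists u; split=> // n N; set xi := G (u n); have [m [hm _]] := hu n; rewrite -/xi in hm.
have Dw : domain_op a (y k (app b xi)) by rewrite -hm; exists (ea (band m) (y k (app b xi)), Tn a ea m (y k (app b xi))) => //; exact: (Tn_at DA).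
have aw : app a (y k (app b xi)) = Tn a ea m (y k (app b xi)) by rewrite /Tn hm.
have Xxi : spec_op (hX k) (xi, app a (y k (app b xi))).
  rewrite XE; apply: subset_closure; exists (app b xi); split; first exact: (appP (bD (u n))).
  by apply: subset_closure; exists (y k (app b xi)); split=> //=; exact: appP.
have [dX qX] := Lm_at Xxi; apply: le_trans (mq_ub N (Lm_form (hX k)) dX) _; rewrite qX aw.
have bTa := M_bop (Tn_M aa DA NA m); rewrite (adjr _ _ bTa).
have [d1 d2] := dom _ (GA (u n)); rewrite (qE _ (GA (u n))) -/xi.
have [_ ->] := Fb_dom ab DB NB d2.
have h1 := mq_ub m fa d1; rewrite (Fa_rd aa DA NA m _ measurableT) (pvm_T ha) -/xi in h1.
set z1 := app b xi in hm aw *; set z2 := adj (Tn a ea m) xi in h1 *.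
have := rd_le (y k z1) z2; have := yY k z1; have n1 := nrm_ge0 z1; have n2 := nrm_ge0 z2.
move=> hy hrd; have h2 : rd (y k z1) z2 <= Y * (nrm z1 * nrm z2).
  by apply: le_trans hrd _; rewrite mulrA ler_wpM2r.
apply: le_trans h2 _; apply: le_trans (_ : _ <= Y / 2 * rho * rd z2 z2 + Y / 2 * rho^-1 * rd z1 z1) _; last first.
  by rewrite lerD2r ler_wpM2l// ltW.
rewrite !rdxx; have amgm : nrm z1 * nrm z2 <= 2^-1 * (rho * nrm z2 ^+ 2 + rho^-1 * nrm z1 ^+ 2).
  have : 0 <= rho^-1 * (nrm z1 - rho * nrm z2) ^+ 2 by rewrite mulr_ge0 ?sqr_ge0// invr_ge0 ltW.
  have -> : rho^-1 * (nrm z1 - rho * nrm z2) ^+ 2 = rho * nrm z2 ^+ 2 + rho^-1 * nrm z1 ^+ 2 - 2 * (nrm z1 * nrm z2).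
    by field; rewrite gt_eqF.
  by lra.
apply: le_trans (ler_wpM2l (ltW Y0) amgm) _; apply: le_of_eq; ring.
Qed.

End Majorant.

(** * Truncation, sums and tails of majorants *)

Section FormOperations.
Implicit Types (x y z : H) (A B U : nat -> H -> H) (e : set R -> H -> H) (s k t v w : R).

Lemma mle_scale t A B : 0 < t -> mle A B -> mle (mscale t A) (mscale t B).
Proof.
move=> t0 h x K hK n; rewrite rdZl mulrC -ler_pdivlMr//; apply: h => m.
by rewrite ler_pdivlMr// mulrC -rdZl; exact: hK.
Qed.

Lemma mle_cut (p : H -> H) A B : orthoproj p -> mle A B -> mle (mcut p A) (mcut p B).
Proof.
move=> [_ sp _] h x K hK n; rewrite sp; apply: h => m.
by have := hK m; rewrite sp.
Qed.

Definition zform : nat -> H -> H := fun _ _ => 0.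

Lemma zform_form : mform zform.
Proof. by split=> [n|n]; [exact: Mp0|]. Qed.

(* Truncation at the level where [A] has trace about [T]: below it [A] is
   bounded, above it [B] is integrable. *)
Lemma truncate A B (K0 T : R) : mform A -> mform B -> 0 < K0 -> 0 < T ->
  Kfun A T (K0 * T) -> Kfun B T (K0 * T) ->
  exists C, [/\ mform C, forall X, mform X -> mle X A -> mle X B -> mle X C,
    forall s k, 0 < s -> K0 * s <= k -> Kfun B s k -> Kfun C s (6 * k) &
    forall s k, 0 < s -> K0 * T <= k -> Kfun A s k -> Kfun C s (6 * k)].
Proof.
move=> hA hB K0p T0 KA KB; have KT : 0 < K0 * T by exact: mulr_gt0.
have [e [h hr]] := mform_tspec hA T0 (ltW KT) KA; have he := ts_pvm h.
(* The first [K0] is the bound [k / s] at [s = T]; the second is the extra height in [lev_bound],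
   which makes the trace above [v] at most [K0 T / K0 = T]. *)
pose v := K0 + K0.
have tP : (tau (e (lev v)) <= T%:E)%E.
  have := lev_bound hA (ts_M h) hr T0 (ltW KT) KA K0p.
  by rewrite mulfK ?gt_eqF// [K0 * T]mulrC mulfK ?gt_eqF.
have v0 : 0 <= v by rewrite addr_ge0// ltW.
have ml := measurable_lev v; have hP := pvm_proj he ml; have MP := ts_M h ml.
pose P := e (lev v); pose Q x := x - P x.
have hQ : orthoproj Q := orthoprojC hP; have MQ : M Q := M_sub M_id MP.
have lowQ n x : rd (A n (Q x)) (Q x) <= v * rd x x.
  have QC : e (~` lev v) (Q x) = Q x by rewrite pvm_C//; have [_ _ iQ] := hQ; exact: iQ.
  have [Dx qx] := lev_low v0 hr QC; apply: le_trans (mq_ub n hA Dx) _; apply: le_trans qx _.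
  by rewrite ler_wpM2l// orthoproj_rd//; exact: orthoproj_le.
have [_ sP] := hP; have [_ sQ] := hQ.
have p2 : 0 < 2 :> R by [].
have fQ := mcut_form MQ hQ hA; have fP := mcut_form MP hP hB.
(* By the parallelogram law a form is at most twice the sum of its cuts to [Q] and [P], whether or
   not it commutes with them. The two cuts have K-functionals at most [2 k] and [k] in one order or
   the other, which gives the factor 6. *)
exists (madd (mscale 2 (mcut Q A)) (mscale 2 (mcut P B))); split.
- by apply: madd_form; exact: mscale_form.
- move=> X hX XA XB; apply: (mle_trans (B := madd (mscale 2 (mcut Q X)) (mscale 2 (mcut P X)))).
    apply: mle_pt => n x; rewrite rdDl !rdZl sQ sP.
    have := form_par (Q x) (P x) (mf_bop n hX); rewrite subrK.
    by have [_ _ /(_ (Q x - P x))] := proj1 hX n; lra.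
  by apply: mle_add; [exact: mscale_form|exact: mscale_form|exact/mle_scale/mle_cut|exact/mle_scale/mle_cut].
- move=> s k s0 ks KBs.
  have k0 : 0 <= k by apply: le_trans ks; rewrite mulr_ge0// ltW.
  have K1 : Kfun (mcut Q A) s (2 * (K0 * s)).
    exists zform; split; first exact: zform_form.
    - by move=> n x; rewrite rd0l; case: (proj1 fQ n).
    - move=> n x; rewrite rd0l add0r sQ.
      by rewrite (_ : 2 * (K0 * s) / s = v)//; rewrite /v; field; rewrite gt_eqF.
    - by move=> n; rewrite tr0 lee_fin mulr_ge0// mulr_ge0// ltW.
  have K2 := Kfun_cut MP hP s0 k0 KBs.
  apply: Kfun_le s0 _ (Kfun_add (Kfun_scale (ltW p2) K1) (Kfun_scale (ltW p2) K2)).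
  by lra.
- move=> s k s0 Tk KAs.
  have k0 : 0 <= k by apply: le_trans Tk; exact: ltW.
  have K1 := Kfun_cut MQ hQ s0 k0 KAs.
  have K2 : Kfun (mcut P B) s (2 * (K0 * T)).
    exists (mcut P B); split=> // [n x|n].
      by rewrite lerDl mulr_ge0// divr_ge0 ?ltW// mulr_gt0.
    have [U [hU _ h2 h3]] := KB; have [hU1 _] := hU.
    have mPU := Mp_cut (hU1 n) MP hP; have mP := Mp_proj MP hP.
    apply: le_trans (_ : (tau (fun x => P (U n (P x)) + rs K0 (P x))%R <= _)%E); last first.
      rewrite (tr_add mPU (Mp_rs (ltW K0p) mP)) (tr_scale (ltW K0p) mP).
      apply: le_trans (leeD (le_trans (tr_cut (hU1 n) MP hP) (h3 n)) (lee_wpmul2l _ tP)) _.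
        by rewrite ltW.
      by rewrite lee_fin; lra.
    apply: (tr_mono (proj1 fP n) (Mp_add mPU (Mp_rs (ltW K0p) mP))) => x.
    rewrite rdDl rdZl !sP; apply: le_trans (h2 n (P x)) _.
    by rewrite mulfK ?gt_eqF// orthoproj_rd// [rd (P x) x]rdC.
  apply: Kfun_le s0 _ (Kfun_add (Kfun_scale (ltW p2) K1) (Kfun_scale (ltW p2) K2)).
  by lra.
Qed.

(** Taking the first [n] forms at stage [n] keeps every term bounded and the sequence increasing;
    its supremum is the sum of all the suprema. *)
Definition csum (C : nat -> nat -> H -> H) : nat -> H -> H := fun n x => \sum_(0 <= i < n) C i n x.

Lemma rd_sum (I : Type) (r : seq I) (F : I -> H) x : rd (\sum_(i <- r) F i) x = \sum_(i <- r) rd (F i) x.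
Proof. by elim: r => [|i r IH]; rewrite ?big_nil ?rd0l// !big_cons rdDl IH. Qed.

Lemma Mp_sum (a : nat -> H -> H) n : (forall i, Mp (a i)) -> Mp (fun x => \sum_(0 <= i < n) a i x) /\
  tau (fun x => \sum_(0 <= i < n) a i x) = (\sum_(0 <= i < n) tau (a i))%E.
Proof.
move=> ha; elim: n => [|n [IH1 IH2]].
  have E : (fun x : H => \sum_(0 <= i < 0) a i x) = fun=> 0 by apply/funext => x; rewrite big_geq.
  by rewrite E big_geq// tr0; split=> //; exact: Mp0.
have E : (fun x : H => \sum_(0 <= i < n.+1) a i x) = fun x => (\sum_(0 <= i < n) a i x) + a n x.
  by apply/funext => x; rewrite big_nat_recr.
rewrite E (tr_add IH1 (ha n)) IH2 big_nat_recr; split=> //.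
exact: Mp_add.
Qed.

Lemma sum_mono (a b : nat -> R) m n : (forall i, 0 <= b i) -> (forall i, a i <= b i) -> (m <= n)%N ->
  \sum_(0 <= i < m) a i <= \sum_(0 <= i < n) b i.
Proof.
move=> b0 ab mn; rewrite (big_cat_nat (leq0n m) mn); rewrite -[X in X <= _]addr0.
by apply: lerD; [exact: ler_sum|exact: sumr_ge0].
Qed.

Lemma csum_form C : (forall i, mform (C i)) -> mform (csum C).
Proof.
move=> hC; split=> [n|n x]; first by case: (Mp_sum n (fun i => proj1 (hC i) n)).
rewrite !rd_sum; apply: sum_mono => // i; [by case: (proj1 (hC i) n.+1)|exact: (proj2 (hC i))].
Qed.

Lemma csum_part C m x K : (forall i, mform (C i)) -> (forall n, rd (csum C n x) x <= K) ->
  forall n, \sum_(0 <= i < m) rd (C i n x) x <= K.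
Proof.
move=> hC hK n; apply: le_trans (hK (maxn m n)); rewrite rd_sum; apply: sum_mono.
- by move=> i; case: (proj1 (hC i) (maxn m n)).
- by move=> i; apply: (mf_le x (hC i)); exact: leq_maxr.
- exact: leq_maxl.
Qed.

Lemma Kfun_csum C s (k : nat -> R) K : (forall i, mform (C i)) -> 0 < s -> (forall i, 0 <= k i) ->
  (forall i, Kfun (C i) s (k i)) -> (forall n, \sum_(0 <= i < n) k i <= K) -> Kfun (csum C) s K.
Proof.
move=> hC s0 k0 hk; have [U hU] := choice hk.
have fU i : mform (U i) by case: (hU i).
exists (csum U); split; first exact: csum_form.
- by move=> n x; rewrite !rd_sum; apply: ler_sum => i; case: (hU i) => _.
- move=> n x; rewrite !rd_sum; apply: le_trans (_ : \sum_(0 <= i < n) (rd (U i n x) x + k i / s * rd x x) <= _).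
    by apply: ler_sum => i; case: (hU i) => _.
  rewrite big_split lerD2l -mulr_suml -mulr_suml ler_wpM2r// ler_pM2r ?invr_gt0//.
- move=> n; rewrite (proj2 (Mp_sum n (fun i => proj1 (fU i) n))).
  apply: le_trans (_ : (\sum_(0 <= i < n) (k i)%:E <= _)%E); last by rewrite sumEFin lee_fin.
  by apply: lee_sum => i; case: (hU i).
Qed.

Lemma geo_half n : \sum_(0 <= i < n) (2^-1 ^+ i : R) <= 2.
Proof.
have -> : \sum_(0 <= i < n) (2^-1 ^+ i : R) = 2 - 2 * 2^-1 ^+ n; last first.
  by rewrite gerBl.
elim: n => [|n IH]; first by rewrite big_geq//; lra.
by rewrite big_nat_recr//= IH exprS; lra.
Qed.

(* Along a subsequence the tails are summable, hence small on the dense set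
   where their sum is finite. *)
Lemma mle_tails X A (T : nat -> nat -> H -> H) (k : nat -> R) : mform X -> mform A ->
  (forall j, mform (T j)) -> (forall j, mle X (madd A (T j))) -> (forall j, Kfun (T j) 1 (k j)) ->
  (forall eps, 0 < eps -> exists j, k j <= eps) -> mle X A.
Proof.
move=> hX hA hT XT KT small.
have hch : forall i : nat, exists j, k j <= 2^-1 ^+ i by move=> i; apply: small.
have [J hJ] := choice hch; pose Q := csum (fun i => T (J i)).
have hQ : mform Q by exact: csum_form.
have KQ : Kfun Q 1 2.
  apply: (@Kfun_csum _ _ (fun i => 2^-1 ^+ i)) => // [i|]; [exact: Kfun_le|exact: geo_half].
have [e [h hr]] := mform_tspec hQ ltr01 (ler0n _ 2) KQ.
apply: (mle_dense hX hA) => t x t0.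
have hG := mscale_form (ltW t0) hA; have := mq_qform hG; have [MG] := M_mres hG.
have [u [ux hu]] := ts_joint h h x MG (fun=> M_zero) (fun _ _ _ => erefl).
exists u; split=> // n N; set xi := mres _ (u n); have [m [hm _]] := hu n.
have DA : mdom A xi by apply/(mscale_dom A _ t0); exact: resolvent_dom.
have [DQ _] := mrep_band hr hm; have [K hK] := DQ.
have part := csum_part _ (fun i => hT (J i)) hK.
have DT i : mdom (T (J i)) xi.
  exists K => n'; apply: le_trans (part i.+1 n'); rewrite big_nat_recr//= lerDr.
  by apply: sumr_ge0 => i'; case: (proj1 (hT (J i')) n').
have sumT m' : \sum_(0 <= i < m') mq (T (J i)) xi <= K.
  have c : (fun n' => \sum_(0 <= i < m') rd (T (J i) n' xi) xi) @ \oo --> \sum_(0 <= i < m') mq (T (J i)) xi.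
    elim: m' => [|m' IH].
      by under eq_fun do rewrite big_geq//; rewrite big_geq//; exact: cvg_cst.
    under eq_fun do rewrite big_nat_recr//; rewrite big_nat_recr//=.
    by apply: cvgD => //; exact: mq_cvg.
  exact: (cvg_le_seq c (cvg_cst K)).
suff : forall eps, 0 < eps -> rd (X N xi) xi <= mq A xi + eps by move=> hle; apply/ler_addgt0Pr.
move=> eps eps0.
have [i hi] : exists i, mq (T (J i)) xi <= eps.
  apply: contrapT => hn; have big i : eps <= mq (T (J i)) xi.
    by rewrite leNgt; apply/negP => /ltW h'; apply: hn; exists i.
  pose m' := (Num.truncn `|K / eps|).+1; have := sumT m'; apply/negP; rewrite -ltNge.
  apply: lt_le_trans (_ : m'%:R * eps <= _); last first.
    apply: le_trans (_ : \sum_(0 <= i < m') eps <= _); last exact: ler_sum => i.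
    by rewrite sumr_const_nat mulr_natl.
  by rewrite -ltr_pdivrMr//; apply: le_lt_trans (ler_norm _) (truncnS_gt _).
apply: le_trans (_ : _ <= mq A xi + mq (T (J i)) xi) _; last by rewrite lerD2l.
apply: XT => n'; rewrite rdDl; apply: lerD; [exact: mq_ub|exact: mq_ub].
Qed.

End FormOperations.

(** * Factorization of an operator through the square root of its majorant *)

Section Factorization.
Implicit Types (x y z : H) (B C : set R).

Lemma spec_sym e (he : @pvm R H e) x y v w : spec_op he (x, y) -> spec_op he (v, w) -> rd y v = rd x w.
Proof.
move=> h hv; have : adjoint_op (spec_op he) (x, y) by rewrite spec_adjoint.
by move=> /(adjointP (spec_closed he)) /(_ _ _ hv); rewrite (rdC y) rdC => ->.
Qed.

Definition ivl (n : nat) : set R := `[n.+1%:R^-1, n.+1%:R].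
(** Truncated inverse: it inverts the operator on a spectral subspace where the operator is bounded
    and bounded away from 0. *)
Definition invf (n : nat) (l : R) : R := l^-1 * \1_(ivl n) l.

Lemma measurable_ivl n : measurable (ivl n). Proof. exact: measurable_itv. Qed.

Lemma ivlP n l : ivl n l -> 0 < l /\ `|l^-1| <= n.+1%:R.
Proof.
rewrite /ivl /= in_itv => /andP[h].
have l0 : 0 < l by exact: lt_le_trans h.
by split=> //; rewrite ger0_norm ?invr_ge0 ?(ltW l0)// invf_ple ?posrE.
Qed.

Lemma bfun_invf n : bfun (invf n).
Proof.
have -> : invf n = fun l => (fun l : R => l `^ (-1)) l * \1_(ivl n) l.
  apply/funext => l; rewrite /invf indicE; case: (boolP (l \in ivl n)) => [/set_mem/ivlP[l0 _]|_]; last by rewrite !mulr0.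
  by rewrite powR_inv1 ?ltW.
apply: (bfun_id_on (K := n.+1%:R)) => //; first exact: measurable_ivl.
by move=> l /ivlP[l0]; rewrite powR_inv1// ltW.
Qed.

Lemma mul_invf n l : l * invf n l = \1_(ivl n) l.
Proof.
rewrite /invf indicE; case: (boolP (l \in ivl n)) => [/set_mem/ivlP[l0]|_]; last by rewrite !mulr0.
by rewrite mulr1 mulfV// gt_eqF.
Qed.

Lemma ivl_nd : nondecreasing_seq ivl.
Proof.
move=> m n mn; apply/subsetPset => l; rewrite /ivl /= !in_itv /= => /andP[h1 h2].
have hmn : m.+1%:R <= n.+1%:R :> R by rewrite ler_nat.
by rewrite (le_trans h2 hmn) andbT; apply: le_trans h1; rewrite lef_pV2 ?posrE.
Qed.

Lemma ivl_cover : \bigcup_n ivl n = ray (0 : R).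
Proof.
apply/seteqP; split=> [l [n _ /ivlP[]]//|l l0].
pose n := maxn (Num.truncn `|l|) (Num.truncn `|l^-1|); exists n => //.
have le1 : `|l| <= n.+1%:R by apply: le_trans (ltW (truncnS_gt _)) _; rewrite ler_nat ltnS leq_maxl.
have le2 : `|l^-1| <= n.+1%:R by apply: le_trans (ltW (truncnS_gt _)) _; rewrite ler_nat ltnS leq_maxr.
rewrite /ray in l0; rewrite /ivl /= in_itv /= (le_trans (ler_norm _) le1) andbT.
by rewrite invf_ple ?posrE//; apply: le_trans le2; exact: ler_norm.
Qed.

Section Inverse.
Variables (e : set R -> H -> H) (he : pvm e).

Lemma spec_invf n x : spec_op he (Phi he (invf n) x, e (ivl n) x).
Proof.
move=> m; have bi := @bfun_invf; have bc := @bfun_cutf.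
have bn := @bfun_indic R _ (@measurable_ivl n); have bm := @bfun_indic R _ (@measurable_band R m).
rewrite -(Phi_indic he (@measurable_ivl n)) -(Phi_indic he (@measurable_band R m)) -!Phi_mul//.
congr (Phi); apply/funext => l; rewrite /cutf -mul_invf; ring.
Qed.

Lemma invf_spec n x y : spec_op he (x, y) -> Phi he (invf n) y = e (ivl n) x.
Proof.
move=> h; have bi := @bfun_invf; have bn := @bfun_indic R _ (@measurable_ivl n).
have ebP m v : e (band m) v = Phi he \1_(band m) v by rewrite Phi_indic//; exact: measurable_band.
apply: (eb_inj he) => m; have bm := @bfun_indic R _ (@measurable_band R m).
rewrite -(Phi_indic he (@measurable_ivl n)) -[LHS](_ : Phi he (invf n) (e (band m) y) = _).
  rewrite (h) ebP -!Phi_mul//; last exact: bfun_cutf.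
  by congr (Phi); apply/funext => l; rewrite /cutf -mul_invf; ring.
by rewrite !ebP -!Phi_mul//; congr (Phi); apply/funext => l; ring.
Qed.

Lemma ivl_cvg x : hcvg (fun n => e (ivl n) x) (e (ray 0) x).
Proof. by rewrite -ivl_cover; apply: (pvm_cvg he x measurable_ivl ivl_nd). Qed.

End Inverse.

Variables (A : nat -> H -> H) (e f : set R -> H -> H) (h : tspec e) (hf : tspec f).
Hypotheses (hA : mform A) (hr : mrep A h) (hle : mle (Lm hf) A).
Local Notation he := (ts_pvm h).
Local Notation d := (spec_op h).
Local Notation X := (spec_op hf).

(* The square root of the form of [X], divided on the right by [d]. *)
Lemma below_contraction : exists c, [/\ M c, forall x, nrm (c x) <= nrm x &
  forall z w v dz dv, X (z, w) -> d (z, dz) -> d (v, dv) -> rd w v = rd (c dz) (c dv)].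
Proof.
have fX := Lm_form hf; have cd := spec_closed he; have e0 := ts_half h; have Me := ts_M h.
have sub v : mdom A v -> mdom (Lm hf) v by move=> [K]; exists K; exact: hle.
have subq v : mdom A v -> mq (Lm hf) v <= mq A v.
  move=> Dv; apply: (cvg_le_seq (mq_cvg fX (sub _ Dv)) (cvg_cst _)) => n.
  by apply: hle => m; exact: mq_ub.
have [hD hq] := hr.
have dns x : exists u : nat -> H, (forall n, mdom (Lm hf) (u n)) /\ hcvg u x.
  have [u [hu]] := cl_dense cd x; exists u; split=> // n; exact/sub/hD.
have [e2 [he2 [e20 Me2 [hD2 hq2]]]] := mform_pvm fX dns.
set T := spec_op he2 in hD2; have cT := spec_closed he2.
have DT v : domain_op d v -> domain_op T v by move=> /hD/sub/hD2.
have Tle v : domain_op d v -> nrm (app T v) <= nrm (app d v).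
  by move=> /hD Dv; apply/nrm_le_rd; rewrite (hq2 _ (sub _ Dv)) hq// subq.
pose r n := Phi he (@invf n).
have Dr n x : domain_op d (r n x) by exists (r n x, e (@ivl n) x) => //; exact: spec_invf.
have dr n x : app d (r n x) = e (@ivl n) x by apply: (appE cd); exact: spec_invf.
have Mr n : M (r n) := M_Phi he Me (bfun_invf n).
have oi n : orthoproj (e (@ivl n)) := pvm_proj he (@measurable_ivl n).
have inrm n x : nrm (e (@ivl n) x) <= nrm x.
  by apply/nrm_le_rd; rewrite orthoproj_rd//; exact: orthoproj_le.
pose cn n x := app T (r n x).
have cnle n x : nrm (cn n x) <= nrm x by apply: le_trans (Tle _ (Dr n x)) _; rewrite dr.
have Tr n x : T (r n x, cn n x) := appP (DT _ (Dr n x)).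
have Mcn n : M (cn n).
  apply: (M_lim (K := 1)) => [m|m x|x].
  - by apply: M_comp (Mr n); exact: (M_Phi he2 Me2 (bfun_cutf m)).
  - rewrite mul1r; apply: le_trans (cnle n x); rewrite -(Tr); apply/nrm_le_rd.
    have om := pvm_proj he2 (@measurable_band R m); rewrite orthoproj_rd//; exact: orthoproj_le.
  - exact: spec_cvg (Tr n x).
have cau x : exists y, hcvg (cn^~ x) y.
  apply: hcomplete => eps eps0; have /hcvgP /(_ (eps / 2)) := ivl_cvg he x.
  case; first by rewrite divr_gt0.
  move=> N hN; exists N => m n Nm Nn.
  have -> : cn m x - cn n x = app T (r m x - r n x) by rewrite (appE cT (clB cT (Tr m x) (Tr n x))).
  have hB := clB cd (spec_invf he m x) (spec_invf he n x).
  apply: le_trans (Tle _ _) _; first by exists (r m x - r n x, e (@ivl m) x - e (@ivl n) x).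
  rewrite (appE cd hB); apply: le_trans (nrm_tri (e (ray 0) x) _ _) _.
  by have := hN m Nm; have := hN n Nn; rewrite nrmBC; lra.
have [c hc] := choice cau.
have cle x : nrm (c x) <= nrm x by exact: (cvg_le_seq (hcvg_nrm (hc x)) (cvg_cst _)).
have : M c by apply: (M_lim (K := 1) Mcn) hc => n x; rewrite mul1r.
(* [v] splits into its part over ]0, +oo[, recovered from [dv] by the truncated inverses, and its
   part in the kernel of [d], which [T] kills because [|T v| <= |d v|]. *)
have cT' v dv : d (v, dv) -> T (v, c dv).
  move=> hv; have T1 : T (e (ray 0) v, c dv).
    apply: (cl_lim cT) (ivl_cvg he v) (hc dv) => n.
    by rewrite -(invf_spec n hv); exact: Tr.
  have d0 : d (v - e (ray 0) v, 0).
    move=> m; have bm := @bfun_cutf; have mr := @measurable_ray R 0.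
    rewrite (bop0 (pvm_bop he (@measurable_band R m))) -(pvm_C he v mr) -[v]e0 (pvm_C he _ mr) -(pvm_C he _ mr).
    rewrite -(pvm_I he); [|exact: measurableC|exact: measurable_half].
    rewrite -Phi_e//; last by apply: measurableI; [exact: measurableC|exact: measurable_half].
    rewrite (_ : (fun => _) = fun=> 0) ?Phi_cst ?rs0//; apply/funext => l; rewrite indicE.
    case: (boolP (l \in _)) => [/set_mem[/negP]|]; rewrite ?mulr0//.
    rewrite -leNgt => h1 h2; have -> : l = 0 by apply/eqP; rewrite eq_le h1.
    by rewrite /cutf !mul0r.
  have D0 : domain_op d (v - e (ray 0) v) by exists (v - e (ray 0) v, 0).
  have T0 : T (v - e (ray 0) v, 0).
    have := appP (DT _ D0); rewrite (_ : app T _ = 0)//; apply: nrm_eq0; apply/eqP.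
    by rewrite eq_le nrm_ge0 andbT; apply: le_trans (Tle _ D0) _; rewrite (appE cd d0) nrm0.
  by have := clD cT T1 T0; rewrite addKC addr0.
exists c; split=> // z w v dz dv hz hdz hdv.
have [Tz Tv] := (cT' _ _ hdz, cT' _ _ hdv).
have mT u Tu : T (u, Tu) -> mdom (Lm hf) u /\ mq (Lm hf) u = rd Tu Tu.
  move=> hu; have : mdom (Lm hf) u by apply/hD2; exists (u, Tu).
  by split=> //; rewrite -hq2// (appE cT hu).
have [D1 q1] := mT _ _ (clD cT Tz Tv); have [D2 q2] := mT _ _ (clB cT Tz Tv).
have l1 : rd (Lm hf n z) v @[n --> \oo] --> rd w v := hcvg_rd (spec_cvg hz) (hcvg_cst v).
have E n : rd (Lm hf n z) v = 4^-1 * (rd (Lm hf n (z + v)) (z + v) - rd (Lm hf n (z - v)) (z - v)).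
  have b := mf_bop n fX; have [_ s] := proj1 fX n; rewrite (bopD b) (bopB b) !rdE.
  by rewrite rdC -s; lra.
have l2 : rd (Lm hf n z) v @[n --> \oo] --> 4^-1 * (mq (Lm hf) (z + v) - mq (Lm hf) (z - v)).
  under eq_fun do rewrite E; apply: cvg_mulc; apply: cvgB; [exact: mq_cvg|exact: mq_cvg].
have -> : rd w v = 4^-1 * (mq (Lm hf) (z + v) - mq (Lm hf) (z - v)) by apply: (cvg_unique _ l1).
by rewrite q1 q2 !rdE rdC; lra.
Qed.

(** With [y] the adjoint of [c] times [c], [below_contraction] gives the identity of forms. To
    identify the closed product with [X], vectors are needed at which [d], [y] and [d] can be
    applied in turn; [core] obtains them from [ts_joint] as images of a dense set under
    [(1 + X)^-1]. The reverse inclusion uses that [X] equals its adjoint. *)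
Lemma factor_below : exists y : H -> H, [/\ M y, forall x, nrm (y x) <= nrm x &
  X = strong_mul (strong_mul d (graph_op y)) d].
Proof.
have [c [Mc cle cE]] := below_contraction; have bc := M_bop Mc.
have cd := spec_closed he; have cX := spec_closed hf.
pose y x := adj c (c x); have [My sy _] : Mp y := Mp_adj Mc.
have yle x : nrm (y x) <= nrm x.
  by apply: le_trans (adj_nrm bc ler01 _ (c x)) _ => [z|]; rewrite mul1r.
have yE z w v dz dv : X (z, w) -> d (z, dz) -> d (v, dv) -> rd w v = rd (y dz) dv.
  by move=> h1 h2 h3; rewrite (cE _ _ _ _ _ h1 h2 h3) (adjl _ _ bc).
pose G := Phi hf (@res1 R).
have GX a b : X (a, b) <-> G (a + b) = a := spec_res1 hf (ts_half hf) a b.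
have GX' u : X (G u, u - G u) by apply/GX; rewrite addKC.
have bG : bop G := Phi_bop _ (@bfun_res1 R).
have MG : M G := M_Phi hf (ts_M hf) (@bfun_res1 R).
have core x : exists u : nat -> H, hcvg u x /\ forall n, exists dz,
    d (G (u n), dz) /\ d (y dz, u n - G (u n)).
  (* The cutoff [m] stands in for the unbounded [d]; once [G v] lies in the band, raising [m]
     changes nothing. *)
  pose G' m v := y (Phi he (@cutf R m) (G v)).
  have MG' m : M (G' m) := M_comp My (M_comp (M_Phi he (ts_M h) (bfun_cutf m)) MG).
  have step m v : e (band m) (G v) = G v -> G' m.+1 v = G' m v.
    move=> hv; rewrite /G'; congr y; rewrite -hv.
    have bm k := @bfun_cutf R k; have mb := @measurable_band R m.
    rewrite -!(Phi_e he)//; congr (Phi he _ (G v)); apply/funext => l.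
    by rewrite /cutf -!mulrA !band_mul.
  have [u [ux hu]] := ts_joint h h x MG MG' step.
  exists u; split=> // n; have [m []] := hu n; rewrite /G'; set z := G (u n) => z1 z2.
  have s1 := spec_eb he m z; rewrite z1 in s1; set dz := Phi he _ z in s1 z2.
  have s2 := spec_eb he m (y dz); rewrite z2 in s2.
  exists dz; split=> //; rewrite (_ : u n - z = Phi he (@cutf R m) (y dz))//.
  apply: rd_inj => v; have [v' [Dv' vv]] := cl_dense cd v.
  apply: (cvg_unique _ (hcvg_rd (hcvg_cst (u n - z)) vv)) => //.
  rewrite (_ : (fun n => _) = fun i => rd (Phi he (@cutf R m) (y dz)) (v' i)).
    exact: (hcvg_rd (hcvg_cst _) vv).
  apply/funext => i; have Dv := appP (Dv' i).
  by rewrite (yE _ _ _ _ _ (GX' (u n)) s1 Dv) (spec_sym s2 Dv).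
exists y; split=> //; apply/seteqP; split=> [[a b] /GX ab|].
  have [u [ux hu]] := core (a + b); apply/closurePairP.
  exists (fun n => G (u n)), (fun n => u n - G (u n)); split=> [n||].
  - have [dz [h1 h2]] := hu n; exists dz; split=> //=; apply: subset_closure.
    by exists (y dz); split.
  - by rewrite -ab; exact: (bop_cvg bG ux).
  - have -> : b = (a + b) - G (a + b) by rewrite ab addrC addKr.
    by apply: hcvgB => //; exact: (bop_cvg bG ux).
have /closed_opP[_ _ _ _ clX] := cX; have /closure_id -> := clX; apply: closure_subset => -[a b] [w /= [haw /closurePairP[wn [bn [hn wc bc']]]]].
have ywb : d (y w, b).
  apply: (cl_lim cd (u := fun n => y (wn n)) (v := bn)) => //; last exact: (bop_cvg (M_bop My) wc).
  by move=> n; have [v []] := hn n; rewrite /graph_op /= => ->.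
rewrite -(spec_adjoint hf); apply/(adjointP cX) => v w1 hv.
have [u [ux hu]] := core (v + w1).
have vE : G (v + w1) = v by apply/GX.
have l1 : rd (u n - G (u n)) a @[n --> \oo] --> rd w1 a.
  apply: hcvg_rd (hcvg_cst a); rewrite [w1](_ : w1 = (v + w1) - G (v + w1)); last by rewrite vE addrC addKr.
  by apply: hcvgB => //; exact: (bop_cvg bG ux).
have l2 : rd (G (u n)) b @[n --> \oo] --> rd v b.
  by apply: hcvg_rd (hcvg_cst b); rewrite -vE; exact: (bop_cvg bG ux).
apply: cvg_unique l1 _ => //; rewrite (_ : (fun n => _) = fun n => rd (G (u n)) b)//.
apply/funext => n; have [dz [h1 h2]] := hu n.
by rewrite (spec_sym h2 haw) sy -(spec_sym h1 ywb).
Qed.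

End Factorization.

(** * Spectral cuts of a positive operator *)

Section Cuts.
Variables (e : set R -> H -> H) (h : tspec e).
Implicit Types (B C : set R) (x y : H).
Local Notation he := (ts_pvm h).

Definition onto B : R -> R := fun l => l * \1_B l.
Definition resc B : R -> R := res1 \o onto B.

(* The part of the positive operator \int l de(l) over B, through its resolvent (1 + .)^-1. *)
Definition cut B : set (H * H) := [set p | Phi he (resc B) (p.1 + p.2) = p.1].

Let mont B : measurable B -> measurable_fun setT (onto B).
Proof. by move=> mB; apply: measurable_funM => //. Qed.

Let br B : measurable B -> bfun (resc B).
Proof. by move=> mB; apply: bfun_comp => //; [exact: mont|exact: bfun_res1]. Qed.

Lemma rescE B l : resc B l = if l \in B then (1 + `|l|)^-1 else 1.
Proof. by rewrite /resc /onto /= /res1 indicE; case: (l \in B); rewrite ?mulr1// mulr0 normr0 addr0 invr1. Qed.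

(** The cut is represented by the push-forward of the spectral measure under [onto B]; the mass
    outside [B] moves to 0, which no ray with [v >= 0] contains. *)
Lemma cut_spec B : measurable B -> exists e' (h' : tspec e'),
  cut B = spec_op h' /\ forall v : R, 0 <= v -> e' (ray v) = e (ray v `&` B).
Proof.
move=> mB; pose g := onto B; have mg := mont mB.
have mp C : measurable C -> measurable (g @^-1` C) by move=> mC; rewrite -[X in measurable X]setTI; exact: mg.
have p0 x : pushp e g (@half R) x = x.
  rewrite -[RHS](ts_half h); apply: (half_eq _ he (ts_half h)); [exact: mp _ (@measurable_half R)|exact: measurable_half|].
  by move=> l l0; rewrite /half /= /g mulr_ge0.
have pv v : 0 <= v -> g @^-1` (ray v) = ray v `&` B.
  move=> v0; apply/seteqP; split=> l; rewrite /ray /g /onto /= indicE.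
    by case: (asboolP (B l)) => Bl; [rewrite mem_set// mulr1|rewrite memNset// mulr0 ltNge v0].
  by move=> [hl Bl]; rewrite mem_set// mulr1.
have [m hm] := ts_tail_ray h ltr01.
have hp : tspec (pushp e g).
  apply: (@tspec_fin _ m%:R (push_pvm he mg) p0); first by move=> C /mp; exact: ts_M.
  rewrite /pushp pv//; apply: le_lt_trans (ltry 1); apply: le_trans hm.
  by apply: (tr_sub he (ts_M h)); [exact: (measurableI _ _ (measurable_ray _))|exact: measurable_ray|move=> l []].
exists (pushp e g), hp; split=> [|v v0]; last by rewrite /pushp pv.
have E x : Phi hp (@res1 R) x = Phi he (resc B) x.
  by rewrite -(push_Phi he mg x bfun_res1).
apply/seteqP; split=> -[x y].
  by move=> hx; apply/(spec_res1 _ p0); rewrite E.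
by move=> /(spec_res1 _ p0); rewrite E.
Qed.

Lemma cutT : cut setT = spec_op he.
Proof.
have E : resc setT = @res1 R by apply/funext => l; rewrite rescE in_setT.
by apply/seteqP; split=> -[x y]; rewrite /cut E => /(spec_res1 he (ts_half h)).
Qed.

Lemma cut0 : cut set0 = [set p | p.2 = 0].
Proof.
have E : resc set0 = fun=> 1 by apply/funext => l; rewrite rescE in_set0.
apply/seteqP; split=> -[x y]; rewrite /cut /= E Phi_cst rs1; last by move=> ->; rewrite addr0.
by move=> hx; apply: (addrI x); rewrite addr0.
Qed.

Let kc B n (l : R) : R := `|l| * \1_B l * \1_(band n) l.

Let bk B n : measurable B -> bfun (kc B n).
Proof.
move=> mB; apply: (@bfun_id_on _ (fun l => `|l| * \1_B l) n%:R); [|exact: measurable_band| |by []].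
  exact: measurable_funM.
by move=> l; rewrite normrM normr_id indicE; case: (l \in B); rewrite ?normr1 ?normr0 ?mulr1 ?mulr0.
Qed.

(** For disjoint sets the resolvent symbol of the union is the product of the two symbols, and the
    sum of the two symbols is 1 plus that product: this is additivity written for resolvents. The
    strong sum being a closure, one inclusion approximates by bands and the other uses that the cut
    over the union is closed. *)
Lemma cut_add B C : measurable B -> measurable C -> B `&` C = set0 ->
  cut (B `|` C) = strong_add (cut B) (cut C).
Proof.
move=> mB mC BC; have mU := measurableU _ _ mB mC.
have nBC l : l \in B -> l \in C = false.
  by move=> lB; apply/negbTE/negP => lC; have : set0 l by rewrite -BC; split; apply/set_mem.
have [bB bC] := (br mB, br mC).
have PU v : Phi he (resc (B `|` C)) v = Phi he (resc B) (Phi he (resc C) v).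
  rewrite -Phi_mul//; congr (Phi he _ v); apply/funext => l; rewrite !rescE in_setU.
  by case: (boolP (l \in B)) => /= [/nBC ->|_]; rewrite ?mulr1 ?mul1r.
have PC v : Phi he (resc B) (Phi he (resc C) v) = Phi he (resc C) (Phi he (resc B) v).
  by rewrite -!Phi_mul//; congr (Phi he _ v); apply/funext => l; rewrite mulrC.
have PS v : Phi he (resc B) v + Phi he (resc C) v = v + Phi he (resc B) (Phi he (resc C) v).
  rewrite -Phi_mul// -PhiD// -[X in X + _]rs1 -(Phi_cst he) -PhiD//; last exact: bfunM.
    congr (Phi he _ v); apply/funext => l; rewrite !rescE.
    by case: (boolP (l \in B)) => [/nBC ->|_]; rewrite ?mulr1 ?mul1r// addrC.
  by split=> //; exists 1 => l; rewrite normr1.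
have mb n := @measurable_band R n.
have bi n : bfun (\1_(band n) : R -> R) := bfun_indic (mb n).
have mul1 D n v : measurable D -> Phi he (resc D) (e (band n) v + Phi he (kc D n) v) = e (band n) v.
  move=> mD; rewrite -(Phi_indic he (mb n)) -PhiD//; last exact: bk.
  rewrite -Phi_mul//; [|exact: br|by case: (bi n) (bk n mD) => m1 [K1 h1] [m2 [K2 h2]]; split;
    [exact: measurable_funD|exists (K1 + K2) => l; apply: le_trans (ler_normD _ _) (lerD _ _)]].
  congr (Phi he _ v); apply/funext => l; rewrite /kc -[X in _ * (X + _)]mul1r -mulrDl mulrA rescE indicE.
  by case: (l \in D); rewrite ?mulr1 ?mulr0 ?addr0 ?mul1r// mulVf ?mul1r// gt_eqF// ltr_wpDr.
have cU : closed_op (cut (B `|` C)) by have [e' [h' [-> _]]] := cut_spec mU; exact: spec_closed.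
apply/seteqP; split=> -[x y].
  rewrite /cut /= => hxy; apply/closurePairP.
  exists (fun n => e (band n) x), (fun n => Phi he (kc B n) x + Phi he (kc C n) x); split; [|exact: (eb_cvg he)|].
    by move=> n; exists (Phi he (kc B n) x), (Phi he (kc C n) x); split=> //; rewrite /cut /= mul1.
  have -> : (fun n => Phi he (kc B n) x + Phi he (kc C n) x) = (fun n => e (band n) y); last exact: (eb_cvg he).
  apply/funext => n; have bn := pvm_bop he (mb n); have bu := br mU.
  have -> : Phi he (kc B n) x + Phi he (kc C n) x = Phi he (kc (B `|` C) n) x.
    rewrite -PhiD; [|exact: bk..]; congr (Phi he _ x); apply/funext => l; rewrite /kc -mulrDl -mulrDr; congr (_ * _ * _).
    by rewrite !indicE in_setU; case: (boolP (l \in B)) => [/nBC ->|_]; rewrite ?addr0 ?add0r.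
  have E : Phi he (resc (B `|` C)) (e (band n) (x + y) + Phi he (kc (B `|` C) n) (x + y)) = e (band n) (x + y) := mul1 _ n _ mU.
  have c2 f v : bfun f -> Phi he (resc (B `|` C)) (Phi he f v) = Phi he f (Phi he (resc (B `|` C)) v).
    by move=> bf; rewrite -!Phi_mul//; congr (Phi he _ v); apply/funext => l; rewrite mulrC.
  move: E; rewrite (bopD (Phi_bop he bu)) -(Phi_indic he (mb n)) !c2 ?hxy//; last exact: bk.
  by rewrite (Phi_indic he (mb n)) (bopD bn) => /addrI.
move=> /closurePairP[u [v [huv hu hv]]]; apply: (cl_lim cU _ hu hv) => n.
have [y1 [y2 [/= h1 h2 h3]]] := huv n; rewrite /cut /= in h1 h2 h3 *.
move: (u n) (v n) h1 h2 h3 => z w h1 h2 ->.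
rewrite PU PC addrA (bopD (Phi_bop he bB)) (bopD (Phi_bop he bC)) h1 -PC.
have {h2} : Phi he (resc C) y2 = z - Phi he (resc C) z.
  by apply/eqP; rewrite eq_sym subr_eq addrC -(bopD (Phi_bop he bC)) h2.
move=> ->; by rewrite (bopB (Phi_bop he bB)) addrA [_ + Phi he (resc B) z]addrC PS addrK.
Qed.

End Cuts.

(** * Lorentz norms of spectral cuts *)

Section CutNorms.
Implicit Types (B C : set R) (T : set (H * H)) (e : set R -> H -> H) (t w z a L r : R).

Definition muf T : R -> R := fine \o mu_op tau T.

Lemma muf_ge0 T t : 0 <= muf T t. Proof. exact/fine_ge0/rearr_ge0. Qed.

Section OfTspec.
Variables (e : set R -> H -> H) (h : tspec e).
Local Notation X := (spec_op h).

Lemma muf_spec : mu_op tau X = rearrangement (ts_dist e).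
Proof. by congr rearrangement; apply/funext => v; rewrite (spec_distribution _ _ _ (ts_half h)). Qed.

Lemma muf_fin t : 0 < t -> mu_op tau X t = (muf X t)%:E.
Proof. by move=> t0; rewrite fineK// muf_spec; exact: ts_mu_fin. Qed.

Lemma muf_noninc s t : 0 < s -> s <= t -> muf X t <= muf X s.
Proof.
move=> s0 st; rewrite -lee_fin -!muf_fin ?(lt_le_trans s0)//; exact: rearr_noninc.
Qed.

Lemma muf_le t z : 0 < t -> 0 <= z -> (forall w, z < w -> (tau (e (ray w)) <= t%:E)%E) -> muf X t <= z.
Proof.
move=> t0 z0 hz; apply/ler_addgt0Pr => d d0; rewrite -lee_fin -muf_fin// muf_spec.
by apply: rearr_le; [rewrite ltr_wpDl|apply: hz; rewrite ltrDl].
Qed.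

Lemma muf_ray t w : 0 < t -> muf X t <= w -> (tau (e (ray w)) <= t%:E)%E.
Proof.
move=> t0 tw; have -> : ray w = \bigcup_n ray (w + n.+1%:R^-1).
  apply/seteqP; split=> [l wl|l [n _]]; last by apply: lt_trans; rewrite ltrDl.
  by have [n] := ltr_add_invr wl; exists n.
apply: (tr_bigcup h (ts_M h)) => [n|m n mn|n]; first exact: measurable_ray.
  apply/subsetPset => l; apply: le_lt_trans; rewrite lerD2l lef_pV2 ?posrE// ler_nat//.
rewrite leNgt; apply/negP => /(rearr_ge (ts_noninc h)).
rewrite -muf_spec muf_fin// leNgt => /negP[]; apply: le_lt_trans tw _.
by rewrite ltrDl.
Qed.

End OfTspec.

Section OfCut.
Variables (e : set R -> H -> H) (h : tspec e).
Local Notation f := (muf (spec_op h)).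
Local Notation phi B := (muf (cut h B)).

Lemma cut_le B t z : measurable B -> 0 < t -> 0 <= z ->
  (forall w, z < w -> (tau (e (ray w `&` B)) <= t%:E)%E) -> phi B t <= z.
Proof.
move=> mB t0 z0 hz; have [e' [h' [-> E]]] := cut_spec h mB.
by apply: muf_le => // w zw; rewrite E ?hz// (le_trans z0 (ltW zw)).
Qed.

Let le_f B t : measurable B -> 0 < t -> phi B t <= f t.
Proof.
move=> mB t0; apply: cut_le => // [|w fw]; first exact: muf_ge0.
apply: le_trans (muf_ray t0 (ltW fw)); apply: (tr_sub h (ts_M h)); [|exact: measurable_ray|by move=> l []].
exact: measurableI (measurable_ray _) mB.
Qed.

Let le_top B t z : measurable B -> 0 < t -> 0 <= z -> (forall l, B l -> l <= z) -> phi B t <= z.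
Proof.
move=> mB t0 z0 hB; apply: cut_le => // w zw; have -> : ray w `&` B = set0.
  by apply/seteqP; split=> // l [wl /hB lz]; have := lt_le_trans wl (le_trans lz (ltW zw)); rewrite ltxx.
by rewrite (_ : e set0 = fun=> 0) ?tr0 ?ltW//; apply/funext => x; exact: (pvm0 h).
Qed.

Let le_bot B a t : measurable B -> 0 < a -> a <= t -> B `<=` ray (f a) -> phi B t <= 0.
Proof.
move=> mB a0 at0 hB; have t0 := lt_le_trans a0 at0; apply: cut_le => // w w0.
apply: le_trans (muf_ray t0 (muf_noninc h a0 at0)); apply: (tr_sub h (ts_M h)); [|exact: measurable_ray|].
  exact: measurableI (measurable_ray _) mB.
by move=> l [_ /hB].
Qed.

(** The Lorentz integrand is nonincreasing for [r >= 1], so [dyadic_integral] applies, and the block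
    at [t] has weight [t * t^(1/r - 1) = t^(1/r)]. The bounds [u] and [v] concern the two sides of
    the centre [a]. *)
Lemma cut_lorentz r a L B (u v : nat -> R) : measurable B -> 1 <= r -> 0 < a ->
  (forall i, phi B (a * 2 ^+ i) <= u i) -> (forall i, phi B (a * 2 ^- i.+1) <= v i) ->
  (forall n, \sum_(0 <= i < n) ((a * 2 ^+ i) `^ r^-1 * u i + (a * 2 ^- i.+1) `^ r^-1 * v i) <= L) ->
  (lorentz_norm tau r (cut h B) <= L%:E)%E.
Proof.
move=> mB r1 a0 hu hv hL; have [e' [h' [E _]]] := cut_spec h mB; rewrite E in hu hv *.
set phi := muf _ in hu; have r0 : 0 < r^-1 by rewrite invr_gt0 (lt_le_trans ltr01).
pose g t := t `^ (r^-1 - 1) * phi t.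
have g0 t : 0 <= g t by rewrite mulr_ge0 ?powR_ge0// muf_ge0.
have gd s t : 0 < s -> s <= t -> g t <= g s.
  move=> s0 st; have t0 := lt_le_trans s0 st; apply: ler_pM; [exact: powR_ge0|exact: muf_ge0| |exact: muf_noninc].
  rewrite -opprB !powRN lef_pV2 ?posrE ?powR_gt0// ge0_ler_powR ?nnegrE ?(ltW s0) ?(ltW t0)//.
  by rewrite subr_ge0 invf_le1// (lt_le_trans ltr01).
have E0 t : `]0, +oo[%classic t -> (g t)%:E = ((t `^ (r^-1 - 1))%:E * mu_op tau (spec_op h') t)%E.
  by rewrite /= in_itv andbT => t0; rewrite muf_fin.
rewrite /lorentz_norm -integral_itv_obnd_cbnd; last first.
  apply: eq_measurable_fun => [t /set_mem|]; first exact: E0.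
  apply/measurable_EFinP; apply: measurable_funS (noninc_measurable gd) => //; first exact: measurable_halfline.
  by move=> t; rewrite /halfline /= !in_itv !andbT => /ltW.
suff : (\int[leb]_(t in `]0%R, +oo[) (g t)%:E <= L%:E)%E.
  by congr (_ <= _)%E; apply: eq_integral => t /set_mem/E0.
apply: (dyadic_integral a0 g0 gd) => n.
apply: le_trans (hL n); apply: ler_sum_nat => i.
have b1 : 0 < a * 2 ^+ i by rewrite mulr_gt0.
have b2 : 0 < a * 2 ^- i.+1 by rewrite mulr_gt0.
by rewrite !mulrA !mulr_powRB1 ?(ltW b1) ?(ltW b2)// lerD// ler_wpM2l ?powR_ge0.
Qed.

(** The projection over [ray (f a)] has trace at most [a], so the rearrangement of the cut vanishes
    from [a] on and the scales below [a] remain. *)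
Lemma cut_hi r a L B : measurable B -> 1 <= r -> 0 < a -> B `<=` ray (f a) ->
  (forall n, \sum_(0 <= i < n) (a * 2 ^- i.+1) `^ r^-1 * f (a * 2 ^- i.+1) <= L) ->
  (lorentz_norm tau r (cut h B) <= L%:E)%E.
Proof.
move=> mB r1 a0 hB hL.
apply: (cut_lorentz (a := a)) => // [i|i|n].
- by apply: le_bot hB => //; rewrite ler_peMr ?(ltW a0)// exprn_ege1// ler1n.
- by apply: le_f => //; rewrite mulr_gt0.
by apply: le_trans (hL n); apply: ler_sum_nat => i; rewrite mulr0 add0r.
Qed.

Let geoM r a b K n : 0 < a -> 0 <= b -> (forall n, \sum_(0 <= i < n) (2 ^- i.+1) `^ r^-1 <= K) ->
  \sum_(0 <= i < n) (a * 2 ^- i.+1) `^ r^-1 * b <= K * (a `^ r^-1 * b).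
Proof.
move=> a0 b0 hK; under eq_bigr do rewrite powRM ?ltW// mulrAC mulrC.
by rewrite -mulr_suml ler_wpM2r// mulr_ge0 ?powR_ge0.
Qed.

(** The cut is bounded by [f a], which stands in for its rearrangement to the left of [a]; [K] sums
    the weights of the scales there. *)
Lemma cut_lo r a L K B : measurable B -> 1 <= r -> 0 < a -> (forall l, B l -> l <= f a) ->
  (forall n, \sum_(0 <= i < n) (2 ^- i.+1) `^ r^-1 <= K) ->
  (forall n, \sum_(0 <= i < n) (a * 2 ^+ i) `^ r^-1 * f (a * 2 ^+ i) <= L) ->
  (lorentz_norm tau r (cut h B) <= (L + K * (a `^ r^-1 * f a))%:E)%E.
Proof.
move=> mB r1 a0 hB hK hL.
apply: (cut_lorentz (a := a) (v := fun=> f a)) => // [i|i|n].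
- by apply: le_f => //; rewrite mulr_gt0.
- by apply: le_top => //; rewrite ?muf_ge0// mulr_gt0.
by rewrite big_split lerD// geoM// muf_ge0.
Qed.

(** The piece has support of trace at most [2 a] and is bounded by [f a]: centred at [2 a], the
    dyadic sum keeps only the scales below its centre. *)
Lemma cut_piece r a K B : measurable B -> 1 <= r -> 0 < a -> (forall l, B l -> f (2 * a) < l <= f a) ->
  (forall n, \sum_(0 <= i < n) (2 ^- i.+1) `^ r^-1 <= K) ->
  (lorentz_norm tau r (cut h B) <= (K * ((2 * a) `^ r^-1 * f a))%:E)%E.
Proof.
move=> mB r1 a0 hB hK; have a2 : 0 < 2 * a by rewrite mulr_gt0.
apply: (cut_lorentz (a := 2 * a) (v := fun=> f a)) => // [i|i|n].
- apply: (le_bot (a := 2 * a)) => //; last by move=> l /hB/andP[].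
  by rewrite ler_peMr ?(ltW a2)// exprn_ege1// ler1n.
- by apply: le_top => //; [rewrite mulr_gt0|exact: muf_ge0|move=> l /hB/andP[]].
apply: le_trans (geoM n a2 (muf_ge0 _ _) hK); apply: ler_sum_nat => i.
by rewrite mulr0 add0r.
Qed.

End OfCut.

Lemma geo_powR r : 1 <= r -> exists2 K, 0 < K & forall n, \sum_(0 <= i < n) (2 ^- i.+1) `^ r^-1 <= K :> R.
Proof.
move=> r1; have r0 : 0 < r^-1 by rewrite invr_gt0 (lt_le_trans ltr01).
have q1 : 1 < 2 `^ r^-1 :> R.
  by have := @gt0_ltr_powR R _ r0 1 2; rewrite powR1 !nnegrE; apply; rewrite ?ltr1n.
have [] := @geo_bounded R 1 (2 `^ r^-1) (fun=> 1) 0 ltr01 q1 => [j|j|K K0 hK]; rewrite ?expr1n//.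
exists K => // n; apply: le_trans (hK n); apply: ler_sum_nat => i.
rewrite pow2V_powR mulr1 exprS invfM ler_piMl ?invf_le1 ?ltW//.
Qed.
End CutNorms.

(** * Majorants from the maximal inequality *)

Section MaximalMajorant.

Lemma opnorm_ub (a : H -> H) x : bop a -> nrm x <= 1 -> nrm (a x) <= opnorm a.
Proof.
move=> ba x1; have [K K0 hK] := bop_bnd ba; apply: ub_le_sup; last by exists x => //=; rewrite nrmE lecR.
exists K => _ [y /= y1 <-]; apply: le_trans (hK y) _; rewrite ler_piMr//.
by move: y1; rewrite nrmE -lecR.
Qed.

Lemma nrm_opnorm (a : H -> H) x : bop a -> nrm (a x) <= opnorm a * nrm x.
Proof.
move=> ba; have [->|x0] := eqVneq x 0; first by rewrite (bop0 ba) nrm0 mulr0.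
have n0 : 0 < nrm x by rewrite lt_neqAle nrm_ge0 andbT; apply: contraNneq x0 => /esym/nrm_eq0 ->.
have i0 : 0 <= (nrm x)^-1 by rewrite invr_ge0.
rewrite -ler_pdivrMr// mulrC -[(nrm x)^-1]ger0_norm// -nrmZ -(boprs ba); apply: opnorm_ub => //.
by rewrite nrmZ ger0_norm// mulVf ?gt_eqF.
Qed.

Let perturb (u w v N : R) : u * w * v < N -> exists2 d, 0 < d & (u + d) * (w + d) * (v + d) <= N.
Proof.
move=> hN; have c (z : R) : z + harmonic n @[n --> \oo] --> z.
  by rewrite -[X in _ --> X]addr0; apply: cvgD; [exact: cvg_cst|exact: cvg_harmonic].
have [n _ /(_ n (leqnn n)) hn] := cvgr_le _ (cvgM (cvgM (c u) (c w)) (c v)) _ hN.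
by exists n.+1%:R^-1; [rewrite invr_gt0|exact: hn].
Qed.

(** [linf_norm] is an infimum, so some factorization beats any strictly larger number; [|C| + 1] in
    place of [C] provides the gap. The three factors may have norm 0 while [factor_majorant] wants
    positive bounds, so [perturb] enlarges each by a common [d > 0] within that gap. *)
Lemma maximal_majorant (S : nat -> set (H * H) -> set (H * H)) r C L T (eX : nat -> set R -> H -> H)
    (hX : forall k, tspec (eX k)) :
  lorentz_maximal_bound M tau S r C -> 1 <= r -> 0 < L -> Stau M tau T -> positive_op T ->
  (lorentz_norm tau r T <= L%:E)%E -> (forall k, S k T = spec_op (hX k)) ->
  exists A, [/\ mform A, forall k, mle (Lm (hX k)) A &
    forall s, 0 < s -> Kfun A s (6 * ((`|C| + 1) * L) * s `^ (1 - r^-1))].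
Proof.
move=> hS r1 L0 sT pT hL EX; have r0 := lt_le_trans ltr01 r1.
have [|[_ [a [y [b hab]]]] hn] := hS T _ pT; first by split=> //; exact: le_lt_trans (ltry L).
have {hn} : linf_norm M tau (Lr r) (fun k => S k T) < (`|C| + 1) * L.
  apply: le_lt_trans hn _; have : (0 <= lorentz_norm tau r T)%E.
    by apply: integral_ge0 => t; rewrite mule_ge0 ?lee_fin ?powR_ge0 ?rearr_ge0.
  move: hL; case: lorentz_norm => //= l; rewrite !lee_fin => lL l0.
  apply: le_lt_trans (ler_wpM2r l0 (ler_norm C)) _; apply: le_lt_trans (ler_wpM2l (normr_ge0 C) lL) _.
  by rewrite ltr_pM2r// ltrDl.
move=> /inf_lt[]; first by eexists; exists a, y, b.
set N := _ * L; move=> {a y b hab} _ [a [y [b [[[sa [_ [ma ia]]] [sb [_ [mb ib]]] My uy Ey] ->]]]].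
set na := nc_norm _ _ a; set nb := nc_norm _ _ b; set Y := sup _ => hN.
have n0 T' : 0 <= nc_norm tau (convexification2 (Lr r)) T' by exact: sqrtr_ge0.
have Yk k : opnorm (y k) <= Y by apply: ub_le_sup => //.
have Y0 : 0 <= Y by apply: le_trans (Yk 0%N); apply: le_trans (nrm_ge0 _) (opnorm_ub (x := 0) (M_bop (My _)) _); rewrite nrm0.
have [d d0] := perturb hN.
have al T' t : measurable_fun halfline (fun t => `|fine (mu_op tau T' t)| ^+ 2) ->
    (Lr_int r (fun t => (`|fine (mu_op tau T' t)| ^+ 2)%R) < +oo)%E -> nc_norm tau (convexification2 (Lr r)) T' <= t ->
    sq_lr r t (mu_op tau T').
  rewrite /=; set I := Lr_int r _ => mt fI ht; split=> //; rewrite -/I.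
  have : (0 <= I)%E by apply: integral_ge0 => x.
  rewrite -(fineK (x := I)) ?ge0_fin_numE//; last exact: integral_ge0 => x.
  move: (fine I) ht => {fI} i ht; rewrite !lee_fin => i0.
  have -> : i = (i `^ r^-1) `^ r by rewrite -powRrM mulVf ?powRr1// gt_eqF.
  rewrite ge0_ler_powR ?nnegrE ?powR_ge0 ?sqr_ge0 ?(ltW r0)//.
  by rewrite -(sqr_sqrtr (powR_ge0 _ _)) ler_pXn2r ?nnegrE// (le_trans (sqrtr_ge0 _) ht).
have ad u : u <= u + d by rewrite lerDl ltW.
have [k x|k|A [hA hXA KA]] := @factor_majorant r (na + d) (nb + d) (Y + d) eX hX a b y r1
  (ltr_wpDl (n0 _) d0) (ltr_wpDl (n0 _) d0) (ltr_wpDl Y0 d0) sa sb (al _ _ ma ia (ad _)) (al _ _ mb ib (ad _)) My.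
- apply: le_trans (nrm_opnorm x (M_bop (My k))) _; rewrite ler_wpM2r//.
  exact: le_trans (ad _).
- by rewrite -EX.
exists A; split=> // s s0; apply: Kfun_le (KA s s0) => //.
by rewrite ler_wpM2r ?powR_ge0// ler_wpM2l.
Qed.

End MaximalMajorant.

(** * One form dominating all the images *)

Section Domination.
Variables (S : nat -> set (H * H) -> set (H * H)) (p q Cp Cq : R).
Hypothesis hS : forall k : nat, positive_linear M tau (lorentz_cone M tau p q) (S k).
Hypotheses (hSp : lorentz_maximal_bound M tau S p Cp) (hSq : lorentz_maximal_bound M tau S q Cq).
Variables (e : set R -> H -> H) (h : tspec e).
Local Notation f := (muf (spec_op h)).
Variables (kappa c0 Kp Kq : R).
Hypotheses (p1 : 1 <= p) (q1 : 1 <= q).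
Hypothesis hkp : forall n, \sum_(0 <= i < n) (2 ^- i.+1) `^ p^-1 * f (2 ^- i.+1) <= kappa.
Hypothesis hkq : forall n, \sum_(0 <= i < n) (2 ^+ i) `^ q^-1 * f (2 ^+ i) <= kappa.
Hypothesis gKp : forall n, \sum_(0 <= i < n) (2 ^- i.+1) `^ p^-1 <= Kp.
Hypothesis gKq : forall n, \sum_(0 <= i < n) (2 ^- i.+1) `^ q^-1 <= Kq.
Hypotheses (Kp0 : 0 < Kp) (Kq0 : 0 < Kq) (c00 : 0 < c0).
Hypothesis hcp : 6 * ((`|Cp| + 1) * (Kp * 2 `^ p^-1)) <= c0.
Hypothesis hcq : 6 * ((`|Cq| + 1) * (Kq * 2 `^ q^-1)) <= c0.
Implicit Types (B C : set R) (A : nat -> H -> H).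

Let pw2 (i : nat) : 0 < 2 ^+ i :> R. Proof. by rewrite exprn_gt0. Qed.
Let pwV (i : nat) : 0 < 2 ^- i :> R. Proof. by rewrite invr_gt0. Qed.

Let lor_hi J B L : measurable B -> B `<=` ray (f (2 ^- J)) ->
  (forall n, \sum_(0 <= i < n) (2 ^- (J + i).+1) `^ p^-1 * f (2 ^- (J + i).+1) <= L) ->
  (lorentz_norm tau p (cut h B) <= L%:E)%E.
Proof.
move=> mB hB hL; apply: cut_hi hB _ => // n; apply: le_trans (hL n); apply: ler_sum_nat => i.
by rewrite -invfM -exprD addnS.
Qed.

Let lor_lo J B L : measurable B -> (forall l, B l -> l <= f (2 ^+ J)) ->
  (forall n, \sum_(0 <= i < n) (2 ^+ (J + i)) `^ q^-1 * f (2 ^+ (J + i)) <= L) ->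
  (lorentz_norm tau q (cut h B) <= (L + Kq * L)%:E)%E.
Proof.
move=> mB hB hL; apply: le_trans (cut_lo mB q1 (pw2 J) hB gKq _) _ => [n|].
  by apply: le_trans (hL n); apply: ler_sum_nat => i; rewrite -exprD.
rewrite lee_fin lerD2l ler_wpM2l ?(ltW Kq0)//; apply: le_trans (hL 1%N).
by rewrite big_nat1 addn0.
Qed.

Let cut_ok B : measurable B -> Stau M tau (cut h B) /\ positive_op (cut h B).
Proof.
move=> mB; have [e' [h' [-> _]]] := cut_spec h mB.
by split; [exact: ts_stau|exact: spec_positive _ (ts_half h')].
Qed.

(** Split at the value [f 1]: above it the sum over scales below 1 bounds the L^(p,1) norm, under it
    the sum over scales from 1 on bounds the L^(q,1) norm. *)
Let cone B : measurable B -> lorentz_cone M tau p q (cut h B).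
Proof.
move=> mB; have mr := @measurable_ray R (f 1); have mc := measurableC mr.
exists (cut h (B `&` ray (f 1))), (cut h (B `&` ~` ray (f 1))).
have [s1 c1] := cut_ok (measurableI _ _ mB mr); have [s2 c2] := cut_ok (measurableI _ _ mB mc).
split; last first.
- rewrite -cut_add; [by rewrite -setIUr setUCr setIT|exact: measurableI|exact: measurableI|].
  by rewrite setIACA setICr setI0.
- split; [split; [exact: s2|apply: le_lt_trans (lor_lo (J := 0) (measurableI _ _ mB mc) _ hkq) (ltry _)]|exact: c2].
  by move=> l [_ /negP]; rewrite -leNgt.
have hB : B `&` ray (f 1) `<=` ray (f (2 ^- 0)) by rewrite invr1 => l [].
have hk n : \sum_(0 <= i < n) (2 ^- (0 + i).+1) `^ p^-1 * f (2 ^- (0 + i).+1) <= kappa.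
  by under eq_bigr do rewrite add0n.
have hl := lor_hi (measurableI _ _ mB mr) hB hk.
by split; [split; [exact: s1|exact: le_lt_trans hl (ltry _)]|exact: c1].
Qed.

(** The spectral measures of all images are fixed by choice once and for all, so that domination can
    be stated for each cut and each [k]. *)
Lemma images_spec : exists (eX : set R -> nat -> set R -> H -> H) (hX : forall B k, tspec (eX B k)),
  forall B k, measurable B -> S k (cut h B) = spec_op (hX B k).
Proof.
have /choice[E hE] (Bk : set R * nat) : exists e' : set R -> H -> H, exists h' : tspec e',
    measurable Bk.1 -> S Bk.2 (cut h Bk.1) = spec_op h'.
  have [mB|nB] := pselect (measurable Bk.1); last by exists e, h.
  have [sS pS] := pl_positive (hS Bk.2) (cone mB).
  by have [e' [h' [-> _]]] := positive_tspec sS pS; exists e', h'.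
have hX Bk : tspec (E Bk) by case: (hE Bk).
exists (fun B k => E (B, k)), (fun B k => hX (B, k)) => B k mB; have [h' ->//] := hE (B, k).
Qed.

Variables (eX : set R -> nat -> set R -> H -> H) (hX : forall B k, tspec (eX B k)).
Hypothesis EX : forall B k, measurable B -> S k (cut h B) = spec_op (hX B k).

Definition dominates B A := forall k, mle (Lm (hX B k)) A.

Let domU B C A A' : measurable B -> measurable C -> B `&` C = set0 -> mform A -> mform A' ->
  dominates B A -> dominates C A' -> dominates (B `|` C) (madd A A').
Proof.
move=> mB mC BC fA fA' dA dA' k; apply: mle_trans (mle_add fA fA' (dA k) (dA' k)).
apply: mle_strong_add; rewrite -!EX//; last exact: measurableU.
by rewrite cut_add// (pl_add (hS k)) //; exact: cone.
Qed.

(** The empty cut is the zero operator, and its images vanish by homogeneity with factor 0. *)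
Let dom0 : dominates set0 zform.
Proof.
have z0 T x y : strong_scale 0 T (x, y) -> y = 0.
  move=> /closurePairP[u [v [uv _ hv]]]; apply: (hcvg_unique hv); rewrite (_ : v = fun=> 0); first exact: hcvg_cst.
  by apply/funext => n; have [[p1' p2'] _ [_ <-]] := uv n; rewrite scale0r.
have E : strong_scale 0 (cut h set0) = cut h set0.
  rewrite cut0; apply/seteqP; split=> -[x y] /=; first exact: z0.
  by move=> ->; apply: subset_closure; exists (x, 0) => //=; rewrite scaler0.
move=> k x K hK n; apply: le_trans (hK n); rewrite (_ : Lm _ n x = 0)//.
have := spec_eb (hX set0 k) n x; rewrite -EX// -{1}E (pl_scale (hS k))//; first exact: z0.
exact: cone.
Qed.

Let majorant B r Cr L : lorentz_maximal_bound M tau S r Cr -> 1 <= r -> 0 < L -> measurable B ->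
  (lorentz_norm tau r (cut h B) <= L%:E)%E -> exists A, [/\ mform A, dominates B A &
    forall s, 0 < s -> Kfun A s (6 * ((`|Cr| + 1) * L) * s `^ (1 - r^-1))].
Proof.
move=> hr r1 L0 mB hL; have [sB cB] := cut_ok mB.
exact: maximal_majorant r1 L0 sB cB hL (fun k => EX k mB).
Qed.

Let piece_r B r Cr K a : lorentz_maximal_bound M tau S r Cr -> 1 <= r -> 0 < K ->
  (forall n, \sum_(0 <= i < n) (2 ^- i.+1) `^ r^-1 <= K) -> 6 * ((`|Cr| + 1) * (K * 2 `^ r^-1)) <= c0 ->
  measurable B -> 0 < a -> 0 < f a -> (forall l, B l -> f (2 * a) < l <= f a) ->
  exists A, [/\ mform A, dominates B A &
    forall s, 0 < s -> Kfun A s (c0 * f a * (s `^ (1 - r^-1) * a `^ r^-1))].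
Proof.
move=> hr r1 K0 gK hc mB a0 fa hB.
have [|A [fA dA KA]] := majorant hr r1 _ mB (cut_piece mB r1 a0 hB gK).
  by rewrite !mulr_gt0// powR_gt0// mulr_gt0.
exists A; split=> // s s0; apply: Kfun_le (KA s s0) => //; rewrite powRM ?(ltW a0)//.
pose Z := f a * (s `^ (1 - r^-1) * a `^ r^-1).
have Z0 : 0 <= Z by rewrite !mulr_ge0 ?powR_ge0 ?ltW.
rewrite -[X in _ <= X]mulrA; apply: le_trans (ler_wpM2r Z0 hc); rewrite le_eqVlt /Z; apply/orP; left; apply/eqP; ring.
Qed.

Let kap_ge0 s a : 0 <= kap p q s a.
Proof. by rewrite /kap; case: ifP => _; rewrite mulr_ge0 ?powR_ge0. Qed.

(** The majorants for [p] and [q] have the same bound [c0 f(a) a] on the K-functional at [s = a], so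
    [truncate] with [T = a] combines them: up to [a] the estimate for [q] is kept, beyond it the one
    for [p]. This is the case distinction in [kap]. *)
Let piece B a : measurable B -> 0 < a -> (forall l, B l -> f (2 * a) < l <= f a) ->
  exists A, [/\ mform A, dominates B A & forall s, 0 < s -> Kfun A s (6 * (c0 * (f a * kap p q s a)))].
Proof.
move=> mB a0 hB; have fa0 : 0 <= f a := muf_ge0 _ _.
(* [truncate] wants a positive height; at height 0 the piece is empty. *)
have [fa|fa] := eqVneq (f a) 0.
  have -> : B = set0.
    by apply/seteqP; split=> // l /hB; rewrite fa => /andP[h1 /(lt_le_trans h1)]; rewrite ltNge muf_ge0.
  exists zform; split=> [||s]; [exact: zform_form|exact: dom0|].
  exists zform; split=> [|n|n x|n]; [exact: zform_form|by []| |by rewrite tr0 fa mul0r !mulr0].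
  by rewrite lerDl fa !(mulr0, mul0r).
have {}fa : 0 < f a by rewrite lt_neqAle eq_sym fa.
have [A [fA dA KA]] := piece_r hSp p1 Kp0 gKp hcp mB a0 fa hB.
have [A' [fA' dA' KA']] := piece_r hSq q1 Kq0 gKq hcq mB a0 fa hB.
have ap (r b : R) : 0 < b -> b `^ (1 - r^-1) * b `^ r^-1 = b.
  by move=> b0; rewrite -powRD ?subrK ?powRr1 ?ltW//; rewrite gt_eqF.
have K0 : 0 < c0 * f a by rewrite mulr_gt0.
have [KAa KAa'] : Kfun A a (c0 * f a * a) /\ Kfun A' a (c0 * f a * a).
  by split; [have := KA _ a0|have := KA' _ a0]; rewrite ap.
have [C [fC hC h1 h2]] := truncate fA fA' K0 a0 KAa KAa'; exists C; split=> // [k|s s0].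
  by apply: hC; [exact: Lm_form|exact: dA|exact: dA'].
rewrite [c0 * _]mulrA.
have mono r b c : 1 <= r -> 0 <= b -> b <= c -> b `^ r^-1 <= c `^ r^-1.
  by move=> r1 b0 bc; rewrite ge0_ler_powR ?nnegrE ?invr_ge0 ?(le_trans b0 bc) ?(le_trans ler01 r1).
rewrite /kap; case: leP => sa; [apply: h1 => //; [|exact: KA']|apply: h2 => //; [|exact: KA]].
  by rewrite ler_pM2l// -{1}(ap q s s0) ler_wpM2l ?powR_ge0// mono// ltW.
rewrite ler_pM2l// -{1}(ap p a a0) ler_wpM2r ?powR_ge0// ge0_ler_powR ?nnegrE ?(ltW a0) ?(ltW s0) ?(ltW sa)//.
by rewrite subr_ge0 invf_le1// (lt_le_trans ltr01).
Qed.

Let tail_small (F : nat -> R) K d : (forall i, 0 <= F i) -> (forall n, \sum_(0 <= i < n) F i <= K) -> 0 < d ->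
  exists N, forall J, (N <= J)%N -> forall n, \sum_(0 <= i < n) F (J + i)%N <= d.
Proof.
move=> F0 hK d0; have nd : nondecreasing_seq (fun n => \sum_(0 <= i < n) F i).
  by apply/nondecreasing_seqP => n; rewrite big_nat_recr//= lerDl.
have [N hN] := incr_cauchy nd hK d0; exists N => J NJ n; apply: le_trans (hN J (J + n)%N NJ (leq_addr _ _)).
apply: le_of_eq; elim: n => [|n IH]; first by rewrite big_geq// addn0 subrr.
by rewrite big_nat_recr//= IH addnS [in RHS]big_nat_recr//= addrAC.
Qed.

Let lvl J : set R := [set l | f (2 ^+ J) < l <= f (2 ^- J)].

Let measurable_seg (a b : R) : measurable [set l | a < l <= b].
Proof. exact: measurable_itv `]a, b]. Qed.

Let fmono (a b : R) : 0 < a -> a <= b -> f b <= f a. Proof. exact: muf_noninc. Qed.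

(** Outside the first [J] shells there are a high part and a low part, whose Lorentz norms are
    bounded by tails of the two convergent sums. [c1] collects the constants that [majorant] and
    [lor_lo] contribute at [s = 1]. *)
Let lvl_rest d : 0 < d -> exists J A, [/\ mform A, dominates (~` lvl J) A & Kfun A 1 d].
Proof.
move=> d0; pose c1 := 6 * (`|Cp| + 1) + 6 * ((`|Cq| + 1) * (1 + Kq)); pose d1 := d / c1.
have c10 : 0 < c1 by rewrite addr_gt0 ?mulr_gt0// ltr_wpDl.
have d10 : 0 < d1 by rewrite divr_gt0.
have ge0 r a : 0 <= a `^ r * f a by rewrite mulr_ge0 ?powR_ge0 ?muf_ge0.
have [N1 h1] := tail_small (fun i => ge0 p^-1 (2 ^- i.+1)) hkp d10.
have [N2 h2] := tail_small (fun i => ge0 q^-1 (2 ^+ i)) hkq d10.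
pose J := maxn N1 N2; exists J; have [J1 J2] : (N1 <= J)%N /\ (N2 <= J)%N by rewrite leq_maxl leq_maxr.
have mh := @measurable_ray R (f (2 ^- J)); have ml := measurableC (@measurable_ray R (f (2 ^+ J))).
have hl l : (~` ray (f (2 ^+ J))) l -> l <= f (2 ^+ J) by move=> /negP; rewrite -leNgt.
have p2J : 2 ^- J <= 2 ^+ J :> R by apply: (@le_trans _ _ 1); rewrite ?invf_le1// exprn_ege1// ler1n.
have [A [fA dA KA]] := majorant hSp p1 d10 mh (lor_hi mh (fun => id) (h1 J J1)).
have [|A' [fA' dA' KA']] := majorant hSq q1 _ ml (lor_lo ml hl (h2 J J2)).
  by rewrite addr_gt0// mulr_gt0.
exists (madd A A'); split; first exact: madd_form.
  rewrite (_ : ~` lvl J = ray (f (2 ^- J)) `|` ~` ray (f (2 ^+ J))); first apply: domU => //.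
    by apply/seteqP; split=> // l [ l1 /hl l2]; have := lt_le_trans l1 (le_trans l2 (fmono (pwV J) p2J)); rewrite ltxx.
  rewrite -[RHS]setCK setCU setCK; congr (~` _); apply/seteqP; split=> l; rewrite /lvl /=.
    by move=> /andP[l1]; split=> //; apply/negP; rewrite -leNgt.
  by move=> [/negP]; rewrite -leNgt => -> ->.
apply: Kfun_le (Kfun_add (KA 1 ltr01) (KA' 1 ltr01)) => //; rewrite !powR1.
rewrite (_ : _ + _ = c1 * d1); first by rewrite mulrC divfK// gt_eqF.
by rewrite /c1; ring.
Qed.

(** Finite additivity dominates the cut to [lvl J] by the sum of the first [J] forms, hence by
    [csum C]. The rest of the operator has majorants whose K-functional at 1 tends to 0, and
    [mle_tails] removes them. Adding the K-functionals of the pieces gives the sums [kpart]. *)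
Lemma dominating_form : exists A, [/\ mform A, dominates setT A &
  forall s K, 0 < s -> (forall n, kpart f p q s n <= K) -> Kfun A s (6 * (c0 * K))].
Proof.
(* Shells of the spectrum between consecutive values of [f] at powers of two, [P i] for scales from
   1 on and [N i] for scales below 1; they are treated in pairs to match the terms of [kpart]. *)
pose P i : set R := [set l | f (2 ^+ i.+1) < l <= f (2 ^+ i)].
pose N i : set R := [set l | f (2 ^- i) < l <= f (2 ^- i.+1)].
have p2S i : 2 ^+ i <= 2 ^+ i.+1 :> R by rewrite ler_eXn2l ?ltr1n.
have pVS i : 2 ^- i.+1 <= 2 ^- i :> R by rewrite lef_pV2 ?posrE.
have pV2 i : 2 ^- i <= 2 ^+ i :> R by apply: (@le_trans _ _ 1); rewrite ?invf_le1// exprn_ege1// ler1n.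
have le3 i : [/\ f (2 ^+ i.+1) <= f (2 ^+ i), f (2 ^+ i) <= f (2 ^- i) & f (2 ^- i) <= f (2 ^- i.+1)].
  by split; apply: fmono.
have /choice[C hC] i : exists A, [/\ mform A, dominates (P i `|` N i) A & forall s, 0 < s ->
    Kfun A s (6 * (c0 * (f (2 ^+ i) * kap p q s (2 ^+ i) + f (2 ^- i.+1) * kap p q s (2 ^- i.+1))))].
  have [|A [fA dA KA]] := piece (measurable_seg _ _ : measurable (P i)) (pw2 i); first by move=> l; rewrite -exprS.
  have [|A' [fA' dA' KA']] := piece (measurable_seg _ _ : measurable (N i)) (pwV i.+1).
    by move=> l; rewrite (_ : 2 / 2 ^+ i.+1 = 2 ^- i)// exprS invfM mulrA mulfV// mul1r.
  exists (madd A A'); split=> [||s s0]; first exact: madd_form.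
    apply: domU => //; [exact: measurable_seg|exact: measurable_seg|]; apply/seteqP; split=> // l [/andP[_ l1] /andP[l2]]; have [_ h2] := le3 i.
    by have := lt_le_trans l2 (le_trans l1 h2); rewrite ltxx.
  by rewrite !mulrDr; exact: Kfun_add (KA s s0) (KA' s s0).
have fC i : mform (C i) by case: (hC i).
pose V J n x := \sum_(0 <= i < J) C i n x.
have VS J : V J.+1 = madd (V J) (C J) by apply/funext => n; apply/funext => x; rewrite /V big_nat_recr.
have [fV dV] : (forall J, mform (V J)) /\ forall J, dominates (lvl J) (V J).
  suff hV J : mform (V J) /\ dominates (lvl J) (V J) by split=> J; case: (hV J).
  elim: J => [|J [fV dV]].
    have -> : V 0 = zform by apply/funext => n; apply/funext => x; rewrite /V big_geq.
    have -> : lvl 0 = set0; last by split; [exact: zform_form|exact: dom0].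
    by apply/seteqP; split=> // l; rewrite /lvl expr0 invr1 => /andP[l1 /(lt_le_trans l1)]; rewrite ltxx.
  rewrite VS; split; first exact: madd_form; have [l1 l2 l3] := le3 J.
  have -> : lvl J.+1 = lvl J `|` (P J `|` N J).
    apply/seteqP; split=> l; rewrite /lvl /N /=.
      move=> /andP[a]; have [c|c] := leP; first by right; left; apply/andP.
      by have [d|d] := leP l (f (2 ^- J)); [left|right; right].
    move=> [/andP[a b]|[/andP[a b]|/andP[a b]]]; apply/andP; split.
    - exact: le_lt_trans a.
    - exact: le_trans l3.
    - exact: a.
    - exact: le_trans (le_trans b l2) l3.
    - exact: le_lt_trans (le_trans l1 l2) a.
    - exact: b.
  apply: domU => //; [exact: measurable_seg|by apply: measurableU; exact: measurable_seg| |by case: (hC J)].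
  apply/seteqP; split=> // l [/andP[a b] [/andP[_ c]|/andP[c]]].
    by have := lt_le_trans a c; rewrite ltxx.
  by have := lt_le_trans c b; rewrite ltxx.
exists (csum C); split=> [|k|s K s0 hK]; first exact: csum_form.
  have /choice[T hT] (j : nat) : exists A J, [/\ mform A, dominates (~` lvl J) A & Kfun A 1 j.+1%:R^-1].
    by have [|J [A]] := @lvl_rest j.+1%:R^-1; [rewrite invr_gt0|exists A, J].
  have fX := csum_form fC; have fT j : mform (T j) by case: (hT j) => J [].
  apply: (mle_tails (Lm_form _) fX fT (k := fun j => j.+1%:R^-1 : R)) => [j|j|eps e0].
  - have [J [_ dA _]] := hT j; rewrite -(setUv (lvl J)).
    have mJ : measurable (lvl J) by exact: measurable_seg.
    apply: mle_trans (domU mJ (measurableC mJ) (setICr _) (fV J) (fT j) (dV J) dA k) _.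
    by apply: mle_add => // x K hK n; rewrite rd_sum; exact: csum_part.
  - by case: (hT j) => J [].
  by have [n] := ltr_add_invr e0; exists n; rewrite -[X in X <= _]add0r ltW.
rewrite mulrA; apply: (Kfun_csum (k := fun i => 6 * c0 * (f (2 ^+ i) * kap p q s (2 ^+ i) + f (2 ^- i.+1) * kap p q s (2 ^- i.+1)))) => // [i|i|n].
- by rewrite ?mulr_ge0 ?(ltW c00)// addr_ge0// mulr_ge0 ?muf_ge0.
- by have [_ _ KC] := hC i; rewrite -mulrA; exact: KC.
rewrite -mulr_sumr ler_pM2l ?mulr_gt0//; apply: le_trans (hK n).
by rewrite big_split.
Qed.

End Domination.

(** * From the majorant to the norm of the sequence *)

Section Assembly.
Implicit Types (A : nat -> H -> H) (s v : R).

Section OfTspec.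
Variables (e : set R -> H -> H) (h : tspec e).
Local Notation d := (spec_op h).

Lemma lev_ray v : 0 <= v -> e (lev v) = e (ray (Num.sqrt v)).
Proof.
move=> v0; apply/funext => x; apply: (half_eq _ h (ts_half h) (measurable_lev _) (measurable_ray _)) => l l0.
by rewrite /lev /= -{1}(sqr_sqrtr v0) ltr_pXn2r ?nnegrE.
Qed.

Lemma measurable_muf : measurable_fun halfline (muf d).
Proof. exact: noninc_measurable (muf_noninc h). Qed.

Let measurable_muf2 : measurable_fun halfline (fun t => muf d t ^+ 2).
Proof. by apply: measurable_funX; exact: measurable_muf. Qed.

Lemma muf_tail v : 0 <= v -> (leb [set t : R | halfline t /\ (v < muf d t ^+ 2)%R] <= tau (e (lev v)))%E.
Proof.
move=> v0; have t0 : (0 <= tau (e (lev v)))%E by apply: tr_ge0; exact: (Mp_e h (ts_M h) (measurable_lev v)).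
(* The point 0 is split off as a null set: there [mu_op] may be infinite and its [fine] part carries
   no information. *)
have [mb eb] := belowE t0; rewrite -[leRHS]adde0 -eb -(lebesgue_measure_set1 (0 : R)).
apply: le_trans (leb_U2 mb (measurable_set1 _)); apply: le_measure; rewrite ?inE; last 2 first.
- exact: measurableU.
- move=> t [ht vt]; have [->|tn] := eqVneq t 0; [by right|left].
  have : 0 < t by move: ht; rewrite /halfline /= in_itv/= andbT le_eqVlt eq_sym (negPf tn).
  split=> //; rewrite ltNge lev_ray//; apply/negP => htau'; move: vt; rewrite ltNge => /negP[].
  rewrite -(sqr_sqrtr v0) ler_pXn2r ?nnegrE ?muf_ge0//; apply: muf_le => // w vw.
  apply: le_trans htau'; apply: (tr_sub h (ts_M h)); [exact: measurable_ray..|].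
  by move=> l; apply: lt_trans.
have := measurable_super v measurable_muf2; congr measurable; apply/seteqP; split=> t /=; by rewrite ger0_norm ?sqr_ge0.
Qed.

Lemma muf_Sfun : Sfun (muf d) /\ Sfun (fun t => `|muf d t| ^+ 2).
Proof.
have [m hm] := ts_tail_ray h ltr01.
have lem : (leb [set t : R | halfline t /\ (m.+1%:R ^+ 2 < muf d t ^+ 2)%R] < +oo)%E.
  apply: le_lt_trans (muf_tail (sqr_ge0 _)) _; rewrite lev_ray// sqrtr_sqr ger0_norm//.
  apply: le_lt_trans (ltry 1); apply: le_trans hm; apply: (tr_sub h (ts_M h)); [exact: measurable_ray..|].
  by move=> l; apply: le_lt_trans; rewrite ler_nat.
split; split.
- exact: measurable_muf.
- exists m.+1%:R; split=> //; move: lem; congr (leb _ < _)%E; apply/seteqP.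
  by split=> t /=; rewrite ltr_pXn2r ?nnegrE ?muf_ge0// ger0_norm// muf_ge0.
- by apply: measurable_funX; apply: measurableT_comp => //; exact: measurable_muf.
exists (m.+1%:R ^+ 2); split; first by rewrite exprn_gt0.
move: lem; congr (leb _ < _)%E; apply/seteqP.
by split=> t /=; rewrite [`| _ ^+ 2 |]ger0_norm// ger0_norm ?muf_ge0.
Qed.

(** The square of [muf d] is at most [k / s] plus its excess over [k / s]. On a set of measure [s]
    the first part contributes [k]; the excess contributes at most [k], because the measures of its
    level sets are bounded by the traces that [tr_layers] sums. *)
Lemma mrep_integral A s k (X : set R) : mform A -> mrep A h -> 0 < s -> 0 <= k -> Kfun A s k ->
  measurable X -> X `<=` halfline -> leb X = s%:E ->
  (\int[leb]_(t in X) (`|muf d t| ^+ 2)%:E <= (2 * k)%:E)%E.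
Proof.
move=> fA rA s0 k0 KA mX sX hX; set hh := fun t : R => muf d t ^+ 2; have ks0 : 0 <= k / s by rewrite divr_ge0// ltW.
pose g t := Num.max (hh t - k / s) 0; have g0 t : 0 <= g t by rewrite le_max lexx orbT.
have mh : measurable_fun X hh by apply: measurable_funS measurable_muf2 => //; exact: measurable_halfline.
have mgh : measurable_fun halfline g by apply: measurable_maxr => //; exact: measurable_funB.
have mg : measurable_fun X g by apply: measurable_funS mgh => //; exact: measurable_halfline.
have hg : (\int[leb]_(t in halfline) (`|g t| * \1_X t)%:E <= k%:E)%E.
  apply: layer_cake_le => // J S mS Sh Sd Sf hS.
  pose c := [seq (dy J, dy J * i.+1%:R) | i <- index_iota 0 (4 ^ J)] : seq (R * R).
  have dy0 := @dy_gt0 R J.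
  apply: le_trans (tr_layers (c := c) fA (ts_M h) rA s0 k0 KA _ _).
  - rewrite big_map; apply: lee_sum => i _; rewrite lee_pmul2l//.
    have dp : 0 <= k / s + dy J * i.+1%:R by rewrite addr_ge0// mulr_ge0// ltW.
    apply: le_trans (muf_tail dp); rewrite integral_indic//; last exact: mS.
    apply: le_trans (leb_sub (measurableI _ _ mX (mS i)) (mS i) (@subIsetr _ _ _)) (le_trans (hS i) _).
    apply: leb_sub; [exact: measurable_super| |].
      have := measurable_super (k / s + dy J * i.+1%:R) measurable_muf2; congr measurable; apply/seteqP.
      by split=> t /=; rewrite ger0_norm ?sqr_ge0.
    move=> t [ht /=]; rewrite ger0_norm// lt_max => /orP[|]; last by rewrite ltNge mulr_ge0// ltW.
    by rewrite ltrBrDl.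
  - by rewrite all_map; apply/allP => i /=; rewrite mulr_ge0 ltW.
  by move=> l l0; rewrite big_map; have [] := layers_bounds J l0.
apply: le_trans (_ : (\int[leb]_(t in X) ((k / s)%:E + (g t)%:E) <= _)%E).
  apply: ge0_le_integral => // [||t].
  - by apply/measurable_EFinP; under eq_fun do rewrite ger0_norm ?muf_ge0//.
  - exact/measurable_EFinP/measurable_funD.
  by rewrite lee_fin ger0_norm ?muf_ge0// -lerBlDl le_max lexx.
rewrite ge0_integralD//; [|by move=> t; rewrite lee_fin|exact/measurable_EFinP].
rewrite integral_cst// [Z in (_ * Z + _)%E]hX -EFinM divfK ?gt_eqF// mulr_natl EFinD leeD2l//.
by move: hg; congr (_ <= _)%E; rewrite -(int_indic g mX sX); apply: eq_integral => t _; rewrite mulrC ger0_norm.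
Qed.

End OfTspec.

(** [factor_below] writes every [X k] as [d y d] with the same [d] and a contraction [y], so the
    norm of the sequence is at most the squared norm of [d] in the 2-convexification, which is the
    Koethe norm of the squared [muf d]. Each [X k] lies in the space because [tr_level] bounds its
    rearrangement by that square. *)
Lemma dominated_linf e (h : tspec e) (F : fspace R) A (X : nat -> set (H * H)) (eX : nat -> set R -> H -> H)
    (hX : forall k, tspec (eX k)) N : symmetric_banach F -> (forall k, X k = spec_op (hX k)) ->
  mform A -> mrep A h -> (forall k, mle (Lm (hX k)) A) ->
  let d := spec_op h in (kothe_norm F (fun t => (`|muf d t| ^+ 2)%R) <= N%:E)%E ->
  linf_space M tau (kothe_dual F) X /\ linf_norm M tau (kothe_dual F) X <= N.
Proof.
move=> hF EX fA rA hA d hN; set hh := fun => _ in hN; have [Sd Shh] := muf_Sfun h.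
have khh : (kothe_norm F hh < +oo)%E by apply: le_lt_trans hN (ltry _).
have nd : nc_space M tau (convexification2 (kothe_dual F)) d by split; [exact: ts_stau|split].
have /choice[y hy] k : exists y : H -> H, [/\ M y, forall x, nrm (y x) <= nrm x &
    X k = strong_mul (strong_mul d (graph_op y)) d] by rewrite EX; exact: factor_below (hA k).
have y1 k : opnorm (y k) <= 1.
  have [My yc _] := hy k; apply: sup_le_ub; first by exists (complex.Re `|y k 0|), 0 => //=; rewrite normr0.
  by move=> _ [x /= x1 <-]; apply: le_trans (yc x) _; move: x1; rewrite nrmE -lecR.
have : linf_factorization M tau (kothe_dual F) X d y d.
  split=> // [k||k]; [by case: (hy k)| |by case: (hy k)].
  by exists 1 => _ [k _ <-].
split.
  split=> [k|]; last by exists d, y, d.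
  split; first by rewrite EX; exact: ts_stau.
  have [Sk _] := muf_Sfun (hX k); rewrite /= -/(muf (X k)) EX; split=> //.
  apply: le_lt_trans khh; apply: (kn_mono hF) => [||t t0]; [exact: Sk.1|exact: Shh.1|].
  suff hle : muf (spec_op (hX k)) t <= `|muf d t| ^+ 2.
    by rewrite (ger0_norm (muf_ge0 _ _)); apply: le_trans (ler_norm _).
  apply: (muf_le (hX k) t0) => [|w hw]; first exact: sqr_ge0.
  have w0 := le_trans (sqr_ge0 _) (ltW hw).
  apply: le_trans (tr_level fA rA (hA k) w0) _; rewrite (lev_ray h w0).
  apply: (muf_ray t0); rewrite -(ger0_norm (muf_ge0 d t)) -[leLHS]ger0_norm; last exact: normr_ge0.
  by rewrite -sqrtr_sqr; exact: ler_wsqrtr (ltW hw).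
have n0 T : 0 <= nc_norm tau (convexification2 (kothe_dual F)) T by exact: sqrtr_ge0.
have f0 : 0 <= fine (kothe_norm F hh) by rewrite fine_ge0// kn_ge0.
apply: le_trans (_ : fine (kothe_norm F hh) <= N); last first.
  by rewrite -lee_fin fineK// ge0_fin_numE ?kn_ge0.
apply: le_trans (ge_inf _ _) _; [|by exists d, y, d|].
  exists 0 => _ [a [b [c [[_ _ My [K hK] _] ->]]]]; rewrite mulr_ge0// mulr_ge0//.
  apply: @le_trans; last by apply: ub_le_sup; [exists K|exists 0%N].
  by apply: le_trans (nrm_ge0 _) (opnorm_ub (x := 0) (M_bop (My _)) _); rewrite nrm0.
rewrite mulrAC -expr2 sqr_sqrtr// ler_piMr//; apply: sup_le_ub; first by exists (opnorm (y 0%N)), 0%N.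
by move=> _ [k _ <-].
Qed.

End Assembly.

End Semifinite.

Theorem theorem5p5 (R : realType) (F E : fspace R) (p q Cp Cq : R)
    (hF : symmetric_banach F) (hFsep : separable_fspace F)
    (hE : E = kothe_dual F)
    (hp : 1 <= p) (hpq : p < q)
    (hqE : (upper_boyd E < q%:E)%E)
    (hpE : p = 1 \/ (p%:E < lower_boyd E)%E) :
  exists C : R,
    forall (H : hilbertSpace R) (M : set (H -> H)) (tau : (H -> H) -> \bar R)
      (hM : von_neumann_algebra M) (htau : nsf_trace M tau)
      (S : nat -> set (H * H) -> set (H * H))
      (hS : forall k : nat, positive_linear M tau (lorentz_cone M tau p q) (S k))
      (hSp : lorentz_maximal_bound M tau S p Cp)
      (hSq : lorentz_maximal_bound M tau S q Cq),
    forall x : set (H * H), nc_space M tau E x -> positive_op x ->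
      linf_space M tau E (fun k : nat => S k x) /\
      linf_norm M tau E (fun k : nat => S k x) <= C * nc_norm tau E x.
Proof.
rewrite {}hE in hqE hpE *; have q1 : 1 <= q := le_trans hp (ltW hpq).
have [b [w [Cw [hW Cw0 hC]]]] := weights_bounded hF hp q1 hqE hpE.
have [Kp Kp0 gKp] := geo_powR hp; have [Kq Kq0 gKq] := geo_powR q1.
pose cp := 6 * ((`|Cp| + 1) * (Kp * 2 `^ p^-1)); pose cq := 6 * ((`|Cq| + 1) * (Kq * 2 `^ q^-1)).
pose c0 := cp + cq.
have cp0 : 0 < cp by rewrite !mulr_gt0 ?powR_gt0// ltr_wpDl.
have cq0 : 0 < cq by rewrite !mulr_gt0 ?powR_gt0// ltr_wpDl.
have c00 : 0 < c0 by rewrite addr_gt0.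
(* The factor 12 is 6 from [dominating_form] times 2 from [mrep_integral]; [c0] comes from the
   maximal bounds and the Lorentz norms of pieces, [Cw] from the dilation norms. None of them
   depends on the algebra or on [x]. *)
exists (12 * c0 * Cw) => H M tau hM htau S hS hSp hSq x [Sx Ex] px.
have [e [h [xE _]]] := positive_tspec hM htau Sx px; rewrite {}xE in Ex {Sx px} *.
set X := spec_op _ in Ex *; have f0 t : 0 <= muf tau X t := muf_ge0 _ _ _.
have fd s t : 0 < s -> s <= t -> muf tau X t <= muf tau X s by exact: muf_noninc.
have mf := measurable_muf hM htau h.
(* At [s = 1] the sums [kpart] reduce to the dyadic L^(p,1) and L^(q,1) sums of the rearrangement of
   [x] below and above 1. Their finiteness puts [x] and its cuts into the cone on which the [S k]
   act. *)
have bf := kbar_fin hF Ex f0 hW hC ltr01; set kappa := fine (kbar (muf tau X) q b w 1).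
have hk n : kpart (muf tau X) p q 1 n <= kappa by rewrite -lee_fin fineK//; exact: kpart_le.
have t0 a : 0 <= muf tau X a * kap p q 1 a by rewrite mulr_ge0// /kap; case: ifP => _; rewrite mulr_ge0 ?powR_ge0.
have hkp n : \sum_(0 <= i < n) (2 ^- i.+1) `^ p^-1 * muf tau X (2 ^- i.+1) <= kappa.
  apply: le_trans (hk n); rewrite /kpart ler_wpDl ?sumr_ge0//; apply: ler_sum_nat => i _.
  have /negPf i1 : ~~ (1 <= 2 ^- i.+1 :> R) by rewrite -ltNge invf_lt1 ?exprn_gt0// exprn_egt1 ?ltr1n.
  by rewrite mulrC /kap i1 powR1 mul1r.
have hkq n : \sum_(0 <= i < n) (2 ^+ i) `^ q^-1 * muf tau X (2 ^+ i) <= kappa.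
  apply: le_trans (hk n); rewrite /kpart ler_wpDr ?sumr_ge0//; apply: ler_sum_nat => i _.
  by rewrite mulrC /kap exprn_ege1 ?ler1n// powR1 mul1r.
have hcp : cp <= c0 by rewrite lerDl ltW.
have hcq : cq <= c0 by rewrite lerDr ltW.
have [eX [hX EX]] := images_spec hM htau hS hp q1 hkp hkq gKq Kq0.
have [A [fA dA KA]] := dominating_form hM htau hS hSp hSq hp q1 hkp hkq gKp gKq Kp0 Kq0 c00 hcp hcq EX.
have k0 : 0 <= kappa by apply: le_trans (hk 0%N); rewrite /kpart !big_geq// addr0.
have K0 K : 0 <= K -> 0 <= 6 * (c0 * K) by move=> ?; rewrite !mulr_ge0// ltW.
have [e' [h' rA]] := mform_tspec hM htau fA ltr01 (K0 _ k0) (KA 1 kappa ltr01 hk).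
apply: (dominated_linf hM htau hF _ fA rA (dA)) => [k|]; first by rewrite -EX// cutT.
have c12 : 0 <= 12 * c0 by rewrite mulr_ge0// ltW.
apply: le_trans (majorized_norm hF hp q1 Ex f0 fd hW hC c12 _ _ _) _ => [|t|Y s mY sY s0 Ys K hK|].
- exact: (muf_Sfun hM htau h').2.1.
- exact: sqr_ge0.
- have Kge : 0 <= K by apply: le_trans (hK 0%N); rewrite /kpart !big_geq// addr0.
  apply: le_trans (mrep_integral hM htau fA rA s0 (K0 _ Kge) (KA s K s0 hK) mY sY Ys) _.
  by rewrite lee_fin le_eqVlt; apply/orP; left; apply/eqP; ring.
rewrite [in leRHS]EFinM lee_pmul2l ?lte_fin ?mulr_gt0// fineK// ge0_fin_numE; first exact: Ex.2.
exact: kn_ge0.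
Qed.
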